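(* Let $1\le q\le\infty$, $2<p<\infty$. Suppose there exist $T>0$ and $\varepsilon>0$ such that the Cauchy problem $$\partial_x\left(\partial_t u+\partial_x^3 u+\partial_x(u^2)\right)+\Delta_y u=0,\qquad u(0,x,y)=u_0(x,y),\qquad (x,y)\in\mathbb R\times\mathbb R^2,$$ admits a unique solution defined on the interval $[-T,T]$ for all initial data $u_0$ in the ball of radius $\varepsilon$ and center $0$ in $l^ql^pL^2$. Then, for $t\in[-T,T]$, $t\ne0$, the flow map $$F_t:u_0\mapsto u(t)$$ is not twice differentiable at $u_0=0$ as a map from $l^ql^pL^2$ to itself.
   Context: Fourier variables $\xi\in\mathbb R$, $\eta\in\mathbb R^2$ are dual to $x$, $y$. Solutions are understood in the Duhamel sense $u(t)=S(t)u_0-\int_0^tS(t-s)\partial_x(u^2)(s)\,ds$, where $\widehat{S(t)u_0}(\xi,\eta)=e^{it(\xi^3-|\eta|^2/\xi)}\hat u_0(\xi,\eta)$. For $\lambda\in2^{\mathbb Z}$ and $k\in\lambda\cdot\mathbb Z^2$ let $$\Gamma_{\lambda,k}=\{(\xi,\eta):\lambda\le|\xi|<2\lambda,\ |\eta/\xi-k|_\infty\le\lambda/2\},\quad |a|_\infty=\max\{|a_1|,|a_2|\},$$ and let $f_{\Gamma_{\lambda,k}}$ be the Fourier projection of $f$ to $\Gamma_{\lambda,k}$. $l^ql^pL^2$ is the closure (completion) of $C_0^\infty(\mathbb R^3)$ with respect to the norm $$\|f\|_{l^ql^pL^2}=\Big\{\sum_{\lambda\in2^{\mathbb Z}}\lambda^{q/2}\Big(\sum_{k\in\lambda\cdot\mathbb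 Z^2}\|f_{\Gamma_{\lambda,k}}\|_{L^2}^p\Big)^{q/p}\Big\}^{1/q},$$ with the standard modification (supremum over $\lambda$) if $q=\infty$. *)

(* Defs.v *)
From HB Require Import structures.
From mathcomp Require Import all_boot all_order all_algebra.
From mathcomp Require Import all_classical all_reals all_analysis.
From mathcomp Require Import complex.

Set Implicit Arguments.
Unset Strict Implicit.
Unset Printing Implicit Defensive.

Import Order.TTheory GRing.Theory Num.Theory.
Import numFieldNormedType.Exports.

Local Open Scope classical_set_scope.
Local Open Scope ring_scope.
Local Open Scope complex_scope.

Section ComplexFunctions.
Context {R : realType}.

Definition expi (x : R) : R[i] := cos x +i* sin x.

Definition cmeasurable d (T : measurableType d) (f : T -> R[i]) : Prop :=
  measurable_fun setT (fun x => complex.Re (f x)) /\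
  measurable_fun setT (fun x => complex.Im (f x)).

Definition cintegrable d (T : measurableType d)
    (mu : {measure set T -> \bar R}) (D : set T) (f : T -> R[i]) : Prop :=
  mu.-integrable D (fun x => (complex.Re (f x))%:E) /\
  mu.-integrable D (fun x => (complex.Im (f x))%:E).

Definition cintegral d (T : measurableType d)
    (mu : {measure set T -> \bar R}) (D : set T) (f : T -> R[i]) : R[i] :=
  (\int[mu]_(x in D) complex.Re (f x)) +i* (\int[mu]_(x in D) complex.Im (f x)).

End ComplexFunctions.

(* The sigma-finite structure inferred for a product m1 \x m2 is the one for
   subprobabilities, hence the separate instances for leb2 and leb3 below. *)
Lemma sigma_finite_prod d1 d2 (T1 : measurableType d1) (T2 : measurableType d2)
    (R : realType) (m1 : {sigma_finite_measure set T1 -> \bar R})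
    (m2 : {sigma_finite_measure set T2 -> \bar R}) :
  sigma_finite setT (m1 \x m2)%E.
Proof.
have /sigma_finiteP[F [TF ndF Foo]] := sigma_finiteT m1.
have /sigma_finiteP[G [TG ndG Goo]] := sigma_finiteT m2.
exists (fun n => F n `*` G n).
  rewrite -setXTT TF TG predeqE => -[x y]; split.
    move=> [/= [n _ Fnx] [k _ Gky]]; exists (maxn n k) => //; split.
    - by move: x Fnx; exact/subsetPset/ndF/leq_maxl.
    - by move: y Gky; exact/subsetPset/ndG/leq_maxr.
  by move=> [n _ []/= ? ?]; split; exists n.
move=> k; have [? ?] := Foo k; have [? ?] := Goo k.
split; first exact: measurableX.
by rewrite product_measure1E// lte_mul_pinfty// ge0_fin_numE.
Qed.

(* Space and frequency variables are nested pairs: (x, y) with y : R * R, and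
   (xi, eta) with eta : R * R. *)
Notation R3 R := (R * (R * R))%type.

Section Fourier.
Context {R : realType}.

(* R^3 with the Borel sigma-algebra underlying lebesgue_measure; as a type,
   borel3 is convertible to R3 R. *)
Definition borel3 : measurableType _ :=
  (measurableTypeR R * (measurableTypeR R * measurableTypeR R))%type.

Definition leb2 := (@lebesgue_measure R \x @lebesgue_measure R)%E.
HB.instance Definition _ := Measure.on leb2.
HB.instance Definition _ := Measure_isSigmaFinite.Build _ _ _ leb2
  (sigma_finite_prod (@lebesgue_measure R) (@lebesgue_measure R)).

Definition leb3 := (@lebesgue_measure R \x leb2)%E.
HB.instance Definition _ := Measure.on leb3.
HB.instance Definition _ := Measure_isSigmaFinite.Build _ _ _ leb3
  (sigma_finite_prod (@lebesgue_measure R) leb2).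

Definition dot3 (z w : R3 R) : R :=
  z.1 * w.1 + (z.2.1 * w.2.1 + z.2.2 * w.2.2).

(* The Fourier transform is normalised to be unitary on L^2(R^3). *)
Definition cst3 : R := (2 * pi) `^ (- (3 / 2)).

Definition fourier (f : R3 R -> R) (w : R3 R) : R[i] :=
  cst3%:C * cintegral leb3 setT (fun z => (f z)%:C * expi (- dot3 z w)).

(* For g the Fourier transform of f, this is f_A: the function of the space
   variable whose Fourier transform is g on A and 0 outside A. *)
Definition fproj (A : set (R3 R)) (g : R3 R -> R[i]) (z : R3 R) : R[i] :=
  cst3%:C * cintegral leb3 A (fun w => g w * expi (dot3 z w)).

(* With the unitary normalisation, the transform of a product f h is
   (2 pi)^(-3/2) times the convolution of the transforms. *)
Definition fconv_integrable (g h : R3 R -> R[i]) (w : R3 R) : Prop :=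
  cintegrable leb3 setT (fun w' => g w' * h (w - w')).

Definition fconv (g h : R3 R -> R[i]) (w : R3 R) : R[i] :=
  cst3%:C * cintegral leb3 setT (fun w' => g w' * h (w - w')).

Definition smooth (f : R3 R -> R) : Prop :=
  forall vs : seq (R3 R),
    let g := foldr (fun (v : R3 R) (h : R3 R -> R) => 'D_v h) f vs in
    continuous g /\ forall z v, derivable g z v.

Definition test_function (f : R3 R -> R) : Prop :=
  smooth f /\ compact (closure [set z | f z != 0]).

End Fourier.

Section Spaces.
Context {R : realType}.

Definition dyad (m : int) : R := 2 ^ m.

(* Gamma_{lambda,k} with lambda = 2^m and k = lambda (a, b). *)
Definition Gamma (m : int) (ab : int * int) : set (R3 R) :=
  [set w | dyad m <= `|w.1| < 2 * dyad m /\
     Num.max `|w.2.1 / w.1 - dyad m * ab.1%:~R|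
             `|w.2.2 / w.1 - dyad m * ab.2%:~R| <= dyad m / 2].

Local Open Scope ereal_scope.

Definition cell_norm (g : R3 R -> R[i]) (m : int) (ab : int * int) : \bar R :=
  'N[leb3]_(2%:E)[ (fun z => (Normc.normc (fproj (Gamma m ab) g z))%:E) ].

(* The l^q l^p L^2 norm of the element with Fourier transform g. *)
Definition lqlp_norm (q : \bar R) (p : R) (g : R3 R -> R[i]) : \bar R :=
  match q with
  | r%:E =>
      (\esum_(m in [set: int]) ((dyad m `^ (r / 2))%:E *
         (\esum_(ab in [set: int * int]) cell_norm g m ab `^ p) `^ (r / p)))
      `^ r^-1
  | _ =>
      ereal_sup [set (dyad m `^ (1 / 2))%:E *
         (\esum_(ab in [set: int * int]) cell_norm g m ab `^ p) `^ p^-1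
         | m in [set: int]]
  end.

(* Elements of the completion need not be distributions on R^3, since their
   Fourier transforms need not be integrable near xi = 0; an element is
   therefore represented by its Fourier transform, a function determined up to
   Lebesgue-null sets. Square integrability on each (bounded) cell makes the
   integrals in fproj converge. Test functions are real valued, so the elements
   are real: their transforms satisfy g(-w) = g(w)^* almost everywhere. *)
Definition lqlpL2 (q : \bar R) (p : R) : set (R3 R -> R[i]) :=
  [set g | [/\ @cmeasurable R _ borel3 g,
     forall m ab,
       \int[leb3]_(w in Gamma m ab) ((Normc.normc (g w)) ^+ 2)%:E < +oo &
     forall e : R, (0 < e)%R -> exists f : R3 R -> R, test_function f /\
       lqlp_norm q p (g - fourier f)%R < e%:E]].

End Spaces.

Section Equation.
Context {R : realType}.

Definition omega (w : R3 R) : R :=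
  w.1 ^+ 3 - (w.2.1 ^+ 2 + w.2.2 ^+ 2) / w.1.

Definition between0 (t : R) : set R := `[Num.min 0 t, Num.max 0 t].

(* Fourier transform of int_0^t S(t - s) d_x (u^2)(s) ds; the factor sg t
   orients the integral when t < 0. *)
Definition duhamel (u : R -> R3 R -> R[i]) (t : R) (w : R3 R) : R[i] :=
  (Num.sg t)%:C * cintegral lebesgue_measure (between0 t) (fun s =>
    expi ((t - s) * omega w) * ('i * (w.1)%:C) * fconv (u s) (u s) w).

(* For almost every frequency w, the integrals in the Duhamel term converge
   absolutely: the one defining the transform of u(s)^2 for almost all s, and
   the one in s. Neither depends on the representatives chosen for the u(s). *)
Definition duhamel_integrable (u : R -> R3 R -> R[i]) (t : R) (w : R3 R) :
    Prop :=
  {ae lebesgue_measure, forall s,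
     between0 t s -> fconv_integrable (u s) (u s) w} /\
  cintegrable lebesgue_measure (between0 t) (fun s => fconv (u s) (u s) w).

Definition aeeq (g h : R3 R -> R[i]) : Prop :=
  {ae leb3, forall w, g w = h w}.

Definition solution (q : \bar R) (p T : R) (u0 : R3 R -> R[i])
    (u : R -> R3 R -> R[i]) : Prop :=
  [/\ forall t, - T <= t <= T -> lqlpL2 q p (u t),
      forall t0, - T <= t0 <= T -> forall e : R, 0 < e ->
        exists2 d : R, 0 < d & forall t, - T <= t <= T -> `|t - t0| < d ->
          (lqlp_norm q p (u t - u t0)%R < e%:E)%E &
      forall t, - T <= t <= T ->
        {ae leb3, forall w, duhamel_integrable u t w /\
          u t w = expi (t * omega w) * u0 w - duhamel u t w}].

Definition ball0 (q : \bar R) (p eps : R) : set (R3 R -> R[i]) :=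
  [set g | lqlpL2 q p g /\ (lqlp_norm q p g < eps%:E)%E].

Definition uniquely_solvable (q : \bar R) (p T eps : R) : Prop :=
  forall u0, ball0 q p eps u0 ->
    (exists u, solution q p T u0 u) /\
    (forall u v, solution q p T u0 u -> solution q p T u0 v ->
       forall t, - T <= t <= T -> aeeq (u t) (v t)).

(* F t u0 = u(t). By uniqueness F t u0 is determined up to almost everywhere
   equality, and so only depends on the class of u0. *)
Definition flow_map (q : \bar R) (p T eps : R)
    (F : R -> (R3 R -> R[i]) -> (R3 R -> R[i])) : Prop :=
  forall u0, ball0 q p eps u0 -> solution q p T u0 (fun t => F t u0).

End Equation.

(* Frechet differentiability in the normed space X / {N = 0}, where X is a
   space of complex functions with seminorm N, regarded as a real vector space;
   identities in the quotient read N (_ - _) = 0. *)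
Section Frechet.
Context {R : realType} {T : Type}.
Variables (X : set (T -> R[i])) (N : (T -> R[i]) -> \bar R).

Definition rscale (a : R) (g : T -> R[i]) : T -> R[i] := fun z => a%:C * g z.

Definition real_linear (L : (T -> R[i]) -> (T -> R[i])) : Prop :=
  forall (a : R) g h, X g -> X h ->
    N (L (rscale a g + h) - (rscale a (L g) + L h))%R = 0%E.

Definition bounded_linear (L : (T -> R[i]) -> (T -> R[i])) : Prop :=
  [/\ forall g, X g -> X (L g), real_linear L &
      exists C : R, forall g, X g -> (N (L g) <= C%:E * N g)%E].

Definition frechet_derivative_at (F : (T -> R[i]) -> (T -> R[i]))
    (u : T -> R[i]) (L : (T -> R[i]) -> (T -> R[i])) : Prop :=
  bounded_linear L /\
  forall e : R, 0 < e -> exists2 d : R, 0 < d &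
    forall h, X h -> (N h < d%:E)%E ->
      (N (F (u + h) - F u - L h)%R <= e%:E * N h)%E.

(* DF is the derivative of F near 0, and B its derivative at 0 as a map into
   the bounded linear operators on X with the operator norm. *)
Definition twice_differentiable_at0 (F : (T -> R[i]) -> (T -> R[i])) : Prop :=
  exists DF B : (T -> R[i]) -> (T -> R[i]) -> (T -> R[i]),
  [/\ exists2 r : R, 0 < r & forall u, X u -> (N u < r%:E)%E ->
        frechet_derivative_at F u (DF u),
      [/\ forall u, X u -> bounded_linear (B u),
          forall v, X v -> real_linear (fun u => B u v) &
          exists C : R, forall u v, X u -> X v ->
            (N (B u v) <= C%:E * (N u * N v))%E] &
      forall e : R, 0 < e -> exists2 d : R, 0 < d &
        forall u v, X u -> X v -> (N u < d%:E)%E ->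
          (N (DF u v - DF (0%R : T -> R[i]) v - B u v)%R
             <= e%:E * (N u * N v))%E].

End Frechet.

(* Main.v *)
Require Import Defs.
From HB Require Import structures.
From mathcomp Require Import all_boot all_order all_algebra.
From mathcomp Require Import all_classical all_reals all_analysis.
From mathcomp Require Import complex measurable_realfun zify ring lra.
Set Implicit Arguments.
Unset Strict Implicit.
Unset Printing Implicit Defensive.
Import Order.TTheory GRing.Theory Num.Theory.
Import numFieldNormedType.Exports.
Local Open Scope classical_set_scope.
Local Open Scope ring_scope.

(** A twice differentiable flow map would have as second derivative at [0], in a
    direction [phi], twice the quadratic term of the expansion of the solution
    with datum [a phi] in powers of [a]; up to a sign this term is the Duhamel
    integral of the free evolution of [phi]. Twice differentiability bounds it
    by a constant times the square of the norm of [phi], and the proof exhibits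
    data for which such a bound fails.

    The data ([datum]) are [alpha * low + beta * high]. The high part sits at
    [|xi| ~ L] with slopes [|eta / xi| <= L / 4], so it meets boundedly many
    cells. The low part sits at [|xi| ~ l] and fills all slopes up to [L], that
    is, about [(L / l)^2] cells; its [l^p] norm over the cells is therefore
    smaller than its [L^2] norm by the factor [(l / L)^(1 - 2 / p)], a gain
    because [p > 2]. With [l = 2^-c L^-2] and [c] large, the resonance function
    ([resonance_identity], [resonance_bound]) satisfies [|t Omega| <= 1 / 2] on
    all pairs of a low and a high frequency. The Duhamel integral then has no
    cancellation: its pairing with a nonnegative profile, transported by the
    free flow, is at least a constant times [L^(5 - 6 / p)] ([quad_lower]),
    whereas [phi] has bounded norm ([datum_norm]) and the bound from
    differentiability is a constant times [L^2] ([second_order]). The ratio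
    [L^(3 - 6 / p)] is unbounded.

    To know the solution for the data [a phi], one constructs it. In Fourier
    variables, with the weight [rho(w) exp (- (T - |s|) |xi|)], convolution is
    bounded by that of [rho], and the factor [|xi|] of the derivative is
    integrated in time against the growing exponential ([duh_diff]); hence the
    Picard iteration converges pointwise for small data ([picard_solution]).
    The limit satisfies the definition of a solution ([picard_is_solution]):
    it takes values in the space since continuous Hermitian functions dominated
    by [rho] are approximated by transforms of test functions ([mem_lqlpL2]),
    and it is continuous in time by dominated convergence ([lqlp_cvg0]). By the
    uniqueness hypothesis it is the value of the flow map.

    All comparisons take place after applying one functional [ell Phi], with
    [Phi] supported in one cell; [ell_le] bounds it by the norm. The bound is
    obtained by duality from the upper bound [plancherel_le], which also
    controls the norm from above; both come from the convolution identity
    [fourier_bump_ift]. The scalar function [a |-> Im (ell Phi (F t (a phi)))]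
    is then treated by one-variable calculus ([taylor2_unique]). *)

(** * Affine changes of variable on the line *)

Section Affine.
Context {R : realType}.
Let mu := @lebesgue_measure R.
Let T1 := measurableTypeR R.

Lemma measurable_affine (a b : R) :
  measurable_fun setT (fun x : T1 => a * x + b : T1).
Proof.
apply: measurable_funD; last exact: measurable_cst.
by apply: measurable_funM; [exact: measurable_cst|exact: measurable_id].
Qed.

(** An affine image of Lebesgue measure has the Lebesgue measure of intervals
    up to the factor [|a|], and such a measure is unique. *)
Lemma lebesgue_preimage_affine (a b : R) (A : set T1) : a != 0 -> measurable A ->
  (`|a|%:E * mu ((fun x : T1 => (a * x + b)%R : T1) @^-1` A) = mu A)%E.
Proof.
move=> a0 mA.
pose nu1 : {measure set T1 -> \bar R} := pushforward mu (fun x : T1 => a * x + b : T1).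
pose nu : {measure set T1 -> \bar R} :=
  mscale (NngNum (normr_ge0 a)) (nu1 (measurable_affine a b)).
suff: mu A = nu A by move=> ->.
apply: (@lebesgue_measure_unique R nu) => // X [[c d] _ <-].
rewrite /nu/= /mscale/= /pushforward/=.
have [a_gt0|] := ltP 0 a.
  have -> : (fun x => a * x + b) @^-1` `]c, d]%classic = `](c - b) / a, (d - b) / a]%classic.
    apply/seteqP; split => x /=; rewrite !in_itv/= ltr_pdivrMr// ler_pdivlMr// (mulrC x) => /andP[? ?]; apply/andP; split; lra.
  rewrite !lebesgue_measure_itv/= !lte_fin ltr_pM2r ?invr_gt0// ltrD2r.
  case: ifP => cd; last by rewrite mule0.
  rewrite -!EFinD -EFinM gtr0_norm//; congr EFin; field; exact: a0.
rewrite le_eqVlt (negbTE a0)/= => a_lt0.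
have -> : (fun x => a * x + b) @^-1` `]c, d]%classic = `[(d - b) / a, (c - b) / a[%classic.
  apply/seteqP; split => x /=; rewrite !in_itv/= ltr_ndivlMr// ler_ndivrMr// (mulrC x) => /andP[? ?]; apply/andP; split; lra.
rewrite !lebesgue_measure_itv/= !lte_fin ltr_nM2r ?invr_lt0// ltrD2r.
case: ifP => cd; last by rewrite mule0.
rewrite -!EFinD -EFinM ltr0_norm//; congr EFin; field; exact: a0.
Qed.

Lemma ge0_integral_affine (a b : R) (f : T1 -> \bar R) : a != 0 ->
  measurable_fun setT f -> (forall x, 0 <= f x)%E ->
  (\int[mu]_x f x = `|a|%:E * \int[mu]_x f (a * x + b)%R)%E.
Proof.
move=> a0 mf f0.
pose nu1 : {measure set T1 -> \bar R} := pushforward mu (fun x : T1 => a * x + b : T1).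
pose nu : {measure set T1 -> \bar R} :=
  mscale (NngNum (normr_ge0 a)) (nu1 (measurable_affine a b)).
rewrite (eq_measure_integral nu); last first.
  by move=> A mA _; exact/esym/lebesgue_preimage_affine.
rewrite ge0_integral_mscale//=; congr *%E.
by rewrite ge0_integral_pushforward//; exact: measurable_affine.
Qed.

End Affine.

(** * Complex-valued functions *)

Notation nc := Normc.normc.

Section Modulus.
Context {R : realType}.
Implicit Types (z w : R[i]) (x : R).

Lemma eqle x y : x = y -> x <= y. Proof. by move=> ->. Qed.

Lemma nc_ge0 z : 0 <= nc z. Proof. by case: z => a b; exact: sqrtr_ge0. Qed.

Lemma nc_real x : nc x%:C%C = `|x|.
Proof. by rewrite /Normc.normc/= expr0n/= addr0 sqrtr_sqr. Qed.

Lemma sqr_nc z : nc z ^+ 2 = complex.Re z ^+ 2 + complex.Im z ^+ 2.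
Proof. by case: z => a b; rewrite /Normc.normc/= sqr_sqrtr// addr_ge0// sqr_ge0. Qed.

Lemma Re_le_nc z : `|complex.Re z| <= nc z.
Proof.
rewrite -(@ler_pXn2r _ 2) ?nnegrE ?nc_ge0// sqr_nc real_normK ?num_real//.
by rewrite lerDl sqr_ge0.
Qed.

Lemma Im_le_nc z : `|complex.Im z| <= nc z.
Proof.
rewrite -(@ler_pXn2r _ 2) ?nnegrE ?nc_ge0// sqr_nc real_normK ?num_real//.
by rewrite lerDr sqr_ge0.
Qed.

Lemma nc_le z : nc z <= `|complex.Re z| + `|complex.Im z|.
Proof.
rewrite -(@ler_pXn2r _ 2) ?nnegrE ?nc_ge0 ?addr_ge0// sqr_nc sqrrD.
rewrite !real_normK ?num_real// -addrA lerD2l lerDr.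
by rewrite mulrn_wge0// mulr_ge0.
Qed.

Lemma nc0 : nc (0 : R[i]) = 0.
Proof. exact: Normc.normc0. Qed.

Lemma ncD z w : nc (z + w) <= nc z + nc w.
Proof. by rewrite -lecR rmorphD/=; exact: (ler_normD z w). Qed.

Lemma ncN z : nc (- z) = nc z.
Proof. by case: z => a b; rewrite /Normc.normc/= !sqrrN. Qed.

Lemma ncB z w : nc (z - w) <= nc z + nc w.
Proof. by rewrite (le_trans (ncD _ _))// ncN. Qed.

Lemma nc_distC z w : nc (z - w) = nc (w - z).
Proof. by rewrite -ncN opprB. Qed.

Lemma ncM z w : nc (z * w) = nc z * nc w.
Proof. exact: Normc.normcM. Qed.

Lemma nc_expi x : nc (expi x) = 1.
Proof. by rewrite /Normc.normc/= cos2Dsin2 sqrtr1. Qed.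

Lemma nc_i : nc ('i%C : R[i]) = 1.
Proof. by rewrite /Normc.normc/= expr0n expr1n add0r sqrtr1. Qed.

Lemma nc_conj z : nc z^*%C = nc z.
Proof. by case: z => a b; rewrite /Normc.normc/= sqrrN. Qed.

Lemma nc_eq0 z : nc z = 0 -> z = 0.
Proof. exact: Normc.eq0_normc. Qed.

Lemma ReD z w : complex.Re (z + w) = complex.Re z + complex.Re w.
Proof. by case: z w => [? ?] [? ?]. Qed.
Lemma ImD z w : complex.Im (z + w) = complex.Im z + complex.Im w.
Proof. by case: z w => [? ?] [? ?]. Qed.
Lemma ReN z : complex.Re (- z) = - complex.Re z. Proof. by case: z. Qed.
Lemma ImN z : complex.Im (- z) = - complex.Im z. Proof. by case: z. Qed.
Lemma ReB z w : complex.Re (z - w) = complex.Re z - complex.Re w.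
Proof. by rewrite ReD ReN. Qed.
Lemma ImB z w : complex.Im (z - w) = complex.Im z - complex.Im w.
Proof. by rewrite ImD ImN. Qed.
Lemma ReM z w : complex.Re (z * w) =
  complex.Re z * complex.Re w - complex.Im z * complex.Im w.
Proof. by case: z w => [? ?] [? ?]. Qed.
Lemma ImM z w : complex.Im (z * w) =
  complex.Re z * complex.Im w + complex.Im z * complex.Re w.
Proof. by case: z w => [? ?] [? ?]. Qed.

Lemma complex_eqP z w : complex.Re z = complex.Re w -> complex.Im z = complex.Im w -> z = w.
Proof. by case: z w => [? ?] [? ?] /= -> ->. Qed.

Lemma expiD x y : expi (x + y) = expi x * expi y :> R[i].
Proof. by apply: complex_eqP; rewrite /= ?cosD ?sinD// addrC mulrC. Qed.

Lemma expi0 : expi 0 = 1 :> R[i].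
Proof. by rewrite /expi cos0 sin0. Qed.

Lemma expiN x : expi (- x) = (expi x)^*%C.
Proof. by rewrite /expi cosN sinN. Qed.

End Modulus.

Section Cmeasurable.
Context {R : realType} d (T : measurableType d).
Implicit Types f g : T -> R[i].

Lemma cmeasurable_cst (c : R[i]) : cmeasurable (fun _ : T => c).
Proof. by split; exact: measurable_cst. Qed.

Lemma cmeasurableD f g : cmeasurable f -> cmeasurable g ->
  cmeasurable (fun x => f x + g x).
Proof.
move=> [f1 f2] [g1 g2]; split.
- by under eq_fun do rewrite ReD; exact: measurable_realfun.measurable_funD.
- by under eq_fun do rewrite ImD; exact: measurable_realfun.measurable_funD.
Qed.

Lemma cmeasurableN f : cmeasurable f -> cmeasurable (fun x => - f x).
Proof.
move=> [f1 f2]; split.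
- by under eq_fun do rewrite ReN; exact: measurableT_comp.
- by under eq_fun do rewrite ImN; exact: measurableT_comp.
Qed.

Lemma cmeasurableB f g : cmeasurable f -> cmeasurable g ->
  cmeasurable (fun x => f x - g x).
Proof. by move=> mf mg; apply: cmeasurableD => //; exact: cmeasurableN. Qed.

Lemma cmeasurableM f g : cmeasurable f -> cmeasurable g ->
  cmeasurable (fun x => f x * g x).
Proof.
move=> [f1 f2] [g1 g2]; split.
- under eq_fun do rewrite ReM.
  by apply: measurable_funB; exact: measurable_funM.
- under eq_fun do rewrite ImM.
  by apply: measurable_realfun.measurable_funD; exact: measurable_funM.
Qed.

Lemma cmeasurable_real (f : T -> R) : measurable_fun setT f ->
  cmeasurable (fun x => (f x)%:C%C).
Proof. by move=> mf; split => //=; exact: measurable_cst. Qed.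

Lemma cmeasurable_expi (f : T -> R) : measurable_fun setT f ->
  cmeasurable (fun x => expi (f x)).
Proof.
move=> mf; split => /=.
- by apply: measurableT_comp => //; apply: continuous_measurable_fun; exact: continuous_cos.
- by apply: measurableT_comp => //; apply: continuous_measurable_fun; exact: continuous_sin.
Qed.

Lemma cmeasurable_conj f : cmeasurable f -> cmeasurable (fun x => (f x)^*%C).
Proof.
move=> [f1 f2]; split.
- by rewrite (_ : (fun _ => _) = (fun x => complex.Re (f x)))//; apply/funext => x; case: (f x).
- rewrite (_ : (fun _ => _) = (fun x => - complex.Im (f x))); first exact: measurableT_comp.
  by apply/funext => x; case: (f x).
Qed.

Lemma cmeasurable_nc f : cmeasurable f -> measurable_fun setT (fun x => nc (f x)).
Proof.
move=> [f1 f2].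
have -> : (fun x => nc (f x)) =
    (fun x => Num.sqrt (complex.Re (f x) ^+ 2 + complex.Im (f x) ^+ 2)).
  by apply/funext => x; case: (f x).
apply: (@measurableT_comp _ _ _ _ _ _ (@Num.sqrt R)).
  by apply: continuous_measurable_fun; exact: sqrt_continuous.
by apply: measurable_realfun.measurable_funD; exact: measurable_funX.
Qed.

Lemma cmeasurable_comp d' (T' : measurableType d') (f : T -> R[i]) (g : T' -> T) :
  cmeasurable f -> measurable_fun setT g -> cmeasurable (fun x => f (g x)).
Proof.
move=> [f1 f2] mg; split.
- exact: (measurableT_comp f1 mg).
- exact: (measurableT_comp f2 mg).
Qed.

End Cmeasurable.

Section Cintegral.
Context {R : realType} d (T : measurableType d) (mu : {measure set T -> \bar R}).
Implicit Types f g : T -> R[i].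

Lemma cintegrable_dom f (g : T -> R) : cmeasurable f ->
  mu.-integrable setT (EFin \o g) -> (forall x, nc (f x) <= g x) ->
  cintegrable mu setT f.
Proof.
move=> [f1 f2] ig fg; split.
- apply: (le_integrable _ _ _ ig) => //; first exact/measurable_EFinP.
  move=> x _ /=; rewrite lee_fin (le_trans (Re_le_nc _))// (le_trans (fg x))//.
  exact: ler_norm.
- apply: (le_integrable _ _ _ ig) => //; first exact/measurable_EFinP.
  move=> x _ /=; rewrite lee_fin (le_trans (Im_le_nc _))// (le_trans (fg x))//.
  exact: ler_norm.
Qed.

Lemma cintegralB f g : cintegrable mu setT f -> cintegrable mu setT g ->
  cintegral mu setT (fun x => f x - g x) = cintegral mu setT f - cintegral mu setT g.
Proof.
move=> [f1 f2] [g1 g2]; apply: complex_eqP; rewrite ?ReB ?ImB/=.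
- by under eq_Rintegral do rewrite ReB; rewrite RintegralB.
- by under eq_Rintegral do rewrite ImB; rewrite RintegralB.
Qed.

Lemma integrable_scale (h : T -> R) (c : R) :
  mu.-integrable setT (EFin \o h) -> mu.-integrable setT (EFin \o (fun x => c * h x)).
Proof. by move=> ih; exact: (integrableZl measurableT c ih). Qed.

Lemma cintegralZ (c : R[i]) f : cintegrable mu setT f ->
  cintegral mu setT (fun x => c * f x) = c * cintegral mu setT f.
Proof.
move=> [f1 f2]; apply: complex_eqP; rewrite ?ReM ?ImM/=.
- under eq_Rintegral do rewrite ReM.
  by rewrite RintegralB ?RintegralZl//; exact: integrable_scale.
- under eq_Rintegral do rewrite ImM.
  by rewrite RintegralD ?RintegralZl//; exact: integrable_scale.
Qed.

Lemma cintegrableZ (c : R[i]) f : cintegrable mu setT f ->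
  cintegrable mu setT (fun x => c * f x).
Proof.
move=> [f1 f2]; split.
- under eq_fun do rewrite ReM.
  by apply: (@integrableB _ _ _ mu setT _
    (EFin \o (fun x => complex.Re c * complex.Re (f x)))
    (EFin \o (fun x => complex.Im c * complex.Im (f x)))) => //; exact: integrable_scale.
- under eq_fun do rewrite ImM.
  by apply: (@integrableD _ _ _ mu setT _
    (EFin \o (fun x => complex.Re c * complex.Im (f x)))
    (EFin \o (fun x => complex.Im c * complex.Re (f x)))) => //; exact: integrable_scale.
Qed.

(** The factor [2] comes from estimating the real and imaginary parts
    separately. *)
Lemma cintegral_le f (g : T -> R) : cmeasurable f ->
  mu.-integrable setT (EFin \o g) -> (forall x, nc (f x) <= g x) ->
  nc (cintegral mu setT f) <= 2 * \int[mu]_x g x.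
Proof.
move=> mf ig fg; have [f1 f2] := cintegrable_dom mf ig fg.
rewrite (le_trans (nc_le _))//= mulr_natl mulr2n lerD//.
- apply: (le_trans (le_normr_Rintegral _ f1)) => //.
  apply: le_Rintegral => //; first exact: integrable_norm.
  by move=> x _; exact: (le_trans (Re_le_nc _)).
- apply: (le_trans (le_normr_Rintegral _ f2)) => //.
  apply: le_Rintegral => //; first exact: integrable_norm.
  by move=> x _; exact: (le_trans (Im_le_nc _)).
Qed.

Lemma cintegral_mkcond (D : set T) f : 
  cintegral mu D f = cintegral mu setT (fun x => (\1_D x)%:C%C * f x).
Proof.
apply: complex_eqP => /=.
- rewrite Rintegral_mkcond; apply: eq_Rintegral => x _.
  by rewrite ReM/= mul0r subr0 /patch indicE; case: (x \in D); rewrite ?(mul1r, mul0r).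
- rewrite Rintegral_mkcond; apply: eq_Rintegral => x _.
  by rewrite ImM/= mul0r addr0 /patch indicE; case: (x \in D); rewrite ?(mul1r, mul0r).
Qed.

End Cintegral.

Section CDominated.
Context {R : realType}.

Definition ccvg (u : nat -> R[i]) (l : R[i]) := nc (u n - l) @[n --> \oo] --> (0 : R).

Lemma ccvgP (u : nat -> R[i]) (l : R[i]) : ccvg u l <->
  (complex.Re (u n) @[n --> \oo] --> complex.Re l) /\
  (complex.Im (u n) @[n --> \oo] --> complex.Im l).
Proof.
split=> [ul|[u1 u2]].
- split; apply/subr_cvg0; apply: norm_cvg0.
  + apply: (squeeze_cvgr _ (cvg_cst 0) ul); apply: nearW => n.
    by rewrite normr_ge0 -ReB Re_le_nc.
  + apply: (squeeze_cvgr _ (cvg_cst 0) ul); apply: nearW => n.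
    by rewrite normr_ge0 -ImB Im_le_nc.
- have h : `|complex.Re (u n) - complex.Re l| + `|complex.Im (u n) - complex.Im l| @[n --> \oo] --> (0 : R).
    rewrite -[X in _ --> X]addr0; apply: cvgD; apply/norm_cvg0P; exact/subr_cvg0.
  apply: (squeeze_cvgr _ (cvg_cst 0) h); apply: nearW => n.
  by rewrite nc_ge0/= -ReB -ImB nc_le.
Qed.

Lemma ccvg_cst (c : R[i]) : ccvg (fun _ => c) c.
Proof. by rewrite /ccvg subrr nc0; exact: cvg_cst. Qed.

Lemma ccvgB (u v : nat -> R[i]) (l m : R[i]) : ccvg u l -> ccvg v m ->
  ccvg (fun n => u n - v n) (l - m).
Proof.
move=> /ccvgP[u1 u2] /ccvgP[v1 v2]; apply/ccvgP; rewrite ReB ImB; split.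
- by under eq_fun do rewrite ReB; exact: cvgB.
- by under eq_fun do rewrite ImB; exact: cvgB.
Qed.

Lemma ccvgM (u v : nat -> R[i]) (l m : R[i]) : ccvg u l -> ccvg v m ->
  ccvg (fun n => u n * v n) (l * m).
Proof.
move=> /ccvgP[u1 u2] /ccvgP[v1 v2]; apply/ccvgP; rewrite ReM ImM; split.
- by under eq_fun do rewrite ReM; apply: cvgB; exact: cvgM.
- by under eq_fun do rewrite ImM; apply: cvgD; exact: cvgM.
Qed.

Lemma ccvg_real (u : nat -> R) (l : R) : (u n @[n --> \oo] --> l) ->
  ccvg (fun n => (u n)%:C%C) l%:C%C.
Proof. by move=> ul; apply/ccvgP; split => //=; exact: cvg_cst. Qed.

Lemma ccvg_expi (u : nat -> R) (l : R) : (u n @[n --> \oo] --> l) ->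
  ccvg (fun n => expi (u n)) (expi l).
Proof.
move=> ul; apply/ccvgP; split => /=.
- by apply: (cvg_comp u cos ul); exact: continuous_cos.
- by apply: (cvg_comp u sin ul); exact: continuous_sin.
Qed.

Lemma ccvg_nc (u : nat -> R[i]) (l : R[i]) : ccvg u l -> nc (u n) @[n --> \oo] --> nc l.
Proof.
move=> ul; apply/subr_cvg0; apply: norm_cvg0.
apply: (squeeze_cvgr _ (cvg_cst 0) ul); apply: nearW => n.
have h1 := ncD (u n - l) l; have h2 := ncD (l - u n) (u n).
move: h1 h2; rewrite !subrK (nc_distC l) normr_ge0/= ler_norml => h1 h2.
by apply/andP; split; lra.
Qed.

Lemma ccvg_unique (u : nat -> R[i]) (l m : R[i]) : ccvg u l -> ccvg u m -> l = m.
Proof.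
move=> /ccvgP[u1 u2] /ccvgP[v1 v2]; apply: complex_eqP.
- exact: (cvg_unique _ u1 v1).
- exact: (cvg_unique _ u2 v2).
Qed.

Context d (T : measurableType d) (mu : {measure set T -> \bar R}).

Lemma Rintegral_cvg (f_ : nat -> T -> R) (f g : T -> R) :
  (forall n, measurable_fun setT (f_ n)) ->
  (forall x, f_ n x @[n --> \oo] --> f x) ->
  mu.-integrable setT (EFin \o g) -> (forall n x, `|f_ n x| <= g x) ->
  \int[mu]_x f_ n x @[n --> \oo] --> \int[mu]_x f x.
Proof.
move=> mf f_f ig f_g.
have mlim : measurable_fun setT f by exact: (measurable_fun_cvg mf).
have f_f' x : (EFin \o f_ n) x @[n --> \oo] --> (EFin \o f) x.
  by apply/fine_cvgP; split; [exact: nearW|exact: f_f].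
have [if_ _ ff] := @dominated_convergence _ _ _ mu setT measurableT
  (fun n => EFin \o f_ n) (EFin \o f) (EFin \o g)
  (fun n => proj2 (measurable_EFinP _ _) (mf n)) (proj2 (measurable_EFinP _ _) mlim)
  (aeW _ (fun x _ => f_f' x)) ig
  (aeW _ (fun x n _ => f_g n x)).
move: ff; rewrite -(fineK (integrable_fin_num measurableT if_)).
by move=> /fine_cvgP[].
Qed.

Lemma cintegral_cvg (f_ : nat -> T -> R[i]) (f : T -> R[i]) (g : T -> R) :
  (forall n, cmeasurable (f_ n)) ->
  (forall x, ccvg (fun n => f_ n x) (f x)) ->
  mu.-integrable setT (EFin \o g) -> (forall n x, nc (f_ n x) <= g x) ->
  ccvg (fun n => cintegral mu setT (f_ n)) (cintegral mu setT f).
Proof.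
move=> mf f_f ig f_g; apply/ccvgP; split => /=.
- apply: (@Rintegral_cvg _ _ g) => //.
  + by move=> n; have [] := mf n.
  + by move=> x; have /ccvgP[] := f_f x.
  + by move=> n x; rewrite (le_trans (Re_le_nc _)).
- apply: (@Rintegral_cvg _ _ g) => //.
  + by move=> n; have [] := mf n.
  + by move=> x; have /ccvgP[] := f_f x.
  + by move=> n x; rewrite (le_trans (Im_le_nc _)).
Qed.

Lemma cmeasurable_cvg (f_ : nat -> T -> R[i]) (f : T -> R[i]) :
  (forall n, cmeasurable (f_ n)) -> (forall x, ccvg (fun n => f_ n x) (f x)) ->
  cmeasurable f.
Proof.
move=> mf ff; split.
- apply: (measurable_fun_cvg (h := fun n x => complex.Re (f_ n x))).
  + by move=> n; have [] := mf n.
  + by move=> x _; have /ccvgP[] := ff x.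
- apply: (measurable_fun_cvg (h := fun n x => complex.Im (f_ n x))).
  + by move=> n; have [] := mf n.
  + by move=> x _; have /ccvgP[] := ff x.
Qed.

End CDominated.

Section CFubini.
Context {R : realType} d1 d2 (T1 : measurableType d1) (T2 : measurableType d2).
Variables (m1 : {sigma_finite_measure set T1 -> \bar R})
          (m2 : {sigma_finite_measure set T2 -> \bar R}).

Lemma measurable_Rintegral (f : T1 * T2 -> R) : measurable_fun setT f ->
  measurable_fun setT (fun x => \int[m2]_y f (x, y)).
Proof.
move=> mf; rewrite /Rintegral.
apply: (@measurableT_comp _ _ _ _ _ _ fine); first exact: fine_measurable.
under eq_fun do rewrite integralE.
have mF : measurable_fun setT (EFin \o f) by exact/measurable_EFinP.
apply: emeasurable_funB.
- have := @measurable_fun_fubini_tonelli_F _ _ _ _ _ m2 (fun z => (EFin \o f)^\+ z)%E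
    (measurable_funepos mF) (funepos_ge0 _).
  apply: eq_measurable_fun => x _; rewrite /fubini_F; apply: eq_integral => y _.
  by rewrite !funeposE.
- have := @measurable_fun_fubini_tonelli_F _ _ _ _ _ m2 (fun z => (EFin \o f)^\- z)%E
    (measurable_funeneg mF) (funeneg_ge0 _).
  apply: eq_measurable_fun => x _; rewrite /fubini_F; apply: eq_integral => y _.
  by rewrite !funenegE.
Qed.

Lemma cmeasurable_cintegral (f : T1 * T2 -> R[i]) : cmeasurable f ->
  cmeasurable (fun x => cintegral m2 setT (fun y => f (x, y))).
Proof.
move=> [f1 f2]; split => /=.
- exact: (measurable_Rintegral f1).
- exact: (measurable_Rintegral f2).
Qed.

Lemma Rintegral_fubini (f : T1 * T2 -> R) :
  (m1 \x m2)%E.-integrable setT (EFin \o f) ->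
  \int[m1]_x \int[m2]_y f (x, y) = \int[m2]_y \int[m1]_x f (x, y).
Proof.
move=> iF; rewrite /Rintegral.
have mf : measurable_fun setT f by apply/measurable_EFinP; exact: measurable_int iF.
have h1 : (\int[m1]_x (fine (\int[m2]_y (f (x, y))%:E))%:E =
           \int[m1]_x \int[m2]_y (f (x, y))%:E)%E.
  apply: ae_eq_integral => //.
  - by apply/measurable_EFinP; exact: (measurable_Rintegral mf).
  - exact: (measurable_fubini_F iF).
  - apply: filterS (ae_integrable1 iF) => x ix _.
    by rewrite fineK//; exact: (integrable_fin_num _ ix).
have h2 : (\int[m2]_y (fine (\int[m1]_x (f (x, y))%:E))%:E =
           \int[m2]_y \int[m1]_x (f (x, y))%:E)%E.
  apply: ae_eq_integral => //.
  - apply/measurable_EFinP; apply: (@measurableT_comp _ _ _ _ _ _ fine).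
      exact: fine_measurable.
    exact: (measurable_fubini_G iF).
  - exact: (measurable_fubini_G iF).
  - apply: filterS (ae_integrable2 iF) => y iy _.
    by rewrite fineK//; exact: (integrable_fin_num _ iy).
by rewrite h1 h2 (Fubini iF).
Qed.

Lemma cintegral_fubini (f : T1 * T2 -> R[i]) : cintegrable (m1 \x m2)%E setT f ->
  cintegral m1 setT (fun x => cintegral m2 setT (fun y => f (x, y))) =
  cintegral m2 setT (fun y => cintegral m1 setT (fun x => f (x, y))).
Proof.
move=> [f1 f2]; apply: complex_eqP => /=.
- exact: (Rintegral_fubini f1).
- exact: (Rintegral_fubini f2).
Qed.

End CFubini.

(** * Fubini theorems for complex-valued functions *)

Section CProduct.
Context {R : realType} d1 d2 (T1 : measurableType d1) (T2 : measurableType d2).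
Variables (m1 : {sigma_finite_measure set T1 -> \bar R})
          (m2 : {sigma_finite_measure set T2 -> \bar R}).

Lemma Rintegral_fubini1 (f : T1 * T2 -> R) :
  (m1 \x m2)%E.-integrable setT (EFin \o f) ->
  \int[(m1 \x m2)%E]_z f z = \int[m1]_x \int[m2]_y f (x, y).
Proof.
move=> iF; rewrite /Rintegral.
have mf : measurable_fun setT f by apply/measurable_EFinP; exact: measurable_int iF.
rewrite -(integral12_prod_meas1 iF); congr fine; apply: ae_eq_integral => //.
- exact: (measurable_fubini_F iF).
- by apply/measurable_EFinP; exact: (measurable_Rintegral _ mf).
- apply: filterS (ae_integrable1 iF) => x ix _.
  by rewrite fineK//; exact: (integrable_fin_num _ ix).
Qed.

Lemma cintegral_fubini1 (f : T1 * T2 -> R[i]) : cintegrable (m1 \x m2)%E setT f ->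
  cintegral (m1 \x m2)%E setT f =
  cintegral m1 setT (fun x => cintegral m2 setT (fun y => f (x, y))).
Proof.
move=> [f1 f2]; apply: complex_eqP => /=.
- exact: (Rintegral_fubini1 f1).
- exact: (Rintegral_fubini1 f2).
Qed.

Lemma integrable_prod (f : T1 -> R) (g : T2 -> R) :
  m1.-integrable setT (EFin \o f) -> m2.-integrable setT (EFin \o g) ->
  (m1 \x m2)%E.-integrable setT (EFin \o (fun z => f z.1 * g z.2)).
Proof.
move=> /integrableP[/measurable_EFinP mf if_] /integrableP[/measurable_EFinP mg ig].
apply/integrable12ltyP.
  apply/measurable_EFinP; apply: measurable_funM.
  - exact: (measurableT_comp mf measurable_fst).
  - exact: (measurableT_comp mg measurable_snd).
have E x : (\int[m2]_y `|(EFin \o (fun z : T1 * T2 => (f z.1 * g z.2)%R)) (x, y)| =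
    `|f x|%:E * \int[m2]_y `|(EFin \o g) y|)%E.
  rewrite -ge0_integralZl//.
  - by apply: eq_integral => y _ /=; rewrite normrM EFinM.
  - by apply/measurable_EFinP; exact: measurableT_comp.
under eq_integral do rewrite E.
rewrite ge0_integralZr//.
- rewrite lte_mul_pinfty//; first exact: integral_ge0.
  by rewrite ge0_fin_numE// integral_ge0.
- by apply/measurable_EFinP; exact: measurableT_comp.
- exact: integral_ge0.
Qed.

Lemma cintegrable_nc d (T : measurableType d) (mu : {measure set T -> \bar R})
    (f : T -> R[i]) :
  cintegrable mu setT f -> mu.-integrable setT (EFin \o (fun x => nc (f x))).
Proof.
move=> [f1 f2].
have h : mu.-integrable setT (EFin \o (fun x => `|complex.Re (f x)| + `|complex.Im (f x)|)).
  by apply: (integrableD measurableT (integrable_norm f1) (integrable_norm f2)).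
apply: (le_integrable _ _ _ h) => //.
- apply/measurable_EFinP/cmeasurable_nc.
  by split; apply/measurable_EFinP; [exact: measurable_int f1|exact: measurable_int f2].
- by move=> x _ /=; rewrite lee_fin (ger0_norm (nc_ge0 _)) [leRHS]ger0_norm ?addr_ge0 ?nc_le.
Qed.

Lemma cintegrable_meas d (T : measurableType d) (mu : {measure set T -> \bar R})
    (f : T -> R[i]) : cintegrable mu setT f -> cmeasurable f.
Proof.
by move=> [f1 f2]; split; apply/measurable_EFinP;
  [exact: measurable_int f1|exact: measurable_int f2].
Qed.

Lemma cintegrable_prod (f : T1 -> R[i]) (g : T2 -> R[i]) :
  cintegrable m1 setT f -> cintegrable m2 setT g ->
  cintegrable (m1 \x m2)%E setT (fun z => f z.1 * g z.2).
Proof.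
move=> if_ ig.
apply: (cintegrable_dom _ (integrable_prod (cintegrable_nc if_) (cintegrable_nc ig))).
- apply: cmeasurableM.
  + exact: (cmeasurable_comp (cintegrable_meas if_) measurable_fst).
  + exact: (cmeasurable_comp (cintegrable_meas ig) measurable_snd).
- by move=> z; rewrite ncM.
Qed.

Lemma cintegral_prod (f : T1 -> R[i]) (g : T2 -> R[i]) :
  cintegrable m1 setT f -> cintegrable m2 setT g ->
  cintegral (m1 \x m2)%E setT (fun z => f z.1 * g z.2) =
  cintegral m1 setT f * cintegral m2 setT g.
Proof.
move=> if_ ig; rewrite (cintegral_fubini1 (cintegrable_prod if_ ig))/=.
under [X in cintegral _ _ X]eq_fun do rewrite cintegralZ//.
rewrite [RHS]mulrC -cintegralZ//; congr (cintegral _ _ _).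
by apply/funext => x; rewrite mulrC.
Qed.

End CProduct.

(** * Integration on R^3 *)

Section Leb3.
Context {R : realType}.
Let mu := @lebesgue_measure R.
Let T1 := measurableTypeR R.
Let T3 := @borel3 R.

Lemma measurable_c1 : measurable_fun setT (fun w : T3 => w.1 : T1).
Proof. exact: measurable_fst. Qed.
Lemma measurable_c2 : measurable_fun setT (fun w : T3 => w.2.1 : T1).
Proof. by apply: (@measurableT_comp _ _ _ _ _ _ fst). Qed.
Lemma measurable_c3 : measurable_fun setT (fun w : T3 => w.2.2 : T1).
Proof. by apply: (@measurableT_comp _ _ _ _ _ _ snd). Qed.

Lemma measurable_triple d (T : measurableType d) (a b c : T -> T1) :
  measurable_fun setT a -> measurable_fun setT b -> measurable_fun setT c ->
  measurable_fun setT (fun x => (a x, (b x, c x)) : T3).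
Proof. by move=> ma mb mc; do 2 apply: measurable_fun_pair => //. Qed.

Definition aff3 (a : R) (b z : R3 R) : R3 R :=
  (a * z.1 + b.1, (a * z.2.1 + b.2.1, a * z.2.2 + b.2.2)).

Lemma measurable_aff3 (a : R) (b : T3) : measurable_fun setT (aff3 a b : T3 -> T3).
Proof.
apply: measurable_triple.
- exact: (measurableT_comp (measurable_affine a b.1) measurable_c1).
- exact: (measurableT_comp (measurable_affine a b.2.1) measurable_c2).
- exact: (measurableT_comp (measurable_affine a b.2.2) measurable_c3).
Qed.

Local Open Scope ereal_scope.

Lemma tonelli3 (f : T3 -> \bar R) : measurable_fun setT f -> (forall x, 0 <= f x) ->
  \int[leb3]_w f w = \int[mu]_x \int[mu]_y \int[mu]_z f (x, (y, z)).
Proof.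
move=> mf f0; rewrite /leb3 fubini_tonelli1//; apply: eq_integral => x _.
rewrite /fubini_F /leb2 fubini_tonelli1//.
by apply: (measurableT_comp mf); apply: measurable_fun_pair.
Qed.

Lemma ge0_integral_aff3 (a : R) (b : T3) (f : T3 -> \bar R) : a != 0%R ->
  measurable_fun setT f -> (forall x, 0 <= f x) ->
  \int[leb3]_w f w = (`|a| ^+ 3)%:E * \int[leb3]_w f (aff3 a b w).
Proof.
move=> a0 mf f0.
have mfa : measurable_fun setT (fun w => f (aff3 a b w)).
  exact: (measurableT_comp mf (measurable_aff3 a b)).
have a0' : 0 <= `|a|%:E by rewrite lee_fin.
have cst d (T : measurableType d) (x : T1) : measurable_fun setT (fun=> x : T1).
  by move=> *; exact: measurable_cst.
rewrite !tonelli3//.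
transitivity (\int[mu]_x (`|a|%:E * (`|a|%:E * \int[mu]_y \int[mu]_z
    f (x, (a * y + b.2.1, a * z + b.2.2)%R)))).
  apply: eq_integral => x _.
  have -> : \int[mu]_y \int[mu]_z f (x, (y, z)) =
      \int[mu]_y (`|a|%:E * \int[mu]_z f (x, (y, a * z + b.2.2)%R)).
    apply: eq_integral => y _.
    rewrite (ge0_integral_affine b.2.2 a0)//.
    by apply: (measurableT_comp mf); exact: measurable_triple.
  have m2 : measurable_fun setT (fun y : T1 => \int[mu]_z f (x, (y, a * z + b.2.2)%R)).
    apply: (@measurable_fun_fubini_tonelli_F _ _ _ _ _ mu
      (fun yz => f (x, (yz.1, a * yz.2 + b.2.2)%R))) => //.
    apply: (measurableT_comp mf); apply: measurable_triple => //.
    exact: (measurableT_comp (measurable_affine a b.2.2)).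
  rewrite ge0_integralZl//; last by move=> y _; exact: integral_ge0.
  congr (_ * _).
  by rewrite (ge0_integral_affine b.2.1 a0)// => y; exact: integral_ge0.
have m3 : measurable_fun setT (fun x : T1 => \int[mu]_y \int[mu]_z
    f (x, (a * y + b.2.1, a * z + b.2.2)%R)).
  rewrite (_ : (fun x => _) = fubini_F leb2 (fun u : T3 =>
      f (u.1, (a * u.2.1 + b.2.1, a * u.2.2 + b.2.2)%R))).
    apply: measurable_fun_fubini_tonelli_F => //.
    apply: (measurableT_comp mf); apply: measurable_triple => //.
    - exact: (measurableT_comp (measurable_affine a b.2.1) measurable_c2).
    - exact: (measurableT_comp (measurable_affine a b.2.2) measurable_c3).
  apply/funext => x; rewrite /fubini_F /leb2 fubini_tonelli1//=.
  apply: (measurableT_comp mf); apply: measurable_triple => //.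
  - by apply: (measurableT_comp (measurable_affine a b.2.1)).
  - by apply: (measurableT_comp (measurable_affine a b.2.2)).
have i0 x : 0 <= \int[mu]_y \int[mu]_z f (x, (a * y + b.2.1, a * z + b.2.2)%R).
  by apply: integral_ge0 => y _; exact: integral_ge0.
rewrite ge0_integralZl//.
- rewrite ge0_integralZl//.
  rewrite (ge0_integral_affine b.1 a0 m3)// !muleA -!EFinM.
  by rewrite (_ : (`|a| * `|a| * `|a|) = `|a| ^+ 3)%R// !exprS expr0; ring.
- exact: measurable_funeM.
- by move=> x _; rewrite mule_ge0.
Qed.

End Leb3.

Section Leb3Integrable.
Context {R : realType}.
Let mu := @lebesgue_measure R.
Let T1 := measurableTypeR R.
Let T3 := @borel3 R.

Lemma integrable_aff3 (a : R) (b : T3) (f : T3 -> R) : a != 0 ->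
  leb3.-integrable setT (EFin \o f) ->
  leb3.-integrable setT (EFin \o (fun w => f (aff3 a b w))).
Proof.
move=> a0 /integrableP[mf if_]; apply/integrableP; split.
  exact: (measurableT_comp mf (measurable_aff3 a b)).
move: if_; rewrite (ge0_integral_aff3 b a0)//; last exact: measurableT_comp.
rewrite -ge0_fin_numE ?mule_ge0 ?integral_ge0 ?lee_fin ?exprn_ge0//.
move=> h; rewrite ltNge leye_eq; apply/eqP => E; move: h.
rewrite E gt0_muley//.
by rewrite lte_fin exprn_gt0// normr_gt0.
Qed.

Lemma Rintegral_aff3 (a : R) (b : T3) (f : T3 -> R) : a != 0 ->
  leb3.-integrable setT (EFin \o f) ->
  \int[leb3]_w f w = `|a| ^+ 3 * \int[leb3]_w f (aff3 a b w).
Proof.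
move=> a0 if_; have ifa := integrable_aff3 b a0 if_.
rewrite -[X in _ = X * _]/(fine (`|a| ^+ 3)%:E) /Rintegral -fineM//; last first.
  exact: integrable_fin_num ifa.
congr fine.
have mf := measurable_int _ if_.
have A := integralE leb3 setT (EFin \o f).
have B := integralE leb3 setT (EFin \o (fun w => f (aff3 a b w))).
rewrite [LHS]A [X in _ = (_ * X)%E]B.
rewrite (ge0_integral_aff3 b a0 (measurable_funepos mf) (funepos_ge0 _)).
rewrite (ge0_integral_aff3 b a0 (measurable_funeneg mf) (funeneg_ge0 _)).
rewrite -muleBr//.
- congr (_ * (_ - _))%E.
  + by apply: eq_integral => x _; rewrite !funeposE.
  + by apply: eq_integral => x _; rewrite !funenegE.
- apply: fin_num_adde_defl; rewrite fin_numN.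
  have -> : (\int[leb3]_w (EFin \o f)^\- (aff3 a b w) =
    \int[leb3]_x (EFin \o (fun w => f (aff3 a b w)))^\- x)%E.
    by apply: eq_integral => x _; rewrite !funenegE.
  exact: (integrable_fin_num _ (integrable_funeneg measurableT ifa)).
Qed.

Lemma cintegrable_aff3 (a : R) (b : T3) (f : T3 -> R[i]) : a != 0 ->
  cintegrable leb3 setT f -> cintegrable leb3 setT (fun w => f (aff3 a b w)).
Proof.
move=> a0 [f1 f2]; split.
- exact: (integrable_aff3 b a0 f1).
- exact: (integrable_aff3 b a0 f2).
Qed.

Lemma cintegral_aff3 (a : R) (b : T3) (f : T3 -> R[i]) : a != 0 ->
  cintegrable leb3 setT f ->
  cintegral leb3 setT f = (`|a| ^+ 3)%:C%C * cintegral leb3 setT (fun w => f (aff3 a b w)).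
Proof.
move=> a0 [f1 f2]; apply: complex_eqP; rewrite ?ReM ?ImM /= !mul0r ?subr0 ?addr0.
- exact: (Rintegral_aff3 b a0 f1).
- exact: (Rintegral_aff3 b a0 f2).
Qed.

Definition cauchy (x : R) : R := (1 + x ^+ 2)^-1.

Lemma cauchy_gt0 x : 0 < cauchy x.
Proof. by rewrite invr_gt0 ltr_wpDr// sqr_ge0. Qed.

Lemma cauchy_ge0 x : 0 <= cauchy x. Proof. exact/ltW/cauchy_gt0. Qed.

Lemma cauchy_le1 x : cauchy x <= 1.
Proof. by rewrite invf_le1 ?lerDl ?sqr_ge0// ltr_wpDr// sqr_ge0. Qed.

Lemma cauchyN x : cauchy (- x) = cauchy x.
Proof. by rewrite /cauchy sqrrN. Qed.

Lemma measurable_cauchy : measurable_fun setT (cauchy : T1 -> T1).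
Proof. apply: continuous_measurable_fun; exact: continuous_oneDsqrV. Qed.

Lemma integral_cauchy : (\int[mu]_x (cauchy x)%:E = pi%:E)%E.
Proof.
rewrite ge0_symfun_integralT//.
- rewrite -set_itvcy; rewrite (@integral0y_oneDsqr R) -EFinM; congr EFin.
  by field.
- exact: cauchy_ge0.
- exact: continuous_oneDsqrV.
- by move=> x /=; rewrite cauchyN.
Qed.

Lemma integrable_cauchy : mu.-integrable setT (EFin \o cauchy).
Proof.
apply/integrableP; split; first by apply/measurable_EFinP; exact: measurable_cauchy.
under eq_integral do rewrite /= ger0_norm ?cauchy_ge0//.
by rewrite integral_cauchy ltry.
Qed.

Definition rho (w : R3 R) : R := cauchy w.1 * (cauchy w.2.1 * cauchy w.2.2).

Lemma rho_gt0 w : 0 < rho w.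
Proof. by rewrite !mulr_gt0// cauchy_gt0. Qed.

Lemma rho_ge0 w : 0 <= rho w. Proof. exact/ltW/rho_gt0. Qed.

Lemma rho_le1 w : rho w <= 1.
Proof. by rewrite !mulr_ile1 ?mulr_ge0 ?cauchy_ge0 ?cauchy_le1. Qed.

Lemma integrable3 (f g h : R -> R) : mu.-integrable setT (EFin \o f) ->
  mu.-integrable setT (EFin \o g) -> mu.-integrable setT (EFin \o h) ->
  leb3.-integrable setT (EFin \o (fun w => f w.1 * (g w.2.1 * h w.2.2))).
Proof. by move=> if_ ig ih; exact: (@integrable_prod _ _ _ _ _ mu leb2 f (fun z => g z.1 * h z.2) if_ (integrable_prod ig ih)). Qed.

Lemma cintegrable3 (f g h : R -> R[i]) : cintegrable mu setT f ->
  cintegrable mu setT g -> cintegrable mu setT h ->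
  cintegrable leb3 setT (fun w => f w.1 * (g w.2.1 * h w.2.2)).
Proof. by move=> if_ ig ih; exact: (@cintegrable_prod _ _ _ _ _ mu leb2 f (fun z => g z.1 * h z.2) if_ (cintegrable_prod ig ih)). Qed.

Lemma cintegral3 (f g h : R -> R[i]) : cintegrable mu setT f ->
  cintegrable mu setT g -> cintegrable mu setT h ->
  cintegral leb3 setT (fun w => f w.1 * (g w.2.1 * h w.2.2)) =
  cintegral mu setT f * (cintegral mu setT g * cintegral mu setT h).
Proof.
move=> if_ ig ih; rewrite -(cintegral_prod ig ih).
exact: (@cintegral_prod _ _ _ _ _ mu leb2 f (fun z => g z.1 * h z.2) if_ (cintegrable_prod ig ih)).
Qed.

Lemma integrable_rho : leb3.-integrable setT (EFin \o rho).
Proof. by apply: integrable3; exact: integrable_cauchy. Qed.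

End Leb3Integrable.

(** * Convolution of Cauchy weights *)

Section Prelim4.
Context {R : realType}.
Let mu := @lebesgue_measure R.
Let T1 := measurableTypeR R.
Let T3 := @borel3 R.

Lemma measurable_inv : measurable_fun setT (GRing.inv : T1 -> T1).
Proof.
pose h n (x : R) : R := x / (x ^+ 2 + n.+1%:R^-1).
apply: (@measurable_fun_cvg _ _ _ setT (h : nat -> T1 -> R)).
- move=> n; apply: continuous_measurable_fun => x.
  apply: cvgM; first exact: cvg_id.
  apply: cvgV; first by rewrite gt_eqF// ltr_wpDl ?sqr_ge0.
  apply: cvgD; last exact: cvg_cst.
  exact: exprn_continuous.
- move=> x _; have [->|x0] := eqVneq x 0.
    by rewrite invr0 /h; under eq_fun do rewrite mul0r; exact: cvg_cst.
  have -> : x^-1 = x / (x ^+ 2 + 0) by field.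
  apply: cvgM; first exact: cvg_cst.
  apply: cvgV; first by rewrite addr0 expf_neq0.
  by apply: cvgD; [exact: cvg_cst|exact: cvg_harmonic].
Qed.

Lemma measurable_div d (T : measurableType d) (f g : T -> R) :
  measurable_fun setT f -> measurable_fun setT g ->
  measurable_fun setT (fun x => f x / g x).
Proof.
by move=> mf mg; apply: measurable_funM => //; exact: (measurableT_comp measurable_inv).
Qed.

Lemma measurable_omega : measurable_fun setT (omega : T3 -> T1).
Proof.
apply: measurable_funB.
- by apply: measurable_funX; exact: measurable_c1.
- apply: measurable_div; last exact: measurable_c1.
  by apply: measurable_realfun.measurable_funD; apply: measurable_funX;
    [exact: measurable_c2|exact: measurable_c3].
Qed.

Lemma measurable_sub3 : measurable_fun setT (fun z : T3 * T3 => z.1 - z.2 : T3).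
Proof.
apply: (@measurable_triple _ _ _ (fun z : T3 * T3 => z.1.1 - z.2.1)
   (fun z : T3 * T3 => z.1.2.1 - z.2.2.1) (fun z : T3 * T3 => z.1.2.2 - z.2.2.2)).
- apply: measurable_funB.
  + exact: (measurableT_comp measurable_c1 measurable_fst).
  + exact: (measurableT_comp measurable_c1 measurable_snd).
- apply: measurable_funB.
  + exact: (measurableT_comp measurable_c2 measurable_fst).
  + exact: (measurableT_comp measurable_c2 measurable_snd).
- apply: measurable_funB.
  + exact: (measurableT_comp measurable_c3 measurable_fst).
  + exact: (measurableT_comp measurable_c3 measurable_snd).
Qed.

Lemma measurable_dot3 : measurable_fun setT (fun z : T3 * T3 => dot3 z.1 z.2 : T1).
Proof.
apply: measurable_realfun.measurable_funD; last apply: measurable_realfun.measurable_funD;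
  apply: measurable_funM.
- exact: (measurableT_comp measurable_c1 measurable_fst).
- exact: (measurableT_comp measurable_c1 measurable_snd).
- exact: (measurableT_comp measurable_c2 measurable_fst).
- exact: (measurableT_comp measurable_c2 measurable_snd).
- exact: (measurableT_comp measurable_c3 measurable_fst).
- exact: (measurableT_comp measurable_c3 measurable_snd).
Qed.

(** By [x^2 <= 2 y^2 + 2 (x - y)^2]. *)
Lemma cauchy_mul (x y : R) :
  cauchy y * cauchy (x - y) <= cauchy x * (2 * cauchy y + 2 * cauchy (x - y)).
Proof.
have p (u : R) : 0 < 1 + u ^+ 2 by rewrite ltr_wpDr// sqr_ge0.
rewrite /cauchy -ler_pdivrMl ?invr_gt0// invrK.
have -> : 2 * (1 + y ^+ 2)^-1 + 2 * (1 + (x - y) ^+ 2)^-1 =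
    (2 * (1 + (x - y) ^+ 2) + 2 * (1 + y ^+ 2)) * ((1 + y ^+ 2)^-1 * (1 + (x - y) ^+ 2)^-1).
  field; apply/andP; split; rewrite gt_eqF//; exact: p.
rewrite ler_wpM2r//; first by rewrite mulr_ge0// invr_ge0 ltW.
have := sqr_ge0 (x - 2 * y); rewrite [_ ^+ 2](_ : _ = 2 * (x - y) ^+ 2 + 2 * y ^+ 2 - x ^+ 2); [lra|ring].
Qed.

Lemma integral_cauchy_refl (x : R) : (\int[mu]_y (cauchy (x - y))%:E = pi%:E)%E.
Proof.
rewrite -integral_cauchy (@ge0_integral_affine _ (-1) x)//.
- rewrite normrN1 mul1e; apply: eq_integral => y _.
  by rewrite mulN1r addrC.
- by apply/measurable_EFinP; exact: measurable_cauchy.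
- by move=> y; rewrite lee_fin cauchy_ge0.
Qed.

Lemma measurable_cauchy_refl (x : R) : measurable_fun setT (fun y : T1 => cauchy (x - y)).
Proof. by apply: (measurableT_comp measurable_cauchy); apply: measurable_funB. Qed.

Lemma integrable_cauchy_refl (x : R) : mu.-integrable setT (EFin \o (fun y => cauchy (x - y))).
Proof.
apply/integrableP; split; first by apply/measurable_EFinP; exact: measurable_cauchy_refl.
under eq_integral do rewrite /= ger0_norm ?cauchy_ge0//.
by rewrite integral_cauchy_refl ltry.
Qed.

Definition cauchy2 (x y : R) : R := 2 * cauchy y + 2 * cauchy (x - y).

Lemma integrable_cauchy2 (x : R) : mu.-integrable setT (EFin \o cauchy2 x).
Proof.
exact: (integrableD measurableT (integrable_scale 2 integrable_cauchy)
  (integrable_scale 2 (integrable_cauchy_refl x))).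
Qed.

Lemma Rintegral_cauchy2 (x : R) : \int[mu]_y cauchy2 x y = 4 * pi.
Proof.
rewrite RintegralD//; last 2 first.
- exact: (integrable_scale 2 integrable_cauchy).
- exact: (integrable_scale 2 (integrable_cauchy_refl x)).
rewrite (RintegralZl 2 measurableT integrable_cauchy).
rewrite (RintegralZl 2 measurableT (integrable_cauchy_refl x)).
by rewrite /Rintegral integral_cauchy integral_cauchy_refl/=; ring.
Qed.

Lemma Rintegral3 (f g h : R -> R) : mu.-integrable setT (EFin \o f) ->
  mu.-integrable setT (EFin \o g) -> mu.-integrable setT (EFin \o h) ->
  \int[leb3]_w (f w.1 * (g w.2.1 * h w.2.2)) =
  (\int[mu]_x f x) * ((\int[mu]_x g x) * (\int[mu]_x h x)).
Proof.
move=> if_ ig ih.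
have cr (k : R -> R) : mu.-integrable setT (EFin \o k) ->
    cintegrable mu setT (fun x => (k x)%:C%C).
  by move=> ik; split => //=; exact: integrable0.
have cre (k : R -> R) : cintegral mu setT (fun x => (k x)%:C%C) = (\int[mu]_x k x)%:C%C.
  apply: complex_eqP => //=; rewrite /Rintegral.
  by rewrite integral0.
have := cintegral3 (cr _ if_) (cr _ ig) (cr _ ih); rewrite !cre -!rmorphM/=.
move=> /(congr1 (@complex.Re R))/= <-.
by apply: eq_Rintegral => w _; rewrite /=; ring.
Qed.

Lemma rho_mul (w v : R3 R) : rho v * rho (w - v) <=
  rho w * (cauchy2 w.1 v.1 * (cauchy2 w.2.1 v.2.1 * cauchy2 w.2.2 v.2.2)).
Proof.
have -> : rho v * rho (w - v) = (cauchy v.1 * cauchy (w.1 - v.1)) *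
   ((cauchy v.2.1 * cauchy (w.2.1 - v.2.1)) * (cauchy v.2.2 * cauchy (w.2.2 - v.2.2))).
  by rewrite /rho/=; ring.
have -> : rho w * (cauchy2 w.1 v.1 * (cauchy2 w.2.1 v.2.1 * cauchy2 w.2.2 v.2.2)) =
   (cauchy w.1 * cauchy2 w.1 v.1) * ((cauchy w.2.1 * cauchy2 w.2.1 v.2.1) *
   (cauchy w.2.2 * cauchy2 w.2.2 v.2.2)) by rewrite /rho; ring.
have c0 x y : 0 <= cauchy y * cauchy (x - y) by rewrite mulr_ge0 ?cauchy_ge0.
apply: ler_pM; [exact: c0|by apply: mulr_ge0; exact: c0|exact: cauchy_mul|].
by apply: ler_pM; [exact: c0|exact: c0|exact: cauchy_mul|exact: cauchy_mul].
Qed.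

Definition dom3 (w v : R3 R) : R :=
  cauchy2 w.1 v.1 * (cauchy2 w.2.1 v.2.1 * cauchy2 w.2.2 v.2.2).

Lemma integrable_dom3 (w : R3 R) : leb3.-integrable setT (EFin \o dom3 w).
Proof. by apply: integrable3; exact: integrable_cauchy2. Qed.

Lemma Rintegral_dom3 (w : R3 R) : \int[leb3]_v dom3 w v = (4 * pi) ^+ 3.
Proof.
rewrite /dom3 Rintegral3; try exact: integrable_cauchy2.
by rewrite !Rintegral_cauchy2; ring.
Qed.

End Prelim4.

(** * Weighted bounds for the Duhamel term *)

Section TimeIntegral.
Context {R : realType}.
Let mu := @lebesgue_measure R.

Lemma continuous_expR_abs (a : R) : continuous (fun s : R => a * expR (a * `|s|)).
Proof.
move=> s; apply: cvgM; first exact: cvg_cst.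
apply: (@continuous_comp _ _ _ (fun s : R => a * `|s|) expR); last exact: continuous_expR.
by apply: cvgM; [exact: cvg_cst|exact: norm_continuous].
Qed.

Lemma integrable_expR_abs (a t : R) :
  mu.-integrable (between0 t) (EFin \o (fun s => a * expR (a * `|s|))).
Proof.
apply: continuous_compact_integrable; first exact: segment_compact.
by apply: continuous_subspaceT; exact: continuous_expR_abs.
Qed.

Lemma Rintegral_expR_abs (a t : R) :
  \int[mu]_(s in between0 t) (a * expR (a * `|s|)) = expR (a * `|t|) - 1.
Proof.
have dF (b x : R) : is_derive x 1 (fun s => expR (b * s)) (b * expR (b * x)).
  have h : is_derive x 1 (fun s : R => b * s) b.
    have := is_deriveM (is_derive_cst b x 1) (is_derive_id x (1 : R)).
    by move=> /is_derive_eq; apply; rewrite /GRing.scale/= mulr1 mulr0 addr0.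
  by rewrite mulrC; exact: (is_derive1_comp (is_derive_expR (b * x)) h).
have cF (b x : R) : {for x, continuous (fun s : R => expR (b * s))}.
  apply: (@continuous_comp _ _ _ (fun s : R => b * s) expR); last exact: continuous_expR.
  by apply: cvgM; [exact: cvg_cst|exact: cvg_id].
rewrite /between0; have [t0|t0|<-] := ltgtP 0 t; last first.
- by rewrite set_itv1 Rintegral_set1 normr0 mulr0 expR0 subrr.
- rewrite /Rintegral (@continuous_FTC2 _ (fun s => a * expR (a * `|s|)) (fun s => - expR ((- a) * s)) t 0)//.
  + rewrite -EFinB/= mulr0 expR0 opprK addrC ltr0_norm//.
    by rewrite mulNr mulrN.
  + by apply: continuous_subspaceT; exact: continuous_expR_abs.
  + split.
    * by move=> x _; apply: derivableN; have [] := dF (- a) x.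
    * by apply: cvg_at_right_filter; apply: cvgN; exact: cF.
    * by apply: cvg_at_left_filter; apply: cvgN; exact: cF.
  + move=> x; rewrite in_itv/= => /andP[_ x0].
    rewrite derive1E (@derive_val _ _ _ _ _ _ _ (is_deriveN (dF (- a) x))).
    rewrite ltr0_norm//; have -> : a * - x = - a * x by ring.
    by ring.
- rewrite /Rintegral (@continuous_FTC2 _ (fun s => a * expR (a * `|s|)) (fun s => expR (a * s)) 0 t)//.
  + by rewrite -EFinB/= mulr0 expR0 gtr0_norm.
  + by apply: continuous_subspaceT; exact: continuous_expR_abs.
  + split.
    * by move=> x _; have [] := dF a x.
    * by apply: cvg_at_right_filter; exact: cF.
    * by apply: cvg_at_left_filter; exact: cF.
  + move=> x; rewrite in_itv/= => /andP[x0 _].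
    by rewrite derive1E (@derive_val _ _ _ _ _ _ _ (dF a x)) gtr0_norm.
Qed.

End TimeIntegral.

Section Weights.
Context {R : realType}.
Let mu := @lebesgue_measure R.
Let T1 := measurableTypeR R.
Let T3 := @borel3 R.

(** The exponential is the analyticity weight: it decreases in [b], which will
    be [T - |s|] at time [s], and it is submultiplicative for convolution. *)
Definition wt (b : R) (w : R3 R) : R := rho w * expR (- (b * `|w.1|)).

Lemma wt_gt0 b w : 0 < wt b w.
Proof. by rewrite mulr_gt0 ?rho_gt0 ?expR_gt0. Qed.

Lemma wt_ge0 b w : 0 <= wt b w. Proof. exact/ltW/wt_gt0. Qed.

Lemma wt_le_rho b w : 0 <= b -> wt b w <= rho w.
Proof.
move=> b0; rewrite ler_piMr ?rho_ge0// -expR0 ler_expR oppr_le0 mulr_ge0//.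
Qed.

(** The triangle inequality in the exponent and [rho_mul]. *)
Lemma wt_mul b (w v : R3 R) : 0 <= b -> wt b v * wt b (w - v) <= wt b w * dom3 w v.
Proof.
move=> b0; rewrite /wt mulrACA [leRHS]mulrAC -expRD.
apply: ler_pM; [by apply: mulr_ge0; exact: rho_ge0|exact: expR_ge0|exact: rho_mul|].
rewrite ler_expR -opprD lerN2 -mulrDr ler_wpM2l//=.
by rewrite (le_trans _ (ler_normD _ _))// addrC subrK.
Qed.

Lemma cmeasurable_conv (g h : R3 R -> R[i]) (w : R3 R) :
  @cmeasurable R _ borel3 g -> @cmeasurable R _ borel3 h ->
  @cmeasurable R _ borel3 (fun v => g v * h (w - v)).
Proof.
move=> mg mh; apply: cmeasurableM => //; apply: (cmeasurable_comp mh).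
have : measurable_fun setT (fun v : T3 => (w, v) : T3 * T3) by apply: measurable_fun_pair.
by move=> mw; exact: (measurableT_comp measurable_sub3 mw).
Qed.

Lemma conv_dom (g h : R3 R -> R[i]) (A B b : R) (w v : R3 R) : 0 <= b ->
  (forall v, nc (g v) <= A * wt b v) -> (forall v, nc (h v) <= B * wt b v) ->
  nc (g v * h (w - v)) <= A * B * wt b w * dom3 w v.
Proof.
move=> b0 gA hB; rewrite ncM.
have A0 : 0 <= A by rewrite -(pmulr_lge0 _ (wt_gt0 b 0)) (le_trans _ (gA 0))// nc_ge0.
have B0 : 0 <= B by rewrite -(pmulr_lge0 _ (wt_gt0 b 0)) (le_trans _ (hB 0))// nc_ge0.
apply: (@le_trans _ _ ((A * wt b v) * (B * wt b (w - v)))).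
  by apply: ler_pM => //; exact: nc_ge0.
rewrite mulrACA -[leRHS]mulrA; apply: ler_wpM2l; first exact: mulr_ge0.
exact: wt_mul.
Qed.

Lemma integrable_dom3Z (c : R) (w : R3 R) :
  leb3.-integrable setT (EFin \o (fun v => c * dom3 w v)).
Proof. exact: (integrable_scale c (integrable_dom3 w)). Qed.

Lemma Rintegral_dom3Z (c : R) (w : R3 R) :
  \int[leb3]_v (c * dom3 w v) = c * (4 * pi) ^+ 3.
Proof. by rewrite (RintegralZl c measurableT (integrable_dom3 w)) Rintegral_dom3. Qed.

Lemma fconv_int (g h : R3 R -> R[i]) (A B b : R) (w : R3 R) : 0 <= b ->
  @cmeasurable R _ borel3 g -> @cmeasurable R _ borel3 h ->
  (forall v, nc (g v) <= A * wt b v) -> (forall v, nc (h v) <= B * wt b v) ->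
  fconv_integrable g h w.
Proof.
move=> b0 mg mh gA hB.
apply: (cintegrable_dom (cmeasurable_conv w mg mh) (integrable_dom3Z (A * B * wt b w) w)).
by move=> v; exact: conv_dom.
Qed.

Definition cfconv : R := cst3 * (2 * (4 * pi) ^+ 3).

Lemma cst3_gt0 : 0 < cst3 :> R.
Proof. by rewrite powR_gt0// mulr_gt0// pi_gt0. Qed.

Lemma cfconv_gt0 : 0 < cfconv.
Proof. by rewrite mulr_gt0 ?cst3_gt0// mulr_gt0// exprn_gt0// mulr_gt0// pi_gt0. Qed.

Lemma fconv_diff_bound (g h : R3 R -> R[i]) (A B D b : R) (w : R3 R) : 0 <= b ->
  @cmeasurable R _ borel3 g -> @cmeasurable R _ borel3 h ->
  (forall v, nc (g v) <= A * wt b v) -> (forall v, nc (h v) <= B * wt b v) ->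
  (forall v, nc (g v - h v) <= D * wt b v) ->
  nc (fconv g g w - fconv h h w) <= cfconv * ((A + B) * D) * wt b w.
Proof.
move=> b0 mg mh gA hB ghD.
rewrite /fconv -mulrBr ncM nc_real (gtr0_norm cst3_gt0).
rewrite -cintegralB; [|exact: (fconv_int _ b0 mg mg gA gA)|exact: (fconv_int _ b0 mh mh hB hB)].
rewrite /cfconv -!mulrA ler_wpM2l ?(ltW cst3_gt0)//.
apply: le_trans.
  apply: (@cintegral_le _ _ _ leb3 _ (fun v => (A + B) * D * wt b w * dom3 w v)).
  - by apply: cmeasurableB; exact: cmeasurable_conv.
  - exact: integrable_dom3Z.
  - move=> v.
    have -> : g v * g (w - v) - h v * h (w - v) =
       (g v - h v) * g (w - v) + h v * (g (w - v) - h (w - v)) by ring.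
    rewrite (le_trans (ncD _ _))//.
    have h1 := @conv_dom (fun v => g v - h v) g D A b w v b0 ghD gA.
    have h2 := @conv_dom h (fun v => g v - h v) B D b w v b0 hB ghD.
    by apply: (le_trans (lerD h1 h2)); rewrite -!mulrDl; apply: eqle; ring.
by rewrite Rintegral_dom3Z; apply: eqle; ring.
Qed.

Lemma fconv_bound (g : R3 R -> R[i]) (A b : R) (w : R3 R) : 0 <= b ->
  @cmeasurable R _ borel3 g -> (forall v, nc (g v) <= A * wt b v) ->
  nc (fconv g g w) <= cfconv * A ^+ 2 * wt b w.
Proof.
move=> b0 mg gA.
have := @fconv_diff_bound g (fun=> 0) A 0 A b w b0 mg (cmeasurable_cst _ _) gA.
have -> : fconv (fun=> 0) (fun=> 0) w = 0 :> R[i].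
  rewrite /fconv; under [X in cintegral _ _ X]eq_fun do rewrite mul0r.
  by apply: complex_eqP; rewrite /cintegral/= /Rintegral integral0/=; ring.
rewrite subr0 addr0 expr2; apply; move=> v.
- by rewrite nc0 mul0r.
- by rewrite subr0.
Qed.

(** Measurability jointly in time and frequency, so that Fubini's theorem
    applies to the Duhamel term. *)
Definition jmeas (u : R -> R3 R -> R[i]) :=
  @cmeasurable R _ (T1 * T3)%type (fun z => u z.1 z.2).

Lemma jmeas_section u s : jmeas u -> @cmeasurable R _ borel3 (u s).
Proof.
move=> mu_; have : measurable_fun setT (fun v : T3 => (s, v) : T1 * T3) by apply: measurable_fun_pair.
by move=> ms; exact: (cmeasurable_comp mu_ ms).
Qed.

Lemma jmeas_fconv u v : jmeas u -> jmeas v ->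
  @cmeasurable R _ (T1 * T3)%type (fun z => fconv (u z.1) (v z.1) z.2).
Proof.
move=> ju jv; apply: cmeasurableM; first exact: cmeasurable_cst.
apply: (@cmeasurable_cintegral _ _ _ (T1 * T3)%type T3 leb3
  (fun z => u z.1.1 z.2 * v z.1.1 (z.1.2 - z.2))).
have m11 : measurable_fun setT (fun z : (T1 * T3) * T3 => z.1.1).
  exact: (measurableT_comp measurable_fst measurable_fst).
apply: cmeasurableM.
- apply: (cmeasurable_comp (f := fun z : T1 * T3 => u z.1 z.2) (g := fun z : (T1 * T3) * T3 => (z.1.1, z.2))) => //.
  by apply: measurable_fun_pair.
- apply: (cmeasurable_comp (f := fun z : T1 * T3 => v z.1 z.2) (g := fun z : (T1 * T3) * T3 => (z.1.1, z.1.2 - z.2))) => //.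
  apply: measurable_fun_pair => //.
  have m : measurable_fun setT (fun z : (T1 * T3) * T3 => (z.1.2, z.2) : T3 * T3).
    apply: measurable_fun_pair => //.
    exact: (measurableT_comp measurable_snd measurable_fst).
  exact: (measurableT_comp measurable_sub3 m).
Qed.

Lemma measurable_between0 (t : R) : @measurable _ T1 (between0 t).
Proof. exact: measurable_itv. Qed.

Lemma measurable_between0_joint :
  measurable_fun setT (fun z : T1 * T1 => \1_(between0 z.1) z.2 : R).
Proof.
have -> : (fun z : T1 * T1 => \1_(between0 z.1) z.2 : R) =
   (fun z => \1_[set z : T1 * T1 | (Num.min 0 z.1 <= z.2) && (z.2 <= Num.max 0 z.1)] z).
  apply/funext => z; rewrite !indicE.
  suff -> : (z.2 \in between0 z.1) =
    (z \in [set z : T1 * T1 | (Num.min 0 z.1 <= z.2) && (z.2 <= Num.max 0 z.1)]) by [].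
  by apply/idP/idP => /set_mem h; apply/mem_set; move: h; rewrite /between0 /= in_itv.
apply: measurable_indic.
have m1 : measurable_fun setT (fun z : T1 * T1 => Num.min 0 z.1 <= z.2).
  by apply: measurable_fun_ler => //; apply: measurable_minr.
have m2 : measurable_fun setT (fun z : T1 * T1 => z.2 <= Num.max 0 z.1).
  by apply: measurable_fun_ler => //; apply: measurable_maxr.
have := measurable_and m1 m2; move=> /(_ measurableT [set true]) /=.
by rewrite setTI; apply.
Qed.

Definition duh_integrand (u : R -> R3 R -> R[i]) (t s : R) (w : R3 R) : R[i] :=
  expi ((t - s) * omega w) * ('i%C * (w.1)%:C%C) * fconv (u s) (u s) w.

Lemma duhamelE u t w : duhamel u t w = (Num.sg t)%:C%C *
  cintegral mu setT (fun s => (\1_(between0 t) s)%:C%C * duh_integrand u t s w).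
Proof. by rewrite /duhamel; congr (_ * _); exact: cintegral_mkcond. Qed.

Lemma jmeas_duh_integrand u : jmeas u ->
  @cmeasurable R _ ((T1 * T3) * T1)%type (fun z => duh_integrand u z.1.1 z.2 z.1.2).
Proof.
move=> ju.
have m11 : measurable_fun setT (fun z : (T1 * T3) * T1 => z.1.1).
  exact: (measurableT_comp measurable_fst measurable_fst).
have m12 : measurable_fun setT (fun z : (T1 * T3) * T1 => z.1.2).
  exact: (measurableT_comp measurable_snd measurable_fst).
apply: cmeasurableM; first apply: cmeasurableM.
- apply: cmeasurable_expi; apply: measurable_funM; first exact: measurable_funB.
  exact: (measurableT_comp measurable_omega m12).
- apply: cmeasurableM; first exact: cmeasurable_cst.
  by apply: cmeasurable_real; exact: (measurableT_comp measurable_c1 m12).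
- apply: (cmeasurable_comp (f := fun z : T1 * T3 => fconv (u z.1) (u z.1) z.2)
    (g := fun z : (T1 * T3) * T1 => (z.2, z.1.2))); first exact: jmeas_fconv.
  by apply: measurable_fun_pair.
Qed.

Lemma jmeas_duhamel u : jmeas u -> jmeas (duhamel u).
Proof.
move=> ju; rewrite /jmeas; under [X in cmeasurable X]eq_fun do rewrite duhamelE.
have m11 : measurable_fun setT (fun z : (T1 * T3) * T1 => z.1.1).
  exact: (measurableT_comp measurable_fst measurable_fst).
apply: cmeasurableM.
  apply: cmeasurable_real.
  have -> : (fun z : T1 * T3 => Num.sg z.1) = (fun z => \1_[set z : T1 * T3 | 0 < z.1] z - \1_[set z : T1 * T3 | z.1 < 0] z).
    apply/funext => z; rewrite !indicE; have [z0|z0|z0] := ltgtP 0 z.1.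
    - have n : ~ [set z : T1 * T3 | z.1 < 0] z.
        by move=> /= h; have := lt_trans z0 h; rewrite ltxx.
      have y : [set z : T1 * T3 | 0 < z.1] z by [].
      by rewrite gtr0_sg// (memNset n) (mem_set y) subr0.
    - have n : ~ [set z : T1 * T3 | 0 < z.1] z.
        by move=> /= h; have := lt_trans z0 h; rewrite ltxx.
      have y : [set z : T1 * T3 | z.1 < 0] z by [].
      by rewrite ltr0_sg// (memNset n) (mem_set y) sub0r.
    - rewrite -z0 sgr0 (memNset (A := [set z : T1 * T3 | 0 < z.1])) ?(memNset (A := [set z : T1 * T3 | z.1 < 0])) ?subrr//= -z0 ltxx//.
  apply: measurable_funB; apply: measurable_indic.
  - have : measurable_fun setT (fun z : T1 * T3 => (0 < z.1)) by apply: measurable_fun_ltr.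
    by move=> /(_ measurableT [set true]); rewrite setTI; apply.
  - have : measurable_fun setT (fun z : T1 * T3 => (z.1 < 0)) by apply: measurable_fun_ltr.
    by move=> /(_ measurableT [set true]); rewrite setTI; apply.
apply: (@cmeasurable_cintegral _ _ _ (T1 * T3)%type T1 mu
  (fun z => (\1_(between0 z.1.1) z.2)%:C%C * duh_integrand u z.1.1 z.2 z.1.2)).
apply: cmeasurableM; last exact: jmeas_duh_integrand.
apply: cmeasurable_real.
have m : measurable_fun setT (fun z : (T1 * T3) * T1 => (z.1.1, z.2) : T1 * T1).
  exact: measurable_fun_pair.
exact: (measurableT_comp measurable_between0_joint m).
Qed.

End Weights.

Section DuhamelBounds.
Context {R : realType}.
Let mu := @lebesgue_measure R.
Let T1 := measurableTypeR R.
Let T3 := @borel3 R.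

(** A majorant in time: [a] is [|xi|], and the exponential is the gain of [wt]
    between time [0] and time [s]. *)
Definition gdom (a t s : R) : R := \1_(between0 t) s * (a * expR (a * `|s|)).

Lemma indic_patch (D : set R) (f : R -> R) : (fun s => \1_D s * f s) = f \_ D.
Proof.
by apply/funext => s; rewrite /patch indicE; case: (s \in D); rewrite ?mul1r ?mul0r.
Qed.

Lemma integrable_gdom a t : mu.-integrable setT (EFin \o gdom a t).
Proof.
rewrite /gdom indic_patch -restrict_EFin.
exact: ((integrable_mkcond _ (measurable_between0 t)).1 (integrable_expR_abs a t)).
Qed.

(** The factor [|xi|] lost to the derivative is paid for by the time integral
    of the exponential. *)
Lemma Rintegral_gdom a t : \int[mu]_s gdom a t s <= expR (a * `|t|).
Proof.
have -> : \int[mu]_s gdom a t s = \int[mu]_(s in between0 t) (a * expR (a * `|s|)).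
  rewrite [RHS]Rintegral_mkcond -indic_patch.
  by apply: eq_Rintegral.
by rewrite Rintegral_expR_abs gerBl.
Qed.

Lemma between0_le (t s : R) : between0 t s -> `|s| <= `|t|.
Proof.
rewrite /between0/= in_itv/= ge_min le_max => /andP[/orP[h1|h1] /orP[h2|h2]].
- have -> : s = 0 by apply/eqP; rewrite eq_le h1 h2.
  by rewrite normr0.
- by rewrite !ger0_norm ?(le_trans h1 h2).
- by rewrite !ler0_norm ?(le_trans h1 h2) ?lerN2.
- by have -> : s = t by apply/eqP; rewrite eq_le h1 h2.
Qed.

Lemma wt_time (T s : R) w : wt (T - `|s|) w = wt T w * expR (`|w.1| * `|s|).
Proof. by rewrite /wt -mulrA -expRD; congr (_ * expR _); ring. Qed.

Lemma wt_timeW (T s : R) w : wt T w <= wt (T - `|s|) w.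
Proof.
by rewrite wt_time ler_peMr ?wt_ge0// -expR0 ler_expR mulr_ge0.
Qed.

(** The weight at time [s] is [wt (T - |s|)], so that solutions lose decay in
    [xi] linearly in time. *)
Definition bdd (T X : R) (u : R -> R3 R -> R[i]) :=
  forall s w, `|s| <= T -> nc (u s w) <= X * wt (T - `|s|) w.

Lemma bdd_pos T X u : 0 <= T -> bdd T X u -> 0 <= X.
Proof.
move=> T0 /(_ 0 0); rewrite normr0 => /(_ T0) h.
by rewrite -(pmulr_lge0 _ (wt_gt0 (T - 0) 0)) (le_trans _ h)// nc_ge0.
Qed.

Lemma nc_duh_factor (t s : R) (w : R3 R) (z : R[i]) :
  nc (expi ((t - s) * omega w) * ('i%C * (w.1)%:C%C) * z) = `|w.1| * nc z.
Proof. by rewrite !ncM nc_expi nc_i nc_real !mul1r. Qed.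

Lemma duh_integrand_dom T X u t w : 0 <= T -> jmeas u -> bdd T X u -> `|t| <= T ->
  forall s, nc ((\1_(between0 t) s)%:C%C * duh_integrand u t s w) <=
     cfconv * X ^+ 2 * wt T w * gdom `|w.1| t s.
Proof.
move=> T0 ju bu tT s; rewrite ncM nc_real /gdom indicE.
have [|_] := boolP (s \in between0 t); last by rewrite mulr0n normr0 !mul0r mulr0.
move=> /set_mem /between0_le st; rewrite mulr1n normr1 !mul1r /duh_integrand nc_duh_factor.
have sT : `|s| <= T by exact: le_trans tT.
have := @fconv_bound _ (u s) X (T - `|s|) w _ (jmeas_section s ju) (fun v => bu s v sT).
rewrite subr_ge0 => /(_ sT) h.
rewrite (le_trans (ler_wpM2l _ h))// wt_time; apply: eqle; ring.
Qed.

Lemma integrable_gdomZ (c a t : R) : mu.-integrable setT (EFin \o (fun s => c * gdom a t s)).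
Proof. exact: (integrable_scale c (integrable_gdom a t)). Qed.

Lemma cmeasurable_duh u t w : jmeas u ->
  @cmeasurable R _ T1 (fun s => (\1_(between0 t) s)%:C%C * duh_integrand u t s w).
Proof.
move=> ju; apply: cmeasurableM.
  by apply: cmeasurable_real; apply: measurable_indic; exact: measurable_between0.
have m : measurable_fun setT (fun s : T1 => ((t, w), s) : (T1 * T3) * T1).
  by apply: measurable_fun_pair.
exact: (cmeasurable_comp (jmeas_duh_integrand ju) m).
Qed.

Lemma duh_cintegrable T X u t w : 0 <= T -> jmeas u -> bdd T X u -> `|t| <= T ->
  cintegrable mu setT (fun s => (\1_(between0 t) s)%:C%C * duh_integrand u t s w).
Proof.
move=> T0 ju bu tT.
exact: (cintegrable_dom (cmeasurable_duh _ _ ju) (integrable_gdomZ _ _ _)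
  (duh_integrand_dom w T0 ju bu tT)).
Qed.

Lemma nc_sg_le (t : R) : nc (Num.sg t)%:C%C <= 1.
Proof. by rewrite nc_real; case: sgrP => _; rewrite ?normr0 ?normr1 ?normrN1. Qed.

Definition cduh : R := 2 * cfconv.

Lemma cduh_gt0 : 0 < cduh. Proof. by rewrite mulr_gt0 ?cfconv_gt0. Qed.

(** The factor [|xi|] from the derivative is absorbed by the growth in time of the weight. *)
Lemma duh_diff T X Y D u v t w : 0 <= T -> jmeas u -> jmeas v ->
  bdd T X u -> bdd T Y v -> bdd T D (fun s w => u s w - v s w) -> `|t| <= T ->
  nc (duhamel u t w - duhamel v t w) <= cduh * ((X + Y) * D) * wt (T - `|t|) w.
Proof.
move=> T0 ju jv bu bv bd tT.
rewrite !duhamelE -mulrBr ncM -cintegralB; last 2 first.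
- exact: (duh_cintegrable w T0 ju bu tT).
- exact: (duh_cintegrable w T0 jv bv tT).
set c := cfconv * ((X + Y) * D) * wt T w.
have c0 : 0 <= c.
  apply: mulr_ge0; last exact: wt_ge0.
  apply: mulr_ge0; first exact/ltW/cfconv_gt0.
  apply: mulr_ge0; last exact: (bdd_pos T0 bd).
  by apply: addr_ge0; [exact: (bdd_pos T0 bu)|exact: (bdd_pos T0 bv)].
have h : nc (cintegral mu setT (fun s => (\1_(between0 t) s)%:C%C * duh_integrand u t s w
     - (\1_(between0 t) s)%:C%C * duh_integrand v t s w)) <= 2 * \int[mu]_s (c * gdom `|w.1| t s).
  apply: cintegral_le.
  - by apply: cmeasurableB; exact: cmeasurable_duh.
  - exact: integrable_gdomZ.
  - move=> s; rewrite -mulrBr ncM nc_real /gdom indicE.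
    have [|_] := boolP (s \in between0 t); last by rewrite mulr0n normr0 !mul0r mulr0.
    move=> /set_mem /between0_le st; rewrite mulr1n normr1 !mul1r.
    rewrite /duh_integrand -mulrBr nc_duh_factor.
    have sT : `|s| <= T by exact: le_trans tT.
    have := @fconv_diff_bound _ (u s) (v s) X Y D (T - `|s|) w _ (jmeas_section s ju)
      (jmeas_section s jv) (fun v => bu s v sT) (fun v => bv s v sT) (fun v => bd s v sT).
    rewrite subr_ge0 => /(_ sT) h.
    rewrite (le_trans (ler_wpM2l _ h))// wt_time /c; apply: eqle; ring.
apply: (le_trans (ler_pM (nc_ge0 _) (nc_ge0 _) (nc_sg_le t) h)).
rewrite mul1r (RintegralZl c measurableT (integrable_gdom _ _)).
have -> : cduh * ((X + Y) * D) * wt (T - `|t|) w = 2 * (c * expR (`|w.1| * `|t|)).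
  by rewrite wt_time /c /cduh; ring.
by rewrite ler_pM2l// ler_wpM2l// Rintegral_gdom.
Qed.

Lemma fconv0 w : fconv (fun=> 0) (fun=> 0) w = 0 :> R[i].
Proof.
rewrite /fconv; under [X in cintegral _ _ X]eq_fun do rewrite mul0r.
by apply: complex_eqP; rewrite /cintegral/= /Rintegral integral0/=; ring.
Qed.

Lemma duhamel0 t w : duhamel (fun _ _ => 0) t w = 0 :> R[i].
Proof.
rewrite duhamelE /duh_integrand.
under [X in cintegral _ _ X]eq_fun do rewrite fconv0 !mulr0.
by apply: complex_eqP; rewrite /cintegral/= /Rintegral integral0/=; ring.
Qed.

Lemma duh_bound T X u t w : 0 <= T -> jmeas u -> bdd T X u -> `|t| <= T ->
  nc (duhamel u t w) <= cduh * X ^+ 2 * wt (T - `|t|) w.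
Proof.
move=> T0 ju bu tT.
have := @duh_diff T X 0 X u (fun _ _ => 0) t w T0 ju (cmeasurable_cst _ _) bu.
rewrite duhamel0 subr0 addr0 expr2; apply => //.
- by move=> s v _; rewrite nc0 mul0r.
- by move=> s v sT; rewrite subr0; exact: bu.
Qed.

End DuhamelBounds.

(** * Continuity in frequency *)

Section Continuity.
Context {R : realType}.
Let mu := @lebesgue_measure R.
Let T1 := measurableTypeR R.
Let T3 := @borel3 R.

Definition cvg3 (x : nat -> R3 R) (w : R3 R) : Prop :=
  [/\ (x n).1 @[n --> \oo] --> w.1, (x n).2.1 @[n --> \oo] --> w.2.1 &
      (x n).2.2 @[n --> \oo] --> w.2.2].

(** Sequential continuity, the form in which dominated convergence uses it. *)
Definition wcont (g : R3 R -> R[i]) : Prop :=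
  forall w x, cvg3 x w -> ccvg (fun n => g (x n)) (g w).

Lemma cvg3_subl (v : R3 R) x w : cvg3 x w -> cvg3 (fun n => x n - v) (w - v).
Proof.
by move=> [x1 x2 x3]; split => /=; apply: cvgB => //; exact: cvg_cst.
Qed.

Lemma omega_cvg x w : cvg3 x w -> w.1 != 0 -> omega (x n) @[n --> \oo] --> omega w.
Proof.
move=> [x1 x2 x3] w0; rewrite /omega; apply: cvgB.
  by rewrite !exprS expr0; under eq_fun do rewrite !exprS expr0; do 3 (apply: cvgM => //); exact: cvg_cst.
apply: cvgM; last exact: cvgV.
by apply: cvgD; rewrite expr2; under eq_fun do rewrite expr2; exact: cvgM.
Qed.

(** Dominated convergence, with the majorant of [fconv_int] uniform in a
    bounded set of frequencies. *)
Lemma fconv_wcont (g : R3 R -> R[i]) (A b : R) : 0 <= b ->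
  @cmeasurable R _ borel3 g -> (forall v, nc (g v) <= A * wt b v) ->
  wcont g -> wcont (fconv g g).
Proof.
move=> b0 mg gA cg w x xw; rewrite /fconv.
have A0 : 0 <= A by rewrite -(pmulr_lge0 _ (wt_gt0 b 0)) (le_trans _ (gA 0))// nc_ge0.
have gA' v : nc (g v) <= A * rho v.
  by rewrite (le_trans (gA v))// ler_wpM2l// wt_le_rho.
have gA'' v : nc (g v) <= A by rewrite (le_trans (gA' v))// ler_piMr// rho_le1.
apply: ccvgM; first exact: ccvg_cst.
apply: (@cintegral_cvg _ _ _ leb3 _ _ (fun v => A ^+ 2 * rho v)).
- by move=> n; exact: cmeasurable_conv.
- by move=> v; apply: ccvgM; [exact: ccvg_cst|apply: cg; exact: cvg3_subl].
- exact: (integrable_scale (A ^+ 2) integrable_rho).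
- move=> n v; rewrite ncM.
  rewrite (le_trans (ler_pM (nc_ge0 _) (nc_ge0 _) (gA' v) (gA'' _)))//.
  by apply: eqle; ring.
Qed.

Lemma integrable_indic0 (c t : R) : mu.-integrable setT (EFin \o (fun s => c * \1_(between0 t) s)).
Proof.
apply: (@integrable_scale _ _ _ mu (\1_(between0 t))).
apply/integrableP; split.
  by apply/measurable_EFinP; apply: measurable_indic; exact: measurable_between0.
under eq_integral => s _ do rewrite /= ger0_norm ?indicE ?ler0n//.
have := @integral_indic _ _ _ mu setT measurableT (between0 t) (measurable_between0 t).
under eq_integral do rewrite indicE.
by move=> ->; rewrite setIT /between0/= lebesgue_measure_itv/=; case: ifP => // _; rewrite ltry.
Qed.

Lemma cvg_norm_bounded (x : nat -> R) (l : R) : (x n @[n --> \oo] --> l) ->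
  exists M : R, forall n, `|x n| <= M.
Proof.
move=> xl; have : cvgn x by apply/cvg_ex; exists l.
move=> /cvg_seq_bounded [M [_ HM]]; exists (M + 1) => n.
by apply: HM => //; rewrite ltrDl.
Qed.

Lemma fconv_bound1 (T X : R) u s w : 0 <= T -> jmeas u -> bdd T X u -> `|s| <= T ->
  nc (fconv (u s) (u s) w) <= cfconv * X ^+ 2.
Proof.
move=> T0 ju bu sT.
have b0 : 0 <= T - `|s| by rewrite subr_ge0.
rewrite (le_trans (fconv_bound w b0 (jmeas_section s ju) (fun v => bu s v sT)))//.
apply: ler_piMr; first by rewrite mulr_ge0 ?sqr_ge0// (ltW cfconv_gt0).
exact: (le_trans (wt_le_rho _ b0) (rho_le1 _)).
Qed.

(** At frequencies with [xi = 0] the symbol [omega] is discontinuous, but there the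
    derivative makes the Duhamel term vanish. *)
Lemma duhamel_wcont T X u t : 0 <= T -> jmeas u -> bdd T X u -> `|t| <= T ->
  (forall s, `|s| <= T -> wcont (u s)) -> wcont (duhamel u t).
Proof.
move=> T0 ju bu tT cu w x xw; rewrite duhamelE; under eq_fun do rewrite duhamelE.
apply: ccvgM; first exact: ccvg_cst.
have [M xM] : exists M : R, forall n, `|(x n).1| <= M by case: xw => /cvg_norm_bounded.
have duhle s v : between0 t s -> nc (duh_integrand u t s v) <= `|v.1| * (cfconv * X ^+ 2).
  move=> ts; rewrite /duh_integrand nc_duh_factor ler_wpM2l//.
  by apply: (fconv_bound1 v T0 ju bu); exact: (le_trans (between0_le ts) tT).
apply: (@cintegral_cvg _ _ _ mu _ _ (fun s => M * (cfconv * X ^+ 2) * \1_(between0 t) s)).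
- by move=> n; exact: cmeasurable_duh.
- move=> s; have [|h] := boolP (s \in between0 t); last first.
    by rewrite indicE (negbTE h); under eq_fun do rewrite mul0r; rewrite mul0r; exact: ccvg_cst.
  move=> /set_mem ts; apply: ccvgM; first exact: ccvg_cst.
  have sT : `|s| <= T by exact: (le_trans (between0_le ts) tT).
  have [w0|w0] := eqVneq w.1 0.
    have -> : duh_integrand u t s w = 0 by rewrite /duh_integrand w0 mulr0 mulr0 mul0r.
    rewrite /ccvg; under eq_fun do rewrite subr0.
    have h : `|(x n).1| * (cfconv * X ^+ 2) @[n --> \oo] --> (0 : R).
      rewrite -(mul0r (cfconv * X ^+ 2)); apply: cvgM; last exact: cvg_cst.
      by apply/norm_cvg0P; rewrite -w0; case: xw.
    apply: (squeeze_cvgr _ (cvg_cst 0) h); apply: nearW => n.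
    by rewrite nc_ge0/= duhle.
  apply: ccvgM; first apply: ccvgM.
  + by apply: ccvg_expi; apply: cvgM; [exact: cvg_cst|exact: omega_cvg].
  + by apply: ccvgM; [exact: ccvg_cst|apply: ccvg_real; case: xw].
  + apply: (@fconv_wcont (u s) X (T - `|s|)) => //.
    * by rewrite subr_ge0.
    * exact: jmeas_section.
    * by move=> v; exact: bu.
    * exact: cu.
- exact: integrable_indic0.
- move=> n s; rewrite ncM nc_real indicE.
  have [|_] := boolP (s \in between0 t); last by rewrite mulr0n normr0 mul0r mulr0.
  move=> /set_mem ts; rewrite mulr1n normr1 mul1r mulr1 (le_trans (duhle s _ ts))//.
  by rewrite ler_wpM2r// mulr_ge0 ?sqr_ge0 ?(ltW cfconv_gt0).
Qed.

(** The oriented integral from [0] to [t] as the integral over the line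
    against a signed indicator. *)
Definition sgn_between (t s : R) : R := Num.sg t * \1_(between0 t) s.

Lemma indic_between0 (t s : R) :
  \1_(between0 t) s = ((Num.min 0 t <= s) && (s <= Num.max 0 t))%R%:R :> R.
Proof.
rewrite indicE; suff -> : (s \in between0 t) = (Num.min 0 t <= s) && (s <= Num.max 0 t) by [].
by apply/idP/idP => [/set_mem|h]; [|apply/mem_set]; rewrite /between0/= in_itv.
Qed.

Lemma sgn_between_gt0 (t s : R) : 0 < s -> sgn_between t s = (s <= t)%R%:R.
Proof.
move=> s0; rewrite /sgn_between indic_between0 ge_min le_max (ltW s0)/= leNgt s0/=.
have [st|ts] := leP s t; last by rewrite mulr0.
by rewrite gtr0_sg ?mulr1// (lt_le_trans s0).
Qed.

Lemma sgn_between_lt0 (t s : R) : s < 0 -> sgn_between t s = - (t <= s)%R%:R.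
Proof.
move=> s0; rewrite /sgn_between indic_between0 ge_min le_max (ltW s0)/= andbT leNgt s0/=.
have [ts|st] := leP t s; last by rewrite mulr0 oppr0.
by rewrite ltr0_sg ?mulr1// (le_lt_trans ts).
Qed.

Lemma sgn_between_diff (t t' s : R) :
  `|sgn_between t s - sgn_between t' s| <= 2 * \1_(`[Num.min t t', Num.max t t']) s.
Proof.
have -> : \1_(`[Num.min t t', Num.max t t']) s =
    (((t <= s) || (t' <= s)) && ((s <= t) || (s <= t')))%R%:R :> R.
  rewrite indicE -ge_min -le_max.
  suff -> : (s \in `[Num.min t t', Num.max t t']%classic) =
    (Num.min t t' <= s) && (s <= Num.max t t') by [].
  by apply/idP/idP => [/set_mem|h]; [|apply/mem_set]; rewrite /= in_itv.
have r0 (c : bool) : 0 <= 2 * c%:R :> R by rewrite mulr_ge0// ler0n.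
have [s0|s0|s0] := ltgtP 0 s.
- rewrite !sgn_between_gt0//.
  have [->|ab] := eqVneq (s <= t) (s <= t'); first by rewrite subrr normr0.
  have -> : ((t <= s) || (t' <= s)) && ((s <= t) || (s <= t')).
    by move: ab; have [?|/ltW->] := lerP s t; have [?|/ltW->] := lerP s t'; rewrite ?orbT.
  by case: (s <= t); case: (s <= t');
    rewrite ?mulr1n ?mulr0n ?subrr ?subr0 ?sub0r ?normrN ?normr0 ?normr1 ?mulr1 ?ler0n ?ler1n.
- rewrite !sgn_between_lt0//.
  have [->|ab] := eqVneq (t <= s) (t' <= s); first by rewrite subrr normr0.
  have -> : ((t <= s) || (t' <= s)) && ((s <= t) || (s <= t')).
    by move: ab; have [?|/ltW->] := lerP t s; have [?|/ltW->] := lerP t' s; rewrite ?orbT.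
  by case: (t <= s); case: (t' <= s);
    rewrite ?mulr1n ?mulr0n ?oppr0 ?addNr ?subr0 ?opprK ?addNr ?add0r ?normrN ?normr0 ?normr1 ?mulr1 ?ler0n ?addr0 ?normrN1 ?normr1 ?ler1n//.
- have E (b : R) : sgn_between b 0 = Num.sg b.
    by rewrite /sgn_between indic_between0 ge_min le_max lexx/= mulr1.
  rewrite -s0; rewrite !E.
  have [x0|x0|x0] := ltgtP 0 t; have [y0|y0|y0] := ltgtP 0 t'; rewrite /= -?x0 -?y0 ?sgr0
      ?(gtr0_sg x0) ?(gtr0_sg y0) ?(ltr0_sg x0) ?(ltr0_sg y0) ?subrr ?normr0//.
  all: rewrite ?mulr1n ?mulr1 (le_trans (ler_normB _ _))// ?normrN1 ?normr1 ?normr0.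
  all: lra.
Qed.

End Continuity.

(** * Continuity in time *)

Section TimeContinuity.
Context {R : realType}.
Let mu := @lebesgue_measure R.
Let T1 := measurableTypeR R.
Let T3 := @borel3 R.

(** The integrand with the factor depending on [t] removed: only the interval
    of integration still depends on [t]. *)
Definition duh_core (u : R -> R3 R -> R[i]) (s : R) (w : R3 R) : R[i] :=
  expi (- (s * omega w)) * ('i%C * (w.1)%:C%C) * fconv (u s) (u s) w.

Lemma duh_coreE u t s w : duh_integrand u t s w = expi (t * omega w) * duh_core u s w.
Proof. by rewrite /duh_integrand /duh_core mulrBl expiD !mulrA. Qed.

Lemma nc_duh_core u s w : nc (duh_core u s w) = `|w.1| * nc (fconv (u s) (u s) w).
Proof. by rewrite /duh_core !ncM nc_expi nc_i nc_real !mul1r. Qed.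

Lemma duh_core_cintegrable T X u t w : 0 <= T -> jmeas u -> bdd T X u -> `|t| <= T ->
  cintegrable mu setT (fun s => (sgn_between t s)%:C%C * duh_core u s w).
Proof.
move=> T0 ju bu tT.
have := cintegrableZ ((Num.sg t)%:C%C * expi (- (t * omega w))) (duh_cintegrable w T0 ju bu tT).
congr (cintegrable _ _ _); apply/funext => s.
rewrite duh_coreE /sgn_between rmorphM/=.
set a := (Num.sg t)%:C%C; set b := (\1_(between0 t) s)%:C%C; set c := duh_core _ _ _.
have -> : a * expi (- (t * omega w)) * (b * (expi (t * omega w) * c)) =
   a * b * c * (expi (- (t * omega w)) * expi (t * omega w)) by ring.
by rewrite -expiD addNr expi0 mulr1.
Qed.

Lemma duhamel_core T X u t w : 0 <= T -> jmeas u -> bdd T X u -> `|t| <= T ->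
  duhamel u t w = expi (t * omega w) *
    cintegral mu setT (fun s => (sgn_between t s)%:C%C * duh_core u s w).
Proof.
move=> T0 ju bu tT.
rewrite duhamelE -!cintegralZ; last 2 first.
- exact: (duh_core_cintegrable w T0 ju bu tT).
- exact: (duh_cintegrable w T0 ju bu tT).
congr (cintegral _ _ _); apply/funext => s.
by rewrite duh_coreE /sgn_between rmorphM/=; ring.
Qed.

Lemma integrable_indic_itv (c a b : R) :
  mu.-integrable setT (EFin \o (fun s => c * \1_(`[a, b]) s)).
Proof.
apply: (@integrable_scale _ _ _ mu (\1_(`[a, b]))).
apply/integrableP; split.
  by apply/measurable_EFinP; apply: measurable_indic; exact: measurable_itv.
under eq_integral => s _ do rewrite /= ger0_norm ?indicE ?ler0n//.
have := @integral_indic _ _ _ mu setT measurableT `[a, b]%classic (measurable_itv `[a, b]).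
under eq_integral do rewrite indicE.
by move=> ->; rewrite setIT /= lebesgue_measure_itv/=; case: ifP => // _; rewrite ltry.
Qed.

Lemma Rintegral_indic_itv (a b : R) : a <= b -> \int[mu]_s \1_(`[a, b]) s = b - a.
Proof.
move=> ab; rewrite /Rintegral.
rewrite (@integral_indic _ _ _ mu setT measurableT `[a, b]%classic (measurable_itv `[a, b])).
rewrite setIT /= lebesgue_measure_itv/= lte_fin.
have [//|ba] := ltP a b.
have -> : a = b by apply/eqP; rewrite eq_le ab ba.
by rewrite subrr.
Qed.

Lemma duh_core_lip T X u t t' w : 0 <= T -> jmeas u -> bdd T X u -> `|t| <= T -> `|t'| <= T ->
  nc (cintegral mu setT (fun s => (sgn_between t s)%:C%C * duh_core u s w) -
      cintegral mu setT (fun s => (sgn_between t' s)%:C%C * duh_core u s w)) <=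
  4 * (`|w.1| * (cfconv * X ^+ 2)) * `|t - t'|.
Proof.
move=> T0 ju bu tT tT'; set M := `|w.1| * _.
have i1 := duh_core_cintegrable w T0 ju bu tT.
have i2 := duh_core_cintegrable w T0 ju bu tT'.
rewrite -cintegralB//.
apply: le_trans.
  apply: (@cintegral_le _ _ _ mu _ (fun s => 2 * M * \1_(`[Num.min t t', Num.max t t']) s)).
  - by apply: cmeasurableB; [exact: (cintegrable_meas i1)|exact: (cintegrable_meas i2)].
  - exact: integrable_indic_itv.
  - move=> s; rewrite -mulrBl ncM -rmorphB nc_real.
    have h := sgn_between_diff t t' s.
    have [/set_mem st|st] := boolP (s \in `[Num.min t t', Num.max t t']%classic); last first.
      move: h; rewrite indicE (negbTE st) mulr0n !mulr0 => h.
      have -> : `|sgn_between t s - sgn_between t' s| = 0.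
        by apply/eqP; rewrite eq_le h normr_ge0.
      by rewrite mul0r.
    have sT : `|s| <= T.
      move: st tT tT'; rewrite /= in_itv/= ge_min le_max !ler_norml.
      by move=> /andP[/orP[?|?] /orP[?|?]] /andP[? ?] /andP[? ?]; apply/andP; split; lra.
    have hM : nc (duh_core u s w) <= M.
      by rewrite nc_duh_core ler_wpM2l// (fconv_bound1 w T0 ju bu sT).
    rewrite (le_trans (ler_pM (normr_ge0 _) (nc_ge0 _) h hM))//.
    by apply: eqle; ring.
rewrite RintegralZl//; last first.
  have := integrable_indic_itv 1 (Num.min t t') (Num.max t t').
  by congr (_.-integrable _ _); apply/funext => s /=; rewrite mul1r.
rewrite Rintegral_indic_itv; last by rewrite ge_min le_max lexx.
apply: eqle; have [tt|tt] := leP t t'; first by rewrite ler0_norm ?subr_le0//; ring.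
by rewrite ger0_norm ?subr_ge0 1?ltW//; ring.
Qed.

Lemma duhamel_tcont T X u (x : nat -> R) t w : 0 <= T -> jmeas u -> bdd T X u ->
  (forall n, `|x n| <= T) -> `|t| <= T -> (x n @[n --> \oo] --> t) ->
  ccvg (fun n => duhamel u (x n) w) (duhamel u t w).
Proof.
move=> T0 ju bu xT tT xt.
rewrite (duhamel_core w T0 ju bu tT).
have -> : (fun n => duhamel u (x n) w) = (fun n => expi (x n * omega w) *
    cintegral mu setT (fun s => (sgn_between (x n) s)%:C%C * duh_core u s w)).
  by apply/funext => n; rewrite (duhamel_core w T0 ju bu (xT n)).
apply: ccvgM.
  by apply: ccvg_expi; apply: cvgM => //; exact: cvg_cst.
have h : 4 * (`|w.1| * (cfconv * X ^+ 2)) * `|x n - t| @[n --> \oo] --> (0 : R).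
  rewrite -(mulr0 (4 * (`|w.1| * (cfconv * X ^+ 2)))); apply: cvgM; first exact: cvg_cst.
  by apply/norm_cvg0P; exact/subr_cvg0.
apply: (squeeze_cvgr _ (cvg_cst 0) h); apply: nearW => n.
by apply/andP; split; [exact: nc_ge0|exact: (duh_core_lip w T0 ju bu (xT n) tT)].
Qed.

End TimeContinuity.

(** * Hermitian symmetry *)

Section Hermitian.
Context {R : realType}.
Let mu := @lebesgue_measure R.
Let T1 := measurableTypeR R.
Let T3 := @borel3 R.

(** Real-valued functions have Hermitian transforms. *)
Definition herm (g : R3 R -> R[i]) : Prop := forall w, g (- w) = (g w)^*%C.

Lemma conj_expi (x : R) : (expi x)^*%C = expi (- x).
Proof. by rewrite expiN. Qed.

Lemma conj_real (x : R) : (x%:C%C)^*%C = x%:C%C :> R[i].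
Proof. by rewrite /= oppr0. Qed.

Lemma conjM (z w : R[i]) : (z * w)^*%C = z^*%C * w^*%C.
Proof. by case: z w => [a b] [c d]; apply: complex_eqP => /=; ring. Qed.

Lemma conjB (z w : R[i]) : (z - w)^*%C = z^*%C - w^*%C.
Proof. by case: z w => [a b] [c d]; apply: complex_eqP => /=; ring. Qed.

Lemma cintegral_conj d (T : measurableType d) (m : {measure set T -> \bar R}) (f : T -> R[i]) :
  cintegrable m setT f ->
  cintegral m setT (fun x => (f x)^*%C) = (cintegral m setT f)^*%C.
Proof.
move=> [f1 f2]; apply: complex_eqP => /=.
- by apply: eq_Rintegral => x _; case: (f x).
- rewrite -mulN1r -RintegralZl//; apply: eq_Rintegral => x _.
  by rewrite mulN1r; case: (f x).
Qed.

Lemma aff3N (w : R3 R) : aff3 (-1) 0 w = - w.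
Proof. by rewrite /aff3 /= !addr0 !mulN1r; case: w => [? [? ?]]. Qed.

Lemma fconv_herm (g : R3 R -> R[i]) (A b : R) : 0 <= b ->
  @cmeasurable R _ borel3 g -> (forall v, nc (g v) <= A * wt b v) ->
  herm g -> herm (fconv g g).
Proof.
move=> b0 mg gA hg w; rewrite /fconv conjM conj_real; congr (_ * _).
rewrite -cintegral_conj; last exact: (fconv_int w b0 mg mg gA gA).
rewrite (@cintegral_aff3 _ (-1) 0) ?oppr_eq0 ?oner_eq0//; last first.
  exact: (fconv_int (- w) b0 mg mg gA gA).
rewrite normrN1 expr1n mul1r; congr (cintegral _ _ _); apply/funext => v.
by rewrite aff3N conjM -!hg opprK; congr (_ * g _); rewrite opprB addrC.
Qed.

Lemma omegaN (w : R3 R) : omega (- w) = - omega w.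
Proof.
rewrite /omega /= !sqrrN invrN mulrN opprD opprK; congr (_ + _).
by rewrite !exprS expr0; ring.
Qed.

Lemma duhamel_herm T X u t : 0 <= T -> jmeas u -> bdd T X u -> `|t| <= T ->
  (forall s, `|s| <= T -> herm (u s)) -> herm (duhamel u t).
Proof.
move=> T0 ju bu tT hu w; rewrite !duhamelE conjM conj_real; congr (_ * _).
rewrite -cintegral_conj; last exact: (duh_cintegrable w T0 ju bu tT).
congr (cintegral _ _ _); apply/funext => s.
rewrite conjM conj_real indicE; have [/set_mem st|_] := boolP (s \in between0 t); last first.
  by rewrite mulr0n !mul0r.
have sT : `|s| <= T by exact: (le_trans (between0_le st) tT).
congr (_ * _); rewrite /duh_integrand (conjM (_ * _) (fconv _ _ _)) (conjM (expi _)) conj_expi omegaN mulrN conjM conj_real.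
congr (_ * _ * _).
  by apply: complex_eqP => /=; ring.
have b0 : 0 <= T - `|s| by rewrite subr_ge0.
exact: (fconv_herm b0 (jmeas_section s ju) (fun v => bu s v sT) (hu s sT) w).
Qed.

End Hermitian.

Section GeometricLimit.
Context {R : realType}.

(** Completeness with the explicit rate of the geometric series. *)
Lemma geometric_cvg (a : nat -> R) (C : R) :
  (forall n, `|a n.+1 - a n| <= C * 2^-1 ^+ n) ->
  exists l, (a n @[n --> \oo] --> l) /\ forall n, `|a n - l| <= 2 * C * 2^-1 ^+ n.
Proof.
move=> aC; pose g n : R := 2 * C * 2^-1 ^+ n.
have gS n : g n.+1 = g n - C * 2^-1 ^+ n by rewrite /g exprS; lra.
pose b n := a n - g n; pose c n := a n + g n.
have ndb : nondecreasing_seq b.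
  apply/nondecreasing_seqP => n; have := aC n.
  by rewrite ler_norml /b gS => /andP[? ?]; lra.
have nic : nonincreasing_seq c.
  apply/nonincreasing_seqP => n; have := aC n.
  by rewrite ler_norml /c gS => /andP[? ?]; lra.
have g0 : g n @[n --> \oo] --> (0 : R).
  rewrite -(mulr0 (2 * C)); apply: cvgM; first exact: cvg_cst.
  by apply: cvg_expr; rewrite ger0_norm// invf_lt1// ltr1n.
have C0 : 0 <= C by have := aC 0%N; rewrite expr0 mulr1; apply: le_trans; exact: normr_ge0.
have gge n : 0 <= g n by rewrite /g mulr_ge0 ?mulr_ge0// exprn_ge0// invr_ge0.
have cb : cvgn b.
  apply: nondecreasing_is_cvgn => //; exists (c 0%N) => _ [n _ <-].
  by rewrite (le_trans _ (nic 0%N n _))// /b /c; have := gge n; lra.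
exists (limn b).
have al : a n @[n --> \oo] --> limn b.
  have -> : a = (fun n => b n + g n) by apply/funext => n; rewrite /b subrK.
  by rewrite -[X in _ --> X]addr0; exact: cvgD.
have cl : c n @[n --> \oo] --> limn b by rewrite -[X in _ --> X]addr0; exact: cvgD.
split=> // n.
have h1 : b n <= limn b by exact: nondecreasing_cvgn_le.
have h2 : limn b <= c n.
  rewrite -(cvg_lim _ cl)//; apply: nonincreasing_cvgn_ge => //.
  by apply/cvg_ex; exists (limn b).
by move: h1 h2; rewrite /b /c ler_norml /g => ? ?; apply/andP; split; lra.
Qed.

End GeometricLimit.

(** * Picard iteration *)

Section Picard.
Context {R : realType}.
Let mu := @lebesgue_measure R.
Let T1 := measurableTypeR R.
Let T3 := @borel3 R.

Definition free (phi : R3 R -> R[i]) (t : R) (w : R3 R) : R[i] :=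
  expi (t * omega w) * phi w.

Lemma ReJ (z : R[i]) : complex.Re z^*%C = complex.Re z. Proof. by case: z. Qed.
Lemma ImJ (z : R[i]) : complex.Im z^*%C = - complex.Im z. Proof. by case: z. Qed.

Lemma subBB (a b c : R[i]) : a - b - (a - c) = - (b - c).
Proof. by ring. Qed.

Lemma jmeas_free phi : @cmeasurable R _ borel3 phi -> jmeas (free phi).
Proof.
move=> mphi; apply: cmeasurableM.
- apply: cmeasurable_expi; apply: measurable_funM => //.
  exact: (measurableT_comp measurable_omega measurable_snd).
- exact: (cmeasurable_comp mphi measurable_snd).
Qed.

Lemma nc_free phi t w : nc (free phi t w) = nc (phi w).
Proof. by rewrite /free ncM nc_expi mul1r. Qed.

Lemma free_herm phi t : herm phi -> herm (free phi t).
Proof. by move=> h w; rewrite /free h conjM omegaN mulrN conj_expi. Qed.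

Lemma free_wcont phi t : wcont phi -> (forall w, w.1 = 0 -> phi w = 0) -> wcont (free phi t).
Proof.
move=> cphi phi0 w x xw; have [w0|w0] := eqVneq w.1 0.
  rewrite /ccvg {2}/free (phi0 w w0) mulr0; under eq_fun do rewrite subr0 nc_free.
  by have := ccvg_nc (cphi w x xw); rewrite (phi0 w w0) nc0.
apply: ccvgM; last exact: cphi.
by apply: ccvg_expi; apply: cvgM; [exact: cvg_cst|exact: omega_cvg].
Qed.

(** A uniform limit of convergent sequences converges to the limit of the
    limits. *)
Lemma ccvg_uniform (U : nat -> nat -> R[i]) (u l : nat -> R[i]) (L : R[i]) (e : nat -> R) :
  (forall n k, nc (U n k - u k) <= e n) -> (forall n, nc (l n - L) <= e n) ->
  (e n @[n --> \oo] --> (0 : R)) -> (forall n, ccvg (U n) (l n)) -> ccvg u L.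
Proof.
move=> Uu lL e0 Ul; apply/cvgr0Pnorm_lt => d d0.
have d3 : 0 < d / 3 by rewrite divr_gt0.
have [n _ en] := (cvgr0Pnorm_lt e).1 e0 _ d3.
have [N _ UN] := (cvgr0Pnorm_lt _).1 (Ul n) _ d3.
exists N => //= k Nk; have := UN k Nk; rewrite /= !ger0_norm ?nc_ge0// => Uk.
have := en n (leqnn n); rewrite ltr_norml => /andP[_ en'].
have -> : u k - L = - (U n k - u k) + (U n k - l n) + (l n - L).
  by rewrite opprB -addrA !subrKA.
have h1 := ncD (- (U n k - u k) + (U n k - l n)) (l n - L).
have h2 := ncD (- (U n k - u k)) (U n k - l n).
have h3 := Uu n k; have h4 := lL n; rewrite ncN in h2.
by lra.
Qed.

Variables (T X : R) (phi : R3 R -> R[i]).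
Hypothesis T0 : 0 <= T.
Hypothesis mphi : @cmeasurable R _ borel3 phi.
Hypothesis phiX : forall w, nc (phi w) <= X * wt T w.
Hypothesis small : 8 * cduh * X <= 1.

Let X0 : 0 <= X.
Proof. by rewrite -(pmulr_lge0 _ (wt_gt0 T 0)) (le_trans _ (phiX 0))// nc_ge0. Qed.

Lemma bdd_free Y : (forall w, nc (phi w) <= Y * wt T w) -> bdd T Y (free phi).
Proof.
move=> phiY; have Y0 : 0 <= Y.
  by rewrite -(pmulr_lge0 _ (wt_gt0 T 0)) (le_trans _ (phiY 0))// nc_ge0.
by move=> s w sT; rewrite nc_free (le_trans (phiY w))// ler_wpM2l// wt_timeW.
Qed.

(** The map is cut off outside [-T, T], where the weighted bounds say nothing. *)
Definition pstep (U : R -> R3 R -> R[i]) (t : R) (w : R3 R) : R[i] :=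
  if `|t| <= T then free phi t w - duhamel U t w else 0.

Lemma pstepE U t w : `|t| <= T -> pstep U t w = free phi t w - duhamel U t w.
Proof. by rewrite /pstep => ->. Qed.

Definition picard (n : nat) : R -> R3 R -> R[i] := iter n pstep (fun _ _ => 0).

Lemma jmeas_pstep U : jmeas U -> jmeas (pstep U).
Proof.
move=> jU.
have -> : pstep U = (fun t w => (\1_(`[- T, T]) t)%:C%C * (free phi t w - duhamel U t w)).
  apply/funext => t; apply/funext => w; rewrite /pstep indicE.
  have -> : (t \in `[- T, T]%classic) = (`|t| <= T).
    by apply/idP/idP => [/set_mem|h]; [|apply/mem_set]; rewrite /= in_itv/= -ler_norml.
  by case: ifP => _; rewrite ?mulr1n ?mulr0n ?mul1r ?mul0r.
apply: cmeasurableM; last first.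
  by apply: cmeasurableB; [exact: jmeas_free|exact: jmeas_duhamel].
apply: cmeasurable_real.
have m : measurable_fun setT (\1_(`[- T, T]) : T1 -> R).
  by apply: measurable_indic; exact: measurable_itv.
exact: (measurableT_comp m measurable_fst).
Qed.

Lemma bdd_pstep U : jmeas U -> bdd T (2 * X) U -> bdd T (2 * X) (pstep U).
Proof.
move=> jU bU s w sT; rewrite pstepE// (le_trans (ncB _ _))//.
have h1 := bdd_free phiX w sT; have h2 := duh_bound w T0 jU bU sT.
apply: (le_trans (lerD h1 h2)); rewrite -mulrDl ler_wpM2r ?wt_ge0//.
have kX : 8 * cduh * X * X <= X by rewrite -[leRHS]mul1r ler_wpM2r.
have -> : cduh * (2 * X) ^+ 2 = (8 * cduh * X * X) / 2 :> R by rewrite expr2; field.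
have := X0; lra.
Qed.

Lemma jmeas_picard n : jmeas (picard n).
Proof.
elim: n => [|n IH]; first exact: cmeasurable_cst.
exact: jmeas_pstep.
Qed.

Lemma bdd_picard n : bdd T (2 * X) (picard n).
Proof.
elim: n => [|n IH]; last exact: (bdd_pstep (jmeas_picard n)).
move=> s w sT; rewrite nc0; apply: mulr_ge0; last exact: wt_ge0.
by apply: mulr_ge0 => //; exact: X0.
Qed.

Lemma pstep_diff D U V : jmeas U -> jmeas V -> bdd T (2 * X) U -> bdd T (2 * X) V ->
  bdd T D (fun s w => U s w - V s w) ->
  bdd T (D / 2) (fun s w => pstep U s w - pstep V s w).
Proof.
move=> jU jV bU bV bD s w sT; rewrite !pstepE//.
rewrite subBB ncN (le_trans (duh_diff w T0 jU jV bU bV bD sT))// ler_wpM2r ?wt_ge0//.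
have D0 := bdd_pos T0 bD.
have -> : cduh * ((2 * X + 2 * X) * D) = (8 * cduh * X) * (D / 2) :> R by field.
by rewrite (le_trans (ler_wpM2r _ small)) ?mul1r// divr_ge0.
Qed.

(** Smallness of [X] makes the quadratic map a contraction with factor [1 / 2]
    on the ball of radius [2 X]. *)
Lemma picard_diff n : bdd T (2 * X * 2^-1 ^+ n) (fun s w => picard n.+1 s w - picard n s w).
Proof.
elim: n => [|n IH].
  move=> s w sT; rewrite expr0 mulr1 subr0.
  exact: (@bdd_picard 1%N).
have := pstep_diff (jmeas_picard n.+1) (jmeas_picard n) (@bdd_picard n.+1) (@bdd_picard n) IH.
by rewrite exprSr mulrA.
Qed.

Lemma picard_limit : exists u : R -> R3 R -> R[i],
  (forall t w, ccvg (fun n => picard n t w) (u t w)) /\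
  (forall n, bdd T (8 * X * 2^-1 ^+ n) (fun s w => picard n s w - u s w)).
Proof.
have H t w : exists l : R[i], ccvg (fun n => picard n t w) l /\
    (`|t| <= T -> forall n, nc (picard n t w - l) <= 8 * X * 2^-1 ^+ n * wt (T - `|t|) w).
  have [tT|tT] := boolP (`|t| <= T); last first.
    exists 0; split => //.
    have -> : (fun n => picard n t w) = (fun=> 0); last exact: ccvg_cst.
    by apply/funext => -[//|n]; rewrite /picard iterS /pstep (negbTE tT).
  pose C := 2 * X * wt (T - `|t|) w.
  have d n : nc (picard n.+1 t w - picard n t w) <= C * 2^-1 ^+ n.
    by rewrite (le_trans (picard_diff n w tT))//; apply: eqle; rewrite /C; ring.
  have [a [ca ha]] := @geometric_cvg R (fun n => complex.Re (picard n t w)) C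
    (fun n => le_trans (eqle (congr1 _ (esym (ReB _ _)))) (le_trans (Re_le_nc _) (d n))).
  have [b [cb hb]] := @geometric_cvg R (fun n => complex.Im (picard n t w)) C
    (fun n => le_trans (eqle (congr1 _ (esym (ImB _ _)))) (le_trans (Im_le_nc _) (d n))).
  exists (a +i* b)%C; split; first exact/ccvgP.
  move=> _ n; rewrite (le_trans (nc_le _))// ReB ImB/= (le_trans (lerD (ha n) (hb n)))//.
  by apply: eqle; rewrite /C; ring.
exists (fun t w => sval (cid (H t w))); split.
- by move=> t w; case: cid => l [].
- by move=> n s w sT; case: cid => l [] /= _ /(_ sT).
Qed.

Lemma cvg_geo (C : R) : C * 2^-1 ^+ n @[n --> \oo] --> (0 : R).
Proof.
rewrite -(mulr0 C); apply: cvgM; first exact: cvg_cst.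
by apply: cvg_expr; rewrite ger0_norm// invf_lt1// ltr1n.
Qed.

(** Continuity at [xi = 0] uses that both the datum and the Duhamel term
    vanish there. *)
Lemma picard_wcont n t : `|t| <= T -> wcont phi -> (forall w, w.1 = 0 -> phi w = 0) ->
  wcont (picard n t).
Proof.
move=> tT cphi phi0; elim: n t tT => [|n IH] t tT w x xw; first exact: ccvg_cst.
rewrite /picard iterS -/(picard n) pstepE//; under eq_fun do rewrite pstepE//.
apply: ccvgB; first exact: free_wcont.
exact: (duhamel_wcont T0 (jmeas_picard n) (@bdd_picard n) tT IH xw).
Qed.

Lemma picard_herm n t : `|t| <= T -> herm phi -> herm (picard n t).
Proof.
move=> tT hphi; elim: n t tT => [|n IH] t tT w; first by rewrite /= oppr0.
rewrite /picard iterS -/(picard n) !pstepE// conjB free_herm//; congr (_ - _).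
exact: (duhamel_herm T0 (jmeas_picard n) (@bdd_picard n) tT IH).
Qed.

Theorem picard_solution : wcont phi -> (forall w, w.1 = 0 -> phi w = 0) -> herm phi ->
  exists u : R -> R3 R -> R[i],
  [/\ jmeas u, bdd T (2 * X) u,
      forall t, `|t| <= T -> wcont (u t) /\ herm (u t) &
      forall t w, `|t| <= T -> u t w = free phi t w - duhamel u t w].
Proof.
move=> cphi phi0 hphi; have [u [cu du]] := picard_limit.
have ju : jmeas u.
  have cu' : forall z : T1 * T3, ccvg (fun n => picard n z.1 z.2) (u z.1 z.2).
    by move=> z; exact: cu.
  exact: (@cmeasurable_cvg R _ (T1 * T3)%type (fun n z => picard n z.1 z.2)
    (fun z => u z.1 z.2) jmeas_picard cu').
have bu : bdd T (2 * X) u.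
  move=> s w sT; have := ccvg_nc (cu s w) => h.
  rewrite -(cvg_lim _ h)//; apply: limr_le; first by apply/cvg_ex; eexists; exact: h.
  by apply: nearW => n; exact: bdd_picard.
exists u; split => //.
- move=> t tT; split.
  + move=> w x xw; apply: (@ccvg_uniform (fun n k => picard n t (x k)) _ (fun n => picard n t w) _
      (fun n => 8 * X * 2^-1 ^+ n)).
    * move=> n k; rewrite (le_trans (du n t (x k) tT))// ler_piMr//.
        by rewrite mulr_ge0 ?mulr_ge0// exprn_ge0// invr_ge0.
      by rewrite (le_trans (wt_le_rho _ _)) ?subr_ge0// rho_le1.
    * move=> n; rewrite (le_trans (du n t w tT))// ler_piMr//.
        by rewrite mulr_ge0 ?mulr_ge0// exprn_ge0// invr_ge0.
      by rewrite (le_trans (wt_le_rho _ _)) ?subr_ge0// rho_le1.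
    * exact: cvg_geo.
    * by move=> n; exact: (picard_wcont n tT cphi phi0 xw).
  + move=> w; apply: (ccvg_unique (cu t (- w))).
    have /ccvgP[c1 c2] := cu t w; apply/ccvgP; split.
    * by rewrite ReJ; under eq_fun do rewrite (picard_herm _ tT hphi) ReJ.
    * by rewrite ImJ; under eq_fun do rewrite (picard_herm _ tT hphi) ImJ; exact: cvgN.
- move=> t w tT; apply: (ccvg_unique (cu t w)).
  pose e n := cduh * ((2 * X + 2 * X) * (8 * X * 2^-1 ^+ n)) * wt (T - `|t|) w.
  have e0 : e n @[n --> \oo] --> (0 : R).
    rewrite (_ : e = fun n => cduh * ((2 * X + 2 * X) * (8 * X)) * wt (T - `|t|) w * 2^-1 ^+ n).
      exact: cvg_geo.
    by apply/funext => n; rewrite /e; ring.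
  have h : ccvg (fun n => picard n.+1 t w) (free phi t w - duhamel u t w).
    apply: (squeeze_cvgr _ (cvg_cst 0) e0); apply: nearW => n; rewrite nc_ge0/=.
    rewrite pstepE//.
    rewrite subBB ncN.
    exact: (duh_diff w T0 (jmeas_picard n) ju (@bdd_picard n) bu (du n) tT).
  by move: h; rewrite /ccvg => h; rewrite -(cvg_shiftS (fun n => nc (picard n t w - (free phi t w - duhamel u t w)))).
Qed.

End Picard.

(** * Smooth functions flat at the origin *)

Section FlatExp.
Context {R : realType}.

(** [x^-k exp (-1/x)] for [x > 0], extended by 0: this family is closed under
    differentiation up to linear combinations. *)
Definition flat (k : nat) (x : R) : R := if 0 < x then x^-1 ^+ k * expR (- x^-1) else 0.

Lemma flat_ge0 k x : 0 <= flat k x.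
Proof.
rewrite /flat; case: ifPn => // x0.
by rewrite mulr_ge0 ?expR_ge0// exprn_ge0// invr_ge0 ltW.
Qed.

Lemma flat_pos x : 0 < x -> 0 < flat 0 x.
Proof. by move=> x0; rewrite /flat x0 expr0 mul1r expR_gt0. Qed.

Lemma flat_npos k x : x <= 0 -> flat k x = 0.
Proof. by rewrite /flat ltNge => ->. Qed.

Lemma flat_sqr k x : flat k x <= (k.+2%:R) ^+ k.+2 * x ^+ 2.
Proof.
rewrite /flat; case: ifPn => x0; last by rewrite mulr_ge0 ?sqr_ge0// exprn_ge0.
have y0 : 0 < x^-1 by rewrite invr_gt0.
set y := x^-1 in y0 *.
have h : (y / k.+2%:R) ^+ k.+2 <= expR y.
  have -> : expR y = expR (y / k.+2%:R) ^+ k.+2.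
    by rewrite -expRM_natr -mulrA mulVf ?mulr1// pnatr_eq0.
  rewrite lerXn2r ?nnegrE ?expR_ge0//; first by rewrite divr_ge0// ltW.
  by rewrite (le_trans _ (expR_ge1Dx _))// lerDr.
have -> : x ^+ 2 = y ^- 2 by rewrite /y exprVn invrK.
rewrite expRN ler_pdivrMr ?expR_gt0//.
have -> : y ^+ k = k.+2%:R ^+ k.+2 * y ^- 2 * (y / k.+2%:R) ^+ k.+2.
  rewrite expr_div_n -[in y ^+ k.+2]addn2 exprD.
  field; rewrite ?expf_neq0 ?pnatr_eq0 ?(gt_eqF y0)//.
by rewrite ler_wpM2l// mulr_ge0 ?exprn_ge0// invr_ge0 exprn_ge0// ltW.
Qed.

Lemma is_derive_flat k (x : R) : is_derive x 1 (flat k) (flat k.+2 x - k%:R * flat k.+1 x).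
Proof.
have [x0|x0|x0] := ltgtP 0 x.
- have [dx] : is_derive x 1 (fun y : R => y^-1 ^+ k * expR (- y^-1)) (flat k.+2 x - k%:R * flat k.+1 x).
    have d1 : is_derive x 1 (fun y : R => y^-1) (- x^-1 ^+ 2).
      have := @is_deriveV R id x 1 1 (negbT (gt_eqF x0)) (is_derive_id _ _).
      by move=> h; apply: (is_derive_eq h); rewrite /GRing.scale/= mulr1 exprVn.
    have d2 : is_derive x 1 (fun y : R => expR (- y^-1)) (expR (- x^-1) * x^-1 ^+ 2).
      have d3 : is_derive x 1 (fun y : R => - y^-1) (x^-1 ^+ 2).
        by have h := is_deriveN d1; apply: (is_derive_eq h); rewrite opprK.
      exact: (@is_derive1_comp R expR (fun y : R => - y^-1) x _ _ (is_derive_expR (- x^-1)) d3).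
    have d4 : is_derive x 1 (fun y : R => y^-1 ^+ k) (- (k%:R * x^-1 ^+ k.+1)).
      case: k => [|k].
        rewrite (_ : (fun _ => _) = cst 1); last by apply/funext => y; rewrite expr0.
        by rewrite mul0r oppr0; exact: is_derive_cst.
      rewrite (_ : (fun _ => _) = (fun y : R => y^-1) ^+ k.+1); last first.
        by apply/funext => y; rewrite exprfctE.
      have h := is_deriveX k.+1 d1; apply: (is_derive_eq h).
      by rewrite /GRing.scale/= !exprS -mulr_natr; ring.
    have h := is_deriveM d4 d2; apply: (is_derive_eq h).
    by rewrite /flat x0 /GRing.scale/= !exprS; ring.
  move=> E; rewrite -E; apply: DeriveDef; last first.
    apply: near_eq_derive; near=> y; rewrite /flat ifT//.
    by near: y; exact: lt_nbhsr.
  apply: near_eq_derivable dx; near=> y; rewrite /flat ifT//.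
  by near: y; exact: lt_nbhsr.
- rewrite !flat_npos ?(ltW x0)// mulr0 subr0.
  apply: (near_eq_is_derive _ (is_derive_cst (0 : R) x (1 : R))).
  near=> y; rewrite flat_npos// ltW//; near: y; exact: lt_nbhsl.
- rewrite -x0 !flat_npos// mulr0 subr0.
  pose C : R := (k.+2%:R) ^+ k.+2.
  have h : h^-1 *: (flat k (h *: (1:R) + 0) - flat k 0) @[h --> (0:R)^'] --> (0 : R).
    apply/cvgr0Pnorm_lt => e e0.
    have C1 : 0 < C + 1 by rewrite ltr_wpDl// exprn_ge0.
    near=> h.
    have h0 : h != 0 by near: h; exact: nbhs_dnbhs_neq.
    rewrite (flat_npos _ (lexx 0)) subr0 /GRing.scale/= mulr1 addr0 normrM normfV.
    rewrite (ger0_norm (flat_ge0 _ _)) mulrC ltr_pdivrMr ?normr_gt0//.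
    rewrite (le_lt_trans (flat_sqr _ _))// -(@real_normK _ h) ?num_real// expr2 mulrA.
    rewrite ltr_pM2r ?normr_gt0//.
    have : `|h| < e / (C + 1).
      near: h; apply: dnbhs0_lt; exact: divr_gt0.
    rewrite ltr_pdivlMr// => H; rewrite (le_lt_trans _ H)// mulrC ler_wpM2l// lerDl//.
  by apply: DeriveDef; [apply/cvg_ex; exists 0|exact: (cvg_lim _ h)].
Unshelve. all: by end_near. Qed.

End FlatExp.

(** * Oscillatory integrals *)

Section SmoothClass.
Context {R : realType}.
Let mu := @lebesgue_measure R.
Let T1 := measurableTypeR R.
Let T3 := @borel3 R.

Definition abs1 (w : R3 R) : R := `|w.1| + (`|w.2.1| + `|w.2.2|).

Lemma abs1_ge0 w : 0 <= abs1 w. Proof. by rewrite /abs1 !addr_ge0. Qed.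

Lemma measurable_abs1 : measurable_fun setT (abs1 : T3 -> T1).
Proof.
apply: measurable_realfun.measurable_funD; first exact: (measurableT_comp _ measurable_c1).
apply: measurable_realfun.measurable_funD.
- exact: (measurableT_comp _ measurable_c2).
- exact: (measurableT_comp _ measurable_c3).
Qed.

Lemma coord_le_norm (z : R3 R) : [/\ `|z.1| <= `|z|, `|z.2.1| <= `|z| & `|z.2.2| <= `|z|].
Proof. by rewrite !prod_normE; split; rewrite !le_max lexx ?orbT. Qed.

Lemma dot3_le (z w : R3 R) : `|dot3 z w| <= `|z| * abs1 w.
Proof.
have [h1 h2 h3] := coord_le_norm z.
rewrite /dot3 /abs1 !mulrDr (le_trans (ler_normD _ _))// lerD ?(le_trans (ler_normD _ _)) ?lerD//.
all: by rewrite normrM ler_wpM2r.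
Qed.

Lemma dot3D (z z' w : R3 R) : dot3 (z + z') w = dot3 z w + dot3 z' w.
Proof. by rewrite /dot3 /=; ring. Qed.

Lemma dot3Z (c : R) (z w : R3 R) : dot3 (c *: z) w = c * dot3 z w.
Proof. by rewrite /dot3 /= /GRing.scale/=; ring. Qed.

Lemma dot3C (z w : R3 R) : dot3 z w = dot3 w z.
Proof. by rewrite /dot3; ring. Qed.

Lemma dot3B (z z' w : R3 R) : dot3 (z - z') w = dot3 z w - dot3 z' w.
Proof. by rewrite /dot3 /=; ring. Qed.

Lemma measurable_dot3l (z : R3 R) : measurable_fun setT (fun w : T3 => dot3 z w : T1).
Proof.
have m : measurable_fun setT (fun w : T3 => (z, w) : T3 * T3) by apply: measurable_fun_pair.
exact: (measurableT_comp measurable_dot3 m).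
Qed.

(** Decay faster than any power makes every derivative of [osc] an absolutely
    convergent integral of the same type. *)
Definition rapid (A : R3 R -> R) : Prop :=
  measurable_fun setT (A : T3 -> T1) /\
  forall j, exists C, forall w, `|A w| * (1 + abs1 w) ^+ j <= C * rho w.

Lemma rapid_integrable A : rapid A -> leb3.-integrable setT (EFin \o A).
Proof.
move=> [mA /(_ 0%N) [C AC]].
apply: (le_integrable _ _ _ (integrable_scale C integrable_rho)) => //.
  exact/measurable_EFinP.
move=> w _ /=; rewrite lee_fin (le_trans _ (ler_norm _))//.
by have := AC w; rewrite expr0 mulr1.
Qed.

Lemma rapid_dot (v : R3 R) A : rapid A -> rapid (fun w => dot3 v w * A w).
Proof.
move=> [mA hA]; split; first by apply: measurable_funM => //; exact: measurable_dot3l.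
move=> j; have [C AC] := hA j.+1; exists (`|v| * C) => w.
rewrite normrM -!mulrA (le_trans (ler_wpM2r _ (dot3_le v w))) ?mulr_ge0 ?exprn_ge0 ?addr_ge0 ?abs1_ge0//.
rewrite -mulrA ler_wpM2l// (le_trans _ (AC w))// mulrCA ler_wpM2l// exprS.
by rewrite ler_wpM2r ?exprn_ge0 ?addr_ge0 ?abs1_ge0// lerDr.
Qed.

Lemma rapidN A : rapid A -> rapid (fun w => - A w).
Proof.
move=> [mA hA]; split; first exact: measurableT_comp.
by move=> j; have [C AC] := hA j; exists C => w; rewrite normrN.
Qed.

Lemma rapid_abs A : rapid A -> rapid (fun w => `|A w|).
Proof.
move=> [mA hA]; split; first exact: measurableT_comp.
by move=> j; have [C AC] := hA j; exists C => w; rewrite normr_id.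
Qed.

Lemma rapid_abs1 A : rapid A -> rapid (fun w => abs1 w * A w).
Proof.
move=> [mA hA]; split; first by apply: measurable_funM => //; exact: measurable_abs1.
move=> j; have [C AC] := hA j.+1; exists C => w.
rewrite normrM (ger0_norm (abs1_ge0 w)) -mulrA (le_trans _ (AC w))// mulrCA ler_wpM2l// exprS.
by rewrite ler_wpM2r ?exprn_ge0 ?addr_ge0 ?abs1_ge0// lerDr.
Qed.

(** The real part of an inverse Fourier transform; the two amplitudes are
    exchanged by differentiation. *)
Definition osc (A B : R3 R -> R) (z : R3 R) : R :=
  \int[leb3]_w (A w * cos (dot3 z w) + B w * sin (dot3 z w)).

Lemma cos_lip (x y : R) : `|cos x - cos y| <= `|x - y|.
Proof.
wlog xy : x y / y <= x.
  by move=> H; have [/H//|/ltW/H] := leP y x; rewrite distrC (distrC x).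
have [c _ ->] := @MVT_segment R cos (fun c => - sin c) y x xy (fun c _ => is_derive_cos c)
  (continuous_subspaceT (@continuous_cos R)).
rewrite normrM normrN ler_piMl//.
by rewrite ler_norml sin_geN1 sin_le1.
Qed.

Lemma sin_lip (x y : R) : `|sin x - sin y| <= `|x - y|.
Proof.
wlog xy : x y / y <= x.
  by move=> H; have [/H//|/ltW/H] := leP y x; rewrite distrC (distrC x).
have [c _ ->] := @MVT_segment R sin (fun c => cos c) y x xy (fun c _ => is_derive_sin c)
  (continuous_subspaceT (@continuous_sin R)).
rewrite normrM ler_piMl//.
by rewrite ler_norml cos_geN1 cos_le1.
Qed.

Lemma measurable_osc_body A B z : rapid A -> rapid B ->
  measurable_fun setT (fun w : T3 => A w * cos (dot3 z w) + B w * sin (dot3 z w) : T1).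
Proof.
move=> [mA _] [mB _].
apply: measurable_realfun.measurable_funD; apply: measurable_funM => //.
- apply: (@measurableT_comp _ _ _ _ _ _ (@cos R)); last exact: measurable_dot3l.
  by apply: continuous_measurable_fun; exact: continuous_cos.
- apply: (@measurableT_comp _ _ _ _ _ _ (@sin R)); last exact: measurable_dot3l.
  by apply: continuous_measurable_fun; exact: continuous_sin.
Qed.

Lemma osc_integrable A B z : rapid A -> rapid B ->
  leb3.-integrable setT (EFin \o (fun w => A w * cos (dot3 z w) + B w * sin (dot3 z w))).
Proof.
move=> rA rB.
have iA := rapid_integrable (rapid_abs rA); have iB := rapid_integrable (rapid_abs rB).
apply: (le_integrable _ _ _ (integrableD measurableT iA iB)) => //.
  by apply/measurable_EFinP; exact: measurable_osc_body.
move=> w _ /=; rewrite lee_fin (le_trans (ler_normD _ _))// [leRHS]ger0_norm ?addr_ge0//.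
by rewrite !normrM lerD// ler_piMr// ler_norml ?cos_geN1 ?cos_le1 ?sin_geN1 ?sin_le1.
Qed.

Lemma osc_continuous A B : rapid A -> rapid B -> continuous (osc A B).
Proof.
move=> rA rB z.
pose G w := abs1 w * `|A w| + abs1 w * `|B w|.
have iG : leb3.-integrable setT (EFin \o G).
  exact: (integrableD measurableT (rapid_integrable (rapid_abs1 (rapid_abs rA)))
   (rapid_integrable (rapid_abs1 (rapid_abs rB)))).
have G0 w : 0 <= G w by rewrite addr_ge0// mulr_ge0 ?abs1_ge0.
pose C := \int[leb3]_w G w.
have C0 : 0 <= C by apply: Rintegral_ge0 => w _; exact: G0.
have lip z' : `|osc A B z - osc A B z'| <= C * `|z - z'|.
  rewrite /osc -RintegralB//; try exact: osc_integrable.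
  have i0 := osc_integrable z rA rB; have i1 := osc_integrable z' rA rB.
  rewrite (le_trans (le_normr_Rintegral measurableT _))//.
    exact: (integrableB measurableT i0 i1).
  rewrite mulrC -RintegralZl//; apply: le_Rintegral => //.
  + exact: (integrable_norm (integrableB measurableT i0 i1)).
  + exact: (integrable_scale _ iG).
  + move=> w _.
    have -> : A w * cos (dot3 z w) + B w * sin (dot3 z w) -
      (A w * cos (dot3 z' w) + B w * sin (dot3 z' w)) =
      A w * (cos (dot3 z w) - cos (dot3 z' w)) + B w * (sin (dot3 z w) - sin (dot3 z' w)) by ring.
    rewrite (le_trans (ler_normD _ _))// !normrM /G mulrDr.
    have h : `|dot3 z w - dot3 z' w| <= `|z - z'| * abs1 w by rewrite -dot3B; exact: dot3_le.
    rewrite lerD//.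
    * by rewrite mulrA (mulrC _ `|A w|) ler_wpM2l// (le_trans (cos_lip _ _)).
    * by rewrite mulrA (mulrC _ `|B w|) ler_wpM2l// (le_trans (sin_lip _ _)).
apply/cvgrPdist_lt => e e0.
have C1 : 0 < C + 1 by rewrite ltr_wpDl.
near=> z'.
rewrite (le_lt_trans (lip z'))//.
have : `|z - z'| < e / (C + 1).
  near: z'; apply: (@cvgr_dist_lt _ _ _ (nbhs z) _ id z); [exact: cvg_id|exact: divr_gt0].
rewrite ltr_pdivlMr// => H; rewrite (le_lt_trans _ H)// mulrC ler_wpM2l// lerDl//.
Unshelve. all: by end_near. Qed.

Lemma derive_along (f : R3 R -> R) (z v : R3 R) (l : R) :
  is_derive (0 : R) (1 : R) (fun h : R => f (h *: v + z)) l -> is_derive z v f l.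
Proof.
move=> [d1 d2].
have dv : derivable f z v by exact/derivable1P.
apply: DeriveDef => //; rewrite -d2 /derive; congr (lim _).
suff -> : (fun h : R => h^-1 *: ((f \o shift z) (h *: v) - f z)) =
  (fun h : R => h^-1 *: (((fun h0 : R => f (h0 *: v + z)) \o shift 0) (h *: (1 : R)) -
     f (0 *: v + z))) by [].
apply/funext => h /=; have -> : h *: (1 : R) = h by exact: mulr1.
  by rewrite addr0 scale0r add0r.
Qed.

Lemma is_derive_osc A B (z v : R3 R) : rapid A -> rapid B ->
  is_derive z v (osc A B) (osc (fun w => dot3 v w * B w) (fun w => - (dot3 v w * A w)) z).
Proof.
move=> rA rB; apply: derive_along.
pose f (x : R) (w : R3 R) := A w * cos (dot3 (x *: v + z) w) + B w * sin (dot3 (x *: v + z) w).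
have df (x : R) (w : R3 R) : is_derive x (1 : R) (fun y : R => f y w) (dot3 v w * B w * cos (dot3 (x *: v + z) w) +
    - (dot3 v w * A w) * sin (dot3 (x *: v + z) w)).
  have d0 : is_derive x (1 : R) (fun x => dot3 (x *: v + z) w) (dot3 v w).
    have -> : (fun x => dot3 (x *: v + z) w) = (fun x : R => x * dot3 v w + dot3 z w).
      by apply/funext => y; rewrite dot3D dot3Z.
    have h := is_deriveD (is_deriveM (is_derive_id x (1:R)) (is_derive_cst (dot3 v w) x (1:R)))
       (is_derive_cst (dot3 z w) x (1:R)).
    by apply: (is_derive_eq h); rewrite /GRing.scale/=; ring.
  have d1 := @is_derive1_comp R cos (fun x : R => dot3 (x *: v + z) w) x _ _ (is_derive_cos _) d0.
  have d2 := @is_derive1_comp R sin (fun x : R => dot3 (x *: v + z) w) x _ _ (is_derive_sin _) d0.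
  have h := is_deriveD (is_deriveM (is_derive_cst (A w) x (1:R)) d1)
     (is_deriveM (is_derive_cst (B w) x (1:R)) d2).
  by apply: (is_derive_eq h); rewrite /GRing.scale/=; ring.
have iG : leb3.-integrable setT (EFin \o (fun w => `|dot3 v w * B w| + `|dot3 v w * A w|)).
  exact: (integrableD measurableT (rapid_integrable (rapid_abs (rapid_dot v rB)))
   (rapid_integrable (rapid_abs (rapid_dot v rA)))).
have I0 : (`](-1 : R), 1[%classic) (0 : R) by rewrite /= in_itv/= ltrN10 ltr01.
have If x : (`](-1 : R), 1[%classic) x -> leb3.-integrable setT (EFin \o f x).
  by move=> _; exact: osc_integrable.
have Id x (w : T3) : (`](-1 : R), 1[%classic) x -> setT w -> derivable (f ^~ w) x 1.
  by move=> _ _; have [] := df x w.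
have dE x w : partial1of2 f x w = dot3 v w * B w * cos (dot3 (x *: v + z) w) +
    - (dot3 v w * A w) * sin (dot3 (x *: v + z) w).
  by rewrite partial1of2E; have [_ ->] := df x w.
have Ib x (w : T3) : (`](-1 : R), 1[%classic) x -> setT w ->
    `|partial1of2 f x w| <= `|dot3 v w * B w| + `|dot3 v w * A w|.
  move=> _ _; rewrite dE (le_trans (ler_normD _ _))//.
  rewrite (normrM _ (cos _)) (normrM _ (sin _)) normrN.
  by rewrite lerD// ler_piMr// ler_norml ?cos_geN1 ?cos_le1 ?sin_geN1 ?sin_le1.
have D1 := derivable_under_integral measurableT I0 If Id (fun w => addr_ge0 (normr_ge0 _) (normr_ge0 _)) iG Ib.
have D2 := differentiation_under_integral measurableT I0 If Id (fun w => addr_ge0 (normr_ge0 _) (normr_ge0 _)) iG Ib.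
apply: DeriveDef; first exact: D1.
rewrite -derive1E; apply: (etrans D2); rewrite /osc.
by apply: eq_Rintegral => w _; rewrite dE scale0r add0r.
Qed.

End SmoothClass.

(** * Test functions *)

Section Smooth.
Context {R : realType}.
Let mu := @lebesgue_measure R.
Let T1 := measurableTypeR R.
Let T3 := @borel3 R.

(** A class of explicit functions closed under directional derivatives, which
    makes smoothness an induction. *)
Inductive sm : (R3 R -> R) -> Prop :=
| sm_cst (c : R) : sm (fun=> c)
| sm_flat k a b : sm (fun z => flat k (a + dot3 b z))
| sm_osc A B : rapid A -> rapid B -> sm (osc A B)
| sm_add f g : sm f -> sm g -> sm (f + g)
| sm_mul f g : sm f -> sm g -> sm (f * g).

Lemma flat_continuous k : continuous (@flat R k).
Proof.
move=> x; have [d _] := is_derive_flat k x.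
by apply/differentiable_continuous/derivable1_diffP.
Qed.

Lemma dot3_continuous (b : R3 R) : continuous (fun z : R3 R => dot3 b z).
Proof.
move=> z; apply/cvgrPdist_lt => e e0.
have C1 : 0 < abs1 b + 1 by rewrite ltr_wpDl// abs1_ge0.
near=> z'.
rewrite !(dot3C b) -dot3B (le_lt_trans (dot3_le _ _))//.
have : `|z - z'| < e / (abs1 b + 1).
  by near: z'; apply: (@cvgr_dist_lt _ _ _ (nbhs z) _ id z); [exact: cvg_id|exact: divr_gt0].
rewrite ltr_pdivlMr// => H; rewrite (le_lt_trans _ H)// ler_wpM2l// lerDl//.
Unshelve. all: by end_near. Qed.

Lemma is_derive_flat_dot k a (b z v : R3 R) :
  is_derive z v (fun z => flat k (a + dot3 b z))
   (dot3 b v * (flat k.+2 (a + dot3 b z) - k%:R * flat k.+1 (a + dot3 b z))).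
Proof.
apply: derive_along.
have d0 : is_derive (0 : R) (1 : R) (fun x : R => a + dot3 b (x *: v + z)) (dot3 b v).
  have -> : (fun x : R => a + dot3 b (x *: v + z)) = (fun x : R => x * dot3 b v + (a + dot3 b z)).
    by apply/funext => y; rewrite !(dot3C b) dot3D dot3Z; ring.
  have h := is_deriveD (is_deriveM (is_derive_id 0 (1:R)) (is_derive_cst (dot3 b v) 0 (1:R)))
       (is_derive_cst (a + dot3 b z) 0 (1:R)).
  by apply: (is_derive_eq h); rewrite /GRing.scale/=; ring.
have E : a + dot3 b (0 *: v + z) = a + dot3 b z by rewrite scale0r add0r.
have h := @is_derive1_comp R (flat k) (fun x : R => a + dot3 b (x *: v + z)) 0 _ _
   (is_derive_flat k _) d0.
by apply: (is_derive_eq h); rewrite E mulrC.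
Qed.

Lemma sm_lin (c : R) f : sm f -> sm (fun z => c * f z).
Proof. by move=> sf; exact: (sm_mul (sm_cst c) sf). Qed.

Lemma sm_derive f : sm f -> forall v, exists2 g, sm g & forall z, is_derive z v f (g z).
Proof.
elim=> [c|k a b|A B rA rB|{}f g sf IHf sg IHg|{}f g sf IHf sg IHg] v.
- by exists (fun=> 0); [exact: sm_cst|move=> z; exact: is_derive_cst].
- exists (fun z => dot3 b v * (flat k.+2 (a + dot3 b z) + (- k%:R) * flat k.+1 (a + dot3 b z))).
    apply: sm_lin; apply: (sm_add (f := fun z => flat k.+2 (a + dot3 b z))
      (g := fun z => (- k%:R) * flat k.+1 (a + dot3 b z))); first exact: sm_flat.
    by apply: sm_lin; exact: sm_flat.
  by move=> z; have := is_derive_flat_dot k a b z v; rewrite mulNr.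
- exists (osc (fun w => dot3 v w * B w) (fun w => - (dot3 v w * A w))).
    by apply: sm_osc; [exact: rapid_dot|exact: rapidN (rapid_dot _ _)].
  by move=> z; exact: is_derive_osc.
- have [f' sf' df] := IHf v; have [g' sg' dg] := IHg v.
  by exists (f' + g'); [exact: sm_add|move=> z; exact: is_deriveD].
- have [f' sf' df] := IHf v; have [g' sg' dg] := IHg v.
  exists (f * g' + g * f'); first by apply: sm_add; exact: sm_mul.
  by move=> z; exact: is_deriveM.
Qed.

Lemma sm_continuous f : sm f -> continuous f.
Proof.
elim=> [c|k a b|A B rA rB|{}f g sf IHf sg IHg|{}f g sf IHf sg IHg].
- by move=> z; exact: cvg_cst.
- move=> z; apply: (@continuous_comp _ _ _ (fun z : R3 R => a + dot3 b z) (flat k)).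
    by apply: cvgD; [exact: cvg_cst|exact: dot3_continuous].
  exact: flat_continuous.
- exact: osc_continuous.
- by move=> z; apply: cvgD; [exact: IHf|exact: IHg].
- by move=> z; apply: cvgM; [exact: IHf|exact: IHg].
Qed.

Lemma sm_smooth f : sm f -> smooth f.
Proof.
move=> sf vs /=.
have sg : sm (foldr (fun (v : R3 R) (h : R3 R -> R) => 'D_v h) f vs).
  elim: vs => [//|v vs IH] /=; have [g sg dg] := sm_derive IH v.
  suff -> : 'D_v (foldr (fun (v : R3 R) (h : R3 R -> R) => 'D_v h) f vs) = g by [].
  by apply/funext => z; have [_ ->] := dg z.
split; first exact: sm_continuous.
by move=> z v; have [g _ dg] := sm_derive sg v; have [] := dg z.
Qed.

Definition bump (x : R) : R := flat 0 (1 + x) * flat 0 (1 - x).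

Lemma bump_ge0 x : 0 <= bump x. Proof. by rewrite mulr_ge0 ?flat_ge0. Qed.

Lemma flat0_le1 (x : R) : flat 0 x <= 1.
Proof.
rewrite /flat; case: ifPn => // x0; rewrite expr0 mul1r -expR0 ler_expR oppr_le0.
by rewrite invr_ge0 ltW.
Qed.

Lemma bump_le1 x : bump x <= 1.
Proof. by rewrite /bump mulr_ile1 ?flat_ge0 ?flat0_le1. Qed.

Lemma bump_out x : 1 <= `|x| -> bump x = 0.
Proof.
rewrite ler_normr /bump => /orP[h|h].
- by rewrite (@flat_npos _ _ (1 - x)) ?mulr0//; lra.
- by rewrite (@flat_npos _ _ (1 + x)) ?mul0r//; lra.
Qed.

Lemma bumpN x : bump (- x) = bump x.
Proof. by rewrite /bump opprK mulrC. Qed.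

Lemma bump_cont : continuous bump.
Proof.
move=> x; apply: cvgM.
- apply: (@continuous_comp _ _ _ (fun x : R => 1 + x) (flat 0)); last exact: flat_continuous.
  by apply: cvgD; [exact: cvg_cst|exact: cvg_id].
- apply: (@continuous_comp _ _ _ (fun x : R => 1 - x) (flat 0)); last exact: flat_continuous.
  by apply: cvgB; [exact: cvg_cst|exact: cvg_id].
Qed.

Lemma measurable_bump : measurable_fun setT (bump : T1 -> T1).
Proof. by apply: continuous_measurable_fun; exact: bump_cont. Qed.

Definition bump3 (s : R) (z : R3 R) : R :=
  bump (s * z.1) * (bump (s * z.2.1) * bump (s * z.2.2)).

Lemma sm_bump3 s : sm (bump3 s).
Proof.
have h (b : R3 R) : sm (fun z => bump (dot3 b z)).
  have -> : (fun z => bump (dot3 b z)) =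
     (fun z => flat 0 (1 + dot3 b z)) * (fun z => flat 0 (1 + dot3 (- b) z)).
    apply/funext => z; rewrite /bump; congr (_ * flat 0 _).
    by rewrite /dot3 /=; ring.
  by apply: sm_mul; exact: sm_flat.
have -> : bump3 s = (fun z => bump (dot3 (s, (0, 0)) z)) *
   ((fun z => bump (dot3 (0, (s, 0)) z)) * (fun z => bump (dot3 (0, (0, s)) z))).
  by apply/funext => z; rewrite /bump3/=; congr (bump _ * (bump _ * bump _)); rewrite /dot3/=; ring.
by do 2 (apply: sm_mul => //).
Qed.

Lemma bump3_supp s z : 0 < s -> bump3 s z != 0 ->
  [/\ `|z.1| <= s^-1, `|z.2.1| <= s^-1 & `|z.2.2| <= s^-1].
Proof.
move=> s0 hb.
have h1 : bump (s * z.1) != 0 by apply: contraNneq hb => h; rewrite /bump3 h mul0r.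
have h2 : bump (s * z.2.1) != 0 by apply: contraNneq hb => h; rewrite /bump3 h mul0r mulr0.
have h3 : bump (s * z.2.2) != 0 by apply: contraNneq hb => h; rewrite /bump3 h !mulr0.
have h x : bump (s * x) != 0 -> `|x| <= s^-1.
  move=> hx; rewrite leNgt; apply/negP => sx; move/negP: hx; apply; apply/eqP.
  apply: bump_out; rewrite normrM (gtr0_norm s0) -(mulfV (lt0r_neq0 s0)) ler_pM2l//.
  exact: ltW.
by split; apply: h.
Qed.

Lemma test_function_bump3 s f : 0 < s -> sm f -> test_function (bump3 s * f).
Proof.
move=> s0 sf; split; first by apply/sm_smooth/sm_mul => //; exact: sm_bump3.
pose I := `[- s^-1, s^-1]%classic : set R.
have cI : compact I by exact: segment_compact.
have cB : compact (I `*` (I `*` I) : set (R3 R)) by do 2 apply: compact_setX => //.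
apply: (subclosed_compact _ cB); first exact: closed_closure.
have clB : closed (I `*` (I `*` I) : set (R3 R)).
  by apply: compact_closed => //; exact: norm_hausdorff.
rewrite [X in _ `<=` X]((closure_id _).1 clB); apply: closureS => z /=.
move=> hz; have hb : bump3 s z != 0.
  by apply: contraNneq hz => h; rewrite [(_ * _) z](_ : _ = bump3 s z * f z) // h mul0r.
have [h1 h2 h3] := bump3_supp s0 hb.
by rewrite /I /= !in_itv/= -!ler_norml.
Qed.

End Smooth.

(** * The Fourier transform of a bump *)

Section Kernel.
Context {R : realType}.
Let mu := @lebesgue_measure R.
Let T1 := measurableTypeR R.
Let T3 := @borel3 R.

Lemma Rintegral_reflect (f : R -> R) : mu.-integrable setT (EFin \o f) ->
  \int[mu]_x f x = \int[mu]_x f (- x).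
Proof.
move=> if_; rewrite /Rintegral; congr fine.
have A := integralE mu setT (EFin \o f).
have B := integralE mu setT (EFin \o (fun x => f (- x))).
rewrite [LHS]A [RHS]B.
have mf := measurable_int _ if_.
have n0 : (-1 : R) != 0 by rewrite oppr_eq0 oner_eq0.
rewrite (ge0_integral_affine 0 n0 (measurable_funepos mf) (funepos_ge0 _)).
rewrite (ge0_integral_affine 0 n0 (measurable_funeneg mf) (funeneg_ge0 _)).
rewrite normrN1 !mul1e.
congr (_ - _)%E.
+ by apply: eq_integral => x _; rewrite !funeposE/= mulN1r addr0.
+ by apply: eq_integral => x _; rewrite !funenegE/= mulN1r addr0.
Qed.

Lemma integrable_indic11 (c : R) : mu.-integrable setT (EFin \o (fun s => c * \1_(`[-1, 1]) s)).
Proof.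
apply: (@integrable_scale _ _ _ mu (\1_(`[-1, 1]))).
apply/integrableP; split.
  by apply/measurable_EFinP; apply: measurable_indic; exact: measurable_itv.
under eq_integral => s _ do rewrite /= ger0_norm ?indicE ?ler0n//.
have := @integral_indic _ _ _ mu setT measurableT `[-1, 1]%classic (measurable_itv `[-1, 1]).
under eq_integral do rewrite indicE.
by move=> ->; rewrite setIT /= lebesgue_measure_itv/=; case: ifP => // _; rewrite ltry.
Qed.

Lemma bump_indic (x : R) : bump x = \1_(`[-1, 1]) x * bump x.
Proof.
have [h|h] := leP `|x| 1.
  by rewrite indicE mem_set ?mul1r//= in_itv/= -ler_norml.
by rewrite bump_out ?mulr0// ltW.
Qed.

Lemma bump_mul_integrable (f : R -> R) : measurable_fun setT (f : T1 -> T1) ->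
  (forall x, `|f x| <= 1) -> mu.-integrable setT (EFin \o (fun x => bump x * f x)).
Proof.
move=> mf f1; apply: (le_integrable _ _ _ (integrable_indic11 1)) => //.
  by apply/measurable_EFinP; apply: measurable_funM => //; exact: measurable_bump.
move=> x _ /=; rewrite lee_fin mul1r bump_indic -mulrA (normrM (\1_ _ x)) ler_piMr//.
have b1 : `|bump x| <= 1 by rewrite (ger0_norm (bump_ge0 x)) bump_le1.
by rewrite (normrM (bump x)) mulr_ile1.
Qed.

Lemma measurable_cosZ (y : R) : measurable_fun setT (fun x : T1 => cos (x * y) : T1).
Proof.
apply: continuous_measurable_fun => x; apply: (@continuous_comp _ _ _ (fun x : R => x * y) cos).
  by apply: cvgM; [exact: cvg_id|exact: cvg_cst].
exact: continuous_cos.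
Qed.

Lemma measurable_sinZ (y : R) : measurable_fun setT (fun x : T1 => sin (x * y) : T1).
Proof.
apply: continuous_measurable_fun => x; apply: (@continuous_comp _ _ _ (fun x : R => x * y) sin).
  by apply: cvgM; [exact: cvg_id|exact: cvg_cst].
exact: continuous_sin.
Qed.

Lemma norm_cos_le1 (x : R) : `|cos x| <= 1.
Proof. by rewrite ler_norml cos_geN1 cos_le1. Qed.
Lemma norm_sin_le1 (x : R) : `|sin x| <= 1.
Proof. by rewrite ler_norml sin_geN1 sin_le1. Qed.

(** The Fourier transform of the even function [bump], hence real. *)
Definition ker1 (y : R) : R := \int[mu]_x (bump x * cos (x * y)).

Lemma bump_cos_integrable y : mu.-integrable setT (EFin \o (fun x => bump x * cos (x * y))).
Proof.
by apply: bump_mul_integrable => [|x]; [exact: measurable_cosZ|exact: norm_cos_le1].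
Qed.

Lemma bump_sin_integrable y : mu.-integrable setT (EFin \o (fun x => bump x * sin (x * y))).
Proof.
by apply: bump_mul_integrable => [|x]; [exact: measurable_sinZ|exact: norm_sin_le1].
Qed.

Lemma bump_expi_integrable y : cintegrable mu setT (fun x => (bump x)%:C%C * expi (x * y)).
Proof.
split.
- under eq_fun do rewrite ReM /= mul0r subr0; exact: bump_cos_integrable.
- under eq_fun do rewrite ImM /= mul0r addr0; exact: bump_sin_integrable.
Qed.

Lemma ker1E y : cintegral mu setT (fun x => (bump x)%:C%C * expi (x * y)) = (ker1 y)%:C%C.
Proof.
apply: complex_eqP => /=.
  by apply: eq_Rintegral => x _; rewrite mul0r subr0.
under eq_Rintegral do rewrite mul0r addr0.
have := Rintegral_reflect (bump_sin_integrable y).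
under [X in _ = X -> _]eq_Rintegral do rewrite bumpN mulNr sinN mulrN.
have -> : \int[mu]_x - (bump x * sin (x * y)) = - \int[mu]_x (bump x * sin (x * y)).
  rewrite -[RHS]mulN1r -RintegralZl//; last exact: bump_sin_integrable.
  by apply: eq_Rintegral => x _; rewrite mulN1r.
by move=> h; lra.
Qed.

Definition bump' (x : R) : R := flat 2 (1 + x) * flat 0 (1 - x) - flat 0 (1 + x) * flat 2 (1 - x).

Definition bump'' (x : R) : R :=
  (flat 4 (1 + x) - 2 * flat 3 (1 + x)) * flat 0 (1 - x) - 2 * (flat 2 (1 + x) * flat 2 (1 - x))
  + flat 0 (1 + x) * (flat 4 (1 - x) - 2 * flat 3 (1 - x)).

Lemma is_derive_flatD k (x : R) : is_derive x (1 : R) (fun x : R => flat k (1 + x))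
  (flat k.+2 (1 + x) - k%:R * flat k.+1 (1 + x)).
Proof.
have h0 := is_deriveD (is_derive_cst (1 : R) x (1:R)) (is_derive_id x (1:R)).
have h := @is_derive1_comp R (flat k) (fun x : R => 1 + x) x _ _ (is_derive_flat k _) h0.
by apply: (is_derive_eq h); ring.
Qed.

Lemma is_derive_flatB k (x : R) : is_derive x (1 : R) (fun x : R => flat k (1 - x))
  (- (flat k.+2 (1 - x) - k%:R * flat k.+1 (1 - x))).
Proof.
have h0 := is_deriveD (is_derive_cst (1 : R) x (1:R)) (is_deriveN (is_derive_id x (1:R))).
have h := @is_derive1_comp R (flat k) (fun x : R => 1 - x) x _ _ (is_derive_flat k _) h0.
by apply: (is_derive_eq h); ring.
Qed.

Lemma is_derive_bump (x : R) : is_derive x (1 : R) bump (bump' x).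
Proof.
have h := is_deriveM (is_derive_flatD 0 x) (is_derive_flatB 0 x).
by apply: (is_derive_eq h); rewrite /bump' /GRing.scale/=; ring.
Qed.

Lemma is_derive_bump' (x : R) : is_derive x (1 : R) bump' (bump'' x).
Proof.
have h := is_deriveB (is_deriveM (is_derive_flatD 2 x) (is_derive_flatB 0 x))
   (is_deriveM (is_derive_flatD 0 x) (is_derive_flatB 2 x)).
by apply: (is_derive_eq h); rewrite /bump'' /GRing.scale/=; ring.
Qed.

Lemma flatD_cont k (x : R) : {for x, continuous (fun x : R => flat k (1 + x))}.
Proof.
by have [d _] := is_derive_flatD k x; apply/differentiable_continuous/derivable1_diffP.
Qed.

Lemma flatB_cont k (x : R) : {for x, continuous (fun x : R => flat k (1 - x))}.
Proof.
by have [d _] := is_derive_flatB k x; apply/differentiable_continuous/derivable1_diffP.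
Qed.

Lemma bump''_cont : continuous bump''.
Proof.
have c k (e : R) (x : R) : {for x, continuous (fun x : R => e * flat k (1 + x))}.
  by apply: cvgM; [exact: cvg_cst|exact: flatD_cont].
have d k (e : R) (x : R) : {for x, continuous (fun x : R => e * flat k (1 - x))}.
  by apply: cvgM; [exact: cvg_cst|exact: flatB_cont].
move=> x; apply: cvgD; first apply: cvgB.
- apply: cvgM; last exact: flatB_cont.
  by apply: cvgB; [exact: flatD_cont|exact: c].
- apply: cvgM; first exact: cvg_cst.
  by apply: cvgM; [exact: flatD_cont|exact: flatB_cont].
- apply: cvgM; first exact: flatD_cont.
  by apply: cvgB; [exact: flatB_cont|exact: d].
Qed.

(** Two integrations by parts: [bump' * cos + y * bump * sin] is a primitive
    and vanishes at the end points. *)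
Lemma ker1_ibp (y : R) :
  \int[mu]_(x in `[-1, 1]) ((bump'' x + y ^+ 2 * bump x) * cos (x * y)) = 0.
Proof.
pose F (x : R) := bump' x * cos (x * y) + y * bump x * sin (x * y).
have dl (x : R) : is_derive x (1 : R) (fun x : R => x * y) y.
  have h := is_deriveM (is_derive_id x (1:R)) (is_derive_cst y x (1:R)).
  by apply: (is_derive_eq h); rewrite /GRing.scale/=; ring.
have dF (x : R) : is_derive x (1 : R) F ((bump'' x + y ^+ 2 * bump x) * cos (x * y)).
  have d1 := @is_derive1_comp R cos (fun x : R => x * y) x _ _ (is_derive_cos _) (dl x).
  have d2 := @is_derive1_comp R sin (fun x : R => x * y) x _ _ (is_derive_sin _) (dl x).
  have h := is_deriveD (is_deriveM (is_derive_bump' x) d1)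
     (is_deriveM (is_deriveM (is_derive_cst y x (1:R)) (is_derive_bump x)) d2).
  apply: (is_derive_eq h); rewrite /GRing.scale/= (_ : (cst y * bump) x = y * bump x)//; ring.
have cF (x : R) : {for x, continuous F}.
  by have [d _] := dF x; apply/differentiable_continuous/derivable1_diffP.
rewrite /Rintegral (@continuous_FTC2 _ _ F (-1) 1).
- rewrite -EFinB /F /bump' /bump /= !subrr !opprK ?addNr.
  by rewrite !(@flat_npos _ _ 0) ?subrr ?addNr// !(mul0r, mulr0, subr0, addr0).
- by lra.
- apply: continuous_subspaceT => x; apply: cvgM.
    by apply: cvgD; [exact: bump''_cont|apply: cvgM; [exact: cvg_cst|exact: bump_cont]].
  apply: (@continuous_comp _ _ _ (fun x : R => x * y) cos).
    by apply: cvgM; [exact: cvg_id|exact: cvg_cst].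
  exact: continuous_cos.
- split.
  + by move=> x _; have [] := dF x.
  + by apply: cvg_at_right_filter; exact: cF.
  + by apply: cvg_at_left_filter; exact: cF.
- by move=> x _; rewrite derive1E; have [_ ->] := dF x.
Qed.

Lemma ker1_restrict y : ker1 y = \int[mu]_(x in `[-1, 1]) (bump x * cos (x * y)).
Proof.
rewrite [RHS]Rintegral_mkcond; apply: eq_Rintegral => x _.
rewrite /patch; have := bump_indic x; rewrite indicE; case: (x \in `[-1, 1]%classic) => //.
by rewrite mul0r => ->; rewrite mul0r.
Qed.

(** By [ker1_ibp] the transform decays like [y^-2], and it is bounded. *)
Lemma ker1_bound : exists2 C : R, 0 <= C & forall y, `|ker1 y| <= C * cauchy y.
Proof.
have iI (f : R -> R) : continuous f -> mu.-integrable `[-1, 1] (EFin \o f).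
  move=> cf; apply: continuous_compact_integrable; first exact: segment_compact.
  exact: continuous_subspaceT.
have cc y : continuous (fun x : R => cos (x * y)).
  move=> x; apply: (@continuous_comp _ _ _ (fun x : R => x * y) cos).
    by apply: cvgM; [exact: cvg_id|exact: cvg_cst].
  exact: continuous_cos.
have cb : continuous (fun x => bump x - bump'' x).
  by move=> x; apply: cvgB; [exact: bump_cont|exact: bump''_cont].
exists (\int[mu]_(x in `[-1, 1]) `|bump x - bump'' x|).
  by apply: Rintegral_ge0 => x _.
move=> y; rewrite /cauchy ler_pdivlMr ?ltr_wpDr ?sqr_ge0//.
rewrite -[X in _ * X]ger0_norm ?addr_ge0 ?sqr_ge0// -normrM mulrDr mulr1.
have -> : ker1 y + ker1 y * y ^+ 2 =
    \int[mu]_(x in `[-1, 1]) ((bump x - bump'' x) * cos (x * y)).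
  have i1 : mu.-integrable `[-1, 1] (EFin \o (fun x => bump x * cos (x * y))).
    by apply: iI => x; apply: cvgM; [exact: bump_cont|exact: cc].
  have i2 : mu.-integrable `[-1, 1] (EFin \o (fun x => (bump'' x + y ^+ 2 * bump x) * cos (x * y))).
    apply: iI => x; apply: cvgM; last exact: cc.
    by apply: cvgD; [exact: bump''_cont|apply: cvgM; [exact: cvg_cst|exact: bump_cont]].
  have i3 : mu.-integrable `[-1, 1] (EFin \o (fun x => (1 + y ^+ 2) * (bump x * cos (x * y)))).
    by apply: iI => x; apply: cvgM; [exact: cvg_cst|apply: cvgM; [exact: bump_cont|exact: cc]].
  transitivity ((1 + y ^+ 2) * ker1 y -
      \int[mu]_(x in `[-1, 1]) ((bump'' x + y ^+ 2 * bump x) * cos (x * y))).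
    by rewrite ker1_ibp; ring.
  rewrite ker1_restrict -RintegralZl// -RintegralB//.
  by apply: eq_Rintegral => x _; ring.
have i4 : mu.-integrable `[-1, 1] (EFin \o (fun x => (bump x - bump'' x) * cos (x * y))).
  by apply: iI => x; apply: cvgM; [exact: cb|exact: cc].
have i5 : mu.-integrable `[-1, 1] (EFin \o (fun x => `|bump x - bump'' x|)).
  by apply: integrable_norm; exact: iI.
rewrite (le_trans (le_normr_Rintegral _ i4))//.
apply: le_Rintegral => //; first exact: integrable_norm.
by move=> x _; rewrite normrM ler_piMr// norm_cos_le1.
Qed.

Lemma ker1N (y : R) : ker1 (- y) = ker1 y.
Proof. by apply: eq_Rintegral => x _; rewrite mulrN cosN. Qed.

Lemma measurable_ker1 : measurable_fun setT (ker1 : T1 -> T1).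
Proof.
apply: (@measurable_Rintegral _ _ _ T1 T1 mu (fun z => bump z.2 * cos (z.2 * z.1))).
apply: measurable_funM; first exact: (measurableT_comp measurable_bump measurable_snd).
apply: (@measurableT_comp _ _ _ _ _ _ (@cos R)).
  by apply: continuous_measurable_fun; exact: continuous_cos.
by apply: measurable_funM.
Qed.

Definition ker3 (w : R3 R) : R := ker1 w.1 * (ker1 w.2.1 * ker1 w.2.2).

Lemma measurable_ker3 : measurable_fun setT (ker3 : T3 -> T1).
Proof.
apply: measurable_funM; first exact: (measurableT_comp measurable_ker1 measurable_c1).
apply: measurable_funM; first exact: (measurableT_comp measurable_ker1 measurable_c2).
exact: (measurableT_comp measurable_ker1 measurable_c3).
Qed.

Lemma ker3_bound : exists2 C : R, 0 <= C & forall w, `|ker3 w| <= C * rho w.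
Proof.
have [C C0 H] := ker1_bound; exists (C ^+ 3); first exact: exprn_ge0.
move=> w; rewrite /ker3 !normrM.
have -> : C ^+ 3 * rho w = (C * cauchy w.1) * ((C * cauchy w.2.1) * (C * cauchy w.2.2)).
  by rewrite /rho; ring.
apply: ler_pM; [exact: normr_ge0|by apply: mulr_ge0; exact: normr_ge0|exact: H|].
by apply: ler_pM; [exact: normr_ge0|exact: normr_ge0|exact: H|exact: H].
Qed.

Lemma ker3N (w : R3 R) : ker3 (- w) = ker3 w.
Proof. by rewrite /ker3 /= !ker1N. Qed.

Lemma integrable_ker3 : leb3.-integrable setT (EFin \o ker3).
Proof.
have [C C0 H] := ker3_bound.
apply: (le_integrable _ _ _ (integrable_scale C integrable_rho)) => //.
  by apply/measurable_EFinP; exact: measurable_ker3.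
by move=> w _ /=; rewrite lee_fin (le_trans (H w))// ler_norm.
Qed.

Lemma bump3_expi1 (v : R3 R) : cintegrable leb3 setT (fun z => (bump3 1 z)%:C%C * expi (dot3 z v)) /\
  cintegral leb3 setT (fun z => (bump3 1 z)%:C%C * expi (dot3 z v)) = (ker3 v)%:C%C.
Proof.
have E : (fun z : R3 R => (bump3 1 z)%:C%C * expi (dot3 z v)) =
  (fun z => ((bump z.1)%:C%C * expi (z.1 * v.1)) * (((bump z.2.1)%:C%C * expi (z.2.1 * v.2.1)) *
    ((bump z.2.2)%:C%C * expi (z.2.2 * v.2.2)))).
  by apply/funext => z; rewrite /bump3 !mul1r /dot3 !expiD !rmorphM/=; ring.
rewrite E; split.
  exact: (cintegrable3 (bump_expi_integrable v.1) (bump_expi_integrable v.2.1)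
    (bump_expi_integrable v.2.2)).
rewrite (cintegral3 (bump_expi_integrable v.1) (bump_expi_integrable v.2.1)
    (bump_expi_integrable v.2.2)).
by rewrite !ker1E -!rmorphM.
Qed.

Lemma bump3_expi (s : R) (v : R3 R) : 0 < s ->
  cintegrable leb3 setT (fun z => (bump3 s z)%:C%C * expi (dot3 z v)) /\
  cintegral leb3 setT (fun z => (bump3 s z)%:C%C * expi (dot3 z v)) =
    (s ^- 3 * ker3 (s^-1 *: v))%:C%C.
Proof.
move=> s0; have [i1 e1] := bump3_expi1 (s^-1 *: v).
have E : (fun z : R3 R => (bump3 s z)%:C%C * expi (dot3 z v)) =
  (fun z => (bump3 1 (aff3 s 0 z))%:C%C * expi (dot3 (aff3 s 0 z) (s^-1 *: v))).
  apply/funext => z; rewrite /bump3 /aff3 /= !mul1r !addr0; congr (_ * expi _).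
  by rewrite /dot3 /= /GRing.scale/=; field; rewrite gt_eqF.
rewrite E; split; first exact: (cintegrable_aff3 0 (lt0r_neq0 s0) i1).
have := cintegral_aff3 0 (lt0r_neq0 s0) i1; rewrite e1 gtr0_norm// => h.
by rewrite rmorphM/= h mulrA -rmorphM/= mulVf ?mul1r// expf_neq0// gt_eqF.
Qed.

End Kernel.

(** * Regularised Fourier inversion *)

Section InverseFourier.
Context {R : realType}.
Let mu := @lebesgue_measure R.
Let T1 := measurableTypeR R.
Let T3 := @borel3 R.

Definition ift (G : R3 R -> R[i]) (z : R3 R) : R[i] :=
  cintegral leb3 setT (fun w => G w * expi (dot3 z w)).

Lemma scale3 (s : R) (w : R3 R) : s *: w = (s * w.1, (s * w.2.1, s * w.2.2)).
Proof. by case: w => [a [b c]]. Qed.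

Lemma cmeasurable_expi_dot (z : R3 R) : @cmeasurable R _ borel3 (fun w => expi (dot3 z w)).
Proof. by apply: cmeasurable_expi; exact: measurable_dot3l. Qed.

Lemma ift_cintegrable (G : R3 R -> R[i]) (z : R3 R) : cintegrable leb3 setT G ->
  cintegrable leb3 setT (fun w => G w * expi (dot3 z w)).
Proof.
move=> iG; apply: (cintegrable_dom _ (cintegrable_nc iG)).
- by apply: cmeasurableM; [exact: (cintegrable_meas iG)|exact: cmeasurable_expi_dot].
- by move=> w; rewrite ncM nc_expi mulr1.
Qed.

Lemma ift_bound (G : R3 R -> R[i]) (z : R3 R) : cintegrable leb3 setT G ->
  nc (ift G z) <= 2 * \int[leb3]_w nc (G w).
Proof.
move=> iG; apply: cintegral_le.
- exact: (cintegrable_meas (ift_cintegrable z iG)).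
- exact: cintegrable_nc.
- by move=> w; rewrite ncM nc_expi mulr1.
Qed.

Lemma cmeasurable_ift (G : R3 R -> R[i]) : @cmeasurable R _ borel3 G ->
  @cmeasurable R _ borel3 (ift G).
Proof.
move=> mG; apply: (@cmeasurable_cintegral _ _ _ T3 T3 leb3
  (fun zw => G zw.2 * expi (dot3 zw.1 zw.2))).
apply: cmeasurableM; first exact: (cmeasurable_comp mG measurable_snd).
by apply: cmeasurable_expi; exact: measurable_dot3.
Qed.

Lemma measurable_bump3 (s : R) : measurable_fun setT (bump3 s : T3 -> T1).
Proof.
have m (c : T3 -> T1) : measurable_fun setT c -> measurable_fun setT (fun z => bump (s * c z) : T1).
  move=> mc; apply: (measurableT_comp measurable_bump).
  by apply: measurable_funM => //; exact: measurable_cst.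
apply: measurable_funM; first exact: m measurable_c1.
by apply: measurable_funM; [exact: m measurable_c2|exact: m measurable_c3].
Qed.

Lemma bump3_ge0 (s : R) z : 0 <= bump3 s z.
Proof. by apply: mulr_ge0; last apply: mulr_ge0; exact: bump_ge0. Qed.

Lemma bump3_le1 (s : R) z : bump3 s z <= 1.
Proof.
apply: mulr_ile1; [exact: bump_ge0|by apply: mulr_ge0; exact: bump_ge0|exact: bump_le1|].
by apply: mulr_ile1; [exact: bump_ge0|exact: bump_ge0|exact: bump_le1|exact: bump_le1].
Qed.

Lemma integrable_bump3 (s : R) : 0 < s -> leb3.-integrable setT (EFin \o bump3 s).
Proof.
move=> s0; have [i _] := bump3_expi 0 s0.
rewrite (_ : bump3 s = (fun z => nc ((bump3 s z)%:C%C * expi (dot3 z 0)))).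
  exact: (cintegrable_nc i).
by apply/funext => z; rewrite ncM nc_expi mulr1 nc_real (ger0_norm (bump3_ge0 _ _)).
Qed.

Definition cker (s : R) (w : R3 R) : R := s ^- 3 * ker3 (s^-1 *: w).

Definition ckconv (s : R) (G : R3 R -> R[i]) (w : R3 R) : R[i] :=
  cintegral leb3 setT (fun v => G v * (cker s (w - v))%:C%C).

(** Fubini on [R^3 x R^3] for a product with an oscillating factor. *)
Lemma fubini_expi (a G : R3 R -> R[i]) : cintegrable leb3 setT a -> cintegrable leb3 setT G ->
  cintegral leb3 setT (fun z => a z * ift G z) =
  cintegral leb3 setT (fun w => G w * ift a w).
Proof.
move=> ia iG.
pose f (zw : T3 * T3) := a zw.1 * G zw.2 * expi (dot3 zw.1 zw.2).
have if_ : cintegrable (leb3 \x leb3)%E setT f.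
  apply: (cintegrable_dom _ (integrable_prod (cintegrable_nc ia) (cintegrable_nc iG))).
  - apply: cmeasurableM.
      exact: (cintegrable_meas (cintegrable_prod ia iG)).
    by apply: cmeasurable_expi; exact: measurable_dot3.
  - by move=> zw; rewrite /f !ncM nc_expi mulr1.
have := cintegral_fubini if_.
have -> : (fun z => cintegral leb3 setT (fun w => f (z, w))) = (fun z => a z * ift G z).
  apply/funext => z; rewrite /ift -(cintegralZ _ (ift_cintegrable z iG)).
  by congr (cintegral _ _ _); apply/funext => w; rewrite /f/= mulrA.
move=> ->; congr (cintegral _ _ _); apply/funext => w.
rewrite /ift -(cintegralZ _ (ift_cintegrable w ia)).
by congr (cintegral _ _ _); apply/funext => z; rewrite /f/= dot3C [a z * _]mulrC mulrA.
Qed.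

Lemma cker_bounded (s : R) : 0 < s -> exists2 C, 0 <= C & forall w, `|cker s w| <= C.
Proof.
move=> s0; have [C C0 H] := @ker3_bound R; exists (s ^- 3 * C).
  by rewrite mulr_ge0// invr_ge0 exprn_ge0// ltW.
move=> w; rewrite /cker normrM ger0_norm ?invr_ge0 ?exprn_ge0 ?(ltW s0)//.
rewrite ler_wpM2l ?invr_ge0 ?exprn_ge0 ?(ltW s0)// (le_trans (H _))// ler_piMr//.
exact: rho_le1.
Qed.

Lemma measurable_cker (s : R) (w : R3 R) :
  measurable_fun setT (fun v : T3 => cker s (w - v) : T1).
Proof.
apply: measurable_funM; first exact: measurable_cst.
have E : (fun v : T3 => ker3 (s^-1 *: (w - v))) = (fun v => ker3 (aff3 (- s^-1) (s^-1 *: w) v)).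
  apply/funext => v; congr ker3; rewrite /aff3 !scale3 /=.
  by congr (_, (_, _)); ring.
by rewrite E; exact: (measurableT_comp (@measurable_ker3 R) (measurable_aff3 _ _)).
Qed.

Lemma ckconv_cintegrable (s : R) (G : R3 R -> R[i]) (w : R3 R) : 0 < s ->
  cintegrable leb3 setT G -> cintegrable leb3 setT (fun v => G v * (cker s (w - v))%:C%C).
Proof.
move=> s0 iG; have [C C0 H] := cker_bounded s0.
apply: (cintegrable_dom _ (integrable_scale C (cintegrable_nc iG))).
- apply: cmeasurableM; first exact: (cintegrable_meas iG).
  by apply: cmeasurable_real; exact: measurable_cker.
- by move=> v; rewrite ncM nc_real mulrC ler_wpM2r ?nc_ge0.
Qed.

Lemma cmeasurable_ckconv (s : R) (G : R3 R -> R[i]) : @cmeasurable R _ borel3 G ->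
  @cmeasurable R _ borel3 (ckconv s G).
Proof.
move=> mG; apply: (@cmeasurable_cintegral _ _ _ T3 T3 leb3
  (fun z => G z.2 * (cker s (z.1 - z.2))%:C%C)).
apply: cmeasurableM; first exact: (cmeasurable_comp mG measurable_snd).
apply: cmeasurable_real; apply: measurable_funM; first exact: measurable_cst.
have E : (fun z : T3 * T3 => ker3 (s^-1 *: (z.1 - z.2))) =
    (fun z : T3 * T3 => ker3 (aff3 s^-1 0 (z.1 - z.2))).
  by apply/funext => v; congr ker3; rewrite /aff3 scale3 /= !addr0.
rewrite E; apply: (measurableT_comp (@measurable_ker3 R)).
exact: (measurableT_comp (measurable_aff3 _ _) (@measurable_sub3 R)).
Qed.

Lemma ckerN s w : cker s (- w) = cker s w.
Proof. by rewrite /cker scalerN ker3N. Qed.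

Lemma bump3_cintegrable (s : R) (h : R3 R -> R[i]) (M : R) : 0 < s ->
  @cmeasurable R _ borel3 h -> (forall z, nc (h z) <= M) ->
  cintegrable leb3 setT (fun z => (bump3 s z)%:C%C * h z).
Proof.
move=> s0 mh hM; apply: (cintegrable_dom _ (integrable_scale M (integrable_bump3 s0))).
- by apply: cmeasurableM => //; apply: cmeasurable_real; exact: measurable_bump3.
- by move=> z; rewrite ncM nc_real ger0_norm ?bump3_ge0// mulrC ler_wpM2r ?bump3_ge0.
Qed.

(** The dilated bump makes all integrals absolutely convergent, so the order of
    integration can be exchanged. *)
Lemma fourier_bump_ift (s : R) (G : R3 R -> R[i]) (w : R3 R) : 0 < s ->
  cintegrable leb3 setT G ->
  cintegral leb3 setT (fun z => (bump3 s z)%:C%C * expi (- dot3 z w) * ift G z) = ckconv s G w.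
Proof.
move=> s0 iG.
have ia : cintegrable leb3 setT (fun z => (bump3 s z)%:C%C * expi (- dot3 z w)).
  apply: (@bump3_cintegrable s _ 1) => //; last by move=> z; rewrite nc_expi.
  apply: cmeasurable_expi; apply: measurableT_comp => //.
  by under eq_fun do rewrite dot3C; exact: measurable_dot3l.
rewrite (fubini_expi ia iG) /ckconv; congr (cintegral _ _ _); apply/funext => v.
congr (_ * _); rewrite /ift -ckerN opprB.
have [_ <-] := bump3_expi (v - w) s0; congr (cintegral _ _ _); apply/funext => z.
by rewrite -mulrA -expiD; congr (_ * expi _); rewrite /dot3 /=; ring.
Qed.

(** Both sides are the triple integral of [bump3 * conj(Phi) * g] against the
    oscillating factor. *)
Lemma parseval_bump (s : R) (g Phi : R3 R -> R[i]) : 0 < s ->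
  cintegrable leb3 setT g -> cintegrable leb3 setT Phi ->
  cintegral leb3 setT (fun z => (bump3 s z)%:C%C * (ift Phi z)^*%C * ift g z) =
  cintegral leb3 setT (fun w => g w * (ckconv s Phi w)^*%C).
Proof.
move=> s0 ig iPhi.
have mP : @cmeasurable R _ borel3 (fun z => (ift Phi z)^*%C).
  by apply: cmeasurable_conj; apply: cmeasurable_ift; exact: (cintegrable_meas iPhi).
have ia : cintegrable leb3 setT (fun z => (bump3 s z)%:C%C * (ift Phi z)^*%C).
  apply: (bump3_cintegrable (M := 2 * \int[leb3]_w nc (Phi w)) s0) => // z.
  by rewrite nc_conj; exact: ift_bound.
rewrite (fubini_expi ia ig); congr (cintegral _ _ _); apply/funext => w.
congr (_ * _); rewrite -(fourier_bump_ift w s0 iPhi) -cintegral_conj.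
  rewrite /ift; congr (cintegral _ _ _); apply/funext => z.
  rewrite !conjM conj_real conj_expi opprK -!mulrA; congr (_ * _).
  by rewrite mulrC dot3C.
have := @bump3_cintegrable s (fun z => expi (- dot3 z w) * ift Phi z) (2 * \int[leb3]_w nc (Phi w)) s0.
under [X in _ -> _ -> cintegrable _ _ X]eq_fun do rewrite mulrA.
apply.
- apply: cmeasurableM; last by apply: cmeasurable_ift; exact: (cintegrable_meas iPhi).
  apply: cmeasurable_expi; apply: measurableT_comp => //.
  by under eq_fun do rewrite dot3C; exact: measurable_dot3l.
- by move=> z; rewrite ncM nc_expi mul1r; exact: ift_bound.
Qed.

Lemma ckconv_subst (s : R) (G : R3 R -> R[i]) (w : R3 R) : 0 < s ->
  cintegrable leb3 setT G ->
  ckconv s G w = cintegral leb3 setT (fun y => G (aff3 (- s) w y) * (ker3 y)%:C%C).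
Proof.
move=> s0 iG.
have ns : - s != 0 by rewrite oppr_eq0 gt_eqF.
have i1 := ckconv_cintegrable w s0 iG.
rewrite /ckconv (cintegral_aff3 w ns i1) -cintegralZ; last exact: (cintegrable_aff3 w ns i1).
congr (cintegral _ _ _); apply/funext => y.
rewrite normrN gtr0_norm// mulrCA; congr (_ * _); rewrite -rmorphM/=; congr (_%:C%C).
rewrite /cker mulrA divff ?mul1r ?expf_neq0 ?gt_eqF//; congr ker3.
rewrite /aff3 scale3 /=; case: y => y1 [y2 y3] /=.
by congr (_, (_, _)); field; rewrite gt_eqF.
Qed.

End InverseFourier.

(** * The upper bound in the Plancherel theorem *)

Section Plancherel.
Context {R : realType}.
Let mu := @lebesgue_measure R.
Let T1 := measurableTypeR R.
Let T3 := @borel3 R.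

Lemma limn_einf_le (u : (\bar R)^nat) (C : \bar R) : (forall n, u n <= C)%E -> (limn_einf u <= C)%E.
Proof.
move=> uC; rewrite limn_einf_lim; apply: lime_le; first exact: is_cvg_einfs.
apply: nearW => n; apply: le_trans (uC n).
by apply: ereal_inf_lbound; exists n => /=.
Qed.

Lemma cintegral_lee d (T : measurableType d) (m : {measure set T -> \bar R}) (f : T -> R[i]) :
  cmeasurable f ->
  ((nc (cintegral m setT f))%:E <= 2%:E * \int[m]_x (nc (f x))%:E)%E.
Proof.
move=> mf; have mn := cmeasurable_nc mf.
have [lt|] := ltP (\int[m]_x (nc (f x))%:E)%E +oo%E; last first.
  rewrite leye_eq => /eqP ->; rewrite gt0_muley ?leey// lte_fin//.
have ig : m.-integrable setT (EFin \o (fun x => nc (f x))).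
  apply/integrableP; split; first exact/measurable_EFinP.
  by under eq_integral do rewrite /= ger0_norm ?nc_ge0//.
rewrite -[X in (_ * X)%E](fineK (integrable_fin_num measurableT ig)) -EFinM lee_fin.
exact: (cintegral_le mf ig (fun x => lexx _)).
Qed.

Definition nsq (G : R3 R -> R[i]) : \bar R := (\int[leb3]_w (nc (G w) ^+ 2)%:E)%E.

(** The [L^1] norm of the kernel, which bounds the convolutions on [L^2]. *)
Definition kmass : R := \int[leb3]_y `|@ker3 R y|.

Lemma kmass_ge0 : 0 <= kmass.
Proof. by apply: Rintegral_ge0 => y _. Qed.

Lemma kmassE : (\int[leb3]_y (`|@ker3 R y|)%:E = kmass%:E)%E.
Proof.
rewrite /kmass /Rintegral fineK//.
exact: (integrable_fin_num measurableT (integrable_norm (@integrable_ker3 R))).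
Qed.

Lemma measurable_nsq (G : R3 R -> R[i]) : @cmeasurable R _ borel3 G ->
  measurable_fun setT (fun w : T3 => (nc (G w) ^+ 2)%:E : \bar R).
Proof. by move=> mG; apply/measurable_EFinP/measurable_funX; exact: cmeasurable_nc. Qed.

(** Schur's test: by [2 |a b| <= |a|^2 + |b|^2] only the [L^1] norm of the kernel enters. *)
Lemma schur_ckconv (s : R) (G : R3 R -> R[i]) : 0 < s -> cintegrable leb3 setT G ->
  ((nc (cintegral leb3 setT (fun w => G w * (ckconv s G w)^*%C)))%:E <=
    (4 * kmass)%:E * nsq G)%E.
Proof.
move=> s0 iG; have mG := cintegrable_meas iG.
have mGc : @cmeasurable R _ borel3 (fun w => G w * (ckconv s G w)^*%C).
  apply: cmeasurableM; first exact: mG.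
  by apply: cmeasurable_conj; exact: cmeasurable_ckconv.
apply: (le_trans (cintegral_lee leb3 mGc)).
have mj : measurable_fun setT (fun z : T3 * T3 => nc (G (aff3 (- s) z.1 z.2)) : T1).
  apply: (measurableT_comp (cmeasurable_nc mG)).
  apply: measurable_triple; (apply: measurable_realfun.measurable_funD;
    [apply: measurable_funM; [exact: measurable_cst|]|]).
  - exact: (measurableT_comp measurable_c1 measurable_snd).
  - exact: (measurableT_comp measurable_c1 measurable_fst).
  - exact: (measurableT_comp measurable_c2 measurable_snd).
  - exact: (measurableT_comp measurable_c2 measurable_fst).
  - exact: (measurableT_comp measurable_c3 measurable_snd).
  - exact: (measurableT_comp measurable_c3 measurable_fst).
have mk2 : measurable_fun setT (fun z : T3 * T3 => `|ker3 z.2| : T1).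
  apply: measurableT_comp => //; exact: (measurableT_comp (@measurable_ker3 R) measurable_snd).
have mj1 : measurable_fun setT (fun z : T3 * T3 => nc (G z.1) : T1).
  exact: (measurableT_comp (cmeasurable_nc mG) measurable_fst).
pose h (z : T3 * T3) : R := (nc (G z.1) ^+ 2 + nc (G (aff3 (- s) z.1 z.2)) ^+ 2) * `|ker3 z.2|.
have mh : measurable_fun setT h.
  apply: measurable_funM => //.
  by apply: measurable_realfun.measurable_funD; exact: measurable_funX.
have h0 z : 0 <= h z by rewrite /h mulr_ge0// addr_ge0// sqr_ge0.
have s1 w : ((nc (G w * (ckconv s G w)^*%C))%:E <= \int[leb3]_y (h (w, y))%:E)%E.
  rewrite ncM nc_conj ckconv_subst// EFinM.
  have mb : @cmeasurable R _ borel3 (fun y => G (aff3 (- s) w y) * (ker3 y)%:C%C).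
    apply: cmeasurableM; first exact: (cmeasurable_comp mG (measurable_aff3 _ _)).
    by apply: cmeasurable_real; exact: measurable_ker3.
  apply: (@le_trans _ _ ((nc (G w))%:E * (2%:E * \int[leb3]_y (nc (G (aff3 (- s) w y) * (ker3 y)%:C%C))%:E))%E).
    by rewrite lee_wpmul2l ?lee_fin ?nc_ge0//; exact: cintegral_lee.
  rewrite muleA -EFinM -ge0_integralZl//; last first.
  - by rewrite lee_fin mulr_ge0// nc_ge0.
  - by move=> y _; rewrite lee_fin nc_ge0.
  - by apply/measurable_EFinP; exact: cmeasurable_nc.
  apply: ge0_le_integral => //.
  - by move=> y _; rewrite -EFinM lee_fin mulr_ge0 ?nc_ge0// mulr_ge0// nc_ge0.
  - by apply: measurable_funeM; apply/measurable_EFinP; exact: cmeasurable_nc.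
  - have m2 : measurable_fun setT (fun y : T3 => (w, y) : T3 * T3) by apply: measurable_fun_pair.
    by apply/measurable_EFinP; exact: (measurableT_comp mh m2).
  - move=> y _; rewrite -EFinM lee_fin ncM nc_real /h/= mulrA ler_wpM2r//.
    have := sqr_ge0 (nc (G w) - nc (G (aff3 (- s) w y))); rewrite sqrrB; lra.
have Eh w : (\int[leb3]_y (h (w, y))%:E = (nc (G w) ^+ 2)%:E * kmass%:E +
   \int[leb3]_y (nc (G (aff3 (- s) w y)) ^+ 2 * `|ker3 y|)%:E)%E.
  have m2 : measurable_fun setT (fun y : T3 => (w, y) : T3 * T3) by apply: measurable_fun_pair.
  have mk : measurable_fun setT (fun y : T3 => `|ker3 y| : T1).
    exact: (measurableT_comp mk2 m2).
  rewrite -kmassE -ge0_integralZl ?lee_fin ?sqr_ge0//; last exact/measurable_EFinP.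
  rewrite -ge0_integralD//.
  - by apply: eq_integral => y _; rewrite /h/= mulrDl EFinD EFinM.
  - by move=> y _; rewrite -EFinM lee_fin mulr_ge0// sqr_ge0.
  - by apply: measurable_funeM; exact/measurable_EFinP.
  - by move=> y _; rewrite lee_fin mulr_ge0// sqr_ge0.
  - apply/measurable_EFinP; apply: measurable_funM => //; apply: measurable_funX.
    exact: (measurableT_comp mj m2).
have mgg : measurable_fun setT (fun z : T3 * T3 => (nc (G (aff3 (- s) z.1 z.2)) ^+ 2 * `|ker3 z.2|)%:E).
  by apply/measurable_EFinP; apply: measurable_funM => //; exact: measurable_funX.
have gg0 (z : T3 * T3) : (0 <= (nc (G (aff3 (- s) z.1 z.2)) ^+ 2 * `|ker3 z.2|)%:E)%E.
  by rewrite lee_fin mulr_ge0// sqr_ge0.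
have E2 : (\int[leb3]_w \int[leb3]_y (nc (G (aff3 (- s) w y)) ^+ 2 * `|ker3 y|)%:E =
    nsq G * kmass%:E)%E.
  rewrite (@fubini_tonelli _ _ _ _ _ leb3 leb3 (fun z : T3 * T3 => (nc (G (aff3 (- s) z.1 z.2)) ^+ 2 * `|ker3 z.2|)%:E))//=.
  rewrite -kmassE -ge0_integralZl//; last first.
  - by apply: integral_ge0 => w _; rewrite lee_fin sqr_ge0.
  - by apply/measurable_EFinP; apply: measurableT_comp => //; exact: measurable_ker3.
  apply: eq_integral => y _.
  rewrite muleC /nsq.
  have n1 : (1 : R) != 0 by exact: oner_neq0.
  rewrite (ge0_integral_aff3 (- s *: y) n1 (measurable_nsq mG)); last first.
    by move=> w; rewrite lee_fin sqr_ge0.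
  rewrite normr1 expr1n mul1e -ge0_integralZl//; last first.
  - by move=> w _; rewrite lee_fin sqr_ge0.
  - exact: (measurableT_comp (measurable_nsq mG) (measurable_aff3 _ _)).
  apply: eq_integral => w _; rewrite -EFinM mulrC; congr (_ * nc (G _) ^+ 2)%:E.
  by rewrite /aff3 scale3 /= !mul1r; congr (_, (_, _)); rewrite addrC.
rewrite (_ : (4 * kmass)%:E = 2%:E * (2%:E * kmass%:E))%E; last first.
  by rewrite -!EFinM; congr EFin; ring.
rewrite -muleA; apply: lee_wpmul2l => //.
apply: (@le_trans _ _ (\int[leb3]_w \int[leb3]_y (h (w, y))%:E)%E).
  apply: ge0_le_integral => //.
  - by move=> w _; rewrite lee_fin nc_ge0.
  - by apply/measurable_EFinP; exact: cmeasurable_nc.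
  - by apply: (@measurable_fun_fubini_tonelli_F _ _ _ _ _ leb3 (EFin \o h)) => //; exact/measurable_EFinP.
under eq_integral do rewrite Eh.
rewrite ge0_integralD//; first last.
- exact: (@measurable_fun_fubini_tonelli_F _ _ _ _ _ leb3 (fun z : T3 * T3 => (nc (G (aff3 (- s) z.1 z.2)) ^+ 2 * `|ker3 z.2|)%:E)).
- by move=> w _; apply: integral_ge0 => y _; exact: (gg0 (w, y)).
- by apply: emeasurable_funM => //; exact: measurable_nsq.
- by move=> w _; rewrite -EFinM lee_fin mulr_ge0 ?sqr_ge0// kmass_ge0.
rewrite E2 ge0_integralZr//; last first.
- by rewrite lee_fin kmass_ge0.
- by move=> w _; rewrite lee_fin sqr_ge0.
- exact: measurable_nsq.
rewrite -/(nsq G) -ge0_muleDr ?lee_fin ?kmass_ge0// muleC -EFinD -EFinM.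
by rewrite (_ : kmass + kmass = 2 * kmass)//; ring.
Qed.

End Plancherel.

Section Plancherel2.
Context {R : realType}.
Let mu := @lebesgue_measure R.
Let T1 := measurableTypeR R.
Let T3 := @borel3 R.

Definition scl (n : nat) : R := n.+1%:R^-1.

Lemma scl_gt0 n : 0 < scl n. Proof. by rewrite invr_gt0 ltr0n. Qed.

Lemma scl_le1 n : scl n <= 1. Proof. by rewrite invf_le1 ?ler1n ?ltr0n. Qed.

Lemma scl_cvg : scl n @[n --> \oo] --> (0 : R). Proof. exact: cvg_harmonic. Qed.

Lemma bump3_cvg z : bump3 (scl n) z @[n --> \oo] --> bump3 1 (0 : R3 R).
Proof.
have h (x : R) : bump (scl n * x) @[n --> \oo] --> bump (1 * 0 : R).
  have h0 : scl n * x @[n --> \oo] --> (0 : R).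
    by rewrite -(mul0r x); apply: cvgM; [exact: scl_cvg|exact: cvg_cst].
  by rewrite mulr0; apply: (cvg_comp _ _ h0); exact: bump_cont.
by apply: cvgM; [exact: h|apply: cvgM; exact: h].
Qed.

Lemma bump_pos (x : R) : `|x| < 1 -> 0 < bump x.
Proof. by rewrite ltr_norml => /andP[? ?]; rewrite mulr_gt0// flat_pos//; lra. Qed.

Lemma bump30_gt0 : 0 < bump3 1 (0 : R3 R).
Proof.
rewrite /bump3 /= mul1r.
have h : 0 < bump (0 : R) by apply: bump_pos; rewrite normr0.
by apply: mulr_gt0 => //; exact: mulr_gt0.
Qed.

Lemma parseval_square (s : R) (G : R3 R -> R[i]) : 0 < s -> cintegrable leb3 setT G ->
  (\int[leb3]_z (bump3 s z * nc (ift G z) ^+ 2)%:E =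
   (nc (cintegral leb3 setT (fun w => G w * (ckconv s G w)^*%C)))%:E)%E.
Proof.
move=> s0 iG; rewrite -(parseval_bump s0 iG iG).
pose f z := bump3 s z * nc (ift G z) ^+ 2.
have E z : (bump3 s z)%:C%C * (ift G z)^*%C * ift G z = (f z)%:C%C.
  rewrite -mulrA /f; apply: complex_eqP; rewrite sqr_nc;
  by case: (ift G z) => a b /=; ring.
have f0 z : 0 <= f z by rewrite mulr_ge0 ?bump3_ge0 ?sqr_ge0.
have iF : leb3.-integrable setT (EFin \o f).
  pose M := 2 * \int[leb3]_w nc (G w).
  apply: (le_integrable _ _ _ (integrable_scale (M ^+ 2) (integrable_bump3 s0))) => //.
    apply/measurable_EFinP; apply: measurable_funM; first exact: measurable_bump3.
    by apply: measurable_funX; apply: cmeasurable_nc; apply: cmeasurable_ift; exact: (cintegrable_meas iG).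
  have Mb z : 0 <= M ^+ 2 * bump3 s z by apply: mulr_ge0; [exact: sqr_ge0|exact: bump3_ge0].
  move=> z _ /=; rewrite lee_fin (ger0_norm (f0 z)) (ger0_norm (Mb z)).
  rewrite /f [leLHS]mulrC; apply: ler_wpM2r; first exact: bump3_ge0.
  have h := ift_bound z iG.
  have M0 : 0 <= M := le_trans (nc_ge0 (ift G z)) h.
  by rewrite lerXn2r ?nnegrE ?nc_ge0.
rewrite [X in nc X](_ : _ = (\int[leb3]_z f z)%:C%C); last first.
  rewrite (_ : (fun z => _) = (fun z => (f z)%:C%C)); last by apply/funext => z; exact: E.
  by apply: complex_eqP => //=; rewrite /Rintegral integral0.
rewrite nc_real ger0_norm; last by apply: Rintegral_ge0 => z _; exact: f0.
by rewrite /Rintegral fineK//; exact: (integrable_fin_num measurableT iF).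
Qed.

Definition cplan : R := 4 * kmass / bump3 1 (0 : R3 R).

Lemma cplan_ge0 : 0 <= cplan.
Proof.
apply: divr_ge0; last exact: bump3_ge0.
by apply: mulr_ge0 => //; exact: kmass_ge0.
Qed.

(** The regularised identity [parseval_square] and Schur's test bound the
    integral against [bump3 (scl n)] uniformly; Fatou's lemma removes the
    regularisation. *)
Lemma plancherel_le (G : R3 R -> R[i]) : cintegrable leb3 setT G ->
  (nsq (ift G) <= cplan%:E * nsq G)%E.
Proof.
move=> iG; have miG := cmeasurable_ift (cintegrable_meas iG).
pose f n (z : T3) : \bar R := (bump3 (scl n) z * nc (ift G z) ^+ 2)%:E.
have mf n : measurable_fun setT (f n).
  apply/measurable_EFinP; apply: measurable_funM; first exact: measurable_bump3.
  by apply: measurable_funX; exact: cmeasurable_nc.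
have f0 n (z : T3) : setT z -> (0 <= f n z)%E.
  by move=> _; rewrite lee_fin; apply: mulr_ge0; [exact: bump3_ge0|exact: sqr_ge0].
have := fatou leb3 measurableT mf f0.
have h1 : (limn_einf (fun n => \int[leb3]_z f n z) <= (4 * kmass)%:E * nsq G)%E.
  apply: limn_einf_le => n; rewrite /f parseval_square ?scl_gt0//.
  exact: schur_ckconv (scl_gt0 n) iG.
move=> /le_trans /(_ h1).
have -> : (\int[leb3]_x limn_einf (f^~ x) = (bump3 1 (0 : R3 R))%:E * nsq (ift G))%E.
  rewrite -ge0_integralZl//.
  - apply: eq_integral => z _.
    have c : f n z @[n --> \oo] --> ((bump3 1 (0 : R3 R))%:E * (nc (ift G z) ^+ 2)%:E)%E.
      rewrite -EFinM; apply/fine_cvgP; split; first exact: nearW.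
      by apply: cvgM; [exact: bump3_cvg|exact: cvg_cst].
    rewrite is_cvg_limn_einfE; first exact: cvg_lim.
    by apply/cvg_ex; eexists; exact: c.
  - by apply/measurable_EFinP; apply: measurable_funX; exact: cmeasurable_nc.
  - by move=> z _; rewrite lee_fin sqr_ge0.
  - by rewrite lee_fin bump3_ge0.
have b0 := bump30_gt0.
rewrite -lee_pdivlMl// muleA -EFinM => h; apply: (le_trans h).
by rewrite /cplan mulrC.
Qed.

(** The mean of the kernel. Convolutions with the dilated kernels converge to
    multiplication by it. *)
Definition ckint : R := \int[leb3]_y @ker3 R y.

Lemma ckconv_cvg (G_ : nat -> R3 R -> R[i]) (w : R3 R) (L : R[i]) (M : R) :
  (forall n, cintegrable leb3 setT (G_ n)) -> (forall n v, nc (G_ n v) <= M) ->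
  (forall y : R3 R, ccvg (fun n => G_ n (aff3 (- scl n) w y)) L) ->
  ccvg (fun n => ckconv (scl n) (G_ n) w) (L * ckint%:C%C).
Proof.
move=> iG GM Gc.
have -> : (fun n => ckconv (scl n) (G_ n) w) = (fun n => cintegral leb3 setT
    (fun y => G_ n (aff3 (- scl n) w y) * (ker3 y)%:C%C)).
  by apply/funext => n; rewrite (ckconv_subst _ (scl_gt0 n) (iG n)).
have -> : L * ckint%:C%C = cintegral leb3 setT (fun y => L * (ker3 y)%:C%C).
  have ik : cintegrable leb3 setT (fun y => (@ker3 R y)%:C%C).
    by split => /=; [exact: integrable_ker3|exact: integrable0].
  rewrite cintegralZ//; congr (_ * _); apply: complex_eqP => //=.
  by rewrite /Rintegral integral0.
apply: (@cintegral_cvg _ _ _ leb3 _ _ (fun y => M * `|ker3 y|)).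
- move=> n; apply: cmeasurableM.
    exact: (cmeasurable_comp (cintegrable_meas (iG n)) (measurable_aff3 _ _)).
  by apply: cmeasurable_real; exact: measurable_ker3.
- by move=> y; apply: ccvgM; [exact: Gc|exact: ccvg_cst].
- exact: (integrable_scale M (integrable_norm (@integrable_ker3 R))).
- by move=> n y; rewrite ncM nc_real ler_wpM2r.
Qed.

Lemma aff3_scl_cvg (w y : R3 R) : cvg3 (fun n => aff3 (- scl n) w y) w.
Proof.
have h (a b : R) : - scl n * a + b @[n --> \oo] --> b.
  have h0 : - scl n * a @[n --> \oo] --> - 0 * a.
    by apply: cvgM; [apply: cvgN; exact: scl_cvg|exact: cvg_cst].
  have := cvgD h0 (cvg_cst b); rewrite oppr0 mul0r add0r; exact.
by split => /=; exact: h.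
Qed.

Lemma ckconv_nc (s : R) (G : R3 R -> R[i]) (w : R3 R) (M : R) : 0 < s ->
  cintegrable leb3 setT G -> (forall v, nc (G v) <= M) ->
  nc (ckconv s G w) <= 2 * (M * kmass).
Proof.
move=> s0 iG GM; rewrite ckconv_subst// /kmass.
rewrite -(RintegralZl M measurableT (integrable_norm (@integrable_ker3 R))).
apply: cintegral_le.
- apply: cmeasurableM.
    exact: (cmeasurable_comp (cintegrable_meas iG) (measurable_aff3 _ _)).
  by apply: cmeasurable_real; exact: measurable_ker3.
- exact: (integrable_scale M (integrable_norm (@integrable_ker3 R))).
- by move=> y; rewrite ncM nc_real ler_wpM2r.
Qed.

Lemma inner_ckconv_cvg (g Phi : R3 R -> R[i]) (M : R) :
  cintegrable leb3 setT g -> cintegrable leb3 setT Phi -> (forall v, nc (Phi v) <= M) ->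
  wcont Phi ->
  ccvg (fun n => cintegral leb3 setT (fun w => g w * (ckconv (scl n) Phi w)^*%C))
    (cintegral leb3 setT (fun w => g w * (Phi w)^*%C) * ckint%:C%C).
Proof.
move=> ig iP PM cP.
have M0 : 0 <= M by rewrite (le_trans (nc_ge0 _) (PM 0)).
have mP : @cmeasurable R _ borel3 (fun w => (Phi w)^*%C).
  by apply: cmeasurable_conj; exact: (cintegrable_meas iP).
rewrite mulrC -cintegralZ; last first.
  apply: (cintegrable_dom _ (integrable_scale M (cintegrable_nc ig))).
  - by apply: cmeasurableM => //; exact: (cintegrable_meas ig).
  - by move=> w; rewrite ncM nc_conj mulrC ler_wpM2r ?nc_ge0.
apply: (@cintegral_cvg _ _ _ leb3 _ _ (fun w => 2 * (M * kmass) * nc (g w))).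
- move=> n; apply: cmeasurableM; first exact: (cintegrable_meas ig).
  by apply: cmeasurable_conj; apply: cmeasurable_ckconv; exact: (cintegrable_meas iP).
- move=> w; rewrite mulrCA; apply: ccvgM; first exact: ccvg_cst.
  have := @ckconv_cvg (fun=> Phi) w (Phi w) M (fun=> iP) (fun=> PM)
    (fun y => cP w _ (aff3_scl_cvg w y)).
  move=> h; rewrite /ccvg.
  have -> : (fun n => nc ((ckconv (scl n) Phi w)^*%C - ckint%:C%C * (Phi w)^*%C)) =
     (fun n => nc (ckconv (scl n) Phi w - Phi w * ckint%:C%C)).
    apply/funext => n; rewrite -[in RHS]nc_conj conjB conjM conj_real.
    by rewrite [ckint%:C%C * _]mulrC.
  exact: h.
- exact: (integrable_scale _ (cintegrable_nc ig)).
- move=> n w; rewrite ncM nc_conj mulrC ler_wpM2r ?nc_ge0//.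
  exact: (ckconv_nc w (scl_gt0 n) iP PM).
Qed.

End Plancherel2.

(** * The mean of the kernel *)

Section Duality.
Context {R : realType}.
Let mu := @lebesgue_measure R.
Let T1 := measurableTypeR R.
Let T3 := @borel3 R.

Lemma Rintegral_ge_itv (f : R -> R) (c d : R) : 0 <= d ->
  mu.-integrable setT (EFin \o f) -> (forall x, 0 <= f x) ->
  (forall x, 0 <= x <= d -> c <= f x) -> c * d <= \int[mu]_x f x.
Proof.
move=> d0 if_ f0 fc.
have h : \int[mu]_x (c * \1_(`[0, d]) x) <= \int[mu]_x f x.
  apply: le_Rintegral => //; first exact: integrable_indic_itv.
  move=> x _; rewrite indicE; have [/set_mem /= h|h] := boolP (x \in `[0, d]%classic).
    by rewrite mulr1 fc//; move: h; rewrite in_itv.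
  by rewrite mulr0.
rewrite (le_trans _ h)// RintegralZl//.
  by rewrite Rintegral_indic_itv// subr0.
have := integrable_indic_itv 1 0 d.
by under eq_fun do rewrite mul1r.
Qed.

Lemma bump_int_gt0 : 0 < \int[mu]_x @bump R x.
Proof.
have b0 : 0 < bump (0 : R) by apply: bump_pos; rewrite normr0.
have := @bump_cont R 0 => /cvgrPdist_lt /(_ (bump 0 / 2)).
rewrite divr_gt0// => /(_ isT)[d /= d0 H].
have ib : mu.-integrable setT (EFin \o @bump R).
  have := @bump_cos_integrable R 0.
  by under eq_fun do rewrite mulr0 cos0 mulr1.
suff h : bump 0 / 2 * (d / 2) <= \int[mu]_x @bump R x.
  by apply: lt_le_trans h; rewrite mulr_gt0// divr_gt0.
apply: Rintegral_ge_itv => //; [lra|exact: bump_ge0|].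
move=> x /andP[x0 xd].
have xd' : x < d by lra.
have := H x; rewrite /= sub0r normrN ger0_norm// => /(_ xd').
by rewrite ltr_norml => /andP[_]; lra.
Qed.

Lemma ker1_lower (y : R) : `|y| <= 2^-1 -> (\int[mu]_x @bump R x) / 2 <= ker1 y.
Proof.
move=> y2.
have ib : mu.-integrable setT (EFin \o @bump R).
  have := @bump_cos_integrable R 0.
  by under eq_fun do rewrite mulr0 cos0 mulr1.
rewrite mulrC -RintegralZl//; apply: le_Rintegral => //.
- exact: integrable_scale.
- exact: bump_cos_integrable.
move=> x _; have [x1|x1] := leP 1 `|x|; first by rewrite bump_out// mulr0 mul0r.
rewrite mulrC ler_wpM2l ?bump_ge0//.
have := cos_lip 0 (x * y); rewrite cos0 sub0r normrN normrM ler_norml => /andP[_].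
have : `|x| * `|y| <= 1 * 2^-1 by rewrite ler_pM// ltW.
lra.
Qed.

Lemma cvg_cube0 (a : nat -> R) (l : R) : a n @[n --> \oo] --> l ->
  (fun n => a n ^+ 3) n @[n --> \oo] --> (0 : R) -> l = 0.
Proof.
move=> al a3.
have h : a n * (a n * a n) @[n --> \oo] --> l * (l * l) by apply: cvgM => //; exact: cvgM.
have : (fun n => a n ^+ 3) n @[n --> \oo] --> l * (l * l).
  by rewrite (_ : (fun n => a n ^+ 3) = (fun n => a n * (a n * a n))).
move=> h'; have E : l * (l * l) = 0 by apply: (cvg_unique _ h' a3).
by apply/eqP; move/eqP: E; rewrite !mulf_eq0 !orbb.
Qed.

(** If the mean were zero, the regularised Parseval identity for [bump3 1] would
    give a zero square integral for its transform, which is the kernel; but the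
    kernel is bounded below near the origin. *)
Lemma ckint_neq0 : @ckint R != 0.
Proof.
apply/eqP => c0.
pose G : R3 R -> R[i] := fun z => (bump3 1 z)%:C%C.
have iG : cintegrable leb3 setT G.
  by split => /=; [exact: integrable_bump3|exact: integrable0].
have GM v : nc (G v) <= 1 by rewrite nc_real ger0_norm ?bump3_ge0// bump3_le1.
have wG : wcont G.
  move=> w z [z1 z2 z3]; apply: ccvg_real; rewrite /bump3.
  have h (x : nat -> R) (l : R) : x n @[n --> \oo] --> l -> bump (1 * x n) @[n --> \oo] --> bump (1 * l).
    move=> xl; have h1 : 1 * x n @[n --> \oo] --> 1 * l by apply: cvgM => //; exact: cvg_cst.
    by apply: (cvg_comp _ _ h1); exact: bump_cont.
  by apply: cvgM; [exact: h|apply: cvgM; exact: h].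
have := inner_ckconv_cvg iG iG GM wG; rewrite c0 mulr0 => /ccvg_nc; rewrite nc0.
pose k n (x : R) := bump (scl n * x) * ker1 x ^+ 2.
have [C C0 HC] := @ker1_bound R.
have kb n x : `|k n x| <= C ^+ 2 * cauchy x.
  have c1 := cauchy_le1 x; have c2 := cauchy_ge0 x; have k1 := HC x.
  rewrite /k normrM normrX ger0_norm ?bump_ge0//.
  have h : `|ker1 x| ^+ 2 <= (C * cauchy x) ^+ 2 by rewrite lerXn2r ?nnegrE//; apply: mulr_ge0.
  have := bump_le1 (scl n * x) => b1.
  apply: (le_trans (ler_piMl (sqr_ge0 _) b1)); apply: (le_trans h).
  rewrite exprMn; apply: ler_wpM2l; first exact: sqr_ge0.
  by rewrite expr2; exact: ler_piMl.
have mk n : measurable_fun setT (k n : T1 -> T1).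
  apply: measurable_funM.
    by apply: (measurableT_comp measurable_bump); exact: measurable_funM.
  by apply: measurable_funX; exact: measurable_ker1.
have ic := integrable_scale (C ^+ 2) (@integrable_cauchy R).
have ik n : mu.-integrable setT (EFin \o k n).
  apply: (le_integrable _ _ _ ic) => //; first (apply/measurable_EFinP; exact: mk).
  by move=> x _; rewrite /= lee_fin (le_trans (kb n x)) ?ler_norm.
have kc x : k n x @[n --> \oo] --> bump 0 * ker1 x ^+ 2.
  apply: cvgM; last exact: cvg_cst.
  have h0 : scl n * x @[n --> \oo] --> (0 : R).
    by rewrite -(mul0r x); apply: cvgM; [exact: scl_cvg|exact: cvg_cst].
  by apply: (cvg_comp _ _ h0); exact: bump_cont.
have E n : nc (cintegral leb3 setT (fun w => G w * (ckconv (scl n) G w)^*%C)) =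
   (\int[mu]_x k n x) ^+ 3.
  apply: EFin_inj; rewrite -(parseval_square (scl_gt0 n) iG).
  have -> : (\int[mu]_x k n x) ^+ 3 =
     \int[leb3]_w (k n w.1 * (k n w.2.1 * k n w.2.2)) by rewrite Rintegral3// -!expr2 -exprS.
  rewrite /Rintegral fineK; last exact: (integrable_fin_num measurableT (integrable3 (ik n) (ik n) (ik n))).
  apply: eq_integral => z _; congr EFin.
  have -> : ift G z = (ker3 z)%:C%C.
    rewrite -(bump3_expi1 z).2; congr (cintegral _ _ _).
    by apply/funext => w; rewrite /G dot3C.
  rewrite nc_real.
  by rewrite /k /bump3 /ker3 real_normK ?num_real//; ring.
have h3 := Rintegral_cvg mk kc ic kb.
under eq_fun do rewrite E.
move=> /(cvg_cube0 h3) I0.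
have b0 : 0 < bump (0 : R) by apply: bump_pos; rewrite normr0.
have ii : mu.-integrable setT (EFin \o (fun x => bump 0 * ker1 x ^+ 2)).
  apply: (le_integrable _ _ _ ic) => //.
    by apply/measurable_EFinP; apply: measurable_funM => //; apply: measurable_funX; exact: measurable_ker1.
  move=> x _; rewrite /= lee_fin (le_trans _ (ler_norm _))//.
  have h : (fun n => `|k n x|) n @[n --> \oo] --> `|bump 0 * ker1 x ^+ 2|.
    by apply: (cvg_norm (kc x)).
  by apply: (cvgr_to_le h); apply: nearW => n; exact: kb.
have B := bump_int_gt0.
suff : 0 < \int[mu]_x (bump 0 * ker1 x ^+ 2) by rewrite I0 ltxx.
suff h : bump 0 * ((\int[mu]_x @bump R x) / 2) ^+ 2 * 2^-1 <= \int[mu]_x (bump 0 * ker1 x ^+ 2).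
  by apply: lt_le_trans h; rewrite mulr_gt0// mulr_gt0// exprn_gt0// divr_gt0.
apply: Rintegral_ge_itv => //.
- by move=> x; apply: mulr_ge0; [exact: bump_ge0|exact: sqr_ge0].
move=> x /andP[x0 x2]; apply: ler_wpM2l; first exact: bump_ge0.
have xl : `|x| <= 2^-1 by rewrite ger0_norm.
have h := ker1_lower xl; have B2 : 0 <= (\int[mu]_x @bump R x) / 2 by rewrite divr_ge0// ltW.
by rewrite lerXn2r ?nnegrE// (le_trans B2 h).
Qed.
End Duality.

(** * Duality *)

Section Duality2.
Context {R : realType}.
Let mu := @lebesgue_measure R.
Let T1 := measurableTypeR R.
Let T3 := @borel3 R.

Definition nrm2 (G : R3 R -> R[i]) : \bar R := 'N[leb3]_(2%:E)[(fun z => (nc (G z))%:E)]%E.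

Lemma nsq_ge0 (G : R3 R -> R[i]) : (0 <= nsq G)%E.
Proof. by apply: integral_ge0 => w _; rewrite lee_fin sqr_ge0. Qed.

Lemma nrm2E (G : R3 R -> R[i]) : nrm2 G = (nsq G `^ 2^-1)%E.
Proof.
have E : (nrm2 G `^ 2)%E = nsq G.
  rewrite /nrm2 poweR_Lnorm//; apply: eq_integral => z _.
  by rewrite /= ger0_norm ?nc_ge0// powR_mulrn// nc_ge0.
by rewrite -E -poweRrM divff// poweRe1// Lnorm_ge0.
Qed.

Lemma nrm2_le (G : R3 R -> R[i]) (K : R) : 0 <= K -> (nsq G <= (K ^+ 2)%:E)%E -> (nrm2 G <= K%:E)%E.
Proof.
move=> K0 h; rewrite nrm2E.
have -> : K%:E = ((K ^+ 2)%:E `^ 2^-1)%E.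
  by rewrite poweR_EFin powR12_sqrt ?sqr_ge0// sqrtr_sqr ger0_norm.
apply: gt0_ler_poweR => //; first by rewrite in_itv/= leey nsq_ge0.
by rewrite in_itv/= leey lee_fin sqr_ge0.
Qed.

Lemma cauchy_schwarz_ift (g Phi : R3 R -> R[i]) : cintegrable leb3 setT g ->
  cintegrable leb3 setT Phi ->
  (\int[leb3]_z (nc (ift Phi z) * nc (ift g z))%:E <= nrm2 (ift Phi) * nrm2 (ift g))%E.
Proof.
move=> ig iP.
have m1 := cmeasurable_nc (cmeasurable_ift (cintegrable_meas iP)).
have m2 := cmeasurable_nc (cmeasurable_ift (cintegrable_meas ig)).
have e : 2^-1 + 2^-1 = 1 :> R by rewrite -div1r -splitr.
have := @hoelder _ T3 R leb3 _ _ 2 2 m1 m2 (ltr0Sn _ _) (ltr0Sn _ _) e.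
rewrite Lnorm1; apply: le_trans.
apply: ge0_le_integral => //.
- by move=> z _; rewrite lee_fin; apply: mulr_ge0; exact: nc_ge0.
- by apply/measurable_EFinP; exact: measurable_funM.
- by apply: measurableT_comp => //; apply/measurable_EFinP; exact: measurable_funM.
by move=> z _; rewrite lee_fin ler_norm.
Qed.

(** The pairing with [Phi] is, up to the factor [ckint], the limit of the
    regularised pairings, which are bounded by Cauchy-Schwarz in space and by
    [plancherel_le] applied to [Phi]. *)
Lemma duality (g Phi : R3 R -> R[i]) (M K : R) : cintegrable leb3 setT g ->
  cintegrable leb3 setT Phi -> (forall v, nc (Phi v) <= M) -> wcont Phi ->
  0 <= K -> (nsq Phi <= (K ^+ 2)%:E)%E ->
  ((`|@ckint R| * nc (cintegral leb3 setT (fun w => g w * (Phi w)^*%C)))%:E <=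
    (2 * (Num.sqrt cplan * K))%:E * nrm2 (ift g))%E.
Proof.
move=> ig iP PM wP K0 hK.
have cpl := @cplan_ge0 R.
have S0 : 0 <= Num.sqrt cplan * K by rewrite mulr_ge0 ?sqrtr_ge0.
have hP : (nrm2 (ift Phi) <= (Num.sqrt cplan * K)%:E)%E.
  apply: nrm2_le => //; apply: (le_trans (plancherel_le iP)).
  by rewrite exprMn sqr_sqrtr// [leRHS]EFinM; apply: lee_wpmul2l; rewrite ?lee_fin.
set RHS := (X in (_ <= X)%E).
have B n : ((nc (cintegral leb3 setT (fun w => g w * (ckconv (scl n) Phi w)^*%C)))%:E <= RHS)%E.
  rewrite -(parseval_bump (scl_gt0 n) ig iP).
  have mi : @cmeasurable R _ borel3 (fun z => (bump3 (scl n) z)%:C%C * (ift Phi z)^*%C * ift g z).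
    apply: cmeasurableM; last by apply: cmeasurable_ift; exact: (cintegrable_meas ig).
    apply: cmeasurableM; first by apply: cmeasurable_real; exact: measurable_bump3.
    by apply: cmeasurable_conj; apply: cmeasurable_ift; exact: (cintegrable_meas iP).
  apply: (le_trans (cintegral_lee _ mi)).
  rewrite /RHS [X in (_ <= X * _)%E]EFinM -muleA; apply: lee_wpmul2l => //.
  apply: (@le_trans _ _ (nrm2 (ift Phi) * nrm2 (ift g))%E); last first.
    by apply: lee_wpmul2r => //; exact: Lnorm_ge0.
  apply: le_trans (cauchy_schwarz_ift ig iP).
  have m1 := cmeasurable_nc (cmeasurable_ift (cintegrable_meas iP)).
  have m2 := cmeasurable_nc (cmeasurable_ift (cintegrable_meas ig)).
  apply: ge0_le_integral => //.
  - by move=> z _; rewrite lee_fin nc_ge0.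
  - by apply/measurable_EFinP; exact: cmeasurable_nc.
  - by apply/measurable_EFinP; exact: measurable_funM.
  move=> z _; rewrite lee_fin !ncM nc_conj nc_real ger0_norm ?bump3_ge0//.
  rewrite -mulrA; apply: ler_piMl; last exact: bump3_le1.
  by apply: mulr_ge0; exact: nc_ge0.
have := ccvg_nc (inner_ckconv_cvg ig iP PM wP).
rewrite ncM nc_real mulrC => c.
move: B; case: RHS => [r B|_|B].
- by rewrite lee_fin; apply: (cvgr_to_le c); apply: nearW => n; rewrite -lee_fin.
- by rewrite leey.
- by have := B 0%N; rewrite leNgt ltNyr.
Qed.
End Duality2.

(** * Cells and the norm *)

Section Sums.
Context {R : realType}.

Lemma esum_le_seq (T : choiceType) (a : T -> \bar R) (B : \bar R) :
  (forall s : seq T, uniq s -> (\sum_(x <- s) a x <= B)%E) ->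
  (\esum_(x in [set: T]) a x <= B)%E.
Proof.
move=> H; apply: ge_ereal_sup => _ [A [fA _]] <-.
by rewrite fsbig_finite//; apply: H; exact: finmap.fset_uniq.
Qed.

Lemma esum_ge1 (T : choiceType) (a : T -> \bar R) (x : T) :
  (a x <= \esum_(x in [set: T]) a x)%E.
Proof.
apply: esum_ge; exists [set x]; last by rewrite fsbig_set1.
by split => //; exact: finite_set1.
Qed.

(** The inclusion of [l^1] in [l^r]. It is used for the passage from [l^2] to
    [l^p] over cells and from [l^1] to [l^q] over dyadic shells. *)
Lemma sum_powR_le (T : eqType) (s : seq T) (x : T -> R) (B r : R) : 1 <= r -> 
  (forall i, 0 <= x i) -> \sum_(i <- s) x i <= B ->
  \sum_(i <- s) x i `^ r <= B `^ r.
Proof.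
move=> r1 x0 sB.
have S0 : 0 <= \sum_(i <- s) x i by apply: sumr_ge0.
have B0 : 0 <= B := le_trans S0 sB.
have r0 : 0 < r by apply: lt_le_trans r1.
have hr : 0 <= r - 1 by rewrite subr_ge0.
have E y : 0 <= y -> y `^ r = y * y `^ (r - 1).
  move=> y0; have [->|yn] := eqVneq y 0; first by rewrite powR0 ?gt_eqF// mul0r.
  rewrite -{2}(powRr1 y0) -powRD; first by rewrite addrC subrK.
  by rewrite (negbTE yn) implybT.
have xs i : i \in s -> x i <= B.
  move=> si; apply: le_trans sB.
  by rewrite (big_rem i)//= lerDl; exact: sumr_ge0.
rewrite E//; apply: (@le_trans _ _ (\sum_(i <- s) x i * B `^ (r - 1))).
  rewrite big_seq_cond [leRHS]big_seq_cond; apply: ler_sum => i /andP[si _].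
  rewrite E//; apply: ler_wpM2l => //.
  by apply: ge0_ler_powR => //; rewrite ?nnegrE//; exact: xs.
by rewrite -mulr_suml; apply: ler_wpM2r => //; exact: powR_ge0.
Qed.

End Sums.

Section Cells.
Context {R : realType}.
Let T1 := measurableTypeR R.
Let T3 := @borel3 R.

Lemma dyad_gt0 m : 0 < @dyad R m. Proof. by rewrite /dyad exprz_gt0. Qed.

Lemma measurable_Gamma m ab : measurable (@Gamma R m ab : set T3).
Proof.
pose b (w : T3) := ((dyad m <= `|w.1|) && (`|w.1| < 2 * dyad m)) &&
  ((`|w.2.1 / w.1 - dyad m * ab.1%:~R| <= dyad m / 2) &&
   (`|w.2.2 / w.1 - dyad m * ab.2%:~R| <= dyad m / 2)).
have mn (f : T3 -> R) : measurable_fun setT (f : T3 -> T1) -> measurable_fun setT (fun w => `|f w| : T1).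
  by move=> mf; apply: measurableT_comp.
have m1 := @measurable_c1 R; have m2 := @measurable_c2 R; have m3 := @measurable_c3 R.
have mq (f : T3 -> R) c : measurable_fun setT (f : T3 -> T1) ->
    measurable_fun setT (fun w => `|f w / w.1 - c| : T1).
  by move=> mf; apply: mn; apply: measurable_funB => //; exact: measurable_div.
have mb : measurable_fun setT b.
  apply: measurable_and; apply: measurable_and.
  - by apply: measurable_fun_ler => //; exact: mn.
  - by apply: measurable_fun_ltr => //; exact: mn.
  - by apply: measurable_fun_ler => //; exact: mq.
  - by apply: measurable_fun_ler => //; exact: mq.
have := mb measurableT [set true] => /(_ _)/=.
have -> : setT `&` b @^-1` [set true] = Gamma m ab.
  apply/seteqP; split => w /=.
    by move=> [_]; rewrite /b /Gamma/= ge_max => /andP[-> /andP[-> ->]].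
  by rewrite /b /Gamma/= ge_max => -[-> ->].
by apply.
Qed.

Definition cut (A : set (R3 R)) (g : R3 R -> R[i]) (w : R3 R) : R[i] := (\1_A w)%:C%C * g w.

Lemma cut_in (A : set (R3 R)) g w : A w -> cut A g w = g w.
Proof. by move=> Aw; rewrite /cut indicE mem_set// mul1r. Qed.

Lemma cut_out (A : set (R3 R)) g w : ~ A w -> cut A g w = 0.
Proof. by move=> Aw; rewrite /cut indicE memNset// mul0r. Qed.

Lemma cmeasurable_cut (A : set (R3 R)) g : measurable (A : set T3) -> @cmeasurable R _ borel3 g ->
  @cmeasurable R _ borel3 (cut A g).
Proof.
by move=> mA mg; apply: cmeasurableM => //; apply: cmeasurable_real; exact: measurable_indic.
Qed.

Lemma nc_cut_le (A : set (R3 R)) g w : nc (cut A g w) <= nc (g w).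
Proof.
have [h|h] := pselect (A w); first by rewrite cut_in.
by rewrite cut_out// nc0 nc_ge0.
Qed.

Lemma cintegrable_cut (A : set (R3 R)) g : measurable (A : set T3) -> cintegrable leb3 setT g ->
  cintegrable leb3 setT (cut A g).
Proof.
move=> mA ig; apply: (cintegrable_dom _ (cintegrable_nc ig)); last exact: nc_cut_le.
by apply: cmeasurable_cut => //; exact: (cintegrable_meas ig).
Qed.

Lemma cst3_ge0 : 0 <= @cst3 R. Proof. exact: powR_ge0. Qed.

Lemma fproj_ift A (g : R3 R -> R[i]) z : fproj A g z = cst3%:C%C * ift (cut A g) z.
Proof.
rewrite /fproj cintegral_mkcond; congr (_ * cintegral _ _ _).
by apply/funext => w; rewrite /cut mulrA.
Qed.

Lemma nrm2Z (c : R) (G : R3 R -> R[i]) : @cmeasurable R _ borel3 G -> 0 <= c ->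
  nrm2 (fun z => c%:C%C * G z) = (c%:E * nrm2 G)%E.
Proof.
move=> mG c0; rewrite !nrm2E.
have -> : nsq (fun z => c%:C%C * G z) = ((c ^+ 2)%:E * nsq G)%E.
  rewrite /nsq -ge0_integralZl//.
  - by apply: eq_integral => w _; rewrite -EFinM ncM nc_real exprMn ger0_norm.
  - exact: measurable_nsq.
  - by move=> w _; rewrite lee_fin sqr_ge0.
  - by rewrite lee_fin sqr_ge0.
rewrite poweRM ?nsq_ge0 ?lee_fin ?sqr_ge0//.
by rewrite poweR_EFin powR12_sqrt ?sqr_ge0// sqrtr_sqr ger0_norm.
Qed.

Lemma cell_normE (g : R3 R -> R[i]) m ab : cintegrable leb3 setT (cut (Gamma m ab) g) ->
  cell_norm g m ab = (cst3%:E * nrm2 (ift (cut (Gamma m ab) g)))%E.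
Proof.
move=> ig; rewrite -nrm2Z ?cst3_ge0//; last by apply: cmeasurable_ift; exact: (cintegrable_meas ig).
by rewrite /cell_norm /nrm2; congr (Lnorm _ _ _); apply/funext => z; rewrite fproj_ift.
Qed.

Definition ccell : R := cst3 * Num.sqrt cplan.

Lemma ccell_ge0 : 0 <= ccell. Proof. by rewrite mulr_ge0 ?cst3_ge0 ?sqrtr_ge0. Qed.

Lemma cell_norm_ge0 (g : R3 R -> R[i]) m ab : (0 <= cell_norm g m ab)%E.
Proof. exact: Lnorm_ge0. Qed.

Lemma cell_le (g : R3 R -> R[i]) m ab (B : R) : cintegrable leb3 setT (cut (Gamma m ab) g) ->
  0 <= B -> (nsq (cut (Gamma m ab) g) <= (B ^+ 2)%:E)%E ->
  (cell_norm g m ab <= (ccell * B)%:E)%E.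
Proof.
move=> ig B0 h; rewrite cell_normE// /ccell -mulrA [leRHS]EFinM.
apply: lee_wpmul2l; first by rewrite lee_fin cst3_ge0.
have cpl := @cplan_ge0 R.
apply: nrm2_le; first by rewrite mulr_ge0 ?sqrtr_ge0.
apply: (le_trans (plancherel_le ig)).
by rewrite exprMn sqr_sqrtr// [leRHS]EFinM; apply: lee_wpmul2l; rewrite ?lee_fin.
Qed.

(** It suffices to bound each row by [X m] and to sum the weighted rows in
    [l^1], whatever [q] is. *)
Lemma lqlp_le (q : \bar R) (p : R) (g : R3 R -> R[i]) (X : int -> R) (B : R) :
  (1%:E <= q)%E -> 2 < p -> (forall m, 0 <= X m) ->
  (forall m, \esum_(ab in [set: int * int]) cell_norm g m ab `^ p <= (X m `^ p)%:E)%E ->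
  (forall s : seq int, uniq s -> \sum_(m <- s) dyad m `^ 2^-1 * X m <= B) ->
  (lqlp_norm q p g <= B%:E)%E.
Proof.
move=> q1 p2 X0 hX hB.
have p0 : 0 < p by lra.
have B0 : 0 <= B by have := hB [::] isT; rewrite big_nil.
have pos (m : int) : 0 <= dyad m `^ 2^-1 * X m by rewrite mulr_ge0 ?powR_ge0.
have e0 m : (0 <= \esum_(ab in [set: int * int]) cell_norm g m ab `^ p)%E.
  by apply: esum_ge0 => ab _; exact: poweR_ge0.
have hr m (r : R) : 0 <= r ->
    ((\esum_(ab in [set: int * int]) cell_norm g m ab `^ p) `^ (r / p) <= (X m `^ r)%:E)%E.
  move=> r0.
  have -> : ((X m `^ r)%:E = (X m `^ p)%:E `^ (r / p))%E.
    by rewrite poweR_EFin -powRrM mulrCA divff ?mulr1// gt_eqF.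
  apply: gt0_ler_poweR => //; first by rewrite divr_ge0// ltW.
    by rewrite in_itv/= leey e0.
  by rewrite in_itv/= leey lee_fin powR_ge0.
case: q q1 => [r r1| _|//] /=.
- have {}r1 : 1 <= r by move: r1; rewrite lee_fin.
  have r0 : 0 < r by lra.
  have -> : B%:E = ((B `^ r)%:E `^ r^-1)%E.
    by rewrite poweR_EFin -powRrM divff ?powRr1// gt_eqF.
  apply: gt0_ler_poweR; first by rewrite invr_ge0 ltW.
  + rewrite in_itv/= leey andbT; apply: esum_ge0 => m _.
    by rewrite mule_ge0 ?poweR_ge0// lee_fin powR_ge0.
  + by rewrite in_itv/= leey lee_fin powR_ge0.
  apply: esum_le_seq => s us.
  apply: (@le_trans _ _ (\sum_(m <- s) ((dyad m `^ 2^-1 * X m) `^ r)%:E)%E).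
    apply: lee_sum => m _.
    have -> : (dyad m `^ 2^-1 * X m) `^ r = dyad m `^ (r / 2) * X m `^ r.
      by rewrite powRM ?powR_ge0// -powRrM [2^-1 * r]mulrC.
    rewrite [leRHS]EFinM; apply: lee_wpmul2l; first by rewrite lee_fin powR_ge0.
    by apply: hr; exact: ltW.
  rewrite sumEFin lee_fin; apply: sum_powR_le => //; exact: hB.
- apply: ge_ereal_sup => _ [m _ <-].
  apply: (@le_trans _ _ (dyad m `^ 2^-1 * X m)%:E); last first.
    by rewrite lee_fin; have := hB [:: m] isT; rewrite big_seq1.
  rewrite EFinM div1r; apply: lee_wpmul2l; first by rewrite lee_fin powR_ge0.
  by have := hr m 1 ler01; rewrite div1r powRr1.
Qed.

Lemma cell_le_lqlp (q : \bar R) (p : R) (g : R3 R -> R[i]) m ab :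
  (1%:E <= q)%E -> 2 < p ->
  ((dyad m `^ 2^-1)%:E * cell_norm g m ab <= lqlp_norm q p g)%E.
Proof.
move=> q1 p2; have p0 : 0 < p by lra.
have h (r : R) : 0 <= r -> (cell_norm g m ab `^ r <=
    (\esum_(ab in [set: int * int]) cell_norm g m ab `^ p) `^ (r / p))%E.
  move=> r0.
  have -> : (cell_norm g m ab `^ r = (cell_norm g m ab `^ p) `^ (r / p))%E.
    by rewrite -poweRrM mulrCA divff ?mulr1// gt_eqF.
  apply: gt0_ler_poweR; first by rewrite divr_ge0// ltW.
  - by rewrite in_itv/= leey poweR_ge0.
  - by rewrite in_itv/= leey; apply/andP; split => //; apply: esum_ge0 => ? _; exact: poweR_ge0.
  exact: (esum_ge1 (fun ab => cell_norm g m ab `^ p)%E).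
case: q q1 => [r r1| _|//] /=.
- have {}r1 : 1 <= r by move: r1; rewrite lee_fin.
  have r0 : 0 < r by lra.
  have -> : ((dyad m `^ 2^-1)%:E * cell_norm g m ab =
      (((dyad m `^ 2^-1)%:E * cell_norm g m ab) `^ r) `^ r^-1)%E.
    rewrite -poweRrM divff ?gt_eqF// poweRe1// mule_ge0 ?cell_norm_ge0//.
    by rewrite lee_fin powR_ge0.
  have t0 n : (0 <= (dyad n `^ (r / 2))%:E * (\esum_(ab in [set: int * int]) cell_norm g n ab `^ p) `^ (r / p))%E.
    by rewrite mule_ge0 ?poweR_ge0// lee_fin powR_ge0.
  apply: gt0_ler_poweR; first by rewrite invr_ge0 ltW.
  + by rewrite in_itv/= leey poweR_ge0.
  + by rewrite in_itv/= leey andbT; apply: esum_ge0.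
  apply: le_trans (esum_ge1 _ m).
  rewrite poweRM ?cell_norm_ge0 ?lee_fin ?powR_ge0// poweR_EFin -powRrM [2^-1 * r]mulrC.
  by apply: lee_wpmul2l; [rewrite lee_fin powR_ge0|apply: h; exact: ltW].
- apply: le_ereal_sup_tmp; exists ((dyad m `^ (1 / 2))%:E *
    (\esum_(ab in [set: int * int]) cell_norm g m ab `^ p) `^ p^-1)%E; first by exists m.
  rewrite div1r; apply: lee_wpmul2l; first by rewrite lee_fin powR_ge0.
  by have := h 1 ler01; rewrite div1r poweRe1 ?cell_norm_ge0.
Qed.
End Cells.

(** * Upper bounds for the norm *)

Section Bound.
Context {R : realType}.
Let T1 := measurableTypeR R.
Let T3 := @borel3 R.

Lemma round_cases (x : R) (a : int) : `|x - a%:~R| <= 2^-1 ->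
  a \in [:: Num.floor x; Num.floor x + 1].
Proof.
rewrite ler_norml => /andP[h1 h2]; rewrite !inE.
have f1 : (Num.floor x)%:~R <= x by exact: floor_le.
have f2 : x < (Num.floor x + 1)%:~R by exact: floorD1_gt.
have a1 : (Num.floor x)%:~R < a%:~R + 1 :> R by lra.
have a2 : a%:~R < (Num.floor x + 1)%:~R + 1 :> R by lra.
rewrite -(intrD _ _ 1) ltr_int in a1; rewrite -(intrD _ _ 1) ltr_int in a2.
move: a1 a2; set f := Num.floor x => a1 a2; apply/orP.
have [->|n] := eqVneq a f; first by left.
by right; apply/eqP; move/eqP: n; lia.
Qed.

(** At a given frequency the slope is within half a cell of at most two
    multiples of the mesh in each coordinate; boundaries are counted twice. *)
Definition near_cells (m : int) (w : R3 R) : seq (int * int) :=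
  let a := Num.floor (w.2.1 / w.1 / dyad m) in let b := Num.floor (w.2.2 / w.1 / dyad m) in
  [:: (a, b); (a, b + 1); (a + 1, b); (a + 1, b + 1)].

Lemma Gamma_cases (m : int) ab (w : R3 R) : Gamma m ab w -> ab \in near_cells m w.
Proof.
move=> [_]; rewrite ge_max => /andP[h1 h2]; rewrite /= in h1 h2.
have d0 := @dyad_gt0 R m.
have key (x : R) (a : int) : `|x - dyad m * a%:~R| <= dyad m / 2 -> `|x / dyad m - a%:~R| <= 2^-1.
  move=> h; have -> : x / dyad m - a%:~R = (x - dyad m * a%:~R) / dyad m by field; rewrite gt_eqF.
  by rewrite normrM normfV (gtr0_norm d0) ler_pdivrMr// [2^-1 * _]mulrC.
case: ab h1 h2 => a b /= h1 h2.
have := round_cases (key _ _ h1); have := round_cases (key _ _ h2).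
by rewrite /near_cells !inE => /orP[]/eqP-> /orP[]/eqP->; rewrite !eqxx ?orbT.
Qed.

Lemma Gamma_mult (m : int) (s : seq (int * int)) (w : R3 R) : uniq s ->
  \sum_(ab <- s) \1_(Gamma m ab) w <= (4 : R).
Proof.
move=> us.
have -> : \sum_(ab <- s) \1_(Gamma m ab) w = (count (fun ab => w \in Gamma m ab) s)%:R :> R.
  by rewrite -sum1_count natr_sum [RHS]big_mkcond; apply: eq_bigr => ab _; rewrite indicE; case: ifP.
rewrite -size_filter (ler_nat _ _ 4).
rewrite (_ : 4%N = size (near_cells m w))//; apply: uniq_leq_size; first exact: filter_uniq.
by move=> ab; rewrite mem_filter => /andP[/set_mem /Gamma_cases].
Qed.

(** The weight [1 + xi^2] gives decay in both directions of the dyadic scale,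
    relative to the factor [dyad m] in the norm. *)
Lemma shell_weight (m : int) ab (w : R3 R) : Gamma m ab w ->
  dyad m * dyad `|m|%N <= 1 + w.1 ^+ 2.
Proof.
move=> [/andP[h _] _]; have d0 := @dyad_gt0 R m; rewrite -(real_normK (num_real w.1)).
case: m d0 h => n d0 h /=.
  have : dyad n * dyad n <= `|w.1| * `|w.1| by apply: ler_pM => //; exact: ltW.
  rewrite -expr2; lra.
rewrite /dyad -expfzDr ?pnatr_eq0// NegzE addNr expr0z.
by rewrite lerDl sqr_ge0.
Qed.

Definition geo (m : int) : R := dyad `|m|%N `^ (- 2^-1).

(** Enumerating the integers by even and odd naturals compares the two-sided
    sum with one geometric series. *)
Lemma geo_sum : exists2 K : R, 0 <= K & forall s : seq int, uniq s -> \sum_(m <- s) geo m <= K.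
Proof.
pose mu : R := 2 `^ (- 4^-1).
have mu0 : 0 <= mu by exact: powR_ge0.
have mu1 : mu < 1.
  rewrite ltNge; apply/negP => h; have := exprn_ege1 4 h.
  have -> : mu ^+ 4 = 2^-1.
    rewrite -powR_mulrn// /mu -powRrM (_ : - 4^-1 * 4%:R = -1 :> R); last by field.
    by rewrite powR_inv1.
  lra.
exists (1 - mu)^-1; first by rewrite invr_ge0 subr_ge0 ltW.
pose e (m : int) := match m with Posz n => n.*2 | Negz n => n.*2.+1 end.
have ei : injective e by move=> [a|a] [b|b]; rewrite /e => h; (exfalso; lia) || (have -> : a = b by lia); by [].
have ge m : geo m <= mu ^+ (e m).
  have -> : geo m = mu ^+ (`|m|%N).*2.
    rewrite /geo /dyad -exprnP; move: `|m|%N => k.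
    rewrite -(@powR_mulrn _ 2) // -powRrM -powR_mulrn// /mu -powRrM; congr (_ `^ _).
    by rewrite -muln2 natrM; field.
  apply: ler_wiXn2l => //; first exact: ltW.
  by case: m => n /=; lia.
move=> s us; apply: (@le_trans _ _ (\sum_(k <- map e s) mu ^+ k)).
  by rewrite big_map; apply: ler_sum.
have {us} : uniq (map e s) by rewrite map_inj_uniq.
move: (map e s) => t ut.
have [N HN] : exists N, forall k, k \in t -> (k < N)%N.
  exists (\max_(k <- t) k).+1 => k kt; rewrite ltnS; exact: leq_bigmax_seq.
have : \sum_(k <- t) mu ^+ k <= \sum_(k <- iota 0 N) mu ^+ k.
  rewrite [leRHS](bigID (fun k => k \in t))/= -[X in _ <= X + _]big_filter.
  rewrite (perm_big (seq.filter (fun k => k \in t) (iota 0 N))) /=.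
    by rewrite lerDl; apply: sumr_ge0 => k _; exact: exprn_ge0.
  apply: uniq_perm => //; first by rewrite filter_uniq// iota_uniq.
  move=> k; rewrite mem_filter mem_iota add0n /=.
  by case kt : (k \in t) => //=; rewrite HN.
move/le_trans; apply.
have d0 : 0 < 1 - mu by rewrite subr_gt0.
have -> : \sum_(k <- iota 0 N) mu ^+ k = \sum_(i < N) mu ^+ i.
  by rewrite -(big_mkord xpredT (fun k => mu ^+ k)) /index_iota subn0.
rewrite -(ler_pM2l d0) divff ?gt_eqF//.
have := subrX1 mu N; have := exprn_ge0 N mu0; set S := \sum_(i < N) _; set P := mu ^+ N.
move=> P0 h; have -> : (1 - mu) * S = 1 - P by rewrite -[LHS]opprK -mulNr opprB -h opprB.
by rewrite gerBl.
Qed.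
End Bound.

Section Bound.
Context {R : realType}.
Let T1 := measurableTypeR R.
Let T3 := @borel3 R.

(** The density of the weighted [L^2] norm that dominates the [l^q l^p L^2]
    norm. *)
Definition wsq (g : R3 R -> R[i]) (w : R3 R) : R := (1 + w.1 ^+ 2) * nc (g w) ^+ 2.

Lemma wsq_ge0 g w : 0 <= wsq g w.
Proof. by rewrite mulr_ge0 ?sqr_ge0// addr_ge0 ?sqr_ge0. Qed.

Lemma measurable_wsq g : @cmeasurable R _ borel3 g -> measurable_fun setT (wsq g : T3 -> T1).
Proof.
move=> mg; apply: measurable_funM; last by apply: measurable_funX; exact: cmeasurable_nc.
apply: measurable_realfun.measurable_funD => //.
by apply: measurable_funX; exact: measurable_c1.
Qed.

Lemma wsq_rho g (C : R) w : nc (g w) <= C * rho w -> wsq g w <= C ^+ 2 * rho w.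
Proof.
move=> h; have c1 := cauchy_ge0 w.1; have c2 := cauchy_ge0 w.2.1; have c3 := cauchy_ge0 w.2.2.
have d0 : 0 < 1 + w.1 ^+ 2 by rewrite ltr_wpDr// sqr_ge0.
have h2 : nc (g w) ^+ 2 <= (C * rho w) ^+ 2.
  by rewrite lerXn2r ?nnegrE ?nc_ge0// (le_trans (nc_ge0 (g w)) h).
apply: (@le_trans _ _ ((1 + w.1 ^+ 2) * (C * rho w) ^+ 2)).
  by rewrite /wsq; apply: ler_wpM2l => //; exact: ltW.
have -> : (1 + w.1 ^+ 2) * (C * rho w) ^+ 2 =
   (C ^+ 2 * rho w) * (((1 + w.1 ^+ 2) * cauchy w.1) * (cauchy w.2.1 * cauchy w.2.2)).
  by rewrite /rho; ring.
have -> : (1 + w.1 ^+ 2) * cauchy w.1 = 1 by rewrite /cauchy divff// gt_eqF.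
rewrite mul1r; apply: ler_piMr.
  by apply: mulr_ge0; [exact: sqr_ge0|exact: rho_ge0].
by apply: mulr_ile1 => //; exact: cauchy_le1.
Qed.

Lemma cintegrable_rho g (C : R) : @cmeasurable R _ borel3 g -> (forall w, nc (g w) <= C * rho w) ->
  cintegrable leb3 setT g.
Proof.
by move=> mg h; exact: (cintegrable_dom mg (integrable_scale C integrable_rho)).
Qed.

Lemma sum_cells (g : R3 R -> R[i]) (m : int) (s : seq (int * int)) (S2 : R) :
  @cmeasurable R _ borel3 g -> uniq s ->
  (\int[leb3]_w (wsq g w)%:E <= S2%:E)%E ->
  (\sum_(ab <- s) nsq (cut (Gamma m ab) g) <= (4 * S2 / (dyad m * dyad `|m|%N))%:E)%E.
Proof.
move=> mg us hS; pose d : R := dyad m * dyad `|m|%N.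
have d0 : 0 < d by rewrite mulr_gt0// dyad_gt0.
have c0 : 0 <= 4 / d by rewrite divr_ge0// ltW.
rewrite /nsq -ge0_integral_sum//; last 2 first.
- move=> ab; apply: measurable_nsq; apply: cmeasurable_cut => //; exact: measurable_Gamma.
- by move=> ab w _; rewrite lee_fin sqr_ge0.
apply: (@le_trans _ _ (\int[leb3]_w (4 / d * wsq g w)%:E)%E).
  apply: ge0_le_integral => //.
  - by move=> w _; apply: sume_ge0 => ab _; rewrite lee_fin sqr_ge0.
  - apply: emeasurable_sum => ab; apply: measurable_nsq; apply: cmeasurable_cut => //.
    exact: measurable_Gamma.
  - by apply/measurable_EFinP; apply: measurable_funM => //; exact: measurable_wsq.
  move=> w _; rewrite sumEFin lee_fin.
  have W0 := wsq_ge0 g w.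
  apply: (@le_trans _ _ (\sum_(ab <- s) \1_(Gamma m ab) w * (d^-1 * wsq g w))).
    apply: ler_sum => ab _; have [h|h] := pselect (Gamma m ab w); last first.
      by rewrite cut_out// nc0 expr0n mulr_ge0// mulr_ge0// invr_ge0 ltW.
    rewrite cut_in// indicE mem_set// mul1r ler_pdivlMl//; apply: ler_wpM2r; first exact: sqr_ge0.
    exact: (shell_weight h).
  rewrite -mulr_suml -mulrA; apply: ler_wpM2r; first by rewrite mulr_ge0// invr_ge0 ltW.
  exact: Gamma_mult.
have -> : (\int[leb3]_w (4 / d * wsq g w)%:E = (4 / d)%:E * \int[leb3]_w (wsq g w)%:E)%E.
  rewrite -ge0_integralZl ?lee_fin//.
  - by apply/measurable_EFinP; exact: measurable_wsq.
  - by move=> w _; rewrite lee_fin wsq_ge0.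
have -> : 4 * S2 / (dyad m * dyad `|m|%N) = (4 / d) * S2 by rewrite mulrAC.
by rewrite [leRHS]EFinM; apply: lee_wpmul2l; rewrite ?lee_fin.
Qed.

(** Over the cells of one shell, [l^p] is dominated by [l^2] since [p >= 2]. *)
Lemma row_le (p : R) (g : R3 R -> R[i]) (m : int) (J : R) : 2 < p -> 0 <= J ->
  (forall ab, cintegrable leb3 setT (cut (Gamma m ab) g)) ->
  (forall s, uniq s -> (\sum_(ab <- s) nsq (cut (Gamma m ab) g) <= (J ^+ 2)%:E)%E) ->
  (\esum_(ab in [set: int * int]) cell_norm g m ab `^ p <= ((ccell * J) `^ p)%:E)%E.
Proof.
move=> p2 J0 ig hJ; apply: esum_le_seq => s us.
have p0 : 0 < p by lra.
pose I ab := fine (nsq (cut (Gamma m ab) g)).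
have IE ab : nsq (cut (Gamma m ab) g) = (I ab)%:E.
  rewrite /I fineK// ge0_fin_numE ?nsq_ge0//.
  by apply: le_lt_trans (ltry (J ^+ 2)); have := hJ [:: ab] isT; rewrite big_seq1.
have I0 ab : 0 <= I ab by rewrite /I fine_ge0// nsq_ge0.
have cc := @ccell_ge0 R.
have sq (x : R) : 0 <= x -> x `^ p = (x ^+ 2) `^ (p / 2).
  move=> x0; rewrite -powR_mulrn// -powRrM; congr (_ `^ _); by field.
have cl ab : (cell_norm g m ab `^ p <= (((ccell ^+ 2 * I ab) `^ (p / 2)))%:E)%E.
  have s0 : 0 <= ccell * Num.sqrt (I ab) by rewrite mulr_ge0 ?sqrtr_ge0.
  have -> : ccell ^+ 2 * I ab = (ccell * Num.sqrt (I ab)) ^+ 2 by rewrite [RHS]exprMn sqr_sqrtr.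
  rewrite -sq// -poweR_EFin; apply: gt0_ler_poweR; first exact: ltW.
  - by rewrite in_itv/= leey cell_norm_ge0.
  - by rewrite in_itv/= leey andbT lee_fin; exact: s0.
  by apply: cell_le => //; rewrite sqr_sqrtr// IE.
apply: (@le_trans _ _ (\sum_(ab <- s) ((ccell ^+ 2 * I ab) `^ (p / 2))%:E)%E).
  by apply: lee_sum => ab _; exact: cl.
rewrite sumEFin lee_fin sq; last by rewrite mulr_ge0.
apply: sum_powR_le; first by lra.
  by move=> ab; rewrite mulr_ge0 ?sqr_ge0.
rewrite -mulr_sumr [leRHS]exprMn; apply: ler_wpM2l; first exact: sqr_ge0.
rewrite -lee_fin -sumEFin; have := hJ s us.
by under eq_bigr do rewrite IE.
Qed.

Lemma lqlp_bound (q : \bar R) (p : R) : (1%:E <= q)%E -> 2 < p ->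
  exists2 Cn : R, 0 <= Cn & forall (g : R3 R -> R[i]) (C S : R), @cmeasurable R _ borel3 g ->
    (forall w, nc (g w) <= C * rho w) -> 0 <= S ->
    (\int[leb3]_w (wsq g w)%:E <= (S ^+ 2)%:E)%E ->
    (lqlp_norm q p g <= (Cn * S)%:E)%E.
Proof.
move=> q1 p2; have [K K0 HK] := @geo_sum R.
have cc := @ccell_ge0 R.
have c20 : 0 <= (ccell : R) * 2 by exact: mulr_ge0.
exists (ccell * 2 * K); first exact: mulr_ge0.
move=> g C S mg gC S0 hS.
have d0 m := @dyad_gt0 R m.
pose J (m : int) : R := 2 * S * (dyad m * dyad `|m|%N) `^ (- 2^-1).
have J0 m : 0 <= J m by rewrite mulr_ge0 ?powR_ge0// mulr_ge0.
apply: (@lqlp_le _ q p g (fun m => ccell * J m)) => //.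
- by move=> m; apply: mulr_ge0.
- move=> m; apply: row_le => //.
    by move=> ab; apply: cintegrable_cut; [exact: measurable_Gamma|exact: (cintegrable_rho mg gC)].
  move=> s us; apply: (le_trans (sum_cells m mg us hS)).
  rewrite lee_fin; apply: eqle; rewrite /J exprMn exprMn.
  set e := dyad m * _; have e0 : 0 < e by rewrite mulr_gt0.
  have -> : (e `^ (- 2^-1)) ^+ 2 = e^-1.
    by rewrite -powR_mulrn ?powR_ge0// -powRrM mulNr mulVf// powR_inv1// ltW.
  by rewrite -[in RHS]natrX.
- move=> s us; apply: (@le_trans _ _ (\sum_(m <- s) ccell * 2 * S * geo m)).
    apply: ler_sum => m _; apply: eqle; rewrite /J /geo.
    rewrite powRM ?(ltW (d0 _))// powRN.
    have : dyad m `^ 2^-1 != 0 :> R by rewrite gt_eqF// powR_gt0.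
    by move=> n0; field.
  rewrite -mulr_sumr [ccell * 2 * K * S]mulrAC; apply: ler_wpM2l; first exact: mulr_ge0.
  exact: HK.
Qed.

Definition irho : R := \int[leb3]_w (rho w : R).

Lemma lqlp_rho (q : \bar R) (p : R) : (1%:E <= q)%E -> 2 < p ->
  exists2 Cn : R, 0 <= Cn & forall (g : R3 R -> R[i]) (C : R), @cmeasurable R _ borel3 g ->
    (forall w, nc (g w) <= C * rho w) -> (lqlp_norm q p g <= (Cn * C)%:E)%E.
Proof.
move=> q1 p2; have [Cn Cn0 H] := lqlp_bound q1 p2.
have i0 : 0 <= irho by apply: Rintegral_ge0 => w _; exact: rho_ge0.
exists (Cn * Num.sqrt irho); first by rewrite mulr_ge0 ?sqrtr_ge0.
move=> g C mg gC.
have C0 : 0 <= C.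
  have h : 0 <= C * rho (0 : R3 R) := le_trans (nc_ge0 _) (gC 0).
  by rewrite -(pmulr_lge0 _ (rho_gt0 (0 : R3 R))).
rewrite -mulrA; apply: (H g C) => //; first by rewrite mulr_ge0 ?sqrtr_ge0.
rewrite exprMn sqr_sqrtr// mulrC.
have iS := integrable_scale (C ^+ 2) (@integrable_rho R).
apply: (@le_trans _ _ (\int[leb3]_w (C ^+ 2 * rho w)%:E)%E).
  apply: ge0_le_integral => //.
  - by move=> w _; rewrite lee_fin wsq_ge0.
  - by apply/measurable_EFinP; exact: measurable_wsq.
  - exact: (measurable_int _ iS).
  by move=> w _; rewrite lee_fin wsq_rho.
rewrite -[leLHS]fineK; last exact: (integrable_fin_num measurableT iS).
by rewrite lee_fin /irho -(RintegralZl _ measurableT integrable_rho)// /Rintegral mulrC.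
Qed.

(** The weighted [L^2] norm passes to the limit by dominated convergence, since
    [(1 + xi^2) rho^2 <= rho]. *)
Lemma lqlp_cvg0 (q : \bar R) (p : R) (g : nat -> R3 R -> R[i]) (C e : R) :
  (1%:E <= q)%E -> 2 < p -> (forall n, @cmeasurable R _ borel3 (g n)) ->
  (forall n w, nc (g n w) <= C * rho w) -> (forall w, ccvg (fun n => g n w) 0) -> 0 < e ->
  exists N, forall n, (N <= n)%N -> (lqlp_norm q p (g n) < e%:E)%E.
Proof.
move=> q1 p2 mg gC g0 e0; have [Cn Cn0 H] := lqlp_bound q1 p2.
have iS := integrable_scale (C ^+ 2) (@integrable_rho R).
have c : \int[leb3]_w wsq (g n) w @[n --> \oo] --> \int[leb3]_w (0 : R).
  apply: (Rintegral_cvg _ _ iS).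
  - by move=> n; exact: measurable_wsq.
  - move=> w; have /ccvg_nc := g0 w; rewrite nc0 => h.
    have h2 : (1 + w.1 ^+ 2) * (nc (g n w) * nc (g n w)) @[n --> \oo] --> (1 + w.1 ^+ 2) * (0 * 0).
      by apply: cvgM; [exact: cvg_cst|exact: cvgM].
    by move: h2; rewrite mul0r mulr0.
  - by move=> n w; rewrite ger0_norm ?wsq_ge0// wsq_rho.
have I0 : \int[leb3]_w (0 : R) = 0 by rewrite /Rintegral integral0.
rewrite I0 in c.
pose S := e / (2 * (Cn + 1)).
have S0 : 0 < S by rewrite divr_gt0// mulr_gt0// ltr_wpDl.
have /cvgrPdist_lt /(_ (S ^+ 2)) := c; rewrite exprn_gt0// => /(_ isT)[N _ HN].
exists N => n Nn; apply: (@le_lt_trans _ _ (Cn * S)%:E).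
  apply: (H _ C) => //; first exact: ltW.
  have iW : leb3.-integrable setT (EFin \o wsq (g n)).
    apply: (le_integrable _ _ _ iS) => //; first by apply/measurable_EFinP; exact: measurable_wsq.
    move=> w _; rewrite /= lee_fin ger0_norm ?wsq_ge0//.
    by rewrite (le_trans (wsq_rho (gC n w))) ?ler_norm.
  rewrite -[leLHS]fineK; last exact: (integrable_fin_num measurableT iW).
  rewrite lee_fin; have := HN n Nn; rewrite /= sub0r normrN => /ltW.
  by apply: le_trans; rewrite ler_norm.
rewrite lte_fin /S.
have -> : Cn * (e / (2 * (Cn + 1))) = e * (Cn / (2 * (Cn + 1))) by rewrite mulrCA.
rewrite gtr_pMr// ltr_pdivrMr ?mul1r ?mulr_gt0//; lra.
Qed.
End Bound.

(** * Approximation by transforms of test functions *)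

Section KernelBound.
Context {R : realType}.
Let mu := @lebesgue_measure R.
Let T1 := measurableTypeR R.
Let T3 := @borel3 R.

(** By [x^2 <= 2 (x - s y)^2 + 2 s^2 y^2]; the factor [s^2] compensates the
    mass [pi / s] of the dilated Cauchy function. *)
Lemma cauchy_mul_scaled (s x y : R) :
  cauchy (- s * y + x) * cauchy y <=
  cauchy x * (2 * cauchy y + 2 * s ^+ 2 * cauchy (- s * y + x)).
Proof.
have p (u : R) : 0 < 1 + u ^+ 2 by rewrite ltr_wpDr// sqr_ge0.
rewrite /cauchy; set z := - s * y + x.
have xE : x = z + s * y by rewrite /z; ring.
rewrite -ler_pdivrMl ?invr_gt0// invrK.
have -> : 2 * (1 + y ^+ 2)^-1 + 2 * s ^+ 2 * (1 + z ^+ 2)^-1 =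
    (2 * (1 + z ^+ 2) + 2 * s ^+ 2 * (1 + y ^+ 2)) * ((1 + z ^+ 2)^-1 * (1 + y ^+ 2)^-1).
  field; apply/andP; split; rewrite gt_eqF//; exact: p.
rewrite ler_wpM2r//; first by rewrite mulr_ge0// invr_ge0 ltW.
have := sqr_ge0 (z - s * y); have := sqr_ge0 s.
rewrite xE [(z - _) ^+ 2](_ : _ = 2 * z ^+ 2 + 2 * (s ^+ 2 * y ^+ 2) - (z + s * y) ^+ 2); [lra|ring].
Qed.

Definition cauchys (s x y : R) : R := 2 * cauchy y + 2 * s ^+ 2 * cauchy (- s * y + x).

Lemma integral_cauchy_scaled (s x : R) : 0 < s ->
  (\int[mu]_y (cauchy (- s * y + x))%:E = (s^-1 * pi)%:E)%E.
Proof.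
move=> s0; have ns : - s != 0 by rewrite oppr_eq0 gt_eqF.
have := @ge0_integral_affine _ (- s) x (fun y => (cauchy y)%:E) ns.
rewrite integral_cauchy normrN gtr0_norm// => /(_ _ _) h.
rewrite EFinM h ?muleA -?EFinM ?mulVf ?mul1e ?gt_eqF//.
- by apply/measurable_EFinP; exact: measurable_cauchy.
- by move=> y; rewrite lee_fin cauchy_ge0.
Qed.

Lemma integrable_cauchy_scaled (s x : R) : 0 < s ->
  mu.-integrable setT (EFin \o (fun y => cauchy (- s * y + x))).
Proof.
move=> s0; apply/integrableP; split.
  apply/measurable_EFinP; apply: (measurableT_comp measurable_cauchy).
  by apply: measurable_realfun.measurable_funD => //; exact: measurable_funM.
under eq_integral do rewrite /= ger0_norm ?cauchy_ge0//.
by rewrite integral_cauchy_scaled// ltry.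
Qed.

Lemma integrable_cauchys (s x : R) : 0 < s -> mu.-integrable setT (EFin \o cauchys s x).
Proof.
move=> s0; exact: (integrableD measurableT (integrable_scale 2 integrable_cauchy)
  (integrable_scale (2 * s ^+ 2) (integrable_cauchy_scaled x s0))).
Qed.

Lemma cauchys_ge0 (s x y : R) : 0 <= cauchys s x y.
Proof.
have a0 := cauchy_ge0 y; have b0 := cauchy_ge0 (- s * y + x).
by apply: addr_ge0; apply: mulr_ge0 => //; apply: mulr_ge0 => //; exact: sqr_ge0.
Qed.

Lemma Rintegral_cauchys (s x : R) : 0 < s -> s <= 1 -> \int[mu]_y cauchys s x y <= 4 * pi.
Proof.
move=> s0 s1; rewrite RintegralD//; last 2 first.
- exact: (integrable_scale 2 integrable_cauchy).
- exact: (integrable_scale (2 * s ^+ 2) (integrable_cauchy_scaled x s0)).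
rewrite (RintegralZl 2 measurableT integrable_cauchy).
rewrite (RintegralZl (2 * s ^+ 2) measurableT (integrable_cauchy_scaled x s0)).
rewrite /Rintegral integral_cauchy integral_cauchy_scaled//=.
have -> : 2 * s ^+ 2 * (s^-1 * pi) = 2 * (s * pi) by field; rewrite gt_eqF.
have : s * pi <= pi by rewrite ler_piMl ?pi_ge0.
lra.
Qed.

(** The decay of [rho] survives convolution with the dilated kernels,
    uniformly in the dilation. *)
Lemma ckconv_rho : exists2 K : R, 0 <= K & forall (s C : R) (G : R3 R -> R[i]) (w : R3 R),
  0 < s -> s <= 1 -> 0 <= C -> cintegrable leb3 setT G -> (forall v, nc (G v) <= C * rho v) ->
  nc (ckconv s G w) <= K * C * rho w.
Proof.
have [K K0 HK] := @ker3_bound R.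
have pi0 : 0 <= (4 * pi : R) by rewrite mulr_ge0// pi_ge0.
exists (2 * (K * (4 * pi) ^+ 3)).
  by apply: mulr_ge0 => //; apply: mulr_ge0 => //; exact: exprn_ge0.
move=> s C G w s0 s1 C0 iG GC; rewrite ckconv_subst//.
pose D y := cauchys s w.1 y.1 * (cauchys s w.2.1 y.2.1 * cauchys s w.2.2 y.2.2).
have iD : leb3.-integrable setT (EFin \o D) by apply: integrable3; exact: integrable_cauchys.
have r0 := rho_ge0 w.
apply: (le_trans (cintegral_le _ (integrable_scale (C * K * rho w) iD) _)).
- apply: cmeasurableM.
    exact: (cmeasurable_comp (cintegrable_meas iG) (measurable_aff3 _ _)).
  by apply: cmeasurable_real; exact: measurable_ker3.
- move=> y; rewrite ncM nc_real.
  apply: (@le_trans _ _ ((C * rho (aff3 (- s) w y)) * (K * rho y))).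
    by apply: ler_pM => //; exact: nc_ge0.
  rewrite mulrACA -[leRHS]mulrA; apply: ler_wpM2l; first exact: mulr_ge0.
  have -> : rho (aff3 (- s) w y) * rho y = (cauchy (- s * y.1 + w.1) * cauchy y.1) *
     ((cauchy (- s * y.2.1 + w.2.1) * cauchy y.2.1) * (cauchy (- s * y.2.2 + w.2.2) * cauchy y.2.2)).
    by rewrite /rho/=; ring.
  have -> : rho w * D y = (cauchy w.1 * cauchys s w.1 y.1) * ((cauchy w.2.1 * cauchys s w.2.1 y.2.1) *
     (cauchy w.2.2 * cauchys s w.2.2 y.2.2)) by rewrite /rho /D; ring.
  have c0 x z : 0 <= cauchy x * cauchy z :> R by apply: mulr_ge0; exact: cauchy_ge0.
  apply: ler_pM; [exact: c0|by apply: mulr_ge0; exact: c0|exact: cauchy_mul_scaled|].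
  by apply: ler_pM; [exact: c0|exact: c0|exact: cauchy_mul_scaled|exact: cauchy_mul_scaled].
rewrite (RintegralZl _ measurableT iD) /D Rintegral3; try exact: integrable_cauchys.
have i0 x : 0 <= \int[mu]_y cauchys s x y by apply: Rintegral_ge0 => y _; exact: cauchys_ge0.
have h x := Rintegral_cauchys x s0 s1.
have P : (\int[mu]_x cauchys s w.1 x) * ((\int[mu]_x cauchys s w.2.1 x) * (\int[mu]_x cauchys s w.2.2 x)) <= (4 * pi) ^+ 3.
  by rewrite exprS expr2; apply: ler_pM => //; [exact: mulr_ge0|exact: ler_pM].
apply: (@le_trans _ _ (2 * (C * K * rho w * (4 * pi) ^+ 3))).
  apply: ler_wpM2l => //; apply: ler_wpM2l => //.
  by apply: mulr_ge0 => //; exact: mulr_ge0.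
by apply: eqle; move: (rho w) ((4 * pi) ^+ 3) => a b; ring.
Qed.

End KernelBound.

Section Density.
Context {R : realType}.
Let T1 := measurableTypeR R.
Let T3 := @borel3 R.

Lemma rapid_of_supp (A : R3 R -> R) (C L : R) : measurable_fun setT (A : T3 -> T1) -> 0 <= C ->
  0 <= L -> (forall w, `|A w| <= C * rho w) -> (forall w, A w != 0 -> abs1 w <= L) -> rapid A.
Proof.
move=> mA C0 L0 AC AL; split => // j; exists ((1 + L) ^+ j * C) => w.
have r0 := rho_ge0 w.
have [->|n] := eqVneq (A w) 0.
  rewrite normr0 mul0r; apply: mulr_ge0 => //; apply: mulr_ge0 => //.
  by apply: exprn_ge0; lra.
rewrite -mulrA [leRHS]mulrC; apply: ler_pM => //.
  by apply: exprn_ge0; have := abs1_ge0 w; lra.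
have := AL _ n; have := abs1_ge0 w => a0 aL.
by apply: lerXn2r; rewrite ?nnegrE; lra.
Qed.

Lemma ift_herm (G : R3 R -> R[i]) z : cintegrable leb3 setT G -> herm G ->
  ift G z = (osc (fun w => complex.Re (G w)) (fun w => - complex.Im (G w)) z)%:C%C.
Proof.
move=> iG hG; have iE := ift_cintegrable z iG.
have c : (ift G z)^*%C = ift G z.
  rewrite /ift -cintegral_conj// [RHS](@cintegral_aff3 _ (-1) 0) ?oppr_eq0 ?oner_eq0//.
  rewrite normrN1 expr1n mul1r; congr (cintegral _ _ _); apply/funext => w.
  by rewrite aff3N conjM conj_expi hG; congr (_ * expi _); rewrite /dot3/=; ring.
have im0 : complex.Im (ift G z) = 0.
  by have := congr1 (@complex.Im R) c; case: (ift G z) => a b /= h; lra.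
apply: complex_eqP => //=; apply: eq_Rintegral => w _.
by rewrite ReM /=; ring.
Qed.

Lemma bump3_scl_cvg (x : nat -> R3 R) w : cvg3 x w ->
  bump3 (scl n) (x n) @[n --> \oo] --> bump3 1 (0 : R3 R).
Proof.
move=> [c1 c2 c3].
have h (y : nat -> R) (l : R) : y n @[n --> \oo] --> l -> bump (scl n * y n) @[n --> \oo] --> bump (1 * 0 : R).
  move=> yl; rewrite mulr0.
  have h0 : scl n * y n @[n --> \oo] --> (0 : R).
    by rewrite -(mul0r l); apply: cvgM => //; exact: scl_cvg.
  by apply: (cvg_comp _ _ h0); exact: bump_cont.
by apply: cvgM; [exact: (h _ _ c1)|apply: cvgM; [exact: (h _ _ c2)|exact: (h _ _ c3)]].
Qed.

Lemma bump3N s (z : R3 R) : bump3 s (- z) = bump3 s z.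
Proof. by rewrite /bump3 /= !mulrN !bumpN. Qed.

(** The normalisation for which [approx] converges to the given function. *)
Definition kappa : R := (cst3 * ckint * bump3 1 (0 : R3 R))^-1.

Definition trunc (u : R3 R -> R[i]) (n : nat) (w : R3 R) : R[i] :=
  (kappa * bump3 (scl n) w)%:C%C * u w.

Definition approx (u : R3 R -> R[i]) (n : nat) : R3 R -> R :=
  bump3 (scl n) * osc (fun w => complex.Re (trunc u n w)) (fun w => - complex.Im (trunc u n w)).

Section Approximation.
Variables (u : R3 R -> R[i]) (C : R).
Hypothesis (mu_ : @cmeasurable R _ borel3 u).
Hypothesis (uC : forall w, nc (u w) <= C * rho w).

Let C0 : 0 <= C.
Proof.
have h : 0 <= C * rho (0 : R3 R) := le_trans (nc_ge0 _) (uC 0).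
by rewrite -(pmulr_lge0 _ (rho_gt0 (0 : R3 R))).
Qed.

Lemma cmeasurable_trunc n : @cmeasurable R _ borel3 (trunc u n).
Proof.
apply: cmeasurableM => //; apply: cmeasurable_real; apply: measurable_funM => //.
exact: measurable_bump3.
Qed.

Lemma trunc_le n w : nc (trunc u n w) <= `|kappa| * C * rho w.
Proof.
rewrite /trunc ncM nc_real normrM -!mulrA; apply: ler_wpM2l => //.
rewrite ger0_norm ?bump3_ge0//; have h := uC w; have n0 := nc_ge0 (u w).
by apply: le_trans h; apply: ler_piMl => //; exact: bump3_le1.
Qed.

Lemma cintegrable_trunc n : cintegrable leb3 setT (trunc u n).
Proof. exact: (cintegrable_rho (cmeasurable_trunc n) (trunc_le n)). Qed.

Lemma test_function_approx n : test_function (approx u n).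
Proof.
have kC : 0 <= `|kappa| * C by exact: mulr_ge0.
have L0 : 0 <= n.+1%:R *+ 3 :> R by rewrite mulrn_wge0.
have supp w : trunc u n w != 0 -> abs1 w <= n.+1%:R *+ 3.
  move=> h; have b : bump3 (scl n) w != 0.
    by apply: contra_neq h => b; rewrite /trunc b mulr0 mul0r.
  have [] := bump3_supp (scl_gt0 n) b; rewrite /scl invrK => h1 h2 h3.
  by rewrite /abs1 mulrS mulr2n; apply: lerD => //; exact: lerD.
apply: test_function_bump3; first exact: scl_gt0.
have [mr mi] := cmeasurable_trunc n.
apply: sm_osc; apply: (@rapid_of_supp _ (`|kappa| * C) (n.+1%:R *+ 3)) => //.
- by move=> w; apply: le_trans (trunc_le n w); exact: Re_le_nc.
- by move=> w h; apply: supp; apply: contra_neq h => ->.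
- by apply: measurableT_comp.
- by move=> w; rewrite normrN; apply: le_trans (trunc_le n w); exact: Im_le_nc.
- by move=> w h; apply: supp; apply: contra_neq h => ->; rewrite /= oppr0.
Qed.

Hypothesis (hu : herm u).

Lemma fourier_approx n w : fourier (approx u n) w = cst3%:C%C * ckconv (scl n) (trunc u n) w.
Proof.
rewrite /fourier -(fourier_bump_ift w (scl_gt0 n) (cintegrable_trunc n)).
congr (_ * cintegral _ _ _); apply/funext => z.
have ht : herm (trunc u n) by move=> v; rewrite /trunc conjM conj_real bump3N hu.
rewrite (ift_herm z (cintegrable_trunc n) ht) /approx.
set o := osc _ _; have -> : (bump3 (scl n) * o) z = bump3 (scl n) z * o z by [].
move: (bump3 (scl n) z) (o z) (expi _) => a b [c d].
by apply: complex_eqP => /=; ring.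
Qed.

Hypothesis (wu : wcont u).

Lemma fourier_approx_cvg w : ccvg (fun n => fourier (approx u n) w) (u w).
Proof.
under eq_fun do rewrite fourier_approx.
have h : ccvg (fun n => ckconv (scl n) (trunc u n) w) ((kappa * bump3 1 (0 : R3 R))%:C%C * u w * ckint%:C%C).
  apply: (@ckconv_cvg _ _ _ _ (`|kappa| * C)).
  - exact: cintegrable_trunc.
  - move=> n v; apply: (le_trans (trunc_le n v)); apply: ler_piMr; first exact: mulr_ge0.
    exact: rho_le1.
  move=> y; have c := aff3_scl_cvg w y; apply: ccvgM; last exact: wu.
  apply: ccvg_real; apply: cvgM; first exact: cvg_cst.
  exact: bump3_scl_cvg c.
have := ccvgM (ccvg_cst cst3%:C%C) h.
have -> : cst3%:C%C * ((kappa * bump3 1 (0 : R3 R))%:C%C * u w * ckint%:C%C) = u w => //.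
have k1 : cst3 * (kappa * bump3 1 (0 : R3 R)) * ckint = 1 :> R.
  have n1 := gt_eqF (@cst3_gt0 R); have n2 := @ckint_neq0 R; have n3 := gt_eqF (@bump30_gt0 R).
  rewrite /kappa; move: (bump3 1 _) n3 (@ckint R) n2 (@cst3 R) n1 => b bn k kn c cn.
  by field; rewrite kn bn cn.
have cm (a b d : R) (z : R[i]) : a%:C%C * (b%:C%C * z * d%:C%C) = (a * b * d)%:C%C * z.
  by case: z => x y; apply: complex_eqP => /=; ring.
by rewrite cm k1 mul1r.
Qed.

Lemma cmeasurable_fourier_approx n : @cmeasurable R _ borel3 (fourier (approx u n)).
Proof.
have -> : fourier (approx u n) = (fun w => cst3%:C%C * ckconv (scl n) (trunc u n) w).
  by apply/funext => w; exact: fourier_approx.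
apply: cmeasurableM; first exact: cmeasurable_cst.
by apply: cmeasurable_ckconv; exact: cmeasurable_trunc.
Qed.

End Approximation.

(** Continuous Hermitian functions with this decay are limits of transforms of
    test functions: regularise by truncation and convolution, and pass to the
    limit by dominated convergence. *)
Lemma mem_lqlpL2 (q : \bar R) (p : R) (u : R3 R -> R[i]) (C : R) : (1%:E <= q)%E -> 2 < p ->
  @cmeasurable R _ borel3 u -> (forall w, nc (u w) <= C * rho w) -> herm u -> wcont u ->
  lqlpL2 q p u.
Proof.
move=> q1 p2 mu_ uC hu wu; split => //.
  move=> m ab; have iS := integrable_scale (C ^+ 2) (@integrable_rho R).
  apply: (@le_lt_trans _ _ (\int[leb3]_(w in setT) (C ^+ 2 * rho w)%:E)%E).
    apply: (@le_trans _ _ (\int[leb3]_(w in setT) (nc (u w) ^+ 2)%:E)%E).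
      apply: ge0_subset_integral => //; first exact: measurable_Gamma.
        exact: measurable_nsq.
      by move=> w _; rewrite lee_fin sqr_ge0.
    apply: ge0_le_integral => //.
    - by move=> w _; rewrite lee_fin sqr_ge0.
    - exact: measurable_nsq.
    - exact: (measurable_int _ iS).
    move=> w _; rewrite lee_fin; apply: le_trans (wsq_rho (uC w)).
    by rewrite /wsq ler_peMl ?sqr_ge0// lerDl sqr_ge0.
  have := integrable_fin_num measurableT iS.
  by rewrite fin_numElt => /andP[].
move=> e e0; have [K K0 HK] := @ckconv_rho R.
have C0 : 0 <= C.
  have h : 0 <= C * rho (0 : R3 R) := le_trans (nc_ge0 _) (uC 0).
  by rewrite -(pmulr_lge0 _ (rho_gt0 (0 : R3 R))).
have kC : 0 <= `|kappa| * C by exact: mulr_ge0.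
have [N HN] : exists N, forall n, (N <= n)%N ->
    (lqlp_norm q p (fun w => u w - fourier (approx u n) w)%R < e%:E)%E.
  apply: (@lqlp_cvg0 _ q p _ (C + cst3 * (K * (`|kappa| * C)))) => //.
  - by move=> n; apply: cmeasurableB => //; exact: (cmeasurable_fourier_approx mu_ uC hu).
  - move=> n w; apply: (le_trans (ncB _ _)); rewrite mulrDl; apply: lerD => //.
    rewrite (fourier_approx mu_ uC hu) ncM nc_real ger0_norm ?cst3_ge0// -mulrA.
    apply: ler_wpM2l; first exact: cst3_ge0.
    apply: HK => //; [exact: scl_gt0|exact: scl_le1|exact: (cintegrable_trunc mu_ uC)|exact: trunc_le].
  - move=> w; have := ccvgB (ccvg_cst (u w)) (fourier_approx_cvg mu_ uC hu wu w).
    by rewrite subrr.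
exists (approx u N); split; first exact: (test_function_approx mu_ uC).
exact: HN.
Qed.
End Density.

(** * The Picard limit as a solution *)

Section IsSolution.
Context {R : realType}.
Let mu := @lebesgue_measure R.
Let T1 := measurableTypeR R.
Let T3 := @borel3 R.
Variables (q : \bar R) (p T X : R) (phi : R3 R -> R[i]) (u : R -> R3 R -> R[i]).
Hypothesis (q1 : (1%:E <= q)%E).
Hypothesis (p2 : 2 < p).
Hypothesis (T0 : 0 <= T).
Hypothesis (ju : jmeas u).
Hypothesis (bu : bdd T X u).

Lemma bdd_rho t w : `|t| <= T -> nc (u t w) <= X * rho w.
Proof.
move=> tT; apply: (le_trans (bu w tT)); apply: ler_wpM2l; first exact: (bdd_pos T0 bu).
by apply: wt_le_rho; rewrite subr_ge0.
Qed.

Lemma duhamel_integrable_bdd t w : `|t| <= T -> duhamel_integrable u t w.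
Proof.
move=> tT; split.
  apply: aeW => s st; have sT : `|s| <= T := le_trans (between0_le st) tT.
  have b0 : 0 <= T - `|s| by rewrite subr_ge0.
  exact: (fconv_int w b0 (jmeas_section s ju) (jmeas_section s ju)
    (fun v => bu v sT) (fun v => bu v sT)).
have mf : @cmeasurable R _ T1 (fun s => fconv (u s) (u s) w).
  have m : measurable_fun setT (fun s : T1 => (s, w) : T1 * T3) by apply: measurable_fun_pair.
  exact: (cmeasurable_comp (jmeas_fconv ju ju) m).
have fin : (mu (between0 t) < +oo)%E.
  rewrite /between0 /mu lebesgue_measure_itv/= lte_fin.
  by case: ifP => _; rewrite ?ltry// -EFinB ltry.
have mb := @measurable_between0 R t.
have ic : mu.-integrable (between0 t) (EFin \o cst (cfconv * X ^+ 2)).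
  apply/integrableP; split; first by apply/measurable_EFinP.
  by under eq_integral do rewrite /=; rewrite integral_cst// lte_mul_pinfty// lee_fin.
have fb s : between0 t s -> nc (fconv (u s) (u s) w) <= cfconv * X ^+ 2.
  move=> st; have sT : `|s| <= T := le_trans (between0_le st) tT.
  exact: (fconv_bound1 w T0 ju bu sT).
case: mf => m1 m2; split.
- apply: (le_integrable _ _ _ ic) => //.
    by apply/measurable_EFinP; apply: measurable_funTS.
  move=> s st; have h := le_trans (Re_le_nc (fconv (u s) (u s) w)) (fb s st).
  exact: (le_trans h (ler_norm _)).
- apply: (le_integrable _ _ _ ic) => //.
    by apply/measurable_EFinP; apply: measurable_funTS.
  move=> s st; have h := le_trans (Im_le_nc (fconv (u s) (u s) w)) (fb s st).
  exact: (le_trans h (ler_norm _)).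
Qed.

Hypothesis (wu : forall t, `|t| <= T -> wcont (u t) /\ herm (u t)).
Hypothesis (eu : forall t w, `|t| <= T -> u t w = free phi t w - duhamel u t w).

Lemma solution_tcont (x : nat -> R) t w : (forall n, `|x n| <= T) -> `|t| <= T ->
  x n @[n --> \oo] --> t -> ccvg (fun n => u (x n) w) (u t w).
Proof.
move=> xT tT xt; rewrite eu//.
have -> : (fun n => u (x n) w) = (fun n => free phi (x n) w - duhamel u (x n) w).
  by apply/funext => n; rewrite eu.
apply: ccvgB; last exact: (duhamel_tcont w T0 ju bu xT tT xt).
apply: ccvgM; last exact: ccvg_cst.
by apply: ccvg_expi; apply: cvgM => //; exact: cvg_cst.
Qed.

Lemma picard_is_solution : solution q p T phi u.
Proof.
have tTE t : - T <= t <= T -> `|t| <= T by rewrite ler_norml.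
split.
- move=> t /tTE tT; have [wut hut] := wu tT.
  by apply: (@mem_lqlpL2 _ q p _ X) => //; [exact: jmeas_section|move=> w; exact: bdd_rho].
- move=> t0 /tTE t0T e e0; apply: contrapT => H.
  have ex n : exists t, [/\ `|t| <= T, `|t - t0| < scl n & ~ (lqlp_norm q p (u t - u t0)%R < e%:E)%E].
    apply: contrapT => h; apply: H; exists (scl n); first exact: scl_gt0.
    move=> t /tTE tT tt0; apply: contrapT => h2; apply: h; exists t.
    by split.
  have [x hx] := choice ex.
  have xT n : `|x n| <= T by have [] := hx n.
  have xt : x n @[n --> \oo] --> t0.
    apply/cvgrPdist_lt => d d0; have /cvgrPdist_lt /(_ d d0)[N _ HN] := @scl_cvg R.
    exists N => // n /= Nn; have := HN n Nn; rewrite /= sub0r normrN ger0_norm ?(ltW (scl_gt0 _))//.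
    by apply: lt_trans; rewrite distrC; have [] := hx n.
  have [N HN] : exists N, forall n, (N <= n)%N ->
      (lqlp_norm q p (fun w => u (x n) w - u t0 w)%R < e%:E)%E.
    apply: (@lqlp_cvg0 _ q p _ (2 * X)) => //.
    + by move=> n; apply: cmeasurableB; exact: jmeas_section.
    + move=> n w; apply: (le_trans (ncB _ _)).
      by rewrite -mulrA mulr_natl mulr2n; apply: lerD; exact: bdd_rho.
    + move=> w; have := ccvgB (solution_tcont w xT t0T xt) (ccvg_cst (u t0 w)).
      by rewrite subrr.
  by have [_ _] := hx N; apply; exact: HN.
- move=> t /tTE tT; apply: aeW => w; split; first exact: duhamel_integrable_bdd.
  exact: eu.
Qed.

End IsSolution.

(** * Second-order Taylor coefficients *)

Section Taylor.
Context {R : realType}.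

Lemma is_derive_eps (f : R -> R) (x l : R) :
  (forall e : R, 0 < e -> exists2 d : R, 0 < d & forall h, `|h| < d ->
    `|f (x + h) - f x - h * l| <= e * `|h|) -> is_derive x (1 : R) f l.
Proof.
move=> H.
have c : h^-1 *: (f (h *: (1 : R) + x) - f x) @[h --> 0^'] --> l.
  apply/cvgrPdist_le => e e0; have [d d0 Hd] := H e e0.
  exists d => //= h; rewrite /ball_ /= sub0r normrN => hd hn.
  have E : l - h^-1 *: (f (h *: (1 : R) + x) - f x) = - (h^-1 * (f (x + h) - f x - h * l)).
    have -> : h *: (1 : R) + x = x + h by rewrite /GRing.scale/= mulr1 addrC.
    by rewrite /GRing.scale/=; field.
  rewrite E normrN normrM normfV ler_pdivrMl ?normr_gt0// [_ * e]mulrC; exact: Hd.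
by apply: DeriveDef; [apply/cvg_ex; exists l|exact: cvg_lim].
Qed.

(** The remainder of a twice differentiable function is controlled through the
    mean value theorem; comparing it at two points isolates the coefficient of
    the square. *)
Lemma taylor2_unique (G g : R -> R) (a1 a2 b d0 M : R) : 0 < d0 ->
  (forall x, `|x| < d0 -> is_derive x (1 : R) G (g x)) ->
  (forall e : R, 0 < e -> exists2 d : R, 0 < d & forall x, `|x| < d ->
    `|g x - g 0 - x * b| <= e * `|x|) ->
  (forall x, `|x| < d0 -> `|G x - (x * a1 + x ^+ 2 * a2)| <= M * `|x| ^+ 3) ->
  b = 2 * a2.
Proof.
move=> d00 dG dg GM.
have M0 : 0 <= M.
  have h : `|d0 / 2| < d0 by rewrite ger0_norm; lra.
  have := le_trans (normr_ge0 _) (GM _ h); rewrite pmulr_lge0// exprn_gt0//.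
  by rewrite ger0_norm; lra.
have G0 : G 0 = 0.
  have := GM 0; rewrite normr0 => /(_ d00).
  by rewrite mul0r !expr0n mul0r mulr0 addr0 subr0 normr_le0 => /eqP.
pose al := a1 - g 0; pose be := a2 - b / 2.
have key (e : R) : 0 < e -> exists2 d : R, 0 < d & forall x, 0 < x -> x < d ->
    `|al + x * be| <= e * x + M * x ^+ 2.
  move=> e0; have [d d0' Hd] := dg e e0.
  exists (Num.min d d0); first by rewrite lt_min d0'.
  move=> x x0; rewrite lt_min => /andP[xd xd0].
  pose H y := G y - (y * g 0 + y ^+ 2 * (b / 2)).
  have dH y : `|y| < d0 -> is_derive y (1 : R) H (g y - (g 0 + y * b)).
    move=> yd.
    have h1 := dG y yd.
    have h2 := is_deriveM (is_derive_id y (1:R)) (is_derive_cst (g 0) y (1:R)).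
    have h3 := is_deriveM (is_deriveX 2 (is_derive_id y (1:R))) (is_derive_cst (b / 2) y (1:R)).
    have h := is_deriveB h1 (is_deriveD h2 h3).
    by apply: (is_derive_eq h); rewrite /GRing.scale/=; field.
  have cH : {within `[0, x], continuous H}.
    apply: derivable_within_continuous => y; rewrite in_itv/= => /andP[y0 yx].
    have yd : `|y| < d0 by rewrite ger0_norm; lra.
    by have [] := dH y yd.
  have dH' y : y \in `]0, x[ -> is_derive y (1 : R) H (g y - (g 0 + y * b)).
    by rewrite in_itv/= => /andP[y0 yx]; apply: dH; rewrite ger0_norm; lra.
  have [c] := MVT x0 dH' cH; rewrite in_itv/= => /andP[c0 cx].
  have H0 : H 0 = 0 by rewrite /H G0; ring.
  rewrite H0 !subr0 => HE.
  have cn : `|c| < d by rewrite ger0_norm; lra.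
  have hc := Hd c cn; rewrite (ger0_norm (ltW c0)) in hc.
  have Hx : `|H x| <= e * x ^+ 2.
    rewrite HE normrM (ger0_norm (ltW x0)) expr2 mulrA; apply: ler_wpM2r; first exact: ltW.
    have -> : g c - (g 0 + c * b) = g c - g 0 - c * b by ring.
    by apply: (le_trans hc); rewrite ler_pM2l// ltW.
  have xn : `|x| < d0 by rewrite ger0_norm// ltW.
  have hG := GM x xn; rewrite (ger0_norm (ltW x0)) in hG.
  rewrite -(ler_pM2l x0).
  have -> : x * `|al + x * be| = `|x * (al + x * be)| by rewrite normrM (ger0_norm (ltW x0)).
  have -> : x * (al + x * be) = H x - (G x - (x * a1 + x ^+ 2 * a2)).
    by rewrite /H /al /be; field.
  apply: (le_trans (ler_normB _ _)).
  have -> : x * (e * x + M * x ^+ 2) = e * x ^+ 2 + M * x ^+ 3 by ring.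
  exact: lerD.
have be0 : be = 0.
  apply/eqP; rewrite -normr_le0; apply/ler_addgt0Pl => e e0.
  have e8 : 0 < e / 8 by lra.
  have [d d0' Hd] := key _ e8.
  pose x := Num.min (d / 2) (e / (8 * (M + 1))).
  have M1 : 0 < 8 * (M + 1) by lra.
  have x0 : 0 < x by rewrite lt_min; apply/andP; split; [lra|exact: divr_gt0].
  have xd : x < d by rewrite gt_min; apply/orP; left; lra.
  have xM : M * x <= e / 8.
    have h : x <= e / (8 * (M + 1)) by rewrite ge_min lexx orbT.
    apply: (@le_trans _ _ (M * (e / (8 * (M + 1))))); first exact: ler_wpM2l.
    rewrite mulrA ler_pdivrMr//; nra.
  have h1 := Hd x x0 xd.
  have x2 : 0 < x / 2 by lra.
  have x2d : x / 2 < d by lra.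
  have h2 := Hd (x / 2) x2 x2d.
  have t := ler_normB (al + x * be) (al + x / 2 * be).
  have E : al + x * be - (al + x / 2 * be) = x / 2 * be by field.
  rewrite E normrM (gtr0_norm x2) in t.
  rewrite addr0 -(ler_pM2l x2).
  apply: (le_trans t); apply: (le_trans (lerD h1 h2)).
  nra.
by move/eqP: be0; rewrite subr_eq0 => /eqP ->; field.
Qed.
End Taylor.

(** * Functionals supported in a cell *)

Section Functional.
Context {R : realType}.
Let T1 := measurableTypeR R.
Let T3 := @borel3 R.
Variables (m : int) (ab : int * int).
Let G0 : set (R3 R) := Gamma m ab.

Lemma eqlee (x y : \bar R) : x = y -> (x <= y)%E. Proof. by move=> ->. Qed.

(** The functions to which a functional supported in the cell applies; all
    members of the space belong to it. *)
Definition locL2 (g : R3 R -> R[i]) : Prop :=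
  @cmeasurable R _ borel3 g /\ (nsq (cut (Gamma m ab) g) < +oo)%E.

Lemma lqlpL2_locL2 q p g : lqlpL2 q p g -> locL2 g.
Proof.
move=> [mg /(_ m ab) h _]; split => //; apply: le_lt_trans h.
rewrite [leRHS]integral_mkcond /nsq; apply: ge0_le_integral => //.
- by move=> w _; rewrite lee_fin sqr_ge0.
- by apply: measurable_nsq; apply: cmeasurable_cut => //; exact: measurable_Gamma.
- apply/(measurable_restrict _ (measurable_Gamma m ab) measurableT); rewrite setTI.
  by apply: measurable_funTS; exact: measurable_nsq.
move=> w _; rewrite /patch; have [/set_mem h|/negP h] := boolP (w \in Gamma m ab).
  by rewrite cut_in.
by rewrite cut_out ?nc0 ?expr0n// => h2; apply: h; exact: mem_set.
Qed.

(** Cells are bounded sets. *)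
Lemma Gamma_rho : exists2 C : R, 0 <= C & forall w, G0 w -> 1 <= C * rho w.
Proof.
have d0 := @dyad_gt0 R m.
pose B (a : int) : R := 2 * dyad m * (dyad m * `|a%:~R| + dyad m / 2).
pose C : R := (1 + (2 * dyad m) ^+ 2) * ((1 + B ab.1 ^+ 2) * (1 + B ab.2 ^+ 2)).
have p (x : R) : 0 < 1 + x ^+ 2 by rewrite ltr_wpDr// sqr_ge0.
have C0 : 0 < C by apply: mulr_gt0; [exact: p|apply: mulr_gt0; exact: p].
exists C; first exact: ltW.
move=> w [/andP[w1 w2] wm].
have hc (x b : R) : `|x| <= b -> (1 + b ^+ 2)^-1 <= cauchy x.
  move=> xb; rewrite /cauchy lef_pV2 ?posrE//; apply: lerD => //.
  rewrite -(real_normK (num_real x)); apply: lerXn2r; rewrite ?nnegrE//.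
  exact: le_trans (normr_ge0 x) xb.
have xi0 : 0 < `|w.1| := lt_le_trans d0 w1.
have he (x : R) (a : int) : `|x / w.1 - dyad m * a%:~R| <= dyad m / 2 -> `|x| <= B a.
  move=> h; have : `|x / w.1| <= dyad m * `|a%:~R| + dyad m / 2.
    have -> : x / w.1 = (x / w.1 - dyad m * a%:~R) + dyad m * a%:~R by rewrite subrK.
    apply: (le_trans (ler_normD _ _)); rewrite [leRHS]addrC; apply: lerD => //.
    by rewrite normrM gtr0_norm.
  rewrite normrM normfV ler_pdivrMr// => h2; apply: (le_trans h2); rewrite /B mulrC.
  apply: ler_wpM2r; last exact: ltW.
  by apply: addr_ge0; [apply: mulr_ge0 => //; exact: ltW|apply: divr_ge0 => //; exact: ltW].
move: wm; rewrite ge_max => /andP[h1 h2].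
have k1 := hc _ _ (ltW w2); have k2 := hc _ _ (he _ _ h1); have k3 := hc _ _ (he _ _ h2).
have -> : (1 : R) = C * ((1 + (2 * dyad m) ^+ 2)^-1 * ((1 + B ab.1 ^+ 2)^-1 * (1 + B ab.2 ^+ 2)^-1)).
  rewrite /C -!invfM divff// gt_eqF//.
apply: ler_wpM2l; first exact: ltW.
have v (x : R) : 0 <= (1 + x ^+ 2)^-1 by rewrite invr_ge0 ltW.
apply: ler_pM => //; first by apply: mulr_ge0; exact: v.
by apply: ler_pM.
Qed.

(** Cauchy-Schwarz on a bounded set, in the form [x <= 1 + x^2]. *)
Lemma locL2_integrable g : locL2 g -> cintegrable leb3 setT (cut G0 g).
Proof.
move=> [mg fg]; have [C C0 HC] := Gamma_rho.
have mc := cmeasurable_cut (measurable_Gamma m ab) mg.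
have i1 := integrable_scale C (@integrable_rho R).
have i2 : leb3.-integrable setT (EFin \o (fun w => nc (cut G0 g w) ^+ 2)).
  apply/integrableP; split; first exact: measurable_nsq.
  apply: le_lt_trans fg; apply: eqlee; apply: eq_integral => w _.
  by rewrite /= ger0_norm ?sqr_ge0.
apply: (cintegrable_dom mc (integrableD measurableT i1 i2)).
move=> w; have [h|h] := pselect (G0 w); last first.
  by rewrite cut_out// nc0 expr0n addr0; apply: mulr_ge0 => //; exact: rho_ge0.
have := HC w h; have := nc_ge0 (cut G0 g w); set x := nc _; set y := C * rho w.
move=> x0 y1; have := sqr_ge0 (x - 1); nra.
Qed.

Lemma cutB g h w : cut G0 (g - h) w = cut G0 g w - cut G0 h w.
Proof. exact: mulrBr. Qed.

Lemma locL2B g h : locL2 g -> locL2 h -> locL2 (g - h).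
Proof.
move=> [mg fg] [mh fh]; split; first exact: cmeasurableB.
have mG := measurable_Gamma m ab.
apply: (@le_lt_trans _ _ (2%:E * nsq (cut G0 g) + 2%:E * nsq (cut G0 h))%E); last first.
  by apply: lte_add_pinfty; apply: lte_mul_pinfty.
have Z f : @cmeasurable R _ borel3 f -> (2%:E * nsq (cut G0 f) =
    \int[leb3]_w (2%:E * (nc (cut G0 f w) ^+ 2)%:E))%E.
  move=> mf; rewrite /nsq -ge0_integralZl//.
  - by apply: measurable_nsq; exact: cmeasurable_cut.
  - by move=> w _; rewrite lee_fin sqr_ge0.
rewrite !Z//.
have m2 f : @cmeasurable R _ borel3 f -> measurable_fun setT
    (fun w : T3 => 2%:E * (nc (cut G0 f w) ^+ 2)%:E : \bar R)%E.
  by move=> mf; apply: measurable_funeM; apply: measurable_nsq; exact: cmeasurable_cut.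
rewrite -ge0_integralD//; last 4 first.
- by move=> w _; rewrite -EFinM lee_fin mulr_ge0 ?sqr_ge0.
- exact: m2.
- by move=> w _; rewrite -EFinM lee_fin mulr_ge0 ?sqr_ge0.
- exact: m2.
apply: ge0_le_integral => //.
- by move=> w _; rewrite lee_fin sqr_ge0.
- by apply: measurable_nsq; apply: cmeasurable_cut => //; exact: cmeasurableB.
- by apply: emeasurable_funD; exact: m2.
move=> w _; rewrite -!EFinM -EFinD lee_fin cutB.
have := ncB (cut G0 g w) (cut G0 h w); have := nc_ge0 (cut G0 g w - cut G0 h w).
set x := nc (_ - _); set y := nc (cut G0 g w); set z := nc (cut G0 h w) => x0 xyz.
have h1 : x ^+ 2 <= (y + z) ^+ 2 by apply: lerXn2r; rewrite ?nnegrE//; exact: le_trans x0 xyz.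
have := sqr_ge0 (y - z); nra.
Qed.

Lemma locL2_scale (a : R) g : locL2 g -> locL2 (rscale a g).
Proof.
move=> [mg fg]; split; first by apply: cmeasurableM => //; exact: cmeasurable_cst.
have mG := measurable_Gamma m ab.
have -> : nsq (cut G0 (rscale a g)) = ((a ^+ 2)%:E * nsq (cut G0 g))%E.
  rewrite /nsq -ge0_integralZl//.
  - apply: eq_integral => w _; rewrite -EFinM /cut /rscale !ncM !nc_real !exprMn.
    by rewrite mulrCA real_normK ?num_real.
  - by apply: measurable_nsq; exact: cmeasurable_cut.
  - by move=> w _; rewrite lee_fin sqr_ge0.
  - by rewrite lee_fin sqr_ge0.
by apply: lte_mul_pinfty => //; rewrite lee_fin sqr_ge0.
Qed.

Variables (Phi : R3 R -> R[i]) (M K : R).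
Hypothesis (iP : cintegrable leb3 setT Phi).
Hypothesis (PM : forall v, nc (Phi v) <= M).
Hypothesis (wP : wcont Phi).
Hypothesis (sP : forall w, ~ G0 w -> Phi w = 0).
Hypothesis (K0 : 0 <= K).
Hypothesis (KP : (nsq Phi <= (K ^+ 2)%:E)%E).

(** The pairing whose boundedness on the space is inherited from one cell
    norm. *)
Definition ell (g : R3 R -> R[i]) : R[i] := cintegral leb3 setT (fun w => g w * (Phi w)^*%C).

Lemma cut_Phi g w : g w * (Phi w)^*%C = cut G0 g w * (Phi w)^*%C.
Proof.
have [h|h] := pselect (G0 w); first by rewrite cut_in.
by rewrite sP// conj_real !mulr0.
Qed.

Lemma ell_integrable g : locL2 g -> cintegrable leb3 setT (fun w => g w * (Phi w)^*%C).
Proof.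
move=> lg; have ig := locL2_integrable lg.
have M0 : 0 <= M := le_trans (nc_ge0 _) (PM 0).
apply: (cintegrable_dom _ (integrable_scale M (cintegrable_nc ig))).
  apply: cmeasurableM; first exact: lg.1.
  by apply: cmeasurable_conj; exact: (cintegrable_meas iP).
move=> w; rewrite cut_Phi ncM nc_conj mulrC; apply: ler_wpM2r => //; exact: nc_ge0.
Qed.

Lemma ellB g h : locL2 g -> locL2 h -> ell (g - h) = ell g - ell h.
Proof.
move=> lg lh; rewrite /ell -cintegralB; [|exact: ell_integrable|exact: ell_integrable].
by congr (cintegral _ _ _); apply/funext => w; rewrite -mulrBl.
Qed.

Lemma ellZ (a : R) g : locL2 g -> ell (rscale a g) = a%:C%C * ell g.
Proof.
move=> lg; rewrite /ell -cintegralZ; last exact: ell_integrable.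
by congr (cintegral _ _ _); apply/funext => w; rewrite /rscale mulrA.
Qed.

Definition cell0 : R := 2 * Num.sqrt cplan / (`|ckint| * cst3).

Lemma cell0_ge0 : 0 <= cell0.
Proof. by apply: divr_ge0; apply: mulr_ge0 => //; exact: cst3_ge0. Qed.

Lemma ell_le (q : \bar R) (p : R) g : (1%:E <= q)%E -> 2 < p -> locL2 g ->
  ((nc (ell g))%:E <= (cell0 * (dyad m `^ (- 2^-1)) * K)%:E * lqlp_norm q p g)%E.
Proof.
move=> q1 p2 lg; have ig := locL2_integrable lg.
have := duality ig iP PM wP K0 KP.
have -> : cintegral leb3 setT (fun w => cut G0 g w * (Phi w)^*%C) = ell g.
  by congr (cintegral _ _ _); apply/funext => w; rewrite -cut_Phi.
have k0 : 0 < `|@ckint R| by rewrite normr_gt0 ckint_neq0.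
have c0 : 0 < @cst3 R := cst3_gt0.
have d0 : 0 < dyad m `^ 2^-1 :> R by rewrite powR_gt0// dyad_gt0.
have h1 := @cell_le_lqlp R q p g m ab q1 p2.
rewrite (cell_normE ig) in h1.
set r := nrm2 _ in h1 *; set N := lqlp_norm q p g in h1 *.
have r0 : (0 <= r)%E by exact: Lnorm_ge0.
have h2 : (r <= (cst3^-1 * (dyad m `^ 2^-1)^-1)%:E * N)%E.
  by rewrite -invfM lee_pdivlMl ?mulr_gt0// mulrC EFinM -muleA.
move=> h; rewrite EFinM -lee_pdivlMl// in h; apply: (le_trans h).
have S0 : 0 <= 2 * (Num.sqrt (@cplan R) * K) by rewrite mulr_ge0// mulr_ge0// sqrtr_ge0.
have h3 : ((2 * (Num.sqrt (@cplan R) * K))%:E * r <= (2 * (Num.sqrt cplan * K))%:E *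
   ((cst3^-1 * (dyad m `^ 2^-1)^-1)%:E * N))%E by apply: lee_wpmul2l; rewrite ?lee_fin.
apply: (@le_trans _ _ (`|@ckint R|^-1%:E * ((2 * (Num.sqrt cplan * K))%:E *
   ((cst3^-1 * (dyad m `^ 2^-1)^-1)%:E * N)))%E).
  by apply: lee_wpmul2l => //; rewrite lee_fin invr_ge0 ltW.
rewrite !muleA -!EFinM; apply: eqlee; congr (_%:E * _)%E.
rewrite /cell0 powRN invfM; move: (@ckint R) (@cst3 R) (Num.sqrt cplan) (dyad m `^ _) => a b c d.
by ring.
Qed.

End Functional.

(** * Second-order expansion of the solution *)

Section Expansion.
Context {R : realType}.
Let mu := @lebesgue_measure R.
Let T1 := measurableTypeR R.
Let T3 := @borel3 R.

Lemma sub_subr (x y z : R[i]) : x - y = x - z - (y - z).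
Proof. by rewrite opprB addrA subrK. Qed.

Lemma duhamel_scale (T X a : R) (U : R -> R3 R -> R[i]) t w : 0 <= T -> jmeas U -> bdd T X U ->
  `|t| <= T -> duhamel (fun s v => a%:C%C * U s v) t w = (a ^+ 2)%:C%C * duhamel U t w.
Proof.
move=> T0 jU bU tT; rewrite !duhamelE [RHS]mulrCA; congr (_ * _).
rewrite -cintegralZ; last exact: (duh_cintegrable w T0 jU bU tT).
congr (cintegral _ _ _); apply/funext => s.
rewrite indicE; have [/set_mem st|_] := boolP (s \in between0 t); last by rewrite !mul0r mulr0.
have sT : `|s| <= T := le_trans (between0_le st) tT.
have b0 : 0 <= T - `|s| by rewrite subr_ge0.
rewrite /duh_integrand.
have -> : fconv (fun v => a%:C%C * U s v) (fun v => a%:C%C * U s v) w = (a ^+ 2)%:C%C * fconv (U s) (U s) w.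
  rewrite /fconv [RHS]mulrCA; congr (_ * _); rewrite -cintegralZ; last first.
    exact: (fconv_int w b0 (jmeas_section s jU) (jmeas_section s jU) (fun v => bU s v sT) (fun v => bU s v sT)).
  congr (cintegral _ _ _); apply/funext => v.
  by move: (U s v) (U s (w - v)) => [x y] [x' y']; apply: complex_eqP => /=; ring.
move: (expi _) (fconv _ _ _) => x y; move: ('i%C * _) => z.
by rewrite !mul1r [RHS]mulrCA.
Qed.

Lemma rho_locL2 m ab (g : R3 R -> R[i]) (C : R) : @cmeasurable R _ borel3 g ->
  (forall w, nc (g w) <= C * rho w) -> locL2 m ab g.
Proof.
move=> mg gC; split => //.
have iS := integrable_scale (C ^+ 2) (@integrable_rho R).
have := integrable_fin_num measurableT iS; rewrite fin_numElt => /andP[_].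
apply: le_lt_trans; apply: ge0_le_integral => //.
- by move=> w _; rewrite lee_fin sqr_ge0.
- by apply: measurable_nsq; apply: cmeasurable_cut => //; exact: measurable_Gamma.
- exact: (measurable_int _ iS).
move=> w _; rewrite lee_fin; apply: le_trans (wsq_rho (gC w)).
apply: (@le_trans _ _ (nc (g w) ^+ 2)).
  by apply: lerXn2r; rewrite ?nnegrE ?nc_ge0// nc_cut_le.
by rewrite /wsq ler_peMl ?sqr_ge0// lerDl sqr_ge0.
Qed.

Lemma ae_imp (P Q : R3 R -> Prop) : (forall w, P w -> Q w) ->
  {ae @leb3 R, forall w, P w} -> {ae @leb3 R, forall w, Q w}.
Proof. by move=> PQ; apply: negligibleS => w /= nQ Pw; apply: nQ; exact: PQ. Qed.

Lemma aeeq_Rintegral (f g : R3 R -> R) : measurable_fun setT (f : T3 -> T1) ->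
  measurable_fun setT (g : T3 -> T1) -> {ae leb3, forall w, f w = g w} ->
  \int[leb3]_w f w = \int[leb3]_w g w.
Proof.
move=> mf mg fg; rewrite /Rintegral; congr fine; apply: ae_eq_integral => //.
- exact/measurable_EFinP.
- exact/measurable_EFinP.
by apply: ae_imp fg => w h _; rewrite /= h.
Qed.

Lemma aeeq_ell (Phi g h : R3 R -> R[i]) : @cmeasurable R _ borel3 Phi ->
  @cmeasurable R _ borel3 g -> @cmeasurable R _ borel3 h -> aeeq g h -> ell Phi g = ell Phi h.
Proof.
move=> mP mg mh gh.
have [mg1 mg2] : @cmeasurable R _ borel3 (fun w => g w * (Phi w)^*%C).
  by apply: cmeasurableM => //; exact: cmeasurable_conj.
have [mh1 mh2] : @cmeasurable R _ borel3 (fun w => h w * (Phi w)^*%C).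
  by apply: cmeasurableM => //; exact: cmeasurable_conj.
apply: complex_eqP => /=; apply: aeeq_Rintegral => //;
  by apply: ae_imp gh => w ->.
Qed.

Variables (T X : R) (phi : R3 R -> R[i]).
Hypothesis (T0 : 0 <= T).
Hypothesis (mphi : @cmeasurable R _ borel3 phi).
Hypothesis (X0 : 0 <= X).
Hypothesis (phiX : forall w, nc (phi w) <= X * wt T w).
Hypothesis (wphi : wcont phi).
Hypothesis (phi0 : forall w, w.1 = 0 -> phi w = 0).
Hypothesis (hphi : herm phi).

Let phirho w : nc (phi w) <= X * rho w.
Proof. by apply: (le_trans (phiX w)); apply: ler_wpM2l => //; exact: wt_le_rho. Qed.

Lemma nc_rscale a w : nc (rscale a phi w) = `|a| * nc (phi w).
Proof. by rewrite /rscale ncM nc_real. Qed.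

Lemma rscale_le a w : nc (rscale a phi w) <= `|a| * X * wt T w.
Proof. by rewrite nc_rscale -mulrA; apply: ler_wpM2l. Qed.

Lemma rscale_rho a w : nc (rscale a phi w) <= `|a| * X * rho w.
Proof. by rewrite nc_rscale -mulrA; apply: ler_wpM2l. Qed.

Lemma cmeasurable_rscale a : @cmeasurable R _ borel3 (rscale a phi).
Proof. by apply: cmeasurableM => //; exact: cmeasurable_cst. Qed.

Lemma wcont_rscale a : wcont (rscale a phi).
Proof. by move=> w x xw; apply: ccvgM; [exact: ccvg_cst|exact: wphi]. Qed.

Lemma herm_rscale a : herm (rscale a phi).
Proof. by move=> w; rewrite /rscale conjM conj_real hphi. Qed.

Lemma free_rscale a t w : free (rscale a phi) t w = a%:C%C * free phi t w.
Proof. by rewrite /free /rscale mulrCA. Qed.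

Lemma rscale_mem q p a : (1%:E <= q)%E -> 2 < p -> lqlpL2 q p (rscale a phi).
Proof.
move=> q1 p2; apply: (mem_lqlpL2 q1 p2 (cmeasurable_rscale a) (rscale_rho a)).
  exact: herm_rscale.
exact: wcont_rscale.
Qed.

Variables (m : int) (ab : int * int) (Phi : R3 R -> R[i]) (M : R).
Hypothesis (iP : cintegrable leb3 setT Phi).
Hypothesis (PM : forall v, nc (Phi v) <= M).
Hypothesis (sP : forall w, ~ Gamma m ab w -> Phi w = 0).

Lemma ell_rho (g : R3 R -> R[i]) (C : R) : @cmeasurable R _ borel3 g ->
  (forall w, nc (g w) <= C * rho w) -> nc (ell Phi g) <= 2 * (C * M * irho).
Proof.
move=> mg gC; rewrite /irho -(RintegralZl _ measurableT integrable_rho).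
apply: cintegral_le.
- by apply: cmeasurableM => //; apply: cmeasurable_conj; exact: (cintegrable_meas iP).
- exact: (integrable_scale (C * M) integrable_rho).
move=> w; rewrite ncM nc_conj mulrAC; apply: ler_pM => //; exact: nc_ge0.
Qed.

(** The solution differs from its free part by [O(a^2)], so replacing it by the
    free part in the quadratic term costs [O(a^3)]. *)
Lemma picard_expansion t : `|t| <= T -> exists2 M3 : R, 0 <= M3 &
  forall a u, jmeas u -> bdd T (2 * (`|a| * X)) u ->
  (forall s w, `|s| <= T -> u s w = free (rscale a phi) s w - duhamel u s w) ->
  nc (ell Phi (u t) - (a%:C%C * ell Phi (free phi t) - (a ^+ 2)%:C%C * ell Phi (duhamel (free phi) t)))
   <= M3 * `|a| ^+ 3.
Proof.
move=> tT; have cd := ltW (@cduh_gt0 R).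
have M0 : 0 <= M := le_trans (nc_ge0 _) (PM 0).
have i0 : 0 <= (irho : R) by apply: Rintegral_ge0 => w _; exact: rho_ge0.
exists (24 * cduh ^+ 2 * X ^+ 3 * M * irho).
  by do 4 (apply: mulr_ge0 => //); rewrite ?exprn_ge0// sqr_ge0.
move=> a u ju bu eu.
have jf := jmeas_free mphi.
have bf : bdd T X (free phi) by exact: bdd_free.
have jv := jmeas_free (cmeasurable_rscale a).
have aX0 : 0 <= `|a| * X by exact: mulr_ge0.
have bv : bdd T (`|a| * X) (free (rscale a phi)).
  by apply: bdd_free => //; exact: rscale_le.
have bd : bdd T (cduh * (2 * (`|a| * X)) ^+ 2) (fun s w => u s w - free (rscale a phi) s w).
  move=> s w sT; rewrite eu// addrAC subrr add0r ncN.
  exact: (duh_bound w T0 ju bu sT).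
pose E w := duhamel u t w - duhamel (free (rscale a phi)) t w.
have dj U (jU : jmeas U) : @cmeasurable R _ borel3 (duhamel U t) := jmeas_section t (jmeas_duhamel jU).
have mE : @cmeasurable R _ borel3 E by apply: cmeasurableB; exact: dj.
have Eb w : nc (E w) <= 12 * cduh ^+ 2 * X ^+ 3 * `|a| ^+ 3 * rho w.
  apply: (le_trans (duh_diff w T0 ju jv bu bv bd tT)).
  have -> : cduh * ((2 * (`|a| * X) + `|a| * X) * (cduh * (2 * (`|a| * X)) ^+ 2)) =
    12 * cduh ^+ 2 * X ^+ 3 * `|a| ^+ 3 by move: (@cduh R) => c; ring.
  apply: ler_wpM2l; last by apply: wt_le_rho; rewrite subr_ge0.
  by do 3 (apply: mulr_ge0 => //); rewrite ?exprn_ge0// sqr_ge0.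
have wr U Y : bdd T Y U -> forall w, nc (U t w) <= Y * rho w.
  move=> bU w; apply: (le_trans (bU t w tT)); apply: ler_wpM2l; first exact: (bdd_pos T0 bU).
  by apply: wt_le_rho; rewrite subr_ge0.
have dr U Y w : jmeas U -> bdd T Y U -> nc (duhamel U t w) <= cduh * Y ^+ 2 * rho w.
  move=> jU bU; apply: (le_trans (duh_bound w T0 jU bU tT)); apply: ler_wpM2l.
    by apply: mulr_ge0 => //; exact: sqr_ge0.
  by apply: wt_le_rho; rewrite subr_ge0.
have l1 : locL2 m ab (free phi t) := rho_locL2 m ab (jmeas_section t jf) (wr _ _ bf).
have l2 : locL2 m ab (duhamel (free phi) t) := rho_locL2 m ab (dj _ jf) (fun w => dr _ _ w jf bf).
have l3 : locL2 m ab E := rho_locL2 m ab mE Eb.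
have -> : u t = rscale a (free phi t) - rscale (a ^+ 2) (duhamel (free phi) t) - E.
  apply/funext => w; rewrite eu// -[RHS]/(rscale a (free phi t) w - rscale (a ^+ 2) (duhamel (free phi) t) w - E w).
  rewrite /E /rscale -(duhamel_scale a w T0 jf bf tT) free_rscale.
  have -> : free (rscale a phi) = (fun s v => a%:C%C * free phi s v).
    by apply/funext => s; apply/funext => v; exact: free_rscale.
  exact: sub_subr.
have ls1 := locL2_scale a l1; have ls2 := locL2_scale (a ^+ 2) l2.
rewrite (ellB iP PM sP (locL2B ls1 ls2) l3) (ellB iP PM sP ls1 ls2).
rewrite (ellZ iP PM sP a l1) (ellZ iP PM sP (a ^+ 2) l2) addrAC subrr add0r ncN.
apply: (le_trans (ell_rho mE Eb)); apply: eqle.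
by move: (@cduh R) (irho : R) => c i; ring.
Qed.

End Expansion.

(** * The second derivative of the flow map *)

Lemma Im_comb {R : realType} (x y : R) (z a b : R[i]) :
  complex.Im (z - (x%:C%C * a - y%:C%C * b)) =
  complex.Im z - (x * complex.Im a - y * complex.Im b).
Proof. by case: z a b => [z1 z2] [a1 a2] [b1 b2] /=; ring. Qed.

Section SecondOrder.
Context {R : realType}.
Let T1 := measurableTypeR R.
Let T3 := @borel3 R.
Variables (q : \bar R) (p T eps : R).
Hypothesis (q1 : (1%:E <= q)%E).
Hypothesis (p2 : 2 < p).
Hypothesis (T0 : 0 < T).
Hypothesis (eps0 : 0 < eps).
Hypothesis (hwp : uniquely_solvable q p T eps).
Variables (F : R -> (R3 R -> R[i]) -> (R3 R -> R[i])).
Hypothesis (hF : flow_map q p T eps F).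
Variable (t : R).
Hypothesis (tT : - T <= t <= T).

Local Notation N := (lqlp_norm q p).
Local Notation V := (lqlpL2 q p).

Lemma lqlp_ge0 g : (0 <= N g)%E.
Proof.
apply: (le_trans _ (@cell_le_lqlp R q p g 0 (0, 0) q1 p2)).
by apply: mule_ge0; [rewrite lee_fin powR_ge0|exact: cell_norm_ge0].
Qed.

Section Direction.
Variables (X : R) (phi : R3 R -> R[i]).
Hypothesis (mphi : @cmeasurable R _ borel3 phi).
Hypothesis (X0 : 0 < X).
Hypothesis (phiX : forall w, nc (phi w) <= X * wt T w).
Hypothesis (wphi : wcont phi).
Hypothesis (phi0 : forall w, w.1 = 0 -> phi w = 0).
Hypothesis (hphi : herm phi).
Variables (m : int) (ab : int * int) (Phi : R3 R -> R[i]) (M K : R).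
Hypothesis (iP : cintegrable leb3 setT Phi).
Hypothesis (PM : forall v, nc (Phi v) <= M).
Hypothesis (wP : wcont Phi).
Hypothesis (sP : forall w, ~ Gamma m ab w -> Phi w = 0).
Hypothesis (K0 : 0 <= K).
Hypothesis (KP : (nsq Phi <= (K ^+ 2)%:E)%E).

Let cl : R := cell0 * (dyad m `^ (- 2^-1)) * K.

Let cl0 : 0 <= cl.
Proof. by apply: mulr_ge0 => //; apply: mulr_ge0; [exact: cell0_ge0|exact: powR_ge0]. Qed.

Let mP : @cmeasurable R _ borel3 Phi. Proof. exact: (cintegrable_meas iP). Qed.

Let ell_real g c : locL2 m ab g -> (N g <= c%:E)%E -> nc (ell Phi g) <= cl * c.
Proof.
move=> lg Ng; rewrite -lee_fin EFinM.
apply: (le_trans (ell_le iP PM wP sP K0 KP q1 p2 lg)).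
by apply: lee_wpmul2l; rewrite ?lee_fin.
Qed.

Let mem a : V (rscale a phi). 
Proof. by apply: (@rscale_mem _ T X) => //; exact: ltW. Qed.

Let addE a b : rscale a phi + rscale b phi = rscale (a + b) phi.
Proof.
by apply/funext => w; rewrite /rscale rmorphD/= mulrDl.
Qed.

Let locV g : V g -> locL2 m ab g. Proof. exact: lqlpL2_locL2. Qed.

Let ell_linear L : real_linear V N L -> (forall g, V g -> V (L g)) ->
  forall a, ell Phi (L (rscale a phi)) = a%:C%C * ell Phi (L phi).
Proof.
move=> lin VL.
have Vphi : V phi.
  by have := mem 1; congr (V _); apply/funext => w; rewrite /rscale mul1r.
have V0 : V (0 : R3 R -> R[i]).
  by have := mem 0; congr (V _); apply/funext => w; rewrite /rscale mul0r.
have key a g h : V g -> V h -> V (rscale a g + h) ->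
    ell Phi (L (rscale a g + h)) = a%:C%C * ell Phi (L g) + ell Phi (L h).
  move=> Vg Vh Vs; have H := lin a g h Vg Vh.
  have l1 := locV (VL _ Vs); have l2 := locL2_scale a (locV (VL _ Vg)); have l3 := locV (VL _ Vh).
  have E : L (rscale a g + h) - (rscale a (L g) + L h) = L (rscale a g + h) - rscale a (L g) - L h.
    by rewrite opprD addrA.
  have l4 := locL2B (locL2B l1 l2) l3; rewrite E in H.
  have := ell_real l4 (eqlee H); rewrite mulr0 => h0.
  have /nc_eq0 : nc (ell Phi (L (rscale a g + h) - rscale a (L g) - L h)) = 0.
    by apply/eqP; rewrite eq_le h0 nc_ge0.
  rewrite (ellB iP PM sP (locL2B l1 l2) l3) (ellB iP PM sP l1 l2) (ellZ iP PM sP a (locV (VL _ Vg))).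
  by move=> /eqP; rewrite subr_eq0 => /eqP <-; rewrite [RHS]addrC subrK.
have z0 : rscale 1 (0 : R3 R -> R[i]) + 0 = 0.
  by apply/funext => w; rewrite /rscale -[LHS]/(1%:C%C * 0 + 0 : R[i]) mulr0 addr0.
have L0 : ell Phi (L 0) = 0.
  have := key 1 0 0 V0 V0; rewrite z0 => /(_ V0).
  rewrite mul1r -[X in X = _ -> _]addr0 => /addrI h; by rewrite -h.
move=> a; have := key a phi 0 Vphi V0; rewrite L0 !addr0.
by apply; exact: mem.
Qed.

(** The second derivative at [0] in a direction [phi] is twice the quadratic
    term of the expansion; testing it against a functional bounds the latter. *)
Lemma second_order (DF B : (R3 R -> R[i]) -> (R3 R -> R[i]) -> (R3 R -> R[i]))
    (r CB nu : R) : 0 < r ->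
  (forall u, V u -> (N u < r%:E)%E -> frechet_derivative_at V N (F t) u (DF u)) ->
  (forall u, V u -> bounded_linear V N (B u)) ->
  (forall v, V v -> real_linear V N (fun u => B u v)) ->
  (forall u v, V u -> V v -> (N (B u v) <= CB%:E * (N u * N v))%E) ->
  (forall e : R, 0 < e -> exists2 d : R, 0 < d & forall u v, V u -> V v -> (N u < d%:E)%E ->
     (N (DF u v - DF (0%R : R3 R -> R[i]) v - B u v)%R <= e%:E * (N u * N v))%E) ->
  0 <= nu -> (N phi <= nu%:E)%E ->
  `|complex.Im (ell Phi (duhamel (free phi) t))| <= cl * (`|CB| * nu ^+ 2).
Proof.
move=> r0 hDF hB lB bB hDB nu0 Nphi.
have T0' := ltW T0; have tT' : `|t| <= T by rewrite ler_norml.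
have p1 : rscale 1 phi = phi by apply/funext => w; rewrite /rscale mul1r.
have Vphi : V phi by rewrite -p1; exact: mem.
have [Cn Cn0 HCn] := @lqlp_rho R q p q1 p2.
pose c1 : R := Cn * X + 1.
have c1_gt0 : 0 < c1 by apply: ltr_wpDl => //; apply: mulr_ge0 => //; exact: ltW.
have Ns a : (N (rscale a phi) <= (c1 * `|a|)%:E)%E.
  apply: (le_trans (HCn _ (`|a| * X) (cmeasurable_rscale mphi a) _)).
    by move=> w; apply: (@rscale_rho _ T X) => //; exact: ltW.
  rewrite lee_fin /c1 mulrDl mul1r [`|a| * X]mulrC mulrA.
  by rewrite lerDl.
have cd := @cduh_gt0 R.
(* amplitudes for which the iteration converges inside the ball *)
pose d0 : R := Num.min (1 / (8 * cduh * X)) (Num.min (eps / c1) (r / c1)).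
have d0_gt0 : 0 < d0.
  have h : 0 < 8 * cduh * X by apply: mulr_gt0 => //; apply: mulr_gt0.
  by rewrite !lt_min; apply/and3P; split; exact: divr_gt0.
have Nlt a (c : R) : 0 < c -> `|a| < c / c1 -> (N (rscale a phi) < c%:E)%E.
  move=> c0; rewrite ltr_pdivlMr// => h; apply: (le_lt_trans (Ns a)).
  by rewrite lte_fin mulrC.
have ball a : `|a| < d0 -> Defs.ball0 q p eps (rscale a phi).
  rewrite !lt_min => /and3P[_ h _]; split; first exact: mem.
  exact: Nlt.
have inr a : `|a| < d0 -> (N (rscale a phi) < r%:E)%E.
  by rewrite !lt_min => /and3P[_ _ h]; exact: Nlt.
have VF a : `|a| < d0 -> V (F t (rscale a phi)).
  by move=> /ball /hF [h _ _]; exact: h.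
have [M3 M30 HM3] := picard_expansion T0' mphi (ltW X0) phiX iP PM sP tT'.
pose G (a : R) := complex.Im (ell Phi (F t (rscale a phi))).
pose g (a : R) := complex.Im (ell Phi (DF (rscale a phi) phi)).
pose a1 := complex.Im (ell Phi (free phi t)).
pose a2 := - complex.Im (ell Phi (duhamel (free phi) t)).
have z0 : rscale 0 phi = 0 by apply/funext => w; rewrite /rscale mul0r.
have b2 : complex.Im (ell Phi (B phi phi)) = 2 * a2.
  apply: (@taylor2_unique R G g a1 a2 _ d0 M3) => //.
  - move=> x xd; apply: is_derive_eps => e e0.
    have [bl hfr] := hDF _ (mem x) (inr x xd).
    have [VD lD _] := bl.
    pose e' := e / ((cl + 1) * c1).
    have e'0 : 0 < e' by rewrite divr_gt0// mulr_gt0// ltr_wpDl.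
    have [d dd Hd] := hfr e' e'0.
    exists (Num.min (d / c1) (d0 - `|x|)); first by rewrite lt_min divr_gt0// subr_gt0.
    move=> h; rewrite lt_min => /andP[h1 h2].
    have xh : `|x + h| < d0 by apply: (le_lt_trans (ler_normD _ _)); lra.
    have := Hd _ (mem h) (Nlt h d dd h1); rewrite addE => H.
    have l1 := locV (VF _ xh); have l2 := locV (VF _ xd); have l3 := locV (VD _ (mem h)).
    have H' : (N (F t (rscale (x + h) phi) - F t (rscale x phi) - DF (rscale x phi) (rscale h phi))%R
       <= (e' * (c1 * `|h|))%:E)%E.
      by apply: (le_trans H); rewrite [leRHS]EFinM; apply: lee_wpmul2l => //; rewrite lee_fin ltW.
    have := ell_real (locL2B (locL2B l1 l2) l3) H'.
    rewrite (ellB iP PM sP (locL2B l1 l2) l3) (ellB iP PM sP l1 l2) (ell_linear lD VD) => H2.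
    have E : G (x + h) - G x - h * g x = complex.Im (ell Phi (F t (rscale (x + h) phi)) -
       ell Phi (F t (rscale x phi)) - h%:C%C * ell Phi (DF (rscale x phi) phi)).
      by rewrite !ImB ImM /= mul0r addr0.
    rewrite E; apply: (le_trans (Im_le_nc _)); apply: (le_trans H2).
    have -> : cl * (e' * (c1 * `|h|)) = e * `|h| * (cl / (cl + 1)).
      by rewrite /e'; field; rewrite !gt_eqF// ltr_wpDl.
    apply: ler_piMr; first by rewrite mulr_ge0// ltW.
    by rewrite ler_pdivrMr ?mul1r ?lerDl// ltr_wpDl.
  - move=> e e0; pose e' := e / ((cl + 1) * c1 ^+ 2).
    have e'0 : 0 < e' by rewrite divr_gt0// mulr_gt0 ?exprn_gt0// ltr_wpDl.
    have [d dd Hd] := hDB e' e'0.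
    exists (Num.min (d / c1) d0); first by rewrite lt_min divr_gt0.
    move=> x; rewrite lt_min => /andP[x1 x2].
    have H := Hd _ _ (mem x) Vphi (Nlt x d dd x1).
    have N1 : (N phi <= c1%:E)%E.
      by have := Ns 1; rewrite normr1 mulr1 p1.
    have H' : (N (DF (rscale x phi) phi - DF (0%R : R3 R -> R[i]) phi - B (rscale x phi) phi)%R
       <= (e' * (c1 * `|x| * c1))%:E)%E.
      apply: (le_trans H); rewrite [leRHS]EFinM; apply: lee_wpmul2l; first by rewrite lee_fin ltW.
      by rewrite [leRHS]EFinM; apply: lee_pmul => //; exact: lqlp_ge0.
    have n0 : `|0 : R| < d0 by rewrite normr0.
    have [[VD _ _] _] := hDF _ (mem x) (inr x x2).
    have [[VD0 _ _] _] := hDF _ (mem 0) (inr 0 n0); rewrite z0 in VD0.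
    have [VB _ _] := hB _ (mem x).
    have l1 := locV (VD _ Vphi); have l2 := locV (VD0 _ Vphi); have l3 := locV (VB _ Vphi).
    have VB' u : V u -> V (B u phi) by move=> Vu; have [h _ _] := hB u Vu; exact: h.
    have := ell_real (locL2B (locL2B l1 l2) l3) H'.
    rewrite (ellB iP PM sP (locL2B l1 l2) l3) (ellB iP PM sP l1 l2) (ell_linear (lB _ Vphi) VB') => H2.
    have E : g x - g 0 - x * complex.Im (ell Phi (B phi phi)) = complex.Im (
       ell Phi (DF (rscale x phi) phi) - ell Phi (DF 0 phi) - x%:C%C * ell Phi (B phi phi)).
      by rewrite !ImB ImM /= mul0r addr0 /g z0.
    rewrite E; apply: (le_trans (Im_le_nc _)); apply: (le_trans H2).
    have -> : cl * (e' * (c1 * `|x| * c1)) = e * `|x| * (cl / (cl + 1)).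
      by rewrite /e'; field; rewrite !gt_eqF// ltr_wpDl.
    apply: ler_piMr; first by rewrite mulr_ge0// ltW.
    by rewrite ler_pdivrMr ?mul1r ?lerDl// ltr_wpDl.
  - move=> x xd; have xX : 8 * cduh * (`|x| * X) <= 1.
      move: xd; rewrite !lt_min => /and3P[h _ _]; move: h; rewrite ltr_pdivlMr; last (by apply: mulr_gt0 => //; apply: mulr_gt0); move=> /ltW.
      by apply: le_trans; apply: eqle; move: (@cduh R) => c; ring.
    have xb w : nc (rscale x phi w) <= `|x| * X * wt T w by exact: rscale_le.
    have x00 w : w.1 = 0 -> rscale x phi w = 0 by move=> w0; rewrite /rscale phi0// mulr0.
    have [u [ju bu wu eu]] := picard_solution T0' (cmeasurable_rscale mphi x) xb xX
      (wcont_rscale wphi x) x00 (herm_rscale hphi x).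
    have su := picard_is_solution q1 p2 T0' ju bu wu eu.
    have [_ uniq] := hwp (ball _ xd).
    have ae := uniq _ _ (hF (ball _ xd)) su t tT.
    have VFx := VF x xd.
    have [mF _ _] := VFx.
    have eE := aeeq_ell mP mF (jmeas_section t ju) ae.
    have := HM3 x u ju bu eu; rewrite -eE => H.
    have E : G x - (x * a1 + x ^+ 2 * a2) = complex.Im (ell Phi (F t (rscale x phi)) -
      (x%:C%C * ell Phi (free phi t) - (x ^+ 2)%:C%C * ell Phi (duhamel (free phi) t))).
      by rewrite Im_comb /a2 mulrN.
    by rewrite E; apply: (le_trans (Im_le_nc _)).
have -> : complex.Im (ell Phi (duhamel (free phi) t)) = - (complex.Im (ell Phi (B phi phi)) / 2).
  by rewrite b2 /a2; field.
have [VB _ _] := hB _ Vphi.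
have NB : (N (B phi phi) <= (`|CB| * nu ^+ 2)%:E)%E.
  apply: (le_trans (bB _ _ Vphi Vphi)); rewrite EFinM.
  apply: (@le_trans _ _ (`|CB|%:E * (N phi * N phi))%E).
    apply: lee_wpmul2r; last by rewrite lee_fin ler_norm.
    by apply: mule_ge0; exact: lqlp_ge0.
  apply: lee_wpmul2l; first by rewrite lee_fin.
  by rewrite expr2 EFinM; apply: lee_pmul => //; exact: lqlp_ge0.
have := ell_real (locV (VB _ Vphi)) NB; have := Im_le_nc (ell Phi (B phi phi)).
move=> h1 h2; have h3 := le_trans h1 h2.
rewrite normrN normrM (ger0_norm (_ : 0 <= 2^-1)) ?invr_ge0//.
have := normr_ge0 (complex.Im (ell Phi (B phi phi))); lra.
Qed.

End Direction.
End SecondOrder.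

(** * Tents *)

Section Tents.
Context {R : realType}.
Let mu := @lebesgue_measure R.
Let T1 := measurableTypeR R.
Let T3 := @borel3 R.

(** A tent, continuous and with compact support. *)
Definition tnt (x : R) : R := (1 - `|x| + `|1 - `|x| |) / 2.

Lemma tnt_ge0 x : 0 <= tnt x.
Proof. by rewrite /tnt; have := ler_norm (- (1 - `|x|)); rewrite normrN; lra. Qed.

Lemma tnt_le1 x : tnt x <= 1.
Proof.
rewrite /tnt; have := normr_ge0 x; have [h|h] := lerP 0 (1 - `|x|).
  by rewrite (ger0_norm h); lra.
by rewrite (ltr0_norm h); lra.
Qed.

Lemma tnt_supp x : tnt x != 0 -> `|x| < 1.
Proof.
apply: contraR; rewrite -leNgt /tnt => h.
have h' : 1 - `|x| <= 0 by rewrite subr_le0.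
by rewrite (ler0_norm h') subrr mul0r.
Qed.

Lemma tnt_half x : `|x| <= 2^-1 -> 2^-1 <= tnt x.
Proof.
rewrite /tnt; move: (ler_norm (1 - `|x|)); move: (`|1 - `|x| |) (`|x|) => a b; lra.
Qed.

Lemma tntN x : tnt (- x) = tnt x. Proof. by rewrite /tnt normrN. Qed.

Lemma tnt_cvg (u : nat -> R) (l : R) : u n @[n --> \oo] --> l -> tnt (u n) @[n --> \oo] --> tnt l.
Proof.
move=> ul; apply: cvgM; last exact: cvg_cst.
have h : 1 - `|u n| @[n --> \oo] --> 1 - `|l| by apply: cvgB; [exact: cvg_cst|exact: cvg_norm].
by apply: cvgD => //; exact: cvg_norm.
Qed.

Lemma measurable_tnt : measurable_fun setT (tnt : T1 -> T1).
Proof.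
have h : measurable_fun setT (fun x : T1 => 1 - `|x| : T1).
  by apply: measurable_funB => //; apply: measurableT_comp.
apply: measurable_funM => //; apply: measurable_realfun.measurable_funD => //.
by apply: measurableT_comp.
Qed.

Lemma int_ind3 (A b : R) : 0 <= A -> 0 <= b ->
  (\int[leb3]_w (\1_`[- A, A] (w.1 : R) * (\1_`[- b, b] (w.2.1 : R) * \1_`[- b, b] (w.2.2 : R)))%:E
   = (8 * (A * b ^+ 2))%:E :> \bar R)%E.
Proof.
move=> A0 b0.
have ii (c : R) : mu.-integrable setT (EFin \o \1_`[- c, c]).
  by have := integrable_indic_itv 1 (- c) c; under eq_fun do rewrite mul1r.
have i3 := integrable3 (ii A) (ii b) (ii b).
rewrite -[LHS]fineK; last exact: (integrable_fin_num measurableT i3).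
have := Rintegral3 (ii A) (ii b) (ii b).
have nn (x : R) : 0 <= x -> - x <= x by lra.
rewrite !Rintegral_indic_itv ?nn// => E; congr EFin.
by rewrite [LHS]E; ring.
Qed.

(** A product of tents; [c] is the absolute value for the even profiles of the
    datum, and the identity for the one-sided test profile. *)
Definition bx (c : R -> R) (a h d : R) (w : R3 R) : R :=
  tnt ((c w.1 - a) / h) * (tnt (w.2.1 / d) * tnt (w.2.2 / d)).

Section Box.
Variables (c : R -> R) (a h d : R).
Hypothesis (cn : forall x, `|c x| = `|x|).
Hypothesis (cc : forall (u : nat -> R) l, u n @[n --> \oo] --> l -> c (u n) @[n --> \oo] --> c l).
Hypothesis (mc : measurable_fun setT (c : T1 -> T1)).
Hypothesis (h0 : 0 < h).
Hypothesis (d0 : 0 < d).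
Hypothesis (a0 : 0 < a).

Lemma bx_ge0 w : 0 <= bx c a h d w.
Proof. by apply: mulr_ge0; [|apply: mulr_ge0]; exact: tnt_ge0. Qed.

Lemma bx_le1 w : bx c a h d w <= 1.
Proof.
apply: mulr_ile1; [exact: tnt_ge0|apply: mulr_ge0; exact: tnt_ge0|exact: tnt_le1|].
by apply: mulr_ile1; [exact: tnt_ge0|exact: tnt_ge0|exact: tnt_le1|exact: tnt_le1].
Qed.

Lemma bx_supp w : bx c a h d w != 0 -> [/\ `|c w.1 - a| < h, `|w.2.1| < d & `|w.2.2| < d].
Proof.
have k (x y : R) : 0 < y -> tnt (x / y) != 0 -> `|x| < y.
  by move=> y0 /tnt_supp; rewrite normrM normfV (gtr0_norm y0) ltr_pdivrMr// mul1r.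
move=> n; split.
- by apply: (k _ _ h0); apply: contra_neq n => e; rewrite /bx e mul0r.
- by apply: (k _ _ d0); apply: contra_neq n => e; rewrite /bx e mul0r mulr0.
- by apply: (k _ _ d0); apply: contra_neq n => e; rewrite /bx e !mulr0.
Qed.

Lemma bx_half w : `|c w.1 - a| <= h / 2 -> `|w.2.1| <= d / 2 -> `|w.2.2| <= d / 2 ->
  8^-1 <= bx c a h d w.
Proof.
have k (x y : R) : 0 < y -> `|x| <= y / 2 -> 2^-1 <= tnt (x / y).
  move=> y0 xy; apply: tnt_half.
  by rewrite normrM normfV (gtr0_norm y0) ler_pdivrMr// mulrC.
move=> h1 h2 h3.
have -> : 8^-1 = 2^-1 * (2^-1 * 2^-1) :> R by field.
apply: ler_pM => //; [exact: k|].
by apply: ler_pM => //; exact: k.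
Qed.

Lemma bx_cvg x w : cvg3 x w -> bx c a h d (x n) @[n --> \oo] --> bx c a h d w.
Proof.
move=> [c1 c2 c3].
have k (u : nat -> R) (l y : R) : u n @[n --> \oo] --> l -> tnt (u n / y) @[n --> \oo] --> tnt (l / y).
  by move=> ul; apply: tnt_cvg; apply: cvgM => //; exact: cvg_cst.
apply: cvgM; last by apply: cvgM; exact: k.
apply: (k (fun n => c (x n).1 - a)); apply: cvgB; [exact: cc|exact: cvg_cst].
Qed.

Lemma measurable_bx : measurable_fun setT (bx c a h d : T3 -> T1).
Proof.
have m1 := @measurable_c1 R; have m2 := @measurable_c2 R; have m3 := @measurable_c3 R.
have k (f : T3 -> R) y : measurable_fun setT (f : T3 -> T1) ->
    measurable_fun setT (fun w => tnt (f w / y) : T1).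
  by move=> mf; apply: (measurableT_comp measurable_tnt); exact: measurable_funM.
apply: measurable_funM; last by apply: measurable_funM; exact: k.
by apply: (k (fun w => c w.1 - a)); apply: measurable_funB => //; exact: (measurableT_comp mc).
Qed.

Lemma bx_ind w : bx c a h d w <= \1_`[- (a + h), a + h] (w.1 : R) *
   (\1_`[- d, d] (w.2.1 : R) * \1_`[- d, d] (w.2.2 : R)).
Proof.
have [->|n] := eqVneq (bx c a h d w) 0; first by rewrite !mulr_ge0.
have [s1 s2 s3] := bx_supp n.
have w1 : `|w.1| <= a + h.
  rewrite -cn; have -> : c w.1 = a + (c w.1 - a) by ring.
  by apply: (le_trans (ler_normD _ _)); rewrite gtr0_norm// lerD2l ltW.
have I (x y : R) : `|x| <= y -> \1_`[- y, y] x = 1 :> R.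
  by rewrite ler_norml => xy; rewrite indicE mem_set//= in_itv.
by rewrite !I ?mulr1 ?bx_le1// ltW.
Qed.

Lemma nsq_bx (g : R) : (nsq (fun w => (g * bx c a h d w)%:C%C) <= (g ^+ 2 * (8 * ((a + h) * d ^+ 2)))%:E)%E.
Proof.
have ah : 0 <= a + h by apply: addr_ge0; exact: ltW.
rewrite EFinM -int_ind3//; last exact: ltW.
have mi (y : R) (f : T3 -> R) : measurable_fun setT (f : T3 -> T1) ->
    measurable_fun setT (fun w => \1_`[- y, y] (f w) : T1).
  by move=> mf; apply: measurableT_comp => //; apply: measurable_indic; exact: measurable_itv.
have m1 := @measurable_c1 R; have m2 := @measurable_c2 R; have m3 := @measurable_c3 R.
have mI : measurable_fun setT (fun w : T3 => (\1_`[- (a + h), a + h] (w.1 : R) *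
   (\1_`[- d, d] (w.2.1 : R) * \1_`[- d, d] (w.2.2 : R))) : T1).
  by apply: measurable_funM; [exact: mi|apply: measurable_funM; exact: mi].
rewrite -ge0_integralZl//.
- apply: ge0_le_integral => //.
  + by move=> w _; rewrite lee_fin sqr_ge0.
  + apply: measurable_nsq; apply: cmeasurable_real; apply: measurable_funM => //; exact: measurable_bx.
  + by apply: measurable_funeM; apply/measurable_EFinP.
  move=> w _; rewrite -EFinM lee_fin nc_real real_normK ?num_real// exprMn.
  apply: ler_wpM2l; first exact: sqr_ge0.
  apply: le_trans (bx_ind w); rewrite expr2; apply: ler_piMl; [exact: bx_ge0|exact: bx_le1].
- by apply/measurable_EFinP.
- by rewrite lee_fin sqr_ge0.
Qed.

Lemma bx_wt (T : R) : exists2 C : R, 0 < C & forall w, bx c a h d w <= C * wt T w.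
Proof.
pose b := cauchy (a + h) * (cauchy d * cauchy d) * expR (- (`|T| * (a + h))).
have b0 : 0 < b by apply: mulr_gt0; [apply: mulr_gt0; [|apply: mulr_gt0]; exact: cauchy_gt0|exact: expR_gt0].
exists b^-1; first by rewrite invr_gt0.
move=> w; have [->|n] := eqVneq (bx c a h d w) 0.
  by apply: mulr_ge0; [rewrite invr_ge0 ltW|exact: wt_ge0].
have [s1 s2 s3] := bx_supp n.
have w1 : `|w.1| <= a + h.
  rewrite -cn; have -> : c w.1 = a + (c w.1 - a) by ring.
  by apply: (le_trans (ler_normD _ _)); rewrite gtr0_norm// lerD2l ltW.
apply: (le_trans (bx_le1 w)); rewrite ler_pdivlMl// mulr1 /b /wt.
have hc (x y : R) : `|x| <= y -> cauchy y <= cauchy x.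
  move=> xy; have p (z : R) : 0 < 1 + z ^+ 2 by rewrite ltr_wpDr// sqr_ge0.
  rewrite /cauchy lef_pV2 ?posrE//; apply: lerD => //.
  rewrite -(real_normK (num_real x)); apply: lerXn2r; rewrite ?nnegrE//.
  exact: le_trans (normr_ge0 x) xy.
have c0 := @cauchy_ge0 R.
apply: ler_pM.
- by apply: mulr_ge0 => //; exact: mulr_ge0.
- exact: expR_ge0.
- apply: ler_pM => //; [exact: mulr_ge0|exact: hc|].
  by apply: ler_pM => //; apply: hc; exact: ltW.
rewrite ler_expR lerN2; apply: (@le_trans _ _ (`|T| * `|w.1|)).
  by apply: ler_wpM2r => //; exact: ler_norm.
exact: ler_wpM2l.
Qed.

End Box.

Lemma sum_cells2 (g : R3 R -> R[i]) (m : int) (s : seq (int * int)) :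
  @cmeasurable R _ borel3 g -> uniq s ->
  (\sum_(ab <- s) nsq (cut (Gamma m ab) g) <= 4%:E * nsq g)%E.
Proof.
move=> mg us; rewrite /nsq -ge0_integral_sum//; last 2 first.
- move=> ab; apply: measurable_nsq; apply: cmeasurable_cut => //; exact: measurable_Gamma.
- by move=> ab w _; rewrite lee_fin sqr_ge0.
rewrite -ge0_integralZl//.
- apply: ge0_le_integral => //.
  + by move=> w _; apply: sume_ge0 => ab _; rewrite lee_fin sqr_ge0.
  + apply: emeasurable_sum => ab; apply: measurable_nsq; apply: cmeasurable_cut => //.
    exact: measurable_Gamma.
  + by apply: measurable_funeM; exact: measurable_nsq.
  move=> w _; rewrite sumEFin -EFinM lee_fin.
  apply: (@le_trans _ _ (\sum_(ab <- s) \1_(Gamma m ab) w * nc (g w) ^+ 2)).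
    apply: ler_sum => ab _; have [k|k] := pselect (Gamma m ab w).
      by rewrite cut_in// indicE mem_set// mul1r.
    by rewrite cut_out// nc0 expr0n mulr_ge0// sqr_ge0.
  rewrite -mulr_suml; apply: ler_wpM2r; first exact: sqr_ge0.
  exact: Gamma_mult.
- exact: measurable_nsq.
- by move=> w _; rewrite lee_fin sqr_ge0.
Qed.

(** Interpolation between the largest cell and the sum over the cells: this is
    where a sum over [k^2] cells of comparable size gains over [l^2]. *)
Lemma row_le2 (p : R) (g : R3 R -> R[i]) (m : int) (J k : R) : 2 < p -> 0 < J -> 0 < k ->
  (forall ab, cintegrable leb3 setT (cut (Gamma m ab) g)) ->
  (forall ab, nsq (cut (Gamma m ab) g) <= (J ^+ 2)%:E)%E ->
  (forall s, uniq s -> (\sum_(ab <- s) nsq (cut (Gamma m ab) g) <= ((k * J) ^+ 2)%:E)%E) ->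
  (\esum_(ab in [set: int * int]) cell_norm g m ab `^ p <= ((ccell * (J * k `^ (2 / p))) `^ p)%:E)%E.
Proof.
move=> p2 J0 k0 ig hJ hs; apply: esum_le_seq => s us.
have p0 : 0 < p by lra.
pose I ab := fine (nsq (cut (Gamma m ab) g)) / J ^+ 2.
have J2 : 0 < J ^+ 2 by rewrite exprn_gt0.
have IE ab : nsq (cut (Gamma m ab) g) = (J ^+ 2 * I ab)%:E.
  rewrite /I mulrCA divff ?gt_eqF// mulr1 fineK// ge0_fin_numE ?nsq_ge0//.
  exact: le_lt_trans (hJ ab) (ltry _).
have I0 ab : 0 <= I ab by apply: divr_ge0; [rewrite fine_ge0// nsq_ge0|exact: ltW].
have I1 ab : I ab <= 1.
  by have := hJ ab; rewrite IE lee_fin -[leRHS]mulr1 ler_pM2l.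
have cc := @ccell_ge0 R.
have cJ : 0 <= (ccell : R) * J by apply: mulr_ge0 => //; exact: ltW.
have cl ab : (cell_norm g m ab `^ p <= ((ccell * J) `^ p * I ab)%:E)%E.
  have B0 : 0 <= J * Num.sqrt (I ab) by apply: mulr_ge0; [exact: ltW|exact: sqrtr_ge0].
  have h : (cell_norm g m ab <= (ccell * (J * Num.sqrt (I ab)))%:E)%E.
    by apply: cell_le => //; rewrite IE lee_fin exprMn sqr_sqrtr.
  apply: (@le_trans _ _ ((ccell * (J * Num.sqrt (I ab)))%:E `^ p)%E).
    apply: gt0_ler_poweR => //; first exact: ltW.
      by rewrite in_itv/= leey cell_norm_ge0.
    by rewrite in_itv/= leey andbT lee_fin; apply: mulr_ge0.
  rewrite poweR_EFin lee_fin mulrA powRM ?sqrtr_ge0//; apply: ler_wpM2l; first exact: powR_ge0.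
  have -> : Num.sqrt (I ab) `^ p = I ab `^ (p / 2).
    by rewrite -powR12_sqrt// -powRrM mulrC.
  rewrite -[leRHS](powRr1 (I0 ab)); have [->|n] := eqVneq (I ab) 0.
    by rewrite !powR0 ?gt_eqF//; lra.
  have Ip : 0 < I ab by rewrite lt_neqAle eq_sym n I0.
  by rewrite ger_powR ?Ip ?I1//; lra.
apply: (@le_trans _ _ (\sum_(ab <- s) ((ccell * J) `^ p * I ab)%:E)%E).
  by apply: lee_sum => ab _; exact: cl.
rewrite sumEFin lee_fin -mulr_sumr [ccell * (J * _)]mulrA [leRHS]powRM ?powR_ge0//.
apply: ler_wpM2l; first exact: powR_ge0.
rewrite -powRrM mulfVK ?gt_eqF// powR_mulrn ?(ltW k0)//.
have := hs s us; under eq_bigr do rewrite IE.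
by rewrite sumEFin lee_fin -mulr_sumr [in X in _ <= X]mulrC exprMn ler_pM2l.
Qed.

End Tents.

(** * The datum *)

Section Datum.
Context {R : realType}.
Let mu := @lebesgue_measure R.
Let T1 := measurableTypeR R.
Let T3 := @borel3 R.

Lemma int_shift (k r c : R) : 0 <= k -> 0 <= r ->
  (\int[mu]_z (k * \1_`[- r, r] (z - c))%:E = (k * (2 * r))%:E)%E.
Proof.
move=> k0 r0.
have mI : measurable_fun setT (\1_`[- r, r] : T1 -> R) by apply: measurable_indic; exact: measurable_itv.
have ii : mu.-integrable setT (EFin \o \1_`[- r, r]).
  by have := integrable_indic_itv 1 (- r) r; under eq_fun do rewrite mul1r.
have I0 : (\int[mu]_z (\1_`[- r, r] z)%:E = (2 * r)%:E)%E.
  rewrite -[LHS]fineK; last exact: (integrable_fin_num measurableT ii).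
  have rr : - r <= r by lra.
  have := Rintegral_indic_itv rr; rewrite /Rintegral => ->; congr EFin; ring.
have ms : measurable_fun setT (fun z : T1 => \1_`[- r, r] (z - c) : R).
  by apply: (measurableT_comp mI); exact: measurable_funB.
under eq_integral do rewrite EFinM.
rewrite ge0_integralZl//; last by apply/measurable_EFinP.
have h := @ge0_integral_affine R 1 (- c) (fun z => (\1_`[- r, r] z)%:E) (oner_neq0 _).
rewrite EFinM -I0 h//; last by apply/measurable_EFinP.
by rewrite normr1 mul1e; congr (_ * _)%E; apply: eq_integral => z _; rewrite mul1r.
Qed.

(** In each slice of constant [xi] a cell of [Gamma] is a square whose centre
    moves with [xi]; this does not change the measure. *)
Lemma int_shear (A r c1 c2 : R) : 0 <= A -> 0 <= r ->
  (\int[leb3]_w (\1_`[- A, A] (w.1 - 0 : R) * (\1_`[- r, r] (w.2.1 - w.1 * c1 : R) *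
    \1_`[- r, r] (w.2.2 - w.1 * c2 : R)))%:E = (8 * (A * r ^+ 2))%:E)%E.
Proof.
move=> A0 r0.
have mi (y : R) (f : T3 -> R) : measurable_fun setT (f : T3 -> T1) ->
    measurable_fun setT (fun w => \1_`[- y, y] (f w) : T1).
  by move=> mf; apply: measurableT_comp => //; apply: measurable_indic; exact: measurable_itv.
have m1 := @measurable_c1 R; have m2 := @measurable_c2 R; have m3 := @measurable_c3 R.
rewrite tonelli3; last 2 first.
- apply/measurable_EFinP; apply: measurable_funM; first by apply: mi; exact: measurable_funB.
  apply: measurable_funM; apply: mi; apply: measurable_funB => //; exact: measurable_funM.
- by move=> w; rewrite lee_fin !mulr_ge0.
have E1 x y : (\int[mu]_z (\1_`[- A, A] (x - 0 : R) * (\1_`[- r, r] (y - x * c1 : R) *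
    \1_`[- r, r] (z - x * c2 : R)))%:E = ((\1_`[- A, A] (x - 0 : R) * (2 * r)) * \1_`[- r, r] (y - x * c1 : R))%:E)%E.
  under eq_integral do rewrite mulrA.
  by rewrite int_shift ?mulr_ge0//; congr EFin; ring.
under eq_integral do under eq_integral do rewrite /= E1.
have E2 x : (\int[mu]_y ((\1_`[- A, A] (x - 0 : R) * (2 * r)) * \1_`[- r, r] (y - x * c1 : R))%:E =
    (((2 * r) * (2 * r)) * \1_`[- A, A] (x - 0 : R))%:E)%E.
  by rewrite int_shift ?mulr_ge0//; congr EFin; ring.
under eq_integral do rewrite /= E2.
by rewrite int_shift ?mulr_ge0//; congr EFin; ring.
Qed.

Lemma dyad_shell (m n : int) (x : R) : dyad m <= x < 2 * dyad m -> dyad n < x < 2 * dyad n -> m = n.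
Proof.
move=> /andP[h1 h2] /andP[h3 h4].
have d2 k : 2 * dyad k = dyad (k + 1) :> R by rewrite /dyad expfzDr ?pnatr_eq0// expr1z mulrC.
have a1 : dyad m < dyad (n + 1) :> R by rewrite -d2; exact: le_lt_trans h1 h4.
have a2 : dyad n < dyad (m + 1) :> R by rewrite -d2; exact: lt_trans h3 h2.
rewrite /dyad ltr_eXz2l ?ltr1n// in a1; rewrite /dyad ltr_eXz2l ?ltr1n// in a2.
lia.
Qed.

Variables (p : R) (mL ml : int).
Hypothesis (p2 : 2 < p).
Let L : R := dyad mL.
Let l : R := dyad ml.
Hypothesis (L1 : 1 <= L).
Hypothesis (lL : 16 * l <= L).

Let l0 : 0 < l. Proof. exact: dyad_gt0. Qed.
Let L0 : 0 < L. Proof. exact: dyad_gt0. Qed.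

Let absn (x : R) : `| `|x| | = `|x|. Proof. exact: normr_id. Qed.
Let absc (u : nat -> R) (y : R) : u n @[n --> \oo] --> y -> `|u n| @[n --> \oo] --> `|y|.
Proof. exact: cvg_norm. Qed.
Let absm : measurable_fun setT ((fun x => `|x|) : T1 -> T1).
Proof. by apply: measurableT_comp. Qed.

Definition low : R3 R -> R := bx (fun x => `|x|) (3 / 2 * dyad ml) (dyad ml / 2) (dyad ml * dyad mL).
Definition high : R3 R -> R := bx (fun x => `|x|) (3 / 2 * dyad mL) (dyad mL / 2) (dyad mL ^+ 2 / 4).

Let h1 : 0 < l / 2. Proof. exact: divr_gt0. Qed.
Let h2 : 0 < L / 2. Proof. exact: divr_gt0. Qed.
Let d1 : 0 < l * L. Proof. exact: mulr_gt0. Qed.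
Let d2 : 0 < L ^+ 2 / 4. Proof. by apply: divr_gt0 => //; exact: exprn_gt0. Qed.
Let a1 : 0 < 3 / 2 * l. Proof. by apply: mulr_gt0. Qed.
Let a2 : 0 < 3 / 2 * L. Proof. by apply: mulr_gt0. Qed.

Lemma low_supp w : low w != 0 -> [/\ l < `|w.1|, `|w.1| < 2 * l, `|w.2.1| < l * L & `|w.2.2| < l * L].
Proof.
move=> /(bx_supp h1 d1)[h s2 s3]; move: h; rewrite ltr_norml => /andP[s0 s1].
by split => //; move: s0 s1; rewrite -/l; lra.
Qed.

Lemma high_supp w : high w != 0 ->
  [/\ L < `|w.1|, `|w.1| < 2 * L, `|w.2.1| < L ^+ 2 / 4 & `|w.2.2| < L ^+ 2 / 4].
Proof.
move=> /(bx_supp h2 d2)[h s2 s3]; move: h; rewrite ltr_norml => /andP[s0 s1].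
by split => //; move: s0 s1; rewrite -/L; lra.
Qed.

Lemma low_half w : `| `|w.1| - 3 / 2 * l| <= l / 4 -> `|w.2.1| <= l * L / 2 -> `|w.2.2| <= l * L / 2 ->
  8^-1 <= low w.
Proof.
move=> k1 k2 k3; apply: (bx_half h1 d1) => //; rewrite -/l.
by apply: (le_trans k1); lra.
Qed.

Lemma high_half w : `| `|w.1| - 3 / 2 * L| <= L / 4 -> `|w.2.1| <= L ^+ 2 / 8 -> `|w.2.2| <= L ^+ 2 / 8 ->
  8^-1 <= high w.
Proof.
have e : L ^+ 2 / 4 / 2 = L ^+ 2 / 8 by field.
move=> k1 k2 k3; apply: (bx_half h2 d2) => //; rewrite -/L ?e//.
by apply: (le_trans k1); lra.
Qed.

Lemma low_ge0 w : 0 <= low w. Proof. exact: bx_ge0. Qed.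
Lemma high_ge0 w : 0 <= high w. Proof. exact: bx_ge0. Qed.

(** The amplitudes make the contribution of each part to the norm of order
    one. *)
Definition alpha : R := (dyad ml ^+ 3 * (2 * dyad mL / dyad ml) `^ (2 / p))^-1.
Definition beta : R := (dyad mL ^+ 3)^-1.

Let kk : R := 2 * L / l.
Let kk0 : 0 < kk. Proof. by apply: divr_gt0 => //; exact: mulr_gt0. Qed.

Lemma alpha_gt0 : 0 < alpha.
Proof. by rewrite invr_gt0; apply: mulr_gt0; [exact: exprn_gt0|exact: powR_gt0]. Qed.

Lemma beta_gt0 : 0 < beta. Proof. by rewrite invr_gt0 exprn_gt0. Qed.

Definition amp (w : R3 R) : R := alpha * low w + beta * high w.
Definition datum (w : R3 R) : R[i] := (amp w)%:C%C.

Lemma amp_ge0 w : 0 <= amp w.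
Proof.
by apply: addr_ge0; apply: mulr_ge0; [exact/ltW/alpha_gt0|exact: low_ge0|exact/ltW/beta_gt0|exact: high_ge0].
Qed.

Lemma amp_supp w : amp w != 0 -> low w != 0 \/ high w != 0.
Proof.
have [e1|n] := eqVneq (low w) 0; last by left.
have [e2|n] := eqVneq (high w) 0; last by right.
by rewrite /amp e1 e2 !mulr0 addr0 eqxx.
Qed.

Lemma measurable_amp : measurable_fun setT (amp : T3 -> T1).
Proof.
by apply: measurable_realfun.measurable_funD; apply: measurable_funM => //; exact: measurable_bx.
Qed.

Lemma cmeasurable_datum : @cmeasurable R _ borel3 datum.
Proof. by apply: cmeasurable_real; exact: measurable_amp. Qed.

Lemma herm_datum : herm datum.
Proof.
by move=> w; rewrite /datum conj_real /amp /low /high /bx /= !normrN !mulNr !tntN.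
Qed.

Lemma wcont_datum : wcont datum.
Proof.
move=> w x xw; apply: ccvg_real; apply: cvgD; apply: cvgM; try exact: cvg_cst.
  exact: bx_cvg.
exact: bx_cvg.
Qed.

Lemma datum0 w : w.1 = 0 -> datum w = 0.
Proof.
move=> w0; rewrite /datum; suff -> : amp w = 0 by [].
apply/eqP; apply: contraT => /amp_supp[/low_supp[]|/high_supp[]]; rewrite w0 normr0 => h.
  by have := lt_trans l0 h; rewrite ltxx.
by have := lt_trans L0 h; rewrite ltxx.
Qed.

Lemma datum_wt (T : R) : exists2 X : R, 0 < X & forall w, nc (datum w) <= X * wt T w.
Proof.
have [C1 C10 H1] := @bx_wt _ _ _ _ _ absn h1 d1 a1 T.
have [C2 C20 H2] := @bx_wt _ _ _ _ _ absn h2 d2 a2 T.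
have p1 := alpha_gt0; have q1 := beta_gt0.
exists (alpha * C1 + beta * C2); first by apply: addr_gt0; exact: mulr_gt0.
move=> w; rewrite nc_real ger0_norm ?amp_ge0// mulrDl -!mulrA.
by apply: lerD; rewrite ler_pM2l.
Qed.

Let glow (w : R3 R) : R[i] := (alpha * low w)%:C%C.
Let ghigh (w : R3 R) : R[i] := (beta * high w)%:C%C.

Let cut_lowE m ab : m != mL -> cut (Gamma m ab) datum = cut (Gamma m ab) glow.
Proof.
move=> mn; apply/funext => w; have [h|h] := pselect (Gamma m ab w); last by rewrite !cut_out.
rewrite !cut_in// /datum /glow /amp; have [->|n] := eqVneq (high w) 0; first by rewrite mulr0 addr0.
have [s1 s2 _ _] := high_supp n; case: h => h _.
by move: mn; rewrite (dyad_shell h (_ : L < `|w.1| < 2 * L)) ?eqxx// s1.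
Qed.

Let cut_highE m ab : m != ml -> cut (Gamma m ab) datum = cut (Gamma m ab) ghigh.
Proof.
move=> mn; apply/funext => w; have [h|h] := pselect (Gamma m ab w); last by rewrite !cut_out.
rewrite !cut_in// /datum /ghigh /amp; have [->|n] := eqVneq (low w) 0; first by rewrite mulr0 add0r.
have [s1 s2 _ _] := low_supp n; case: h => h _.
by move: mn; rewrite (dyad_shell h (_ : l < `|w.1| < 2 * l)) ?eqxx// s1.
Qed.

Let cut_high0 m ab : m != mL -> cut (Gamma m ab) ghigh = fun=> 0.
Proof.
move=> mn; apply/funext => w; have [h|h] := pselect (Gamma m ab w); last by rewrite cut_out.
rewrite cut_in// /ghigh; have [->|n] := eqVneq (high w) 0; first by rewrite mulr0.
have [s1 s2 _ _] := high_supp n; case: h => h _.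
by move: mn; rewrite (dyad_shell h (_ : L < `|w.1| < 2 * L)) ?eqxx// s1.
Qed.

Let mlow : @cmeasurable R _ borel3 glow.
Proof. by apply: cmeasurable_real; apply: measurable_funM => //; exact: measurable_bx. Qed.
Let mhigh : @cmeasurable R _ borel3 ghigh.
Proof. by apply: cmeasurable_real; apply: measurable_funM => //; exact: measurable_bx. Qed.

Let cell_low ab : (nsq (cut (Gamma ml ab) glow) <= (alpha ^+ 2 * (16 * l ^+ 5))%:E)%E.
Proof.
have l20 : 0 <= 2 * l by apply: mulr_ge0 => //; exact: ltW.
have lq : 0 <= l ^+ 2 by exact: sqr_ge0.
have -> : alpha ^+ 2 * (16 * l ^+ 5) = alpha ^+ 2 * (8 * ((2 * l) * (l ^+ 2) ^+ 2)) by move: alpha => a; ring.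
rewrite EFinM -(int_shear (l * ab.1%:~R) (l * ab.2%:~R) l20 lq).
have mi (y : R) (f : T3 -> R) : measurable_fun setT (f : T3 -> T1) ->
    measurable_fun setT (fun w => \1_`[- y, y] (f w) : T1).
  by move=> mf; apply: measurableT_comp => //; apply: measurable_indic; exact: measurable_itv.
have m1 := @measurable_c1 R; have m2 := @measurable_c2 R; have m3 := @measurable_c3 R.
have mI : measurable_fun setT (fun w : T3 => (\1_`[- (2 * l), 2 * l] (w.1 - 0 : R) *
    (\1_`[- l ^+ 2, l ^+ 2] (w.2.1 - w.1 * (l * ab.1%:~R) : R) *
    \1_`[- l ^+ 2, l ^+ 2] (w.2.2 - w.1 * (l * ab.2%:~R) : R))) : T1).
  apply: measurable_funM; first by apply: mi; exact: measurable_funB.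
  apply: measurable_funM; apply: mi; apply: measurable_funB => //; exact: measurable_funM.
rewrite -ge0_integralZl//; last 2 first.
- by apply/measurable_EFinP.
- by rewrite lee_fin sqr_ge0.
apply: ge0_le_integral => //.
- by move=> w _; rewrite lee_fin sqr_ge0.
- by apply: measurable_nsq; apply: cmeasurable_cut => //; exact: measurable_Gamma.
- by apply: measurable_funeM; apply/measurable_EFinP.
move=> w _; rewrite -EFinM lee_fin.
have [h|h] := pselect (Gamma ml ab w); last first.
  by rewrite cut_out// nc0 expr0n mulr_ge0 ?sqr_ge0// !mulr_ge0.
rewrite cut_in// nc_real real_normK ?num_real// exprMn; apply: ler_wpM2l; first exact: sqr_ge0.
have lw1 : low w ^+ 2 <= 1.
  by rewrite expr_le1 ?low_ge0//; exact: bx_le1.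
case: h => /andP[w1 w2]; rewrite -/l in w1 w2 *; rewrite ge_max => /andP[c1 c2].
have I (x y : R) : `|x| <= y -> \1_`[- y, y] x = 1 :> R.
  by rewrite ler_norml => xy; rewrite indicE mem_set//= in_itv.
have n0 : w.1 != 0 by rewrite -normr_gt0; exact: lt_le_trans l0 w1.
have key (x : R) (a : int) : `|x / w.1 - l * a%:~R| <= l / 2 -> `|x - w.1 * (l * a%:~R)| <= l ^+ 2.
  move=> h; have -> : x - w.1 * (l * a%:~R) = (x / w.1 - l * a%:~R) * w.1 by field.
  rewrite normrM; apply: (@le_trans _ _ ((l / 2) * (2 * l))).
    by apply: ler_pM => //; exact: ltW.
  by apply: eqle; field.
by rewrite !I ?key// ?subr0 ?mulr1// ltW.
Qed.

Lemma datum_norm (q : \bar R) : (1%:E <= q)%E -> (lqlp_norm q p datum <= (6 * ccell)%:E)%E.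
Proof.
move=> q1; have p1 := alpha_gt0; have b1 := beta_gt0; have cc := @ccell_ge0 R.
pose sl := Num.sqrt l; pose sL := Num.sqrt L.
have sl2 : sl ^+ 2 = l by rewrite sqr_sqrtr// ltW.
have sL2 : sL ^+ 2 = L by rewrite sqr_sqrtr// ltW.
have sl0 : 0 < sl by rewrite sqrtr_gt0.
have sL0 : 0 < sL by rewrite sqrtr_gt0.
pose J1 := 4 * alpha * l ^+ 2 * sl; pose J2 := 2 * beta * L ^+ 2 * sL.
have J10 : 0 < J1 by apply: mulr_gt0 => //; apply: mulr_gt0; [exact: mulr_gt0|exact: exprn_gt0].
have J20 : 0 < J2 by apply: mulr_gt0 => //; apply: mulr_gt0; [exact: mulr_gt0|exact: exprn_gt0].
have k2 : 0 < kk `^ (2 / p) by exact: powR_gt0.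
have [X X0 bX] := datum_wt 0.
have ig : cintegrable leb3 setT datum.
  apply: (@cintegrable_rho _ _ X); first exact: cmeasurable_datum.
  move=> w; apply: (le_trans (bX w)); apply: ler_wpM2l; [exact: ltW|exact: wt_le_rho].
have icut m ab : cintegrable leb3 setT (cut (Gamma m ab) datum).
  by apply: cintegrable_cut => //; exact: measurable_Gamma.
pose Y (m : int) : R := if m == ml then J1 * kk `^ (2 / p) else if m == mL then J2 else 0.
have lLn : ml != mL.
  apply/eqP => e; have : l = L by rewrite /l e.
  by move=> e2; move: lL L1; rewrite e2; lra.
have Y0 m : 0 <= Y m.
  rewrite /Y; case: ifP => _; first by apply: mulr_ge0; exact: ltW.
  by case: ifP => _ //; exact: ltW.
apply: (@lqlp_le _ q p datum (fun m => ccell * Y m)) => //.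
- by move=> m; apply: mulr_ge0.
- move=> m; rewrite /Y; have [->|mn] := eqVneq m ml.
    apply: row_le2 => //.
    + move=> ab; rewrite cut_lowE//; apply: (le_trans (cell_low ab)); rewrite lee_fin; apply: eqle.
      by rewrite /J1 exprMn sl2; move: alpha => a; ring.
    + move=> s us; under eq_bigr do rewrite cut_lowE//.
      apply: (le_trans (sum_cells2 ml mlow us)).
      apply: (@le_trans _ _ (4%:E * (alpha ^+ 2 * (8 * ((3 / 2 * l + l / 2) * (l * L) ^+ 2)))%:E)%E).
        by apply: lee_wpmul2l => //; exact: (nsq_bx absn absm h1 d1 a1).
      rewrite -EFinM lee_fin; apply: eqle.
      rewrite [RHS]exprMn /J1 [(_ * sl) ^+ 2]exprMn sl2 /kk; move: alpha => a; field.
      by rewrite gt_eqF.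
  have [->|mn2] := eqVneq m mL.
    apply: row_le => //; first exact: ltW.
    move=> s us; have mn' : mL != ml by rewrite eq_sym.
    under eq_bigr do rewrite cut_highE//.
    apply: (le_trans (sum_cells2 mL mhigh us)).
    apply: (@le_trans _ _ (4%:E * (beta ^+ 2 * (8 * ((3 / 2 * L + L / 2) * (L ^+ 2 / 4) ^+ 2)))%:E)%E).
      by apply: lee_wpmul2l => //; exact: (nsq_bx absn absm h2 d2 a2).
    rewrite -EFinM lee_fin; apply: eqle.
    by rewrite /J2 [RHS]exprMn sL2; move: beta => b; field.
  apply: row_le => // s us; rewrite big1 ?expr0n// => ab _.
  rewrite cut_highE// cut_high0// /nsq; apply: integral0_eq => w _.
  by rewrite nc0 expr0n.
- move=> s us.
  have w1 : dyad ml `^ 2^-1 * (ccell * (J1 * kk `^ (2 / p))) = 4 * ccell.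
    rewrite powR12_sqrt ?(ltW l0)// -/l -/sl /J1 /alpha -/l -/L -/kk.
    have n1 := gt_eqF k2; have n2 := gt_eqF l0.
    have -> : sl * (ccell * (4 * (l ^+ 3 * kk `^ (2 / p))^-1 * l ^+ 2 * sl * kk `^ (2 / p))) =
       ccell * (4 * (l ^+ 3 * kk `^ (2 / p))^-1 * l ^+ 2 * sl ^+ 2 * kk `^ (2 / p)).
      by move: (@ccell R) => c; ring.
    rewrite sl2; move: (kk `^ _) n1 (@ccell R) => x xn c; field.
    by rewrite n2 xn.
  have w2 : dyad mL `^ 2^-1 * (ccell * J2) = 2 * ccell.
    rewrite powR12_sqrt ?(ltW L0)// -/L -/sL /J2 /beta -/L.
    have n2 := gt_eqF L0.
    have -> : sL * (ccell * (2 * (L ^+ 3)^-1 * L ^+ 2 * sL)) =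
       ccell * (2 * (L ^+ 3)^-1 * L ^+ 2 * sL ^+ 2) by move: (@ccell R) => c; ring.
    rewrite sL2; move: (@ccell R) => c; field.
    by rewrite n2.
  apply: (@le_trans _ _ (\sum_(m <- s) (4 * ccell * (m == ml)%:R + 2 * ccell * (m == mL)%:R))).
    apply: ler_sum => m _; rewrite /Y; have [->|mn] := eqVneq m ml.
      by rewrite w1 (negbTE lLn) mulr1 mulr0 addr0.
    have [->|mn2] := eqVneq m mL; first by rewrite w2 mulr0 add0r mulr1.
    by rewrite !mulr0 addr0.
  rewrite big_split /= -!mulr_sumr.
  have cnt (a : int) : \sum_(i <- s) (i == a)%:R <= 1 :> R.
    have -> : \sum_(i <- s) (i == a)%:R = (count_mem a s)%:R :> R.
      by rewrite -sum1_count natr_sum [RHS]big_mkcond; apply: eq_bigr => i _ /=; case: (i == a).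
    by rewrite (ler_nat _ _ 1) count_uniq_mem// leq_b1.
  have := cnt ml; have := cnt mL; move: (\sum_(i <- s) _) (\sum_(i <- s) _) => x y hx hy.
  nra.
Qed.
End Datum.

(** * The resonance function *)

Section Resonance.
Context {R : realType}.
Let mu := @lebesgue_measure R.
Let T1 := measurableTypeR R.
Let T3 := @borel3 R.

Lemma resonance_identity (x y a b c d : R) : x != 0 -> y != 0 -> x + y != 0 ->
  omega (x, (a, b)) + omega (y, (c, d)) - omega (x + y, (a + c, b + d)) =
  - (3 * x * y * (x + y)) - x * y / (x + y) * ((a / x - c / y) ^+ 2 + (b / x - d / y) ^+ 2).
Proof. by move=> x0 y0 z0; rewrite /omega /=; field; rewrite x0 y0 z0. Qed.

(** Both parts of [resonance_identity] are of size [l L^2]: the slopes are at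
    most [L] on the low side and [L / 4] on the high side. *)
Lemma resonance_bound (l L x y a b c d : R) : 0 < l -> 0 < L ->
  l < `|x| -> `|x| < 2 * l -> `|a| < l * L -> `|b| < l * L ->
  L < `|y| -> `|y| < 2 * L -> `|c| < L ^+ 2 / 4 -> `|d| < L ^+ 2 / 4 ->
  L <= `|x + y| -> `|x + y| <= 2 * L ->
  `|omega (x, (a, b)) + omega (y, (c, d)) - omega (x + y, (a + c, b + d))| <= 37 * (l * L ^+ 2).
Proof.
move=> l0 L0 x1 x2 al bl y1 y2 cl dl z1 z2.
have x0 : 0 < `|x| by lra.
have y0 : 0 < `|y| by lra.
have z0 : 0 < `|x + y| by lra.
rewrite resonance_identity -?normr_gt0//.
have q1 (u : R) : `|u| < l * L -> `|u / x| <= L.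
  move=> h; rewrite normrM normfV ler_pdivrMr//; apply: (le_trans (ltW h)).
  by rewrite mulrC ler_pM2l// ltW.
have q2 (u : R) : `|u| < L ^+ 2 / 4 -> `|u / y| <= L / 4.
  move=> h; rewrite normrM normfV ler_pdivrMr//; apply: (le_trans (ltW h)).
  have -> : L ^+ 2 / 4 = L / 4 * L by field.
  by rewrite ler_pM2l ?divr_gt0// ltW.
have q3 (u v : R) : `|u| <= L -> `|v| <= L / 4 -> (u - v) ^+ 2 <= 25 / 16 * L ^+ 2.
  move=> hu hv; rewrite -(real_normK (num_real (u - v))).
  have -> : 25 / 16 * L ^+ 2 = (5 / 4 * L) ^+ 2 by field.
  apply: lerXn2r; rewrite ?nnegrE//; first by apply: mulr_ge0 => //; exact: ltW.
  apply: (le_trans (ler_normB _ _)); apply: (le_trans (lerD hu hv)).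
  by apply: eqle; field.
have s1 := q3 _ _ (q1 _ al) (q2 _ cl); have s2 := q3 _ _ (q1 _ bl) (q2 _ dl).
have e1 : `|3 * x * y * (x + y)| <= 24 * (l * L ^+ 2).
  have m1 : `|x| * `|y| <= (2 * l) * (2 * L) by apply: ler_pM => //; exact: ltW.
  have -> : `|3 * x * y * (x + y)| = 3 * (`|x| * `|y| * `|x + y|).
    by rewrite !normrM (ger0_norm (ler0n R 3)) !mulrA.
  have -> : 24 * (l * L ^+ 2) = 3 * ((2 * l) * (2 * L) * (2 * L)) by ring.
  apply: ler_wpM2l => //; apply: ler_pM => //; exact: mulr_ge0.
have e2 : `|x * y / (x + y) * ((a / x - c / y) ^+ 2 + (b / x - d / y) ^+ 2)| <= 13 * (l * L ^+ 2).
  rewrite normrM; apply: (@le_trans _ _ ((4 * l) * (25 / 8 * L ^+ 2))).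
    apply: ler_pM => //.
      rewrite normrM normfV ler_pdivrMr// normrM.
      apply: (@le_trans _ _ ((2 * l) * (2 * L))); first by apply: ler_pM => //; exact: ltW.
      have -> : (2 * l) * (2 * L) = 4 * l * L by ring.
      by apply: ler_wpM2l => //; apply: mulr_ge0 => //; exact: ltW.
    rewrite ger0_norm; last by apply: addr_ge0; exact: sqr_ge0.
    by apply: (le_trans (lerD s1 s2)); apply: eqle; field.
  have P : 0 < l * L ^+ 2 by rewrite mulr_gt0// exprn_gt0.
  have -> : 4 * l * (25 / 8 * L ^+ 2) = 25 / 2 * (l * L ^+ 2) by field.
  by rewrite ler_pM2r//; lra.
apply: (le_trans (ler_normB _ _)); rewrite normrN; apply: (le_trans (lerD e1 e2)).
by rewrite -mulrDl; apply: eqle; congr (_ * _); ring.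
Qed.

Lemma cos_half (x : R) : `|x| <= 2^-1 -> 2^-1 <= cos x.
Proof.
move=> h; have := cos_lip 0 x; rewrite cos0 sub0r normrN ler_norml => /andP[_].
lra.
Qed.

Variables (p t : R) (mL ml : int).
Let L : R := dyad mL.
Let l : R := dyad ml.
Hypothesis (lL : 16 * l <= L).
Hypothesis (tL : 74 * `|t| * (l * L ^+ 2) <= 1).

Let l0 : 0 < l. Proof. exact: dyad_gt0. Qed.
Let L0 : 0 < L. Proof. exact: dyad_gt0. Qed.

(** The profile is one-sided and narrower than [high], so that small shifts of
    its core stay in the core of [high]. *)
Definition test_amp : R3 R -> R := bx id (3 / 2 * dyad mL) (dyad mL / 4) (dyad mL ^+ 2 / 8).

Let h3 : 0 < L / 4. Proof. exact: divr_gt0. Qed.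
Let d3 : 0 < L ^+ 2 / 8. Proof. by apply: divr_gt0 => //; exact: exprn_gt0. Qed.

Lemma test_supp w : test_amp w != 0 ->
  [/\ 5 / 4 * L < w.1, w.1 < 7 / 4 * L, `|w.2.1| < L ^+ 2 / 8 & `|w.2.2| < L ^+ 2 / 8].
Proof.
move=> /(bx_supp h3 d3)[h s2 s3]; move: h; rewrite ltr_norml => /andP[s0 s1].
by split => //; move: s0 s1; rewrite -/L; lra.
Qed.

Lemma test_ge0 w : 0 <= test_amp w. Proof. exact: bx_ge0. Qed.

Definition Om (w v : R3 R) : R := omega v + omega (w - v) - omega w.

(** In the shell of the test profile only pairs of a low and a high frequency
    interact: two low frequencies sum to a lower one, and two high ones to a
    frequency above or below the shell. *)
Lemma Om_bound w v : test_amp w != 0 -> amp p mL ml v != 0 -> amp p mL ml (w - v) != 0 ->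
  `|Om w v| <= 37 * (l * L ^+ 2).
Proof.
move=> /test_supp[w1 w2 _ _] /amp_supp hv /amp_supp hwv.
have L0' := L0; have l0' := l0; have lL' := lL.
have wz : L <= `|w.1| by rewrite ger0_norm; lra.
have wz2 : `|w.1| <= 2 * L by rewrite ger0_norm; lra.
have dec : w = (v.1 + (w - v).1, (v.2.1 + (w - v).2.1, v.2.2 + (w - v).2.2)).
  have k (x y : R) : y + (x - y) = x by rewrite addrC subrK.
  have e (w' v' : R3 R) : (v'.1 + (w' - v').1, (v'.2.1 + (w' - v').2.1, v'.2.2 + (w' - v').2.2)) = w'.
    by case: w' => [z [c d]]; case: v' => [x [a b]] /=; rewrite !k.
  by rewrite e.
have sub1 : w.1 = v.1 + (w - v).1 by rewrite {1}dec.
case: hv => [/low_supp[x1 x2 x3 x4]|/high_supp[x1 x2 x3 x4]];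
  case: hwv => [/low_supp[y1 y2 y3 y4]|/high_supp[y1 y2 y3 y4]].
- exfalso; have := ler_normD v.1 (w - v).1; rewrite -sub1.
  by move: x2 y2; rewrite -/l; lra.
- rewrite /Om {2}dec; move: sub1 x1 x2 x3 x4 y1 y2 y3 y4 wz wz2.
  case: v {dec} => [x [a b]]; case: (w - _) => [y [c d]] /= -> *.
  exact: resonance_bound.
- rewrite /Om {2}dec addrC [X in `|X|](_ : _ = omega (w - v) + omega v - omega ((w - v).1 + v.1,
     ((w - v).2.1 + v.2.1, (w - v).2.2 + v.2.2))); last first.
    by rewrite [v.1 + _]addrC [v.2.1 + _]addrC [v.2.2 + _]addrC; ring.
  move: sub1 x1 x2 x3 x4 y1 y2 y3 y4 wz wz2; rewrite [v.1 + _]addrC.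
  case: v {dec} => [x [a b]]; case: (w - _) => [y [c d]] /= -> *.
  exact: resonance_bound.
- exfalso; move: x1 x2 y1 y2; rewrite -/L.
  have [px|nx] := lerP 0 v.1; have [py|ny] := lerP 0 (w - v).1.
  + by rewrite !ger0_norm//; lra.
  + by rewrite (ger0_norm px) (ltr0_norm ny); lra.
  + by rewrite (ltr0_norm nx) (ger0_norm py); lra.
  + by rewrite (ltr0_norm nx) (ltr0_norm ny); lra.
Qed.

Let A := amp p mL ml.

Lemma cos_Om s w v : `|s| <= `|t| -> test_amp w != 0 ->
  2^-1 * (A v * A (w - v)) <= cos (s * Om w v) * (A v * A (w - v)).
Proof.
move=> st hw.
have P0 : 0 <= A v * A (w - v) by apply: mulr_ge0; exact: amp_ge0.
have [e|n1] := eqVneq (A v) 0; first by rewrite e !mul0r !mulr0.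
have [e|n2] := eqVneq (A (w - v)) 0; first by rewrite e !mulr0.
apply: ler_wpM2r => //; apply: cos_half; rewrite normrM.
have h := Om_bound hw n1 n2.
have P : 0 <= l * L ^+ 2 by apply: mulr_ge0; [exact: ltW|exact: sqr_ge0].
apply: (@le_trans _ _ (`|t| * (37 * (l * L ^+ 2)))); first by apply: ler_pM.
by move: tL; move: (`|t|) (l * L ^+ 2) => a b; lra.
Qed.

Let D := datum p mL ml.
Let U := free D.

Definition pair_mass (w : R3 R) : R := \int[leb3]_v (A v * A (w - v)).

Section Bounds.
Variable (X : R).
Hypothesis (DX : forall w, nc (D w) <= X * wt `|t| w).

Let mD : @cmeasurable R _ borel3 D. Proof. exact: cmeasurable_datum. Qed.
Let jU : jmeas U. Proof. exact: jmeas_free. Qed.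
Let bU : bdd `|t| X U. Proof. exact: bdd_free. Qed.

Lemma pair_integrable w : leb3.-integrable setT (EFin \o (fun v => A v * A (w - v))).
Proof.
have [h _] := fconv_int w (normr_ge0 t) mD mD DX DX.
suff -> : (EFin \o (fun v => A v * A (w - v))) = (fun v => (complex.Re (D v * D (w - v)))%:E) by [].
by apply/funext => v; rewrite /= mulr0 subr0.
Qed.

Lemma pair_mass_ge0 w : 0 <= pair_mass w.
Proof. by apply: Rintegral_ge0 => v _; apply: mulr_ge0; exact: amp_ge0. Qed.

Lemma fconv_lower s w : `|s| <= `|t| -> test_amp w != 0 ->
  2^-1 * (cst3 * pair_mass w) <= complex.Re (expi (- (s * omega w)) * fconv (U s) (U s) w).
Proof.
move=> st hw; have b0 : 0 <= `|t| - `|s| by rewrite subr_ge0.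
have iF : cintegrable leb3 setT (fun v => U s v * U s (w - v)).
  exact: (fconv_int w b0 (jmeas_section s jU) (jmeas_section s jU) (fun v => bU v st) (fun v => bU v st)).
have E : expi (- (s * omega w)) * fconv (U s) (U s) w =
   cst3%:C%C * cintegral leb3 setT (fun v => expi (- (s * omega w)) * (U s v * U s (w - v))).
  by rewrite cintegralZ// /fconv mulrCA.
have iE : cintegrable leb3 setT (fun v => expi (- (s * omega w)) * (U s v * U s (w - v))).
  exact: cintegrableZ.
have Ev v : expi (- (s * omega w)) * (U s v * U s (w - v)) = expi (s * Om w v) * (A v * A (w - v))%:C%C.
  rewrite /U /free /D /datum -/A.
  have -> : s * Om w v = - (s * omega w) + (s * omega v + s * omega (w - v)) by rewrite /Om; ring.
  rewrite !expiD rmorphM /=.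
  by move: (expi _) (expi _) (expi _) (A v)%:C%C (A (w - v))%:C%C => a b c d e; ring.
have R1 : complex.Re (expi (- (s * omega w)) * fconv (U s) (U s) w) =
   cst3 * \int[leb3]_v (cos (s * Om w v) * (A v * A (w - v))).
  rewrite E ReM; have -> : complex.Im (cst3%:C%C : R[i]) = 0 by [].
  rewrite mul0r subr0; congr (_ * _); apply: eq_Rintegral => v _.
  by rewrite Ev ReM /= mulr0 subr0.
rewrite R1 mulrCA; apply: ler_wpM2l; first exact: cst3_ge0.
have iP := pair_integrable w.
rewrite /pair_mass -(RintegralZl _ measurableT iP); apply: le_Rintegral => //.
- exact: (integrable_scale 2^-1 iP).
- case: iE => iE _; suff -> : (EFin \o (fun v => cos (s * Om w v) * (A v * A (w - v)))) =
    (fun v => (complex.Re (expi (- (s * omega w)) * (U s v * U s (w - v))))%:E) by [].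
  by apply/funext => v; rewrite Ev ReM /= mulr0 subr0.
by move=> v _; exact: cos_Om.
Qed.

(** The free evolution of the profile cancels the oscillation of the Duhamel
    term in [t]. *)
Definition test_fun : R3 R -> R[i] := free (fun w => (test_amp w)%:C%C) t.

(** After removing the free phase the integrand is [cos (s Om)] times a
    nonnegative function, and the cosine is at least [1 / 2]. *)
Lemma duhamel_lower w : 2^-1 * `|t| * (w.1 * test_amp w * (cst3 * pair_mass w)) <=
  Num.sg t * complex.Im (duhamel U t w * (test_fun w)^*%C).
Proof.
have [e|hw] := eqVneq (test_amp w) 0.
  by rewrite e mulr0 mul0r mulr0 /test_fun /free e mulr0 conj_real mulr0 /= mulr0.
have [w1 _ _ _] := test_supp hw; have L0' := L0.
have iI := duh_cintegrable w (normr_ge0 t) jU bU (lexx _).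
pose c : R[i] := (test_fun w)^*%C.
pose k s : R[i] := expi (- (s * omega w)) * fconv (U s) (U s) w.
have Es s : c * ((\1_(between0 t) s)%:C%C * duh_integrand U t s w) =
   (w.1 * test_amp w * \1_(between0 t) s)%:C%C * ('i%C * k s).
  rewrite /c /test_fun /free conjM conj_expi conj_real /duh_integrand /k.
  have -> : expi ((t - s) * omega w) = expi (t * omega w) * expi (- (s * omega w)).
    by rewrite -expiD; congr expi; ring.
  have e1 : expi (- (t * omega w)) * expi (t * omega w) = 1 :> R[i] by rewrite -expiD addNr expi0.
  rewrite !rmorphM /=; move: e1.
  move: (expi (- (t * omega w))) (expi (t * omega w)) (expi _) (fconv _ _ _) (test_amp w)%:C%C (w.1)%:C%C (\1_(between0 t) s)%:C%C ('i%C : R[i]).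
  move=> a b x y z x1 o i ab; rewrite -[RHS]mul1r -ab; ring.
have iC := cintegrableZ c iI.
have E : duhamel U t w * (test_fun w)^*%C = (Num.sg t)%:C%C *
   cintegral mu setT (fun s => c * ((\1_(between0 t) s)%:C%C * duh_integrand U t s w)).
  by rewrite cintegralZ// duhamelE -/c mulrAC -mulrA.
have ImE s : complex.Im (c * ((\1_(between0 t) s)%:C%C * duh_integrand U t s w)) =
   w.1 * test_amp w * \1_(between0 t) s * complex.Re (k s).
  by rewrite Es; case: (k s) => a b /=; ring.
have E2 : complex.Im (duhamel U t w * (test_fun w)^*%C) = Num.sg t *
   \int[mu]_s (w.1 * test_amp w * \1_(between0 t) s * complex.Re (k s)).
  rewrite E ImM; have -> : complex.Im ((Num.sg t)%:C%C : R[i]) = 0 by [].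
  by rewrite mul0r addr0; congr (_ * _); apply: eq_Rintegral => s _; exact: ImE.
have [t00|tn] := eqVneq t 0.
  by rewrite E2 t00 sgr0 normr0 !mul0r mulr0 mul0r.
rewrite E2 [leRHS]mulrA -expr2 sqr_sg tn mul1r.
have w10 : 0 <= w.1 * test_amp w by apply: mulr_ge0; [lra|exact: test_ge0].
have ib : mu.-integrable setT (EFin \o (fun s => 2^-1 * (w.1 * test_amp w * (cst3 * pair_mass w)) * \1_(between0 t) s)).
  exact: integrable_indic_itv.
have -> : 2^-1 * `|t| * (w.1 * test_amp w * (cst3 * pair_mass w)) =
   \int[mu]_s (2^-1 * (w.1 * test_amp w * (cst3 * pair_mass w)) * \1_(between0 t) s).
  rewrite RintegralZl//; last first.
    by have := integrable_indic_itv 1 (Num.min 0 t) (Num.max 0 t); under eq_fun do rewrite mul1r.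
  rewrite Rintegral_indic_itv; last by rewrite ge_min le_max lexx.
  have -> : Num.max 0 t - Num.min 0 t = `|t|.
    have [h|h] := leP 0 t; first by rewrite subr0 ger0_norm.
    by rewrite sub0r ltr0_norm.
  by rewrite -!mulrA; congr (_ * _); rewrite mulrC -!mulrA.
apply: le_Rintegral => //.
- case: iC => _ iC; suff -> : (EFin \o (fun s => w.1 * test_amp w * \1_(between0 t) s * complex.Re (k s))) =
    (fun s => (complex.Im (c * ((\1_(between0 t) s)%:C%C * duh_integrand U t s w)))%:E) by [].
  by apply/funext => s; rewrite ImE.
move=> s _; rewrite indicE; have [/set_mem st|_] := boolP (s \in between0 t); last by rewrite !mulr0 mul0r.
rewrite !mulr1 mulrCA; apply: ler_wpM2l => //.
by apply: fconv_lower => //; exact: between0_le.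
Qed.

End Bounds.
End Resonance.

(** * The lower bound *)

Section Lower.
Context {R : realType}.
Let mu := @lebesgue_measure R.
Let T1 := measurableTypeR R.
Let T3 := @borel3 R.

Definition slab (a b d : R) (w : R3 R) : R :=
  \1_`[a, b] (w.1 : R) * (\1_`[- d, d] (w.2.1 : R) * \1_`[- d, d] (w.2.2 : R)).

Lemma slab_cases a b d w : slab a b d w = 0 \/
  [/\ slab a b d w = 1, a <= w.1 <= b, `|w.2.1| <= d & `|w.2.2| <= d].
Proof.
have I (x y z : R) : \1_`[y, z] x = ((y <= x <= z)%R)%:R :> R.
  by rewrite indicE mem_setE in_itv.
rewrite /slab !I !ler_norml.
case: (a <= w.1 <= b); last by left; rewrite mul0r.
case: (- d <= w.2.1 <= d); last by left; rewrite mul0r mulr0.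
by case: (- d <= w.2.2 <= d); [right; rewrite !mulr1|left; rewrite !mulr0].
Qed.

Lemma slab_integrable a b d : leb3.-integrable setT (EFin \o slab a b d).
Proof.
have ii (x y : R) : mu.-integrable setT (EFin \o \1_`[x, y]).
  by have := integrable_indic_itv 1 x y; under eq_fun do rewrite mul1r.
exact: (integrable3 (ii a b) (ii (- d) d) (ii (- d) d)).
Qed.

Lemma slab_mass a b d : a <= b -> 0 <= d -> \int[leb3]_w slab a b d w = (b - a) * (2 * d) ^+ 2.
Proof.
move=> ab d0.
have ii (x y : R) : mu.-integrable setT (EFin \o \1_`[x, y]).
  by have := integrable_indic_itv 1 x y; under eq_fun do rewrite mul1r.
have dd : - d <= d by lra.
have := Rintegral3 (ii a b) (ii (- d) d) (ii (- d) d).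
by rewrite !Rintegral_indic_itv// => E; rewrite [LHS]E; ring.
Qed.

Variables (p t : R) (mL ml : int).
Let L : R := dyad mL.
Let l : R := dyad ml.
Hypothesis (lL : 16 * l <= L).
Hypothesis (tL : 74 * `|t| * (l * L ^+ 2) <= 1).
Variable (X : R).
Hypothesis (DX : forall w, nc (datum p mL ml w) <= X * wt `|t| w).

Let l0 : 0 < l. Proof. exact: dyad_gt0. Qed.
Let L0 : 0 < L. Proof. exact: dyad_gt0. Qed.
Let al := alpha p mL ml.
Let be : R := beta mL.
Let al0 : 0 < al. Proof. exact: alpha_gt0. Qed.
Let be0 : 0 < be. Proof. exact: beta_gt0. Qed.
Let h3 : 0 < L / 4. Proof. exact: divr_gt0. Qed.
Let d3 : 0 < L ^+ 2 / 8. Proof. by apply: divr_gt0 => //; exact: exprn_gt0. Qed.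
Let a3 : 0 < 3 / 2 * L. Proof. exact: mulr_gt0. Qed.
Let idm : measurable_fun setT ((id : R -> R) : T1 -> T1). Proof. exact: measurable_id. Qed.

(** For [w] in the core of the test profile and [v] in the core of [low], the
    shift [w - v] lies in the core of [high]. *)
Lemma pair_mass_lower w : 11 / 8 * L <= w.1 <= 13 / 8 * L -> `|w.2.1| <= L ^+ 2 / 16 ->
  `|w.2.2| <= L ^+ 2 / 16 -> al * be / 64 * (l / 2 * (l * L) ^+ 2) <= pair_mass p mL ml w.
Proof.
move=> /andP[w1 w2] w3 w4; have l0' := l0; have L0' := L0; have lL' := lL.
have ll : 5 / 4 * l <= 7 / 4 * l by lra.
have dd : 0 <= l * L / 2 by apply: divr_ge0 => //; apply: mulr_ge0; exact: ltW.
have -> : l / 2 * (l * L) ^+ 2 = \int[leb3]_v slab (5 / 4 * l) (7 / 4 * l) (l * L / 2) v.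
  by rewrite slab_mass//; field.
rewrite -(RintegralZl _ measurableT (slab_integrable _ _ _)); apply: le_Rintegral => //.
- exact: (integrable_scale _ (slab_integrable _ _ _)).
- exact: (pair_integrable DX).
move=> v _; have [->|[-> /andP[v1 v2] v3 v4]] := slab_cases (5 / 4 * l) (7 / 4 * l) (l * L / 2) v.
  by rewrite mulr0; apply: mulr_ge0; exact: amp_ge0.
have q : l * L <= L ^+ 2 / 16.
  have -> : L ^+ 2 / 16 = L / 16 * L by field.
  by rewrite ler_pM2r//; lra.
have k1 : 8^-1 <= low mL ml v.
  have v10 : 0 <= v.1 by lra.
  apply: low_half => //; rewrite -/l (ger0_norm v10).
  by rewrite ler_norml; apply/andP; split; lra.
have nb (x y : R) : `|x| <= L ^+ 2 / 16 -> `|y| <= l * L / 2 -> `|x - y| <= L ^+ 2 / 8.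
  by move=> hx hy; apply: (le_trans (ler_normB _ _)); lra.
have k2 : 8^-1 <= high mL (w - v).
  apply: high_half; rewrite -/L; [|exact: nb|exact: nb].
  have -> : (w - v).1 = w.1 - v.1 by [].
  have wv0 : 0 <= w.1 - v.1 by lra.
  rewrite (ger0_norm wv0).
  by rewrite ler_norml; apply/andP; split; lra.
have n1 : 0 <= high mL v := high_ge0 mL v.
have n2 : 0 <= low mL ml (w - v) := low_ge0 mL ml (w - v).
have e1 : al / 8 <= amp p mL ml v.
  rewrite /amp -/al -/be; have := mulr_ge0 (ltW be0) n1; have := ler_wpM2l (ltW al0) k1; lra.
have e2 : be / 8 <= amp p mL ml (w - v).
  rewrite /amp -/al -/be; have := mulr_ge0 (ltW al0) n2; have := ler_wpM2l (ltW be0) k2; lra.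
rewrite mulr1; have -> : al * be / 64 = (al / 8) * (be / 8) by field.
by apply: ler_pM => //; apply: divr_ge0 => //; exact: ltW.
Qed.

Let Phi : R3 R -> R[i] := test_fun t mL.

Lemma test_fun_le1 w : nc (Phi w) <= 1.
Proof. by rewrite /Phi /test_fun nc_free nc_real ger0_norm ?test_ge0//; exact: bx_le1. Qed.

Lemma test_fun_wcont : wcont Phi.
Proof.
apply: free_wcont.
  by move=> w x xw; apply: ccvg_real; apply: bx_cvg.
move=> w w0; have [->//|n] := eqVneq (test_amp mL w) 0.
have L0' := L0; have [k1 _ _ _] := test_supp n; exfalso; move: k1; rewrite w0 -/L; lra.
Qed.

Lemma test_fun_supp w : ~ Gamma mL (0, 0) w -> Phi w = 0.
Proof.
move=> nG; rewrite /Phi /test_fun /free.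
have [->|n] := eqVneq (test_amp mL w) 0; first by rewrite mulr0.
have L0' := L0; have [k1 k2 k3 k4] := test_supp n; exfalso; apply: nG.
rewrite -/L in k1 k2 k3 k4.
have w0 : 0 < w.1 by lra.
have q (x : R) : `|x| < L ^+ 2 / 8 -> `|x / w.1 - L * 0%:~R| <= L / 2.
  move=> h; rewrite mulr0 subr0 normrM normfV (gtr0_norm w0) ler_pdivrMr//.
  apply: (le_trans (ltW h)); have -> : L ^+ 2 / 8 = L / 2 * (L / 4) by field.
  by rewrite ler_pM2l; lra.
split; first by rewrite gtr0_norm// -/L; apply/andP; split; lra.
by rewrite ge_max /= -/L !q.
Qed.

Lemma test_fun_integrable : cintegrable leb3 setT Phi.
Proof.
have [C C0 H] := @bx_wt _ _ _ _ _ (fun x => erefl) h3 d3 a3 0.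
apply: (@cintegrable_rho _ _ C).
  apply: (jmeas_section t (@jmeas_free _ _ _)).
  by apply: cmeasurable_real; exact: measurable_bx.
move=> w; rewrite /Phi /test_fun nc_free nc_real ger0_norm ?test_ge0//.
by apply: (le_trans (H w)); apply: ler_wpM2l; [exact: ltW|exact: wt_le_rho].
Qed.

Lemma test_fun_nsq : (nsq Phi <= ((L ^+ 2 * Num.sqrt L) ^+ 2)%:E)%E.
Proof.
have -> : nsq Phi = nsq (fun w => (1 * test_amp mL w)%:C%C).
  by apply: eq_integral => w _; rewrite /Phi /test_fun nc_free mul1r.
apply: (le_trans (nsq_bx (fun x => erefl) idm h3 d3 a3 1)).
rewrite lee_fin [leRHS]exprMn sqr_sqrtr ?(ltW L0)// expr1n mul1r.
have P : 0 < L ^+ 5 by rewrite exprn_gt0.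
have -> : 8 * ((3 / 2 * L + L / 4) * (L ^+ 2 / 8) ^+ 2) = 7 / 32 * L ^+ 5 by field.
have -> : (L ^+ 2) ^+ 2 * L = L ^+ 5 by ring.
lra.
Qed.

Lemma quad_lower : `|t| * cst3 * (al * be * l ^+ 3 * L ^+ 8) / (64 * 64 * 128) <=
  `|complex.Im (ell Phi (duhamel (free (datum p mL ml)) t))|.
Proof.
have l0' := l0; have L0' := L0.
have c30 := @cst3_ge0 R.
have ll : 11 / 8 * L <= 13 / 8 * L by lra.
have dd : 0 <= L ^+ 2 / 16 by apply: divr_ge0 => //; exact: sqr_ge0.
set pm := al * be / 64 * (l / 2 * (l * L) ^+ 2).
have pm0 : 0 <= pm.
  by apply: mulr_ge0; [apply: divr_ge0 => //; apply: mulr_ge0; exact: ltW|apply: mulr_ge0; [apply: divr_ge0 => //; exact: ltW|exact: sqr_ge0]].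
pose c0 := 2^-1 * `|t| * (L * 8^-1 * (cst3 * pm)).
have -> : `|t| * cst3 * (al * be * l ^+ 3 * L ^+ 8) / (64 * 64 * 128) =
    c0 * \int[leb3]_w slab (11 / 8 * L) (13 / 8 * L) (L ^+ 2 / 16) w.
  rewrite slab_mass// /c0 /pm; by move: (`|t|) (@cst3 R) al be => a b c d; field.
set U := free (datum p mL ml).
have jU : jmeas U by apply: jmeas_free; exact: cmeasurable_datum.
have bU : bdd `|t| X U by exact: bdd_free.
have mD : @cmeasurable R _ borel3 (duhamel U t) := jmeas_section t (jmeas_duhamel jU).
have iE : cintegrable leb3 setT (fun w => duhamel U t w * (Phi w)^*%C).
  apply: (ell_integrable test_fun_integrable test_fun_le1 test_fun_supp).
  apply: (@rho_locL2 _ _ _ _ (cduh * X ^+ 2)) => // w.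
  have := duh_bound w (normr_ge0 t) jU bU (lexx _); rewrite subrr => h; apply: (le_trans h).
  by apply: ler_wpM2l; [apply: mulr_ge0; [exact/ltW/cduh_gt0|exact: sqr_ge0]|exact: wt_le_rho].
have [_ iI] := iE.
have S : Num.sg t * complex.Im (ell Phi (duhamel U t)) =
    \int[leb3]_w (Num.sg t * complex.Im (duhamel U t w * (Phi w)^*%C)).
  by rewrite (RintegralZl (Num.sg t) measurableT iI).
apply: (@le_trans _ _ (Num.sg t * complex.Im (ell Phi (duhamel U t)))); last first.
  apply: (le_trans (ler_norm _)); rewrite normrM; apply: ler_piMl => //.
  by rewrite normr_sg; case: (t != 0).
rewrite S -(RintegralZl _ measurableT (slab_integrable _ _ _)); apply: le_Rintegral => //.
- exact: (integrable_scale _ (slab_integrable _ _ _)).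
- exact: (integrable_scale _ iI).
move=> w _; apply: (le_trans _ (duhamel_lower lL tL DX w)).
have pw := pair_mass_ge0 p mL ml w; have tw := test_ge0 mL w.
have [->|[-> /andP[w1 w2] w3 w4]] := slab_cases (11 / 8 * L) (13 / 8 * L) (L ^+ 2 / 16) w.
  rewrite mulr0; have [->|n] := eqVneq (test_amp mL w) 0; first by rewrite mulr0 mul0r mulr0.
  have [k1 _ _ _] := test_supp n; rewrite -/L in k1.
  apply: mulr_ge0; first exact: mulr_ge0.
  by apply: mulr_ge0; [apply: mulr_ge0 => //; lra|exact: mulr_ge0].
have k : 8^-1 <= test_amp mL w.
  have e : L ^+ 2 / 8 / 2 = L ^+ 2 / 16 by field.
  apply: (bx_half h3 d3); rewrite -/L ?e//.
  by rewrite ler_norml; apply/andP; split; lra.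
rewrite mulr1 /c0; apply: ler_wpM2l; first exact: mulr_ge0.
apply: ler_pM; [by apply: mulr_ge0 => //; lra|exact: mulr_ge0| |].
  by apply: ler_pM => //; lra.
apply: ler_wpM2l => //; apply: pair_mass_lower => //; by rewrite w1 w2.
Qed.

End Lower.

(** * Divergence of the second derivative *)

Section Divergence.
Context {R : realType}.

(** [2^(3 M (1 - 2 / p))] is unbounded because [2 < p]. *)
Lemma scale_divergence (p C : R) (c : nat) : 2 < p ->
  exists M : nat, C < (2 ^+ M) ^+ 3 * ((2 ^+ (3 * M + c.+1) : R) `^ (2 / p))^-1.
Proof.
move=> p2; have p0 : 0 < p by lra.
pose d := 3 * (1 - 2 / p); pose g := c.+1%:R * (2 / p).
have d0 : 0 < d by rewrite /d mulr_gt0// subr_gt0 ltr_pdivrMr// mul1r.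
have g0 : 0 <= g by apply: mulr_ge0 => //; apply: divr_ge0 => //; exact: ltW.
pose n := Num.bound `|C|.
have hn : C < n%:R by apply: (le_lt_trans (ler_norm C)); rewrite archi_boundP.
have X0 : 0 <= (n%:R + g) / d by apply: divr_ge0; [apply: addr_ge0|exact: ltW].
exists (Num.bound ((n%:R + g) / d)); set M := Num.bound _.
have hM : n%:R + g <= d * M%:R by rewrite mulrC -ler_pdivrMr//; apply/ltW/archi_boundP.
apply: (lt_le_trans hn).
have two k : 2 ^+ k = 2 `^ k%:R :> R by rewrite powR_mulrn.
have -> : (2 ^+ M) ^+ 3 * ((2 ^+ (3 * M + c.+1) : R) `^ (2 / p))^-1 = 2 `^ (d * M%:R - g).
  rewrite -exprM !two -powRrM -powRN -powRD; last by rewrite pnatr_eq0 implybT.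
  congr (_ `^ _); rewrite /d /g natrM natrD natrM; field.
  by rewrite gt_eqF.
apply: (@le_trans _ _ (2 `^ n%:R)).
  by rewrite -two -natrX ler_nat ltnW// ltn_expl.
by rewrite ler_powR// ?ler1n//; lra.
Qed.

Lemma slope_scale (a b : R) (M c : nat) : a = 2 ^+ M -> b = (2 ^+ (2 * M + c))^-1 ->
  2 * a / b = 2 ^+ (3 * M + c.+1).
Proof.
move=> -> ->; rewrite invrK.
have e : (3 * M + c.+1 = M.+1 + (2 * M + c))%N by lia.
by rewrite e [RHS]exprD exprS.
Qed.

End Divergence.

Theorem theorem1p3 (R : realType) (q : \bar R) (p : R)
    (hq : (1%:E <= q)%E) (hp : 2 < p)
    (T eps : R) (hT : 0 < T) (heps : 0 < eps)
    (hwp : uniquely_solvable q p T eps)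
    (F : R -> (R * (R * R) -> R[i]) -> (R * (R * R) -> R[i]))
    (hF : flow_map q p T eps F)
    (t : R) (ht : - T <= t <= T) (ht0 : t != 0) :
  ~ twice_differentiable_at0 (lqlpL2 q p) (lqlp_norm q p) (F t).
Proof.
move=> [DF [B [[r r0 hDF] [hB lB [CB bB]] hDB]]].
have t0 : 0 < `|t| by rewrite normr_gt0.
have c30 : 0 < @cst3 R := cst3_gt0.
have cc := @ccell_ge0 R.
have nu0 : 0 <= 6 * (ccell : R) by apply: mulr_ge0.
pose c := (Num.bound (74 * `|t|) + 4)%N.
have hc : 74 * `|t| <= 2 ^+ c.
  apply: (@le_trans _ _ c%:R); last by rewrite -natrX ler_nat ltnW// ltn_expl.
  rewrite /c natrD; have := archi_boundP (mulr_ge0 (ler0n R 74) (normr_ge0 t)) => /ltW h.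
  by apply: (le_trans h); rewrite lerDl.
(* The dyadic scale is taken so large that the lower bound for the quadratic
   term beats the upper bound forced by differentiability. *)
pose E := cell0 * (`|CB| * (6 * (ccell : R)) ^+ 2) * (64 * 64 * 128) / (`|t| * cst3).
have [M hM] := scale_divergence E c hp.
pose mL : int := M; pose ml : int := - ((2 * M + c)%N : int).
have LE : dyad mL = 2 ^+ M :> R by [].
have lE : dyad ml = (2 ^+ (2 * M + c))^-1 :> R by rewrite /dyad /ml -exprnN.
have l0 := @dyad_gt0 R ml; have L0 := @dyad_gt0 R mL.
have L1 : 1 <= dyad mL :> R by rewrite LE exprn_ege1// ler1n.
have lL2 : dyad ml * dyad mL ^+ 2 = (2 ^+ c)^-1 :> R.
  have h2 k : 2 ^+ k != 0 :> R by rewrite expf_neq0// pnatr_eq0.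
  rewrite lE LE exprD mulnC exprM.
  have := h2 M; have := h2 c; move: (2 ^+ M) (2 ^+ c) => x y y0 x0; field.
  by rewrite x0 y0.
have lL : 16 * dyad ml <= dyad mL :> R.
  apply: le_trans L1; rewrite lE ler_pdivrMr ?exprn_gt0// mul1r.
  have -> : 16 = 2 ^+ 4 :> R by rewrite -natrX.
  by apply: ler_weXn2l; rewrite ?ler1n// /c addnA leq_addl.
have tL : 74 * `|t| * (dyad ml * dyad mL ^+ 2) <= 1.
  by rewrite lL2 ler_pdivrMr ?exprn_gt0// mul1r.
have [X X0 DX] := datum_wt p mL ml T.
have [X' X'0 DX'] := datum_wt p mL ml `|t|.
have K0 : 0 <= dyad mL ^+ 2 * Num.sqrt (dyad mL) :> R.
  by apply: mulr_ge0; [exact: sqr_ge0|exact: sqrtr_ge0].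
have up := second_order hq hp hT heps hwp hF ht (cmeasurable_datum p mL ml) X0 DX
  (wcont_datum p mL ml) (@datum0 R p mL ml) (herm_datum p mL ml)
  (test_fun_integrable t mL) (test_fun_le1 t mL) (test_fun_wcont t mL)
  (@test_fun_supp R t mL) K0 (test_fun_nsq t mL)
  r0 hDF hB lB bB hDB nu0 (datum_norm hp L1 lL hq).
have lo := quad_lower lL tL DX'.
have := le_trans lo up; apply/negP; rewrite -ltNge.
set L : R := dyad mL in L0 L1 lL2 lL tL K0 LE up lo *; set l : R := dyad ml in l0 lL2 lL tL lE up lo *.
have sL : L `^ (- 2^-1) * (L ^+ 2 * Num.sqrt L) = L ^+ 2.
  rewrite powRN powR12_sqrt ?(ltW L0)//.
  have s0 : Num.sqrt L != 0 by rewrite gt_eqF// sqrtr_gt0.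
  by move: s0; move: (Num.sqrt L) => s s0; field.
rewrite -[cell0 * _ * _]mulrA sL.
have kE : 2 * L / l = 2 ^+ (3 * M + c.+1).
  exact: (slope_scale LE lE).
have abE : alpha p mL ml * beta mL * l ^+ 3 * L ^+ 8 = L ^+ 2 * (L ^+ 3 * ((2 ^+ (3 * M + c.+1) : R) `^ (2 / p))^-1).
  rewrite /alpha /beta -/L -/l kE.
  have x0 : (2 ^+ (3 * M + c.+1) : R) `^ (2 / p) != 0 by rewrite gt_eqF// powR_gt0// exprn_gt0.
  have l1 := gt_eqF l0; have L2 := gt_eqF L0.
  move: x0; move: (_ `^ _) => x x0; field.
  by rewrite l1 x0 L2.
rewrite abE; move: hM; rewrite -LE.
set Y := L ^+ 3 * _ => hM.
have P : 0 < `|t| * cst3 by exact: mulr_gt0.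
move: hM; rewrite /E ltr_pdivrMr// => hM.
have Q : 0 < L ^+ 2 by rewrite exprn_gt0.
rewrite ltr_pdivlMr//.
have -> : `|t| * cst3 * (L ^+ 2 * Y) = L ^+ 2 * (Y * (`|t| * cst3)) by ring.
have -> : cell0 * L ^+ 2 * (`|CB| * (6 * ccell) ^+ 2) * (64 * 64 * 128) =
  L ^+ 2 * (cell0 * (`|CB| * (6 * ccell) ^+ 2) * (64 * 64 * 128)).
  by move: (@cell0 R) (@ccell R) => a b; ring.
by rewrite ltr_pM2l.
Qed.
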